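(* Let $(M,g)$ and $(M,g')$ be space-times (on the same manifold $M$) with Levi-Civita connections $\nabla$ and $\nabla'$, with $(M,g)$ non-flat and of holonomy type $R_{11}$, and suppose that $(M,g)$ is of curvature class $\mathbf{D}$ at each point of some open dense subset of $M$. Suppose that $g$ and $g'$ are projectively related. Then there is an open dense subset $W$ of $M$ such that each $m\in W$ has an open neighbourhood $V$ on which one of the following holds: (1) $\nabla=\nabla'$ on $V$; or (2) $V$ is a coordinate domain with coordinates $u,v,x^3,x^4$ in which $$g=2\,du\,dv+u^2h_{\alpha\beta}(x^3,x^4)\,dx^\alpha dx^\beta\qquad(\alpha,\beta\in\{3,4\}),$$ where the functions $h_{\alpha\beta}$ are independent of $u$ and $v$, and there are real constants $c,e_1,e_2$ and a constant $\kappa>0$ such that, with $$F=\kappa^4\left[1+2cuv+2e_1u+(e_1^2-ce_2)u^2\right]^{-1},$$ one has on $V$ $$g'=\kappa F g-\kappa^{-3}F^2\Big[(cv^2+2e_1v+e_2)\,du^2+cu^2\,dv^2+2u\big(cv+e_1+(e_1^2-ce_2)u\big)\,du\,dv\Big],$$ and the 1-form $\psi$ relating $\nabla$ and $\nabla'$ is $\psi=d\left(\tfrac12\ln F\right)$.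
   Context: A space-time $(M,g)$ is a 4-dimensional, Hausdorff, connected, smooth manifold $M$ with a smooth metric $g$ of Lorentz signature $(-,+,+,+)$. It is non-flat if its curvature tensor $\mathrm{Riem}$ does not vanish identically on any non-empty open subset of $M$. Projectively related: $g$ and $g'$ are projectively related if the sets of unparametrised geodesics of $\nabla$ and $\nabla'$ coincide; equivalently there is a (unique) global smooth 1-form $\psi$ on $M$ with $\Gamma'^a_{bc}-\Gamma^a_{bc}=\delta^a_b\psi_c+\delta^a_c\psi_b$ in every coordinate domain. Bivectors: for $m\in M$ and $p,q\in T_mM$, $p\wedge q$ denotes the bivector $F^{ab}=p^aq^b-q^ap^b$, identified (using $g(m)$) with the skew-self-adjoint endomorphism $F^a{}_b=F^{ac}g_{cb}$ of $T_mM$. A null tetrad at $m$ is a basis $l,n,x,y$ of $T_mM$ whose only non-vanishing inner products are $g(l,n)=g(x,x)=g(y,y)=1$. Holonomy type: let $\phi$ be the Lie algebra of the holonomy group of $\nabla$ at a point $m\in M$, regarded as a Lie algebra of skew-self-adjoint endomorphisms (bivectors) of $T_mM$. $(M,g)$ is of holonomy type $R_{11}$ if, for some null tetrad $l,n,x,y$ at $m$, $\phi$ is the 3-dimensional algebra spanned by $l\wedge x,\ l\wedge y,\ x\wedge y$. (The type does not depend on the choice of $m$.) Curvature class $\mathbf{D}$ at $m$: the linear map $F^{ab}\mapsto R^{ab}{}_{cd}F^{cd}$ on bivectors at $m$ has rank 1. *)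

(* Defs.v *)
From HB Require Import structures.
From mathcomp Require Import all_boot all_order all_algebra.
From mathcomp Require Import all_classical all_reals all_analysis.

Set Implicit Arguments.
Unset Strict Implicit.
Unset Printing Implicit Defensive.

Import Order.TTheory GRing.Theory Num.Theory.
Import numFieldNormedType.Exports.

Local Open Scope classical_set_scope.
Local Open Scope ring_scope.

(** Conventions. Points of R^4 are row vectors, components of tangent vectors
    are column vectors, and tensor fields on M are given by their components in
    the charts of the (maximal) atlas, subject to the usual transformation law.
    Functions attached to a chart carry meaningless values outside its domain;
    every condition below is imposed on the domain only. *)

Section Calculus.
Variable R : realType.

Definition partial (i : 'I_4) (f : 'rV[R]_4 -> R) : 'rV[R]_4 -> R :=
  fun x => 'D_(delta_mx 0 i) f x.

(* C^oo on an open set O of R^4: all iterated partial derivatives exist and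
   are continuous. *)
Definition smooth_on (O : set 'rV[R]_4) (f : 'rV[R]_4 -> R) : Prop :=
  forall (s : seq 'I_4) (x : 'rV[R]_4), O x ->
    {for x, continuous (foldr partial f s)} /\
    (forall i, derivable (foldr partial f s) x (delta_mx 0 i)).

(* C^oo on an open set O of R. *)
Definition smooth1_on (O : set R) (f : R -> R) : Prop :=
  forall (n : nat) (t : R), O t -> derivable (derive1n n f) t 1.

Definition open_interval (I : set R) : Prop := open I /\ is_interval I.

End Calculus.

Section Manifold.
Variables (R : realType) (M : topologicalType).

(* A homeomorphism from an open subset of M onto an open subset of R^4. *)
Record chart := Chart {
  chart_dom : set M;
  chart_map : M -> 'rV[R]_4;
  chart_inv : 'rV[R]_4 -> M;
  chart_dom_open : open chart_dom;
  chart_cod_open : open (chart_map @` chart_dom);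
  chart_mapK : forall p, chart_dom p -> chart_inv (chart_map p) = p;
  chart_map_cont : forall p, chart_dom p -> {for p, continuous chart_map};
  chart_inv_cont : forall x, (chart_map @` chart_dom) x ->
    {for x, continuous chart_inv} }.

Definition smooth_transition (phi chi : chart) : Prop :=
  forall a : 'I_4,
    smooth_on (chart_map phi @` (chart_dom phi `&` chart_dom chi))
              (fun x => chart_map chi (chart_inv phi x) 0 a).

Definition compatible (phi chi : chart) : Prop :=
  smooth_transition phi chi /\ smooth_transition chi phi.

(* A 4-dimensional smooth structure, i.e. a maximal smooth atlas: the
   coordinate systems of M are exactly the members of [charts]. *)
Record smooth_structure := SmoothStructure {
  charts :> chart -> Prop;
  charts_cover : forall p, exists2 phi, charts phi & chart_dom phi p;
  charts_compatible : forall phi chi, charts phi -> charts chi ->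
    compatible phi chi;
  charts_maximal : forall chi, (forall phi, charts phi -> compatible phi chi) ->
    charts chi }.

(* The partial derivative of f : M -> R along the i-th coordinate of phi. *)
Definition pd (phi : chart) (i : 'I_4) (f : M -> R) (p : M) : R :=
  partial i (f \o chart_inv phi) (chart_map phi p).

(* Jacobian matrix of the change of coordinates from phi to chi. *)
Definition jacobian (phi chi : chart) (p : M) : 'M[R]_4 :=
  \matrix_(a, b) pd phi b (fun q => chart_map chi q 0 a) p.

End Manifold.

(* A quadratic form of signature (-,+,+,+). *)
Definition lorentzian (R : realType) (G : 'M[R]_4) : Prop :=
  exists2 P : 'M[R]_4, P \in unitmx &
    P^T *m G *m P = diag_mx (\row_(i < 4) (if i == 0 then -1 else 1)).

(* [g phi p a b] is the component g_ab at p in the chart phi. *)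
Record lorentz_metric (R : realType) (M : topologicalType)
    (A : smooth_structure R M) := LorentzMetric {
  metric_comp :> chart R M -> M -> 'M[R]_4;
  metric_sym : forall phi p, A phi -> chart_dom phi p ->
    (metric_comp phi p)^T = metric_comp phi p;
  metric_lorentz : forall phi p, A phi -> chart_dom phi p ->
    lorentzian (metric_comp phi p);
  metric_smooth : forall phi a b, A phi ->
    smooth_on (chart_map phi @` chart_dom phi)
              (fun x => metric_comp phi (chart_inv phi x) a b);
  metric_tensor : forall phi chi p, A phi -> A chi ->
    chart_dom phi p -> chart_dom chi p ->
    metric_comp phi p =
      (jacobian phi chi p)^T *m metric_comp chi p *m jacobian phi chi p }.

Section Connection.
Variables (R : realType) (M : topologicalType) (A : smooth_structure R M).
Variable g : lorentz_metric A.
Implicit Types (phi chi : chart R M) (p : M) (I : set R) (gam : R -> M).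

(* Gamma^a_bc *)
Definition christoffel phi p (a b c : 'I_4) : R :=
  2^-1 * \sum_d invmx (g phi p) a d *
    (pd phi b (fun q => g phi q d c) p + pd phi c (fun q => g phi q d b) p
     - pd phi d (fun q => g phi q b c) p).

(* R^a_bcd *)
Definition riemann phi p (a b c d : 'I_4) : R :=
  pd phi c (fun q => christoffel phi q a d b) p
  - pd phi d (fun q => christoffel phi q a c b) p
  + \sum_e christoffel phi p a c e * christoffel phi p e d b
  - \sum_e christoffel phi p a d e * christoffel phi p e c b.

Definition non_flat : Prop :=
  forall U : set M, open U -> U !=set0 ->
    ~ (forall phi p a b c d, A phi -> chart_dom phi p -> U p ->
         riemann phi p a b c d = 0).

(* The map F^ab |-> R^ab_cd F^cd, where R^ab_cd = g^be R^a_ecd. *)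
Definition curvature_map phi p (F : 'M[R]_4) : 'M[R]_4 :=
  \matrix_(a, b) \sum_c \sum_d
    (\sum_e invmx (g phi p) b e * riemann phi p a e c d) * F c d.

Lemma curvature_map_is_linear phi p : linear (curvature_map phi p).
Proof.
move=> k F G; apply/matrixP => a b; rewrite !mxE mulr_sumr -big_split /=.
apply: eq_bigr => c _; rewrite mulr_sumr -big_split /=.
by apply: eq_bigr => d _; rewrite !mxE mulrDr !mulrA [k * _]mulrC.
Qed.

HB.instance Definition _ phi p :=
  GRing.isLinear.Build R 'M[R]_4 'M[R]_4 *:%R (curvature_map phi p)
    (curvature_map_is_linear phi p).

(* Skew-symmetric F^ab. *)
Definition bivectors : {vspace 'M[R]_4} :=
  lker (\1%VF + linfun (@trmx R 4 4))%R.

Lemma bivectorsP (F : 'M[R]_4) : (F \in bivectors) = (F^T == - F).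
Proof. by rewrite memv_ker add_lfunE id_lfunE lfunE /= addrC addr_eq0. Qed.

Definition curvature_class_D p : Prop :=
  forall phi, A phi -> chart_dom phi p ->
    \dim (linfun (curvature_map phi p) @: bivectors)%VS = 1%N.

Definition smooth_curve I gam : Prop :=
  (forall t, I t -> {for t, continuous gam}) /\
  (forall phi a, A phi ->
     smooth1_on (I `&` gam @^-1` chart_dom phi)
                (fun t => chart_map phi (gam t) 0 a)).

Definition velocity phi gam (t : R) (a : 'I_4) : R :=
  derive1 (fun s => chart_map phi (gam s) 0 a) t.

(* Affinely parametrised geodesics. *)
Definition geodesic I gam : Prop :=
  smooth_curve I gam /\
  (forall phi t a, A phi -> I t -> chart_dom phi (gam t) ->
     derive1n 2 (fun s => chart_map phi (gam s) 0 a) t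
     + \sum_b \sum_c christoffel phi (gam t) a b c *
         velocity phi gam t b * velocity phi gam t c = 0).

(* The curve gam on I is a geodesic up to a reparametrisation sigma : J -> I. *)
Definition unparametrised_geodesic I gam : Prop :=
  exists (J : set R) (sigma : R -> R),
    [/\ open_interval J, smooth1_on J sigma, sigma @` J = I,
        (forall t, J t -> derive1 sigma t != 0)
      & geodesic J (gam \o sigma)].

(* X phi t are the components in phi of a vector at gam t. *)
Definition parallel_along I gam (X : chart R M -> R -> 'cV[R]_4) : Prop :=
  (forall phi chi t, A phi -> A chi -> I t ->
     chart_dom phi (gam t) -> chart_dom chi (gam t) ->
     X chi t = jacobian phi chi (gam t) *m X phi t) /\
  (forall phi t a, A phi -> I t -> chart_dom phi (gam t) ->
     derivable (fun s => X phi s a 0) t 1 /\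
     derive1 (fun s => X phi s a 0) t =
       - \sum_b \sum_c christoffel phi (gam t) a b c *
           velocity phi gam t b * X phi t c 0).

(* P is the matrix, with respect to phi and chi, of the parallel transport
   T_p M -> T_q M along a smooth arc [0, 1] -> M from p to q. *)
Definition arc_transport phi p chi q (P : 'M[R]_4) : Prop :=
  exists (I : set R) (gam : R -> M),
    [/\ open_interval I /\ `[0, 1] `<=` I, smooth_curve I gam,
        gam 0 = p, gam 1 = q
      & forall w : 'cV[R]_4, exists X,
          [/\ parallel_along I gam X, X phi 0 = w & X chi 1 = P *m w]].

(* Parallel transport along piecewise smooth curves. *)
Inductive transport phi p : chart R M -> M -> 'M[R]_4 -> Prop :=
| transport_refl : transport phi p phi p 1%:M
| transport_arc chi q chi' q' P Q :
    transport phi p chi q P -> A chi' -> chart_dom chi' q' ->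
    arc_transport chi q chi' q' Q -> transport phi p chi' q' (Q *m P).

(* The holonomy group at p, acting on T_p M = R^4 through the chart phi. *)
Definition holonomy_group phi p : set 'M[R]_4 :=
  [set P | transport phi p phi p P].

(* The Lie algebra of the Lie subgroup [holonomy_group phi p] of GL(4, R): the
   velocities at the identity of the C^1 curves lying in it. *)
Definition holonomy_algebra phi p : set 'M[R]_4 :=
  [set B | exists P : R -> 'M[R]_4,
     [/\ P 0 = 1%:M, (forall s, holonomy_group phi p (P s)),
         (forall a b s, derivable (fun t => P t a b) s 1),
         (forall a b, continuous (derive1 (fun t => P t a b)))
       & (forall a b, derive1 (fun t => P t a b) 0 = B a b)]].

Definition inner phi p (w z : 'cV[R]_4) : R := (w^T *m g phi p *m z) 0 0.

(* The endomorphism (w /\ z)^ac g_cb. *)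
Definition wedge phi p (w z : 'cV[R]_4) : 'M[R]_4 :=
  (w *m z^T - z *m w^T) *m g phi p.

Definition null_tetrad phi p (l n x y : 'cV[R]_4) : Prop :=
  [/\ basis_of fullv [:: l; n; x; y],
      [/\ inner phi p l n = 1, inner phi p x x = 1 & inner phi p y y = 1],
      [/\ inner phi p l l = 0, inner phi p n n = 0 & inner phi p x y = 0],
      inner phi p l x = 0 /\ inner phi p l y = 0
    & inner phi p n x = 0 /\ inner phi p n y = 0].

Definition holonomy_type_R11 : Prop :=
  exists phi p (l n x y : 'cV[R]_4),
    [/\ A phi, chart_dom phi p, null_tetrad phi p l n x y
      & forall B : 'M[R]_4, holonomy_algebra phi p B <->
          B \in <<[:: wedge phi p l x; wedge phi p l y; wedge phi p x y]>>%VS].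

End Connection.

Section Projective.
Variables (R : realType) (M : topologicalType) (A : smooth_structure R M).
Variables g g' : lorentz_metric A.

Definition projectively_related : Prop :=
  forall (I : set R) (gam : R -> M), open_interval I ->
    unparametrised_geodesic g I gam <-> unparametrised_geodesic g' I gam.

Definition same_connection (V : set M) : Prop :=
  forall phi p a b c, A phi -> chart_dom phi p -> V p ->
    christoffel g phi p a b c = christoffel g' phi p a b c.

(* On V, Gamma'^a_bc - Gamma^a_bc = delta^a_b psi_c + delta^a_c psi_b in every
   chart, where psi phi p c is the component psi_c at p in phi. *)
Definition projective_form (V : set M) (psi : chart R M -> M -> 'I_4 -> R) :
    Prop :=
  forall phi p a b c, A phi -> chart_dom phi p -> V p ->
    christoffel g' phi p a b c - christoffel g phi p a b c =
      (a == b)%:R * psi phi p c + (a == c)%:R * psi phi p b.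

End Projective.

Definition differential (R : realType) (M : topologicalType) (f : M -> R) :
    chart R M -> M -> 'I_4 -> R :=
  fun phi p c => pd phi c f p.

(* The matrix of the symmetric product dx^i dx^j, so that 2 dx^i dx^j has
   off-diagonal components 1 if i != j, and dx^i dx^i has diagonal entry 1. *)
Definition dxdx (R : realType) (i j : 'I_4) : 'M[R]_4 :=
  2^-1 *: (delta_mx i j + delta_mx j i).

(* In the chart phi, with coordinates (u, v, x^3, x^4) numbered 0, 1, 2, 3. *)
Section NormalForm.
Variables (R : realType) (M : topologicalType) (phi : chart R M).
Variables (c e1 e2 kappa : R).

Let u (p : M) : R := chart_map phi p 0 0.
Let v (p : M) : R := chart_map phi p 0 1.
Let du2 : 'M[R]_4 := dxdx R 0 0.
Let dv2 : 'M[R]_4 := dxdx R 1 1.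
Let dudv : 'M[R]_4 := dxdx R 0 1.

Definition warped_metric (h : R -> R -> 'M[R]_2) (p : M) : 'M[R]_4 :=
  2 *: dudv
  + u p ^+ 2 *: \sum_(al < 2) \sum_(be < 2)
      h (chart_map phi p 0 2) (chart_map phi p 0 3) al be *:
        dxdx R (rshift 2 al) (rshift 2 be).

Definition Ffun (p : M) : R :=
  kappa ^+ 4 *
  (1 + 2 * c * u p * v p + 2 * e1 * u p + (e1 ^+ 2 - c * e2) * u p ^+ 2)^-1.

Definition projective_partner (G : 'M[R]_4) (p : M) : 'M[R]_4 :=
  (kappa * Ffun p) *: G
  - (kappa ^- 3 * Ffun p ^+ 2) *:
      ((c * v p ^+ 2 + 2 * e1 * v p + e2) *: du2
       + (c * u p ^+ 2) *: dv2
       + (2 * u p * (c * v p + e1 + (e1 ^+ 2 - c * e2) * u p)) *: dudv).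

End NormalForm.

(* Main.v *)
From HB Require Import structures.
From mathcomp Require Import all_boot all_order all_algebra.
From mathcomp Require Import all_classical all_reals all_analysis.
From mathcomp Require Import ring lra.
Require Import Defs.

Set Implicit Arguments.
Unset Strict Implicit.
Unset Printing Implicit Defensive.

Import Order.TTheory GRing.Theory Num.Theory.
Import numFieldNormedType.Exports.

Local Open Scope classical_set_scope.
Local Open Scope ring_scope.

(** Two metrics are projectively related iff [a = E g'^-1 g], with
    [E = (det g' / det g)^(1/5)], solves Sinyukov's equation
    [nabla_c a = e_c (x) lam + lam (x) e_c] for some vector field [lam].
    Holonomy of type R11 yields a local parallel null vector field [l]: the
    infinitesimal holonomy along thin loops kills [l] at the base point. Hence
    [R(l, .) = 0], and contracting the Ricci identity for [a] with [l] gives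
    [nabla lam = sigma id] with [sigma] constant, so that the curvature commutes
    with [a] and kills [lam]. Where [lam] and the curvature [F] do not vanish,
    [a F = kap F] with [kap] constant, and [a - kap] maps [l] to [u lam] with
    [grad u = l]. This gives a vector field [s] with [nabla s = id] and
    [a = kap + c s s + e1 (s l + l s) + e2 l l].  With [v = s.s / 2u] and
    [n = grad v] the null fields [l] and [n] commute; functions constant along
    both complete [(u, v)] to coordinates in which [g] is the warped metric, and
    [g'] is recovered from [a].  The constant [kap] is positive because [g'] has
    only one timelike direction. *)

(** * Calculus in R^n *)

(** The weight [E] is forced. In dimension 4 the difference of the connections has trace [5 psi],
    and the logarithmic derivative of [det g' / det g] is twice that trace, so precisely the fifth
    root has [d ln E = 2 psi]. This cancels the trace part of the difference when [E g'^-1 g] is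
    differentiated, and the same [E] turns out to be the [F] of the statement, whence
    [psi = d (ln F / 2)]. A dense set is all that can be reached by shrinking: on a given open set
    either [psi] vanishes, or some point has [lam], the curvature and [(a - kap) l] all nonzero. The
    last may vanish at a point, but not on an open set where [lam] and the curvature do not. The
    holonomy group consists of transports along paths, so a parallel field can only be extracted if
    transport depends smoothly on the path; geodesics, the inverse function theorem and the adapted
    coordinates need flows too. One theorem on smooth local flows serves them all: parameters become
    coordinates with zero velocity, and time is rescaled so that the time-one map exists. The
    constants of the statement are [kappa = 1 / kap] and the cone constants divided by [kap]. *)

Section EpsilonDelta.
Variable R : realType.

Lemma row_coord_le n (x : 'rV[R]_n) i : `|x 0 i| <= `|x|.
Proof.
rewrite [in leRHS]/Num.Def.normr /= mx_normrE.
by apply: le_trans (le_bigmax _ _ (0, i)).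
Qed.

Lemma row_norm_le n (x : 'rV[R]_n) e :
  0 <= e -> (forall i, `|x 0 i| <= e) -> `|x| <= e.
Proof.
move=> e0 H; rewrite [in leLHS]/Num.Def.normr /= mx_normrE.
by apply/bigmax_leP; split=> // -[j i] _ /=; rewrite ord1.
Qed.

Lemma row_norm_lt n (x : 'rV[R]_n) e :
  0 < e -> (forall i, `|x 0 i| < e) -> `|x| < e.
Proof.
move=> e0 H; rewrite [in ltLHS]/Num.Def.normr /= mx_normrE.
by apply/bigmax_ltP; split=> // -[j i] _ /=; rewrite ord1.
Qed.

Lemma open_ball_sub (U : normedModType R) (O : set U) x :
  open O -> O x -> exists2 e : R, 0 < e & forall y, `|y - x| < e -> O y.
Proof.
rewrite openE => oO /oO /nbhs_normP[e /= e0 He].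
by exists e => // y yx; apply: He => /=; rewrite distrC.
Qed.

Lemma open_of_balls (U : normedModType R) (O : set U) :
  (forall x, O x -> exists2 e : R, 0 < e & forall y, `|y - x| < e -> O y) -> open O.
Proof.
move=> H; rewrite openE => x /H[e e0 He]; apply/nbhs_normP; exists e => //= y /=.
by rewrite distrC => /He.
Qed.

Lemma near_normP (U : normedModType R) (x : U) (P : U -> Prop) :
  (\forall y \near x, P y) <-> exists2 e : R, 0 < e & forall y, `|y - x| < e -> P y.
Proof.
split=> [/nbhs_normP[e /= e0 He]|[e e0 He]].
  by exists e => // y yx; apply: He => /=; rewrite distrC.
by apply/nbhs_normP; exists e => //= y /=; rewrite distrC => /He.
Qed.

Lemma continuous_eps (U W : normedModType R) (f : U -> W) x :
  {for x, continuous f} <->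
  forall e : R, 0 < e -> exists2 d : R, 0 < d & forall y, `|y - x| < d -> `|f y - f x| < e.
Proof.
split=> [/cvgrPdist_lt H e /H /near_normP[d d0 Hd]|H].
  by exists d => // y /Hd; rewrite distrC.
apply/cvgrPdist_lt => e /H [d d0 Hd]; apply/near_normP; exists d => // y /Hd.
by rewrite distrC.
Qed.

(** Multiplying by [h] turns the limit of difference quotients into a bound that also holds at
    [h = 0], so the estimates below need not leave out the origin. *)
Lemma is_derive_eps (U : normedModType R) (f : U -> R) x v l :
  is_derive x v f l <->
  forall e : R, 0 < e -> exists2 d : R, 0 < d &
    forall h : R, `|h| < d -> `|f (x + h *: v) - f x - h * l| <= e * `|h|.
Proof.
have E (h : R) : h != 0 ->
  `|l - h^-1 *: ((f \o shift x) (h *: v) - f x)| * `|h| =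
    `|f (x + h *: v) - f x - h * l|.
  move=> h0; rewrite -normrM distrC /= [h *: v + x]addrC /GRing.scale /=.
  by congr (`|_|); field.
split=> [[df dv] e e0|H].
  have : h^-1 *: ((f \o shift x) (h *: v) - f x) @[h --> 0^'] --> l.
    by rewrite -dv; exact: df.
  move=> /cvgrPdist_le /(_ e e0); rewrite near_withinE => /near_normP[d d0 Hd].
  exists d => // h hd; have [->|h0] := eqVneq h 0.
    by rewrite scale0r addr0 subrr mul0r subrr normr0 mulr0.
  by rewrite -E//; apply: ler_wpM2r => //; apply: Hd; rewrite ?subr0.
have cv : h^-1 *: ((f \o shift x) (h *: v) - f x) @[h --> 0^'] --> l.
  apply/cvgrPdist_le => e /H[d d0 Hd]; rewrite near_withinE.
  apply: (iffRL (near_normP (0 : R) _)).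
  exists d => // h; rewrite subr0 => hd h0.
  have hp : 0 < `|h| by rewrite normr_gt0.
  by rewrite -(ler_pM2r hp) E//; exact: Hd.
split; first by apply/cvg_ex; exists l.
exact: cvg_lim cv.
Qed.

(** Brings directional derivatives down to one real variable, where the mean value theorem
    applies. *)
Lemma is_derive_line (U : normedModType R) (f : U -> R) x v l t :
  is_derive (x + t *: v) v f l <-> is_derive t 1 (fun s : R => f (x + s *: v)) l.
Proof.
have E h : x + t *: v + h *: v = x + (t + h *: 1) *: v.
  by rewrite -addrA -scalerDl /GRing.scale /= mulr1.
split=> /is_derive_eps H; apply/is_derive_eps => e /H[d d0 Hd];
  by exists d => // h /Hd; rewrite E.
Qed.

Lemma is_derive_cont (f : R -> R) (t l : R) :
  is_derive t 1 f l -> {for t, continuous f}.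
Proof. by case=> /derivable1_diffP /differentiable_continuous. Qed.

Lemma is_derive_unique (U : normedModType R) (f : U -> R) x v l l' :
  is_derive x v f l -> is_derive x v f l' -> l = l'.
Proof. by move=> [_ <-] [_ <-]. Qed.

Lemma mean_value (f df : R -> R) (a b : R) :
  (forall t : R, Num.min a b <= t <= Num.max a b -> is_derive t 1 f (df t)) ->
  exists2 c : R, Num.min a b <= c <= Num.max a b & f b - f a = df c * (b - a).
Proof.
wlog ab : a b / a <= b.
  move=> W H; case/orP: (le_total a b) => [ab|ba]; first exact: W.
  have [t|c Hc E] := W b a ba; first by rewrite minC maxC; apply: H.
  by exists c; rewrite 1?minC 1?maxC// -opprB E -mulrN opprB.
rewrite min_l// max_r// => H.
have [| |c] := @MVT_segment R f df a b ab.
- by move=> x /[!in_itv] /= /andP[/ltW ? /ltW ?]; apply: H; apply/andP.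
- apply: derivable_within_continuous => x /[!in_itv] /= Hx.
  by case: (H _ Hx).
- by rewrite in_itv /= => Hc ->; exists c.
Qed.

Lemma derivative_bound (f df : R -> R) (a b M : R) :
  (forall t : R, Num.min a b <= t <= Num.max a b ->
     is_derive t 1 f (df t) /\ `|df t| <= M) ->
  `|f b - f a| <= M * `|b - a|.
Proof.
move=> H; have [t /H[]//|c /H[_ Hc] ->] := @mean_value f df a b.
by rewrite normrM ler_wpM2r.
Qed.

Lemma zero_derivative_eq (f : R -> R) (a b : R) :
  (forall t : R, Num.min a b <= t <= Num.max a b -> is_derive t 1 f 0) -> f a = f b.
Proof.
move=> H; have [c _] := mean_value H.
by rewrite mul0r => /eqP; rewrite subr_eq0 => /eqP.
Qed.

Lemma finite_delta n (P : 'I_n -> R -> Prop) :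
  (forall i, exists2 d : R, 0 < d & P i d) ->
  (forall i d d', 0 < d' -> d' <= d -> P i d -> P i d') ->
  exists2 d : R, 0 < d & forall i, P i d.
Proof.
move=> H mono; have [D HD] : {D : 'I_n -> R & forall i, 0 < D i /\ P i (D i)}.
  by apply: (@choice _ _ (fun i d => 0 < d /\ P i d)) => i; have [d] := H i; exists d.
have m0 : 0 < \big[Num.min/1]_i D i.
  by apply/bigmin_gtP; split=> // i _; have [] := HD i.
(* The initial value 1 covers the case of no indices. *)
exists (\big[Num.min/1]_i D i) => // i; have [_ /mono] := HD i; apply => //.
exact: bigmin_le.
Qed.

End EpsilonDelta.

(** * Strict differentiability and the chain rule *)

Section StrictDifferentiability.
Variable R : realType.

(** [partial] in arbitrary dimension: the flows below live on state spaces of dimension 6, 8 and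
    12. *)
Definition pt n (i : 'I_n) (f : 'rV[R]_n -> R) : 'rV[R]_n -> R :=
  fun x => 'D_(delta_mx 0 i) f x.

Lemma pt_is_derive n (i : 'I_n) (f : 'rV[R]_n -> R) x :
  derivable f x (delta_mx 0 i) -> is_derive x (delta_mx 0 i) f (pt i f x).
Proof. by split. Qed.

Lemma is_derive_pt n (i : 'I_n) (f : 'rV[R]_n -> R) x l :
  is_derive x (delta_mx 0 i) f l -> pt i f x = l.
Proof. by case. Qed.

(** Telescoping over a path from [b] to [a] that changes one coordinate at a time reduces the
    estimate to mean values in one variable. The sup norm matters here: its balls are boxes, so the
    path does not leave the ball. *)
Lemma mvt_ball n (f : 'rV[R]_n -> R) x0 (m e : R) : 0 < m ->
  (forall i (x : 'rV[R]_n), `|x - x0| < m -> derivable f x (delta_mx 0 i) /\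
     `|pt i f x - pt i f x0| <= e) ->
  forall a b : 'rV[R]_n, `|a - x0| < m -> `|b - x0| < m ->
    `|f a - f b - \sum_i pt i f x0 * (a 0 i - b 0 i)| <= n%:R * (e * `|a - b|).
Proof.
move=> m0 H a b ad bd.
pose c k : 'rV[R]_n := \row_j (if (j < k)%N then a 0 j else b 0 j).
have c0 : c 0%N = b by apply/rowP => j; rewrite !mxE.
have cn : c n = a by apply/rowP => j; rewrite !mxE ltn_ord.
have -> : f a - f b = \sum_(k < n) (f (c k.+1) - f (c k)).
  by rewrite -c0 -cn -(@telescope_sumr _ 0 n (fun k => f (c k))) // big_mkord.
rewrite -sumrB; apply: (le_trans (ler_norm_sum _ _ _)).
apply: (@le_trans _ _ (\sum_(k < n) e * `|a - b|)); last first.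
  by rewrite sumr_const card_ord -[leLHS]mulr_natl.
apply: ler_sum => k _.
have cS : c k.+1 = c k + (a 0 k - b 0 k) *: delta_mx 0 k.
  apply/rowP => j; rewrite !mxE /= ltnS.
  case: (ltngtP j k) => [jk|kj|/val_inj ->].
  - by rewrite -val_eqE /= (ltn_eqF jk) mulr0 addr0.
  - by rewrite -val_eqE /= (gtn_eqF kj) mulr0 addr0.
  - by rewrite eqxx mulr1 addrC subrK.
have inb (s : R) : Num.min 0 (a 0 k - b 0 k) <= s <= Num.max 0 (a 0 k - b 0 k) ->
    `|c k + s *: delta_mx 0 k - x0| < m.
  move=> Hs; apply: row_norm_lt => //.
  move=> j; have := le_lt_trans (row_coord_le _ j) ad.
  have := le_lt_trans (row_coord_le _ j) bd; rewrite !mxE /= !ltr_norml.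
  case: (ltngtP j k) => [jk|kj|/val_inj jk].
  - by rewrite -val_eqE /= (ltn_eqF jk) mulr0 addr0.
  - by rewrite -val_eqE /= (gtn_eqF kj) mulr0 addr0.
  - rewrite jk eqxx mulr1; move: Hs.
    case: (lerP 0 (a 0 k - b 0 k)) => _ /andP[? ?] /andP[? ?] /andP[? ?];
    by apply/andP; split; lra.
have [s Hs|xi Hxi] := @mean_value R (fun s => f (c k + s *: delta_mx 0 k))
   (fun s => pt k f (c k + s *: delta_mx 0 k)) 0 (a 0 k - b 0 k).
  apply: (iffLR (is_derive_line f (c k) (delta_mx 0 k) _ s)).
  exact: pt_is_derive (H k _ (inb _ Hs)).1.
rewrite scale0r addr0 -cS subr0 => ->; rewrite -mulrBl normrM.
have ? : `|a 0 k - b 0 k| <= `|a - b|.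
  by have := row_coord_le (a - b) k; rewrite !mxE.
by rewrite ler_pM// (H k _ (inb _ Hxi)).2.
Qed.

(** Both points are free to move. The chain rule needs only one moving point, but local injectivity
    in the inverse function theorem needs two. *)
Lemma strict_diff n (O : set 'rV[R]_n) (f : 'rV[R]_n -> R) x0 :
  open O -> O x0 -> (forall i x, O x -> derivable f x (delta_mx 0 i)) ->
  (forall i, {for x0, continuous (pt i f)}) ->
  forall e : R, 0 < e -> exists2 d : R, 0 < d &
    forall a b : 'rV[R]_n, `|a - x0| < d -> `|b - x0| < d ->
      `|f a - f b - \sum_i pt i f x0 * (a 0 i - b 0 i)| <= e * `|a - b|.
Proof.
move=> oO Ox0 df cf e e0.
have e1 : 0 < e / n.+1%:R by rewrite divr_gt0.
have [d1 d10 H1] := open_ball_sub oO Ox0.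
have [d2 d20 H2] : exists2 d : R, 0 < d & forall i y, `|y - x0| < d ->
    `|pt i f y - pt i f x0| < e / n.+1%:R.
  apply: finite_delta => [i|i d d' d'0 dd' H y yd].
    by have /continuous_eps/(_ _ e1) := cf i.
  by apply: H; apply: lt_le_trans dd'.
have m0 : 0 < Num.min d1 d2 by rewrite lt_min d10.
exists (Num.min d1 d2) => // a b ad bd.
apply: (le_trans (@mvt_ball n f x0 _ (e / n.+1%:R) m0 _ a b ad bd)).
  move=> i x; rewrite lt_min => /andP[xd1 xd2].
  by split; [apply: df; exact: H1|apply/ltW; exact: H2].
rewrite mulrA ler_wpM2r//.
by rewrite mulrCA ler_piMr ?(ltW e0)// ler_pdivrMr// mul1r ler_nat.
Qed.

Lemma is_derive_dir n (f : 'rV[R]_n -> R) x v l :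
  is_derive x v f l <-> is_derive (0 : R) 1 (fun s : R => f (x + s *: v)) l.
Proof.
have := is_derive_line f x v l 0; rewrite scale0r addr0; exact.
Qed.

Lemma chain_curve n (O : set 'rV[R]_n) (f : 'rV[R]_n -> R) (c : R -> 'rV[R]_n)
    (t : R) (dc : 'I_n -> R) :
  open O -> (forall i x, O x -> derivable f x (delta_mx 0 i)) ->
  (forall i x, O x -> {for x, continuous (pt i f)}) -> O (c t) ->
  (forall i, is_derive t 1 (fun s => c s 0 i) (dc i)) ->
  is_derive t 1 (fun s => f (c s)) (\sum_i pt i f (c t) * dc i).
Proof.
move=> oO df cf Oct dcP; apply: (iffRL (is_derive_eps _ _ _ _)) => e e0.
(* [M] and [N] bound the gradient of [f] and the velocity of [c], the added 1 making them positive;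
   half of [e] pays for the error of [f], the other half for that of [c]. *)
pose M := \sum_i `|pt i f (c t)| + 1; pose N := \sum_i `|dc i| + 1.
have M0 : 0 < M by rewrite ltr_wpDl// sumr_ge0.
have N0 : 0 < N by rewrite ltr_wpDl// sumr_ge0.
have e1 : 0 < e / 2 / N by rewrite !divr_gt0.
have e2 : 0 < Num.min 1 (e / 2 / M) by rewrite lt_min ltr01 !divr_gt0.
have [d1 d10 H1] := strict_diff oO Oct df (fun i => cf i _ Oct) e1.
have [d2 d20 H2] : exists2 d : R, 0 < d & forall i h, `|h| < d ->
    `|c (t + h *: 1) 0 i - c t 0 i - h * dc i| <= Num.min 1 (e / 2 / M) * `|h|.
  apply: finite_delta => [i|i d d' d'0 dd' H y yd].
    by have /is_derive_eps/(_ _ e2) := dcP i.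
  by apply: H; apply: lt_le_trans dd'.
exists (Num.min d2 (d1 / N)) => [|h]; first by rewrite lt_min d20 divr_gt0.
rewrite lt_min => /andP[hd2 hd1]; set c' := c (t + h *: 1).
have cN : `|c' - c t| <= N * `|h|.
  apply: row_norm_le => [|i]; first by rewrite mulr_ge0// ltW.
  rewrite !mxE; apply: (@le_trans _ _ (1 * `|h| + `|h * dc i|)).
    have -> : c' 0 i - c t 0 i = (c' 0 i - c t 0 i - h * dc i) + h * dc i by rewrite subrK.
    apply: le_trans (ler_normD _ _) _; apply: lerD => //.
    by apply: le_trans (H2 _ _ hd2) _; rewrite ler_wpM2r// ge_min lexx.
  rewrite normrM [`|h| * _]mulrC -mulrDl ler_wpM2r// addrC lerD2r.
  by rewrite (bigD1 i)//= lerDl sumr_ge0.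
have -> : f c' - f (c t) - h * (\sum_i pt i f (c t) * dc i) =
   (f c' - f (c t) - \sum_i pt i f (c t) * (c' 0 i - c t 0 i)) +
   \sum_i pt i f (c t) * (c' 0 i - c t 0 i - h * dc i).
  rewrite mulr_sumr -[RHS]addrA; congr (_ + _); rewrite -!sumrN -big_split /=.
  by apply: eq_bigr => i _; ring.
apply: le_trans (ler_normD _ _) _.
have -> : e * `|h| = e / 2 / N * (N * `|h|) + M * (e / 2 / M * `|h|).
  by field; rewrite !lt0r_neq0.
apply: lerD.
  apply: le_trans (H1 _ _ _ _) _; rewrite ?subrr ?normr0//.
    by apply: le_lt_trans cN _; rewrite mulrC -ltr_pdivlMr.
  by rewrite ler_wpM2l// ltW.
apply: le_trans (ler_norm_sum _ _ _) _.
apply: (@le_trans _ _ (\sum_i `|pt i f (c t)| * (e / 2 / M * `|h|))).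
  apply: ler_sum => i _; rewrite normrM ler_wpM2l//.
  by apply: le_trans (H2 _ _ hd2) _; rewrite ler_wpM2r// ge_min lexx orbT.
by rewrite -mulr_suml ler_wpM2r ?lerDl// mulr_ge0// !divr_ge0// ltW.
Qed.

End StrictDifferentiability.

(** * Functions of class C^k on an open set *)

Section Ck.
Variable R : realType.

(** Graded by the order, so that closure under products, inverses and composition is an induction on
    [k]; [smooth_on] is recovered by asking for every [k]. *)
Fixpoint Ck n (k : nat) (O : set 'rV[R]_n) (f : 'rV[R]_n -> R) : Prop :=
  (forall x, O x -> {for x, continuous f}) /\
  if k is k'.+1 then forall i,
    (forall x, O x -> derivable f x (delta_mx 0 i)) /\ Ck k' O (pt i f)
  else True.

Lemma Ck_cont n k (O : set 'rV[R]_n) f x :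
  Ck k O f -> O x -> {for x, continuous f}.
Proof. by case: k => [|k] [H _]; exact: H. Qed.

Lemma Ck_der n k (O : set 'rV[R]_n) f x i :
  Ck k.+1 O f -> O x -> is_derive x (delta_mx 0 i) f (pt i f x).
Proof. by move=> [_ /(_ i)[H _]] Ox; split => //; apply: H. Qed.

Lemma Ck_pt n k (O : set 'rV[R]_n) f i : Ck k.+1 O f -> Ck k O (pt i f).
Proof. by move=> [_ /(_ i)[]]. Qed.

Lemma CkW n k (O : set 'rV[R]_n) f : Ck k.+1 O f -> Ck k O f.
Proof.
elim: k f => [|k IH] f /=; first by case.
by move=> [cf H]; split=> // i; have [df /IH] := H i.
Qed.

Lemma CkS1 n k (O : set 'rV[R]_n) f : Ck k.+1 O f -> Ck 1 O f.
Proof. by elim: k => // k IH /CkW/IH. Qed.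

Lemma Ck_sub n k (O O' : set 'rV[R]_n) f : O' `<=` O -> Ck k O f -> Ck k O' f.
Proof.
move=> sO; elim: k f => [|k IH] f [cf H]; first by split=> // x /sO/cf.
split=> [x /sO/cf//|i].
by have [df /IH] := H i; split=> // x /sO/df.
Qed.

(** Functions read in a chart have arbitrary values outside it, hence equality may be assumed on [O]
    only. *)
Lemma Ck_eq n k (O : set 'rV[R]_n) f g : open O ->
  (forall x, O x -> f x = g x) -> Ck k O f -> Ck k O g.
Proof.
move=> oO; elim: k f g => [|k IH] f g fg /= [cf H].
  split=> // x Ox; apply/continuous_eps => e e0.
  have [d1 d10 H1] := open_ball_sub oO Ox.
  have /continuous_eps/(_ _ e0)[d2 d20 H2] := cf _ Ox.
  exists (Num.min d1 d2); first by rewrite lt_min d10.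
  by move=> y; rewrite lt_min => /andP[/H1 Oy /H2]; rewrite !fg.
have near x : O x -> \forall y \near x, f y = g y.
  move=> Ox; apply/near_normP; have [d d0 H'] := open_ball_sub oO Ox.
  by exists d => // y /H'/fg.
split.
  have /CkW/(IH f g fg) : Ck k.+1 O f by [].
  by move=> ckg x Ox; exact: (Ck_cont ckg Ox).
move=> i; have [df ck] := H i; split.
  by move=> x Ox; apply: near_eq_derivable (near _ Ox) (df _ Ox).
by apply: IH ck => x Ox; apply: near_eq_derive; exact: near.
Qed.

Lemma Ck_cst n k (O : set 'rV[R]_n) (a : R) : Ck k O (fun=> a).
Proof.
elim: k a => [|k IH] a; first by split=> // x _; exact: cst_continuous.
split=> [x _|i]; first exact: cst_continuous.
split=> [x _|]; first exact: derivable_cst.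
suff -> : pt i (fun=> a) = (fun=> 0) :> ('rV[R]_n -> R) by [].
by apply/funext => x; exact: derive_cst.
Qed.

Lemma coord_is_derive n (j : 'I_n) (x v : 'rV[R]_n) :
  is_derive x v (fun y => y 0 j) (v 0 j).
Proof.
apply/is_derive_eps => e e0; exists 1 => // h _.
by rewrite !mxE [x 0 j + _]addrC addrK subrr normr0 mulr_ge0// ltW.
Qed.

Lemma Ck_coord n k (O : set 'rV[R]_n) (j : 'I_n) : Ck k O (fun x => x 0 j).
Proof.
case: k => [|k]; first by split=> // x _; exact: coord_continuous.
split=> [x _|i]; first exact: coord_continuous.
split=> [x _|]; first by case: (coord_is_derive j x (delta_mx 0 i)).
suff -> : pt i (fun x => x 0 j) = (fun=> (i == j)%:R) :> ('rV[R]_n -> R).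
  exact: Ck_cst.
apply/funext => x; rewrite (is_derive_pt (coord_is_derive _ _ _)).
by rewrite mxE eqxx eq_sym.
Qed.

Lemma CkD n k (O : set 'rV[R]_n) f g : open O ->
  Ck k O f -> Ck k O g -> Ck k O (fun x => f x + g x).
Proof.
move=> oO; elim: k f g => [|k IH] f g [cf Hf] [cg Hg].
  by split=> // x Ox; apply: continuousD; [exact: cf|exact: cg].
split; first by move=> x Ox; apply: continuousD; [exact: cf|exact: cg].
move=> i; have [df ckf] := Hf i; have [dg ckg] := Hg i; split.
  by move=> x Ox; apply: derivableD; [exact: df|exact: dg].
apply: Ck_eq (IH _ _ ckf ckg) => // x Ox.
by rewrite /pt [RHS]deriveD//; [exact: df|exact: dg].
Qed.

Lemma CkM n k (O : set 'rV[R]_n) f g : open O ->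
  Ck k O f -> Ck k O g -> Ck k O (fun x => f x * g x).
Proof.
move=> oO; elim: k f g => [|k IH] f g Ckf Ckg.
  by split=> // x Ox; apply: continuousM; [exact: (Ck_cont Ckf Ox)|exact: (Ck_cont Ckg Ox)].
split; first by move=> x Ox; apply: continuousM; [exact: (Ck_cont Ckf Ox)|exact: (Ck_cont Ckg Ox)].
move=> i; have [_ /(_ i)[df ckf]] := Ckf; have [_ /(_ i)[dg ckg]] := Ckg; split.
  by move=> x Ox; apply: derivableM; [exact: df|exact: dg].
apply: Ck_eq (CkD oO (IH _ _ (CkW Ckf) ckg) (IH _ _ (CkW Ckg) ckf)) => // x Ox.
by rewrite /pt [RHS]deriveM//; [exact: df|exact: dg].
Qed.

Lemma CkN n k (O : set 'rV[R]_n) f : open O -> Ck k O f -> Ck k O (fun x => - f x).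
Proof.
move=> oO cf; apply: Ck_eq (CkM oO (Ck_cst k O (-1)) cf) => // x _.
by rewrite mulN1r.
Qed.

Lemma CkB n k (O : set 'rV[R]_n) f g : open O ->
  Ck k O f -> Ck k O g -> Ck k O (fun x => f x - g x).
Proof. by move=> oO cf cg; apply: CkD => //; apply: CkN. Qed.

Lemma Ck_sum n k (O : set 'rV[R]_n) (I : Type) (r : seq I) (P : pred I) F :
  open O -> (forall i, Ck k O (F i)) ->
  Ck k O (fun x => \sum_(i <- r | P i) F i x).
Proof.
move=> oO H; elim: r => [|i r IH].
  by apply: Ck_eq (Ck_cst k O 0) => // x _; rewrite big_nil.
have [Pi|Pi] := boolP (P i).
  by apply: Ck_eq (CkD oO (H i) IH) => // x _; rewrite big_cons Pi.
by apply: Ck_eq IH => // x _; rewrite big_cons (negbTE Pi).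
Qed.

Lemma Ck_prod n k (O : set 'rV[R]_n) (I : Type) (r : seq I) (P : pred I) F :
  open O -> (forall i, Ck k O (F i)) ->
  Ck k O (fun x => \prod_(i <- r | P i) F i x).
Proof.
move=> oO H; elim: r => [|i r IH].
  by apply: Ck_eq (Ck_cst k O 1) => // x _; rewrite big_nil.
have [Pi|Pi] := boolP (P i).
  by apply: Ck_eq (CkM oO (H i) IH) => // x _; rewrite big_cons Pi.
by apply: Ck_eq IH => // x _; rewrite big_cons (negbTE Pi).
Qed.

Lemma CkV n k (O : set 'rV[R]_n) f : open O -> (forall x, O x -> f x != 0) ->
  Ck k O f -> Ck k O (fun x => (f x)^-1).
Proof.
move=> oO f0; elim: k => [|k IH] Ckf.
  by split=> // x Ox; apply: continuousV; [exact: f0|exact: (Ck_cont Ckf Ox)].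
split; first by move=> x Ox; apply: continuousV; [exact: f0|exact: (Ck_cont Ckf Ox)].
move=> i; have [_ /(_ i)[df ckf]] := Ckf; split.
  by move=> x Ox; apply: derivableV; [exact: f0|exact: df].
have ckv := IH (CkW Ckf).
apply: Ck_eq (CkN oO (CkM oO (CkM oO ckv ckv) ckf)) => // x Ox.
rewrite /pt [RHS]deriveV; [|exact: f0|exact: df].
by rewrite /GRing.scale /= mulNr -exprVn expr2.
Qed.

Lemma chain_Ck n k (O : set 'rV[R]_n) f (c : R -> 'rV[R]_n) (t : R) (dc : 'I_n -> R) :
  open O -> Ck k.+1 O f -> O (c t) ->
  (forall i, is_derive t 1 (fun s => c s 0 i) (dc i)) ->
  is_derive t 1 (fun s => f (c s)) (\sum_i pt i f (c t) * dc i).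
Proof.
move=> oO /CkS1 [_ H] Oct dcP; apply: (@chain_curve _ _ O) => //.
  by move=> i; have [] := H i.
by move=> i x Ox; have [_ [Hc _]] := H i; exact: Hc.
Qed.

Lemma row_continuous n (U : normedModType R) (h : U -> 'rV[R]_n) x :
  (forall j, {for x, continuous (fun y => h y 0 j)}) -> {for x, continuous h}.
Proof.
move=> H; apply/continuous_eps => e e0.
have [d d0 Hd] : exists2 d : R, 0 < d & forall j y, `|y - x| < d ->
    `|h y 0 j - h x 0 j| < e.
  apply: finite_delta => [i|i d d' d'0 dd' Hd y yd].
    by have /continuous_eps/(_ _ e0) := H i.
  by apply: Hd; apply: lt_le_trans dd'.
exists d => // y yd; apply: row_norm_lt => // i; rewrite !mxE; exact: Hd.
Qed.

Lemma continuous_for_comp (U V W : topologicalType) (h : U -> V) (f : V -> W) x :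
  {for x, continuous h} -> {for h x, continuous f} ->
  {for x, continuous (fun y => f (h y))}.
Proof. exact: continuous_comp. Qed.

Lemma chain_map n m k (O' : set 'rV[R]_m) (h : 'rV[R]_n -> 'rV[R]_m) f x v
    (dh : 'I_m -> R) :
  open O' -> Ck k.+1 O' f -> O' (h x) ->
  (forall j, is_derive x v (fun y => h y 0 j) (dh j)) ->
  is_derive x v (fun y => f (h y)) (\sum_j pt j f (h x) * dh j).
Proof.
move=> oO' ckf Ohx H; apply/is_derive_dir.
have := @chain_Ck _ _ O' f (fun s : R => h (x + s *: v)) 0 dh oO' ckf.
rewrite scale0r addr0 => /(_ Ohx); apply => j.
exact: (iffLR (is_derive_dir (fun y => h y 0 j) x v (dh j)) (H j)).
Qed.

(** By the chain rule a partial derivative of the composite is a sum of products, each of a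
    composite of lower order with a partial derivative of [h]; the induction hypothesis covers the
    composite. *)
Lemma Ck_comp n m k (O : set 'rV[R]_n) (O' : set 'rV[R]_m)
    (h : 'rV[R]_n -> 'rV[R]_m) f :
  open O -> open O' -> (forall j, Ck k O (fun x => h x 0 j)) ->
  (forall x, O x -> O' (h x)) -> Ck k O' f -> Ck k O (fun x => f (h x)).
Proof.
move=> oO oO'; elim: k f => [|k IH] f Ckh Oh Ckf.
  split=> // x Ox; apply: continuous_for_comp.
    by apply: row_continuous => j; exact: (Ck_cont (Ckh j) Ox).
  exact: (Ck_cont Ckf (Oh _ Ox)).
split.
  move=> x Ox; apply: continuous_for_comp.
    by apply: row_continuous => j; exact: (Ck_cont (Ckh j) Ox).
  exact: (Ck_cont Ckf (Oh _ Ox)).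
have H i x (Ox : O x) := chain_map oO' Ckf (Oh _ Ox)
  (fun j => Ck_der i (Ckh j) Ox).
move=> i; split; first by move=> x Ox; case: (H i x Ox).
apply: (@Ck_eq _ _ _ (fun x => \sum_j pt j f (h x) * pt i (fun y => h y 0 j) x)) => //.
  by move=> x Ox; rewrite (is_derive_pt (H i x Ox)).
apply: Ck_sum => // j; apply: CkM => //; last exact: Ck_pt.
by apply: IH => // [j'|]; [apply: CkW|apply: Ck_pt].
Qed.


Lemma norm_delta_le n (i : 'I_n) : `|delta_mx 0 i : 'rV[R]_n| <= 1.
Proof.
by apply: row_norm_le => // j; rewrite mxE eqxx /=; case: eqP; rewrite ?normr1 ?normr0.
Qed.

Lemma norm_two_steps n (i j : 'I_n) (s t : R) :
  `|s *: delta_mx 0 i + t *: delta_mx 0 j : 'rV[R]_n| <= `|s| + `|t|.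
Proof.
by apply: le_trans (ler_normD _ _) _; rewrite !normrZ lerD// ler_piMr// norm_delta_le.
Qed.

(** The mean value theorem is used twice, first for the difference in direction [j] regarded as a
    function of the step in direction [i]. *)
Lemma double_difference n (f : 'rV[R]_n -> R) i j x (r h : R) :
  (forall y, `|y - x| < r -> derivable f y (delta_mx 0 i) /\
                             derivable (pt i f) y (delta_mx 0 j)) ->
  0 < h -> h + h < r ->
  exists2 y, `|y - x| < r &
    f (x + h *: delta_mx 0 i + h *: delta_mx 0 j) - f (x + h *: delta_mx 0 i)
    - f (x + h *: delta_mx 0 j) + f x = h * h * pt j (pt i f) y.
Proof.
move=> H h0 hr; set ei := delta_mx 0 i; set ej := delta_mx 0 j.
have inr (s t : R) : 0 <= s <= h -> 0 <= t <= h -> `|x + s *: ei + t *: ej - x| < r.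
  move=> /andP[s0 sh] /andP[t0 th]; rewrite -[x + _ + _]addrA [x + _]addrC addrK.
  apply: le_lt_trans (norm_two_steps _ _ _ _) _; rewrite !ger0_norm//; lra.
have mM : (Num.min 0 h = 0) * (Num.max 0 h = h) by rewrite min_l ?max_r ?ltW.
have hh : 0 <= h <= h by rewrite ltW/=.
have h00 : (0 : R) <= 0 <= h by rewrite lexx ltW.
have [s|xi] := @mean_value R (fun s => f (x + h *: ej + s *: ei) - f (x + s *: ei))
   (fun s => pt i f (x + h *: ej + s *: ei) - pt i f (x + s *: ei)) 0 h.
  rewrite !mM => Hs; apply: is_deriveB.
    apply: (iffLR (is_derive_line f (x + h *: ej) ei _ s)).
    have I1 : `|x + h *: ej + s *: ei - x| < r.
      by rewrite [x + h *: ej + _]addrAC; exact: inr.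
    exact: pt_is_derive (H _ I1).1.
  apply: (iffLR (is_derive_line f x ei _ s)).
  have := inr s 0 Hs h00; rewrite scale0r addr0 => I1.
  exact: pt_is_derive (H _ I1).1.
rewrite !mM !scale0r !addr0 subr0 => Hxi E1.
have [t|eta] := @mean_value R (fun t => pt i f (x + xi *: ei + t *: ej))
   (fun t => pt j (pt i f) (x + xi *: ei + t *: ej)) 0 h.
  rewrite !mM => Ht; apply: (iffLR (is_derive_line (pt i f) (x + xi *: ei) ej _ t)).
  exact: pt_is_derive (H _ (inr _ _ Hxi Ht)).2.
rewrite !mM !scale0r !addr0 subr0 => Heta E2.
exists (x + xi *: ei + eta *: ej); first exact: inr.
move: E1; rewrite [x + h *: ej + _ *: ei]addrAC [x + h *: ej + _ *: ei]addrAC E2.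
move=> E1; rewrite mulrC mulrA -E1; ring.
Qed.

(** The second difference over a square is symmetric in [i] and [j], so the two mixed derivatives
    take a common value at two nearby points; continuity of both at [x] finishes the proof. *)
Lemma pt_comm n (O : set 'rV[R]_n) f i j x : open O -> Ck 2 O f -> O x ->
  pt i (pt j f) x = pt j (pt i f) x.
Proof.
move=> oO ckf Ox; apply/eqP; rewrite -subr_eq0 -normr_le0; apply/ler_addgt0Pr => e e0.
have e2 : 0 < e / 2 by rewrite divr_gt0.
have [d1 d10 H1] := open_ball_sub oO Ox.
have /continuous_eps/(_ _ e2)[d2 d20 H2] := Ck_cont (Ck_pt i (Ck_pt j ckf)) Ox.
have /continuous_eps/(_ _ e2)[d3 d30 H3] := Ck_cont (Ck_pt j (Ck_pt i ckf)) Ox.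
pose r := Num.min d1 (Num.min d2 d3); have r0 : 0 < r by rewrite !lt_min d10 d20.
have D k l y : `|y - x| < r -> derivable f y (delta_mx 0 k) /\
                             derivable (pt k f) y (delta_mx 0 l).
  rewrite !lt_min => /andP[/H1 Oy _]; split; first by case: (Ck_der k ckf Oy).
  by case: (Ck_der l (Ck_pt k ckf) Oy).
(* Two sides of the square together must stay below [r]. *)
have h0 : 0 < r / 3 by rewrite divr_gt0.
have hr : r / 3 + r / 3 < r by lra.
have [y yr Ey] := double_difference (@D i j) h0 hr.
have [z zr Ez] := double_difference (@D j i) h0 hr.
have {Ey Ez} yz : pt j (pt i f) y = pt i (pt j f) z.
  have hh0 : r / 3 * (r / 3) != 0 by rewrite mulf_neq0// lt0r_neq0.
  apply: (mulfI hh0); rewrite -Ey -Ez.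
  by rewrite [x + _ + _ in RHS]addrAC; ring.
move: yr zr; rewrite !lt_min => /and3P[_ _ /H3 Hy] /and3P[_ /H2 Hz _].
rewrite add0r; move: Hy Hz; rewrite yz.
set p := pt i (pt j f) z; set a := pt i _ x; set b := pt j _ x => Hy Hz.
have -> : a - b = (p - b) - (p - a) by ring.
apply: (le_trans (ler_normB _ _)); rewrite (splitr e).
exact: (lerD (ltW Hy) (ltW Hz)).
Qed.

End Ck.

Section Smooth.
Variable R : realType.

Definition sm n (O : set 'rV[R]_n) (f : 'rV[R]_n -> R) := forall k, Ck k O f.

(** [foldr] applies the last index of the word first, so words are taken apart from the right. *)
Lemma Ck_smooth_on (O : set 'rV[R]_4) f : smooth_on O f <-> sm O f.
Proof.
split=> [H k|H].
  elim: k f H => [|k IH] f H; first by split=> // x /(H [::])[].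
  split=> [x /(H [::])[]//|i]; split=> [x /(H [::])[_]//|].
  by apply: IH => s x Ox; have := H (rcons s i) x Ox; rewrite foldr_rcons.
move=> s; elim/last_ind: s f H => [|s i IH] f H x Ox.
  by split=> [|i]; [exact: (Ck_cont (H 0%N) Ox)|case: (Ck_der i (H 1%N) Ox)].
by rewrite foldr_rcons; apply: IH Ox => k; apply: Ck_pt (H k.+1).
Qed.

Lemma sm_pt n (O : set 'rV[R]_n) f i : sm O f -> sm O (pt i f).
Proof. by move=> H k; apply: Ck_pt (H k.+1). Qed.

End Smooth.

(** * Ordinary differential equations *)

Section Antiderivative.
Variable R : realType.

Lemma antiderivative_bounded (h : R -> R) (T : R) : continuous h -> 0 < T ->
  exists2 H : R -> R, H 0 = 0 & forall t : R, `|t| < T -> is_derive t 1 H (h t).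
Proof.
move=> ch T0; pose mu := @lebesgue_measure R.
pose F x := (\int[mu]_(t in [set` `[- T, x]]) h t)%R.
exists (fun x => F x - F 0); first by rewrite subrr.
move=> t; rewrite ltr_norml => /andP[Tt tT].
have intg : mu.-integrable `[- T, T] (EFin \o h).
  apply: continuous_compact_integrable; first exact: segment_compact.
  by apply: continuous_subspaceT => x; exact: ch.
have [dF FE] := @continuous_FTC1_closed R h (- T) t T tT intg Tt (ch t).
have -> : h t = h t - 0 by rewrite subr0.
apply: is_deriveB; split; [exact: dF|by rewrite -derive1E].
Qed.

(** The antiderivatives on growing intervals all vanish at 0, hence agree where they are both
    defined, and can be glued. *)
Lemma antiderivative (h : R -> R) : continuous h ->
  exists2 H : R -> R, H 0 = 0 & forall t : R, is_derive t 1 H (h t).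
Proof.
move=> ch.
have /choice[H HH] : forall k : nat, exists H : R -> R, H 0 = 0 /\
    forall t : R, `|t| < k.+1%:R -> is_derive t 1 H (h t).
  move=> k; have [|H H0 HH] := @antiderivative_bounded h k.+1%:R ch; first by [].
  by exists H.
have uniq k m t : `|t| < k.+1%:R -> `|t| < m.+1%:R -> H k t = H m t.
  move=> tk tm; apply/eqP; rewrite -subr_eq0; apply/eqP.
  have := @zero_derivative_eq R (fun s => H k s - H m s) 0 t.
  rewrite (HH k).1 (HH m).1 subrr => E; symmetry; apply: E => s Hs.
  have st : `|s| <= `|t|.
    move: Hs; case: (lerP 0 t) => t0 /andP[a b].
      by rewrite !ger0_norm.
    by rewrite !ler0_norm ?lerN2// ltW.
  have -> : 0 = h s - h s by rewrite subrr.
  by apply: is_deriveB; [apply: (HH k).2|apply: (HH m).2]; apply: le_lt_trans st _.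
pose N (t : R) := Num.trunc `|t|.
have NP t : `|t| < (N t).+1%:R by rewrite truncnS_gt.
exists (fun t => H (N t) t); first by rewrite (HH _).1.
move=> t; pose k := (N t).+1.
have tk : `|t| < k.+1%:R by apply: lt_trans (NP t) _; rewrite ltr_nat.
apply: near_eq_is_derive ((HH k).2 t tk).
apply/(near_normP t); exists 1 => // s st; apply: uniq (NP s).
have -> : s = (s - t) + t by rewrite subrK.
apply: le_lt_trans (ler_normD _ _) _.
by rewrite -natr1 addrC; apply: ltrD.
Qed.

Lemma geometric_small (C e : R) : 0 < e -> exists k, C * 2 ^- k <= e.
Proof.
move=> e0; have [C0|C0] := leP C 0.
  by exists 0%N; rewrite expr0 invr1 mulr1 (le_trans C0)// ltW.
pose k := (Num.trunc (C / e)).+1; exists k.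
rewrite ler_pdivrMr ?exprn_gt0// mulrC -ler_pdivrMr//.
apply: (le_trans (ltW (truncnS_gt _))); rewrite -/k -natrX ler_nat ltnW//.
exact: ltn_expl.
Qed.

(** The intervals of radius [2 * C * 2 ^- k] about [u k] are nested; the limit is the supremum of
    their left ends. *)
Lemma geometric_limit (u : nat -> R) (C : R) :
  (forall k, `|u k.+1 - u k| <= C * 2 ^- k) ->
  exists l, forall k, `|u k - l| <= 2 * C * 2 ^- k.
Proof.
move=> H; pose a k := u k - 2 * C * 2 ^- k; pose b k := u k + 2 * C * 2 ^- k.
have half k : 2 ^- k.+1 = 2^-1 * 2 ^- k :> R by rewrite exprS invfM.
have aS k : a k <= a k.+1.
  by move: (H k); rewrite ler_norml /a half => /andP[A B]; lra.
have bS k : b k.+1 <= b k.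
  by move: (H k); rewrite ler_norml /b half => /andP[A B]; lra.
have C0 : 0 <= C by have := le_trans (normr_ge0 _) (H 0%N); rewrite expr0 invr1 mulr1.
have ab k : a k <= b k.
  rewrite /a /b; have : 0 <= 2 * C * 2 ^- k by rewrite !mulr_ge0// invr_ge0 exprn_ge0.
  by move=> ?; lra.
have abb j k : a j <= b k.
  have aD i : a j <= a (j + i)%N.
    by elim: i => [|i IH]; rewrite ?addn0// addnS (le_trans IH).
  have bD i : b (k + i)%N <= b k.
    by elim: i => [|i IH]; rewrite ?addn0// addnS (le_trans (bS _)).
  by apply: le_trans (aD k) (le_trans (ab _) _); rewrite addnC.
have hs : has_sup (range a).
  split; first by exists (a 0%N), 0%N.
  by exists (b 0%N) => _ [j _ <-].
exists (sup (range a)) => k.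
have : a k <= sup (range a) by apply: sup_upper_bound => //; exists k.
have : sup (range a) <= b k by apply: ge_sup => [|_ [j _ <-]//]; exact: hs.1.
rewrite /a /b ler_norml => ? ?; apply/andP; split; lra.
Qed.

(** The derivative of [A * expR (L * s)] dominates that of [g]. Integrating a bound with this weight
    gains the factor [1 / L], which makes Picard iteration contract on intervals of any length. *)
Lemma exp_comparison (g dg : R -> R) (A L t : R) : 0 <= t -> 0 <= A -> 0 <= L ->
  g 0 = 0 ->
  (forall s : R, 0 <= s <= t -> is_derive s 1 g (dg s)) ->
  (forall s : R, 0 <= s <= t -> `|dg s| <= A * L * expR (L * s)) ->
  `|g t| <= A * expR (L * t).
Proof.
move=> t0 A0 L0 g0 dgP bd.
have E (s : R) : is_derive s 1 (fun x => A * expR (L * x)) (A * L * expR (L * s)).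
  have d1 : is_derive s 1 (fun x => L * x) L.
    by apply: is_derive_eq; rewrite /GRing.scale /= mulr1.
  have d2 := is_derive1_comp (is_derive_expR (L * s)) d1.
  have d3 := is_deriveZ A d2.
  apply: is_derive_eq d3 _; rewrite /GRing.scale /=; ring.
have mM : (Num.min 0 t = 0) * (Num.max 0 t = t) by rewrite min_l ?max_r.
have P (sg : R) : `|sg| = 1 -> sg * g t <= A * expR (L * t).
  move=> sg1.
  have [s|c] := @mean_value R (fun x => A * expR (L * x) - sg * g x)
     (fun x => A * L * expR (L * x) - sg * dg x) 0 t.
    by rewrite !mM => Hs; apply: is_deriveB; have := is_deriveZ sg (dgP _ Hs).
  rewrite !mM g0 mulr0 subr0 mulr0 expR0 mulr1 subr0 => Hc Ec.
  have : 0 <= (A * L * expR (L * c) - sg * dg c) * t.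
    rewrite mulr_ge0// subr_ge0 (le_trans _ (bd _ Hc))//.
    by apply: le_trans (ler_norm _) _; rewrite normrM sg1 mul1r.
  by rewrite -Ec => ?; lra.
rewrite ler_norml; have := P 1 (normr1 _); have := P (-1) (normrN1 _).
by rewrite mul1r mulN1r => ? ?; apply/andP; split; lra.
Qed.

Lemma exp_comparison_sym (g dg : R -> R) (A L t : R) : 0 <= A -> 0 <= L ->
  g 0 = 0 ->
  (forall s : R, `|s| <= `|t| -> is_derive s 1 g (dg s)) ->
  (forall s : R, `|s| <= `|t| -> `|dg s| <= A * L * expR (L * `|s|)) ->
  `|g t| <= A * expR (L * `|t|).
Proof.
move=> A0 L0 g0 dgP bd; have [t0|t0] := leP 0 t.
  rewrite [in leRHS]ger0_norm//; apply: (@exp_comparison g dg) => // s /andP[s0 st].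
    by apply: dgP; rewrite !ger0_norm// (le_trans s0).
  rewrite -[in leRHS](ger0_norm s0); apply: bd; rewrite !ger0_norm// (le_trans s0).
have := @exp_comparison (fun s => g (- s)) (fun s => - dg (- s)) A L (- t).
rewrite opprK (ltr0_norm t0); apply => //; rewrite ?oppr0 ?oppr_ge0 ?ltW//.
  move=> s /andP[s0 st].
  have d1 : is_derive s 1 (fun x : R => - x) (-1).
    by apply: is_derive_eq.
  have d2 := is_derive1_comp (dgP (- s) _) d1.
  apply: is_derive_eq (d2 _) _; last by rewrite mulrN1.
  by rewrite normrN (ger0_norm s0) (ltr0_norm t0).
move=> s /andP[s0 st]; rewrite normrN -[in leRHS](ger0_norm s0) -[in leRHS]normrN.
by apply: bd; rewrite normrN (ger0_norm s0) (ltr0_norm t0).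
Qed.

End Antiderivative.

Lemma between_dist (R : realType) (t h s : R) :
  Num.min t (t + h) <= s <= Num.max t (t + h) -> `|s - t| <= `|h|.
Proof.
have [hge|/ltW hle] := leP 0 h.
  rewrite min_l ?max_r ?lerDl// (ger0_norm hge) ler_norml => /andP[? ?].
  by apply/andP; split; lra.
rewrite min_r ?max_l ?gerDl// (ler0_norm hle) ler_norml => /andP[? ?].
by apply/andP; split; lra.
Qed.

(** * Picard iteration for globally Lipschitz equations *)

Section Picard.
Variables (R : realType) (n : nat) (f : R -> 'rV[R]_n -> 'rV[R]_n) (L : R).
Hypothesis L0 : 0 < L.
Hypothesis lipf : forall t y z, `|f t y - f t z| <= L * `|y - z|.
Hypothesis contf : forall y i, continuous (fun t => f t y 0 i).

Lemma lipschitz_comp_continuous (y : R -> 'rV[R]_n) i (t : R) :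
  {for t, continuous y} -> {for t, continuous (fun s => f s (y s) 0 i)}.
Proof.
move=> cy; apply/continuous_eps => e e0.
have e2 : 0 < e / 2 by rewrite divr_gt0.
have e3 : 0 < e / 2 / L by rewrite !divr_gt0.
have /continuous_eps/(_ _ e2)[d1 d10 H1] := @contf (y t) i t.
have /continuous_eps/(_ _ e3)[d2 d20 H2] := cy.
exists (Num.min d1 d2); first by rewrite lt_min d10.
move=> s; rewrite lt_min => /andP[/H1 A /H2 B].
have -> : f s (y s) 0 i - f t (y t) 0 i =
  (f s (y s) - f s (y t)) 0 i + (f s (y t) 0 i - f t (y t) 0 i).
  by rewrite !mxE addrA subrK.
apply: le_lt_trans (ler_normD _ _) _; rewrite (splitr e); apply: ltrD => //.
apply: le_lt_trans (row_coord_le _ _) _; apply: le_lt_trans (lipf _ _ _) _.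
by rewrite mulrC -ltr_pdivlMr.
Qed.

(** In the weight [expR (2 * L * |t|)] every iteration halves the bound on the difference of
    consecutive iterates, so [T] need not be small. *)
Lemma picard (x0 : 'rV[R]_n) (T : R) : 0 < T ->
  exists y : R -> 'rV[R]_n, y 0 = x0 /\ forall (t : R) i, `|t| < T ->
    is_derive t 1 (fun s => y s 0 i) (f t (y t) 0 i).
Proof.
move=> T0; have /choice[G HG] : forall y : R -> 'rV[R]_n, exists z : R -> 'rV[R]_n,
    continuous y -> z 0 = x0 /\
    forall (t : R) i, is_derive t 1 (fun s => z s 0 i) (f t (y t) 0 i).
  move=> y; have [cy|ny] := pselect (continuous y); last by exists y.
  have /choice[H HH] : forall i, exists H : R -> R, H 0 = 0 /\
      forall t : R, is_derive t 1 H (f t (y t) 0 i).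
    move=> i; have [|H H0 HH] := @antiderivative R (fun t => f t (y t) 0 i).
      by move=> t; apply: lipschitz_comp_continuous; exact: cy.
    by exists H.
  exists (fun t => x0 + \row_i H i t) => _; split.
    by apply/rowP => i; rewrite !mxE (HH i).1 addr0.
  move=> t i; have := is_deriveD (is_derive_cst (x0 0 i) t 1) ((HH i).2 t).
  rewrite add0r; congr is_derive; apply/funext => s /=.
  by rewrite !mxE.
pose Y k := iter k G (fun=> x0).
have contY k : continuous (Y k).
  elim: k => [|k IH] t; first exact: cst_continuous.
  apply: row_continuous => i; exact: is_derive_cont ((HG _ IH).2 t i).
have Y0 k : Y k 0 = x0 by case: k => // k; exact: (HG _ (contY k)).1.
have dY k := (HG _ (contY k)).2.
have [C C0 HC] : exists2 C : R, 0 <= C & forall t, `|t| <= T -> `|f t x0| <= C.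
  have Hc : {within `[- T, T], continuous (fun t => `|f t x0|)}.
    apply: continuous_subspaceT => t.
    apply: cvg_norm; suff : {for t, continuous (fun t => f t x0)} by [].
    by apply: row_continuous => i; exact: contf.
  have [|c _ H] := EVT_max _ Hc; first by rewrite (@le_trans _ _ 0)// ?oppr_le0 ltW.
  exists `|f c x0| => // t tT; apply: H; by rewrite in_itv /= -ler_norml.
(* Chosen so that the weighted bound on the first derivative, [A * (2 * L)], equals [C]. *)
pose A := C / (2 * L); have A0 : 0 <= A by rewrite divr_ge0// mulr_ge0// ltW.
have L20 : 0 <= 2 * L by rewrite mulr_ge0// ltW.
have p2 (k : nat) : 0 <= 2 ^- k :> R by rewrite invr_ge0 exprn_ge0.
have bound k t : `|t| <= T ->
    `|Y k.+1 t - Y k t| <= A * 2 ^- k * expR (2 * L * `|t|).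
  elim: k t => [|k IH] t tT.
    rewrite expr0 invr1 mulr1; apply: row_norm_le => [|i].
      by rewrite mulr_ge0// expR_ge0.
    rewrite !mxE; apply: (@exp_comparison_sym R (fun s => Y 1%N s 0 i - Y 0%N s 0 i)
        (fun s => f s (Y 0%N s) 0 i - 0)) => //.
    - by rewrite !Y0 subrr.
    - by move=> s _; exact: (is_deriveB (dY 0%N s i) (is_derive_cst (x0 0 i) s 1)).
    - move=> s st; rewrite subr0.
      apply: le_trans (row_coord_le _ _) _; apply: le_trans (HC _ (le_trans st tT)) _.
      rewrite /A divfK; last by rewrite mulf_neq0// gt_eqF.
      rewrite ler_peMr//; apply: le_trans (expR_ge1Dx _); by rewrite lerDl mulr_ge0.
  apply: row_norm_le => [|i].
    exact: (mulr_ge0 (mulr_ge0 A0 (p2 _)) (expR_ge0 _)).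
  rewrite !mxE; apply: (@exp_comparison_sym R (fun s => Y k.+2 s 0 i - Y k.+1 s 0 i)
      (fun s => f s (Y k.+1 s) 0 i - f s (Y k s) 0 i)) => //.
  - by rewrite (mulr_ge0 A0 (p2 _)).
  - by rewrite !Y0 subrr.
  - move=> s st.
    have -> : f s (Y k.+1 s) 0 i - f s (Y k s) 0 i = (f s (Y k.+1 s) - f s (Y k s)) 0 i.
      by rewrite !mxE.
    apply: le_trans (row_coord_le _ _) _; apply: le_trans (lipf _ _ _) _.
    have := IH s (le_trans st tT); rewrite -(ler_pM2l L0) => /le_trans; apply.
    rewrite exprS invfM le_eqVlt; apply/orP; left; apply/eqP; field.
    by rewrite expf_neq0.
pose K := A * expR (2 * L * `|T|).
have K0 : 0 <= K by rewrite mulr_ge0// expR_ge0.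
have boundK k t i : `|t| <= T -> `|Y k.+1 t 0 i - Y k t 0 i| <= K * 2 ^- k.
  move=> tT; have := row_coord_le (Y k.+1 t - Y k t) i; rewrite !mxE => /le_trans; apply.
  apply: le_trans (bound k t tT) _; rewrite /K mulrAC ler_wpM2r ?p2//.
  rewrite ler_wpM2l// ler_expR ler_wpM2l//; apply: le_trans tT _; exact: ler_norm.
have /choice[y Hy] : forall t : R, exists y : 'rV[R]_n,
    `|t| <= T -> forall k, `|Y k t - y| <= 2 * K * 2 ^- k.
  move=> t; have [tT|tT] := leP `|t| T; last first.
    by exists x0.
  have /choice[l Hl] : forall i, exists l : R, forall k, `|Y k t 0 i - l| <= 2 * K * 2 ^- k.
    by move=> i; apply: geometric_limit => k; exact: boundK.
  exists (\row_i l i) => _ k; apply: row_norm_le => [|i]; last by rewrite !mxE.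
  by rewrite (mulr_ge0 _ (p2 _))// mulr_ge0.
pose K2 := 2 * K.
have conty (t : R) : `|t| < T -> {for t, continuous y}.
  move=> tT; apply/continuous_eps => e e0.
  have e3 : 0 < e / 3 by rewrite divr_gt0.
  have e4 : 0 < e / 4 by rewrite divr_gt0.
  have [k Hk] := geometric_small K2 e4.
  have /continuous_eps/(_ _ e3)[d d0 Hd] := contY k t.
  exists (Num.min d (T - `|t|)); first by rewrite lt_min d0 subr_gt0.
  move=> s; rewrite lt_min => /andP[/Hd A1 A2].
  have sT : `|s| <= T.
    have -> : s = (s - t) + t by rewrite subrK.
    by apply: le_trans (ler_normD _ _) _; lra.
  have := Hy s sT k; have := Hy t (ltW tT) k => B1 B2.
  have -> : y s - y t = (Y k s - Y k t) - (Y k s - y s) + (Y k t - y t).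
    by apply/rowP => j; rewrite !mxE; ring.
  apply: le_lt_trans (ler_normD _ _) _.
  have := ler_normB (Y k s - Y k t) (Y k s - y s) => B3.
  rewrite -/K2 in B1 B2; clear - e0 Hk B1 B2 B3 A1; lra.
exists y; split.
  apply/eqP; rewrite -subr_eq0 -normr_le0; apply/ler_addgt0Pr => e e0.
  have [k Hk] := geometric_small K2 e0; rewrite add0r distrC.
  by apply: le_trans Hk; rewrite -(Y0 k); apply: Hy; rewrite normr0 ltW.
move=> t i tT; apply/is_derive_eps => e e0.
have e2 : 0 < e / 2 by rewrite divr_gt0.
have e4 : 0 < e / 4 by rewrite divr_gt0.
have /continuous_eps/(_ _ e2)[d d0 Hd] := lipschitz_comp_continuous (i := i) (conty t tT).
exists (Num.min d (T - `|t|)); first by rewrite lt_min d0 subr_gt0.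
move=> h; rewrite lt_min [h *: 1]mulr1 => /andP[hd hT].
have [->|h0] := eqVneq h 0.
  by rewrite addr0 subrr mul0r subr0 normr0 mulr0.
have hp : 0 < `|h| by rewrite normr_gt0.
have near s := @between_dist R t h s.
have inT s : `|s - t| <= `|h| -> `|s| <= T.
  move=> sh; have -> : s = (s - t) + t by rewrite subrK.
  by apply: le_trans (ler_normD _ _) _; lra.
(* The index may depend on [h]: [y] is compared with the iterate [Y k.+1], whose derivative is
   known, and the error of this replacement has to be small relative to [|h|]. *)
have [k1 Hk1] := geometric_small (L * K2) e4.
have eh : 0 < e / 8 * `|h| by rewrite mulr_gt0// divr_gt0.
have [k2 Hk2] := geometric_small K2 eh.
pose k := maxn k1 k2.
have expm (j : nat) : (j <= k)%N -> 2 ^- k <= 2 ^- j :> R.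
  by move=> jk; rewrite lef_pV2 ?posrE ?exprn_gt0// ler_weXn2l// ler1n.
have K20 : 0 <= K2 by rewrite mulr_ge0.
have {}Hk1 : L * K2 * 2 ^- k <= e / 4.
  by apply: le_trans Hk1; rewrite ler_wpM2l ?expm ?leq_maxl// mulr_ge0// ltW.
have {}Hk2 : K2 * 2 ^- k.+1 <= e / 8 * `|h|.
  apply: le_trans Hk2; rewrite ler_wpM2l// (le_trans _ (expm k2 _)) ?leq_maxr//.
  by rewrite lef_pV2 ?posrE ?exprn_gt0// ler_weXn2l// ler1n.
have B0 : `|t| <= T by rewrite ltW.
have B1 : `|Y k.+1 t 0 i - y t 0 i| <= e / 8 * `|h|.
  have := row_coord_le (Y k.+1 t - y t) i; rewrite !mxE => /le_trans; apply.
  exact: le_trans (Hy t B0 k.+1) Hk2.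
have thh : `|t + h - t| <= `|h| by rewrite addrC addKr.
have B2 : `|Y k.+1 (t + h) 0 i - y (t + h) 0 i| <= e / 8 * `|h|.
  have := row_coord_le (Y k.+1 (t + h) - y (t + h)) i; rewrite !mxE => /le_trans; apply.
  exact: le_trans (Hy _ (inT _ thh) k.+1) Hk2.
have := @derivative_bound R (fun s => Y k.+1 s 0 i - s * f t (y t) 0 i)
  (fun s => f s (Y k s) 0 i - f t (y t) 0 i) t (t + h) (e / 4 + e / 2).
have -> : t + h - t = h by ring.
set ft := f t (y t) 0 i => B3.
have {}B3 : `|Y k.+1 (t + h) 0 i - (t + h) * ft - (Y k.+1 t 0 i - t * ft)| <=
    (e / 4 + e / 2) * `|h|.
  apply: B3 => s /near sh; split.
    have D1 : is_derive s 1 (fun s0 : R => s0 * ft) ft.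
      have := is_deriveM (is_derive_id s 1) (is_derive_cst ft s 1).
      move=> D; apply: is_derive_eq D _.
      by rewrite /GRing.scale /= mulr0 add0r mulr1.
    exact: (is_deriveB (dY k s i) D1).
  have -> : f s (Y k s) 0 i - ft = (f s (Y k s) - f s (y s)) 0 i + (f s (y s) 0 i - ft).
    by rewrite !mxE addrA subrK.
  apply: le_trans (ler_normD _ _) _; apply: lerD.
    apply: le_trans (row_coord_le _ _) _; apply: le_trans (lipf _ _ _) _.
    apply: le_trans Hk1; rewrite -mulrA ler_wpM2l ?(ltW L0)//.
    exact: Hy (inT _ sh) k.
  by apply/ltW/Hd; exact: le_lt_trans sh hd.
have -> : y (t + h) 0 i - y t 0 i - h * ft =
   (Y k.+1 (t + h) 0 i - (t + h) * ft - (Y k.+1 t 0 i - t * ft))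
   - (Y k.+1 (t + h) 0 i - y (t + h) 0 i) + (Y k.+1 t 0 i - y t 0 i) by ring.
apply: le_trans (ler_normD _ _) _.
have -> : e * `|h| = (e / 4 + e / 2) * `|h| + e / 8 * `|h| + e / 8 * `|h| by field.
apply: lerD => //; apply: le_trans (ler_normB _ _) _; exact: lerD.
Qed.

End Picard.

(** * Gronwall's inequality for systems *)

Section Gronwall.
Variable R : realType.

Lemma is_derive_bigsum (U : normedModType R) (I : Type) (r : seq I) (x v : U)
    (F : I -> U -> R) (dF : I -> R) :
  (forall i, is_derive x v (F i) (dF i)) ->
  is_derive x v (fun y => \sum_(i <- r) F i y) (\sum_(i <- r) dF i).
Proof.
move=> H; elim: r => [|i r IH].
  rewrite big_nil; under eq_fun do rewrite big_nil; exact: is_derive_cst.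
by rewrite big_cons; under eq_fun do rewrite big_cons; exact: is_deriveD.
Qed.

(** The sup norm is not differentiable, so the estimate runs through the sum of squares [phi] and
    the integrating factor [expR (- c * s)]. The bound [B] is chosen before [D], hence is uniform in
    the solutions compared. *)
Lemma gronwall n (K T : R) : 0 <= K -> 0 <= T ->
  exists2 B : R, 0 < B &
  forall (D : R -> 'rV[R]_n) (dD : R -> 'I_n -> R) (e : R), 0 <= e ->
  (forall (t : R) i, 0 <= t <= T -> is_derive t 1 (fun s => D s 0 i) (dD t i)) ->
  (forall t i, 0 <= t <= T -> `|dD t i| <= K * `|D t| + e) ->
  forall t, 0 <= t <= T -> `|D t| <= B * (`|D 0| + e).
Proof.
(* [2 * K + 1] comes from [2 d (K d + e) <= (2 K + 1) d^2 + e^2] and [N] from the sum over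
   coordinates; [1 <= c] lets [c] absorb the term [N * e ^+ 2]. *)
move=> K0 T0; pose N : R := n%:R; pose c := N * (2 * K + 1) + 1.
have N0 : 0 <= N by rewrite ler0n.
have c1 : 1 <= c by rewrite lerDr mulr_ge0// addr_ge0// mulr_ge0.
have c0 : 0 < c by rewrite (lt_le_trans _ c1).
pose B := (N + 1) * expR (c * T).
have B0 : 0 < B by rewrite mulr_gt0 ?expR_gt0// ltr_wpDl.
exists B => // D dD e e0 dP bd t tT.
pose phi s := \sum_i D s 0 i * D s 0 i.
pose dphi s := \sum_i (D s 0 i * dD s i + D s 0 i * dD s i).
have phi0 s : 0 <= phi s by apply: sumr_ge0 => i _; rewrite -expr2 sqr_ge0.
have phi1 s : `|D s| ^+ 2 <= phi s.
  have [[i ->]|->] : (exists i, `|D s| = `|D s 0 i|) \/ `|D s| = 0.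
  - have [->|Ds] := eqVneq (D s) 0; [right; exact: normr0|left].
    have : mx_norm (D s) != 0 by apply: contra_neq Ds; exact: mx_norm_eq0.
    by case/mx_norm_neq0 => -[j i] /= E; exists i; rewrite -[LHS]/(mx_norm _) E ord1.
  - rewrite real_normK ?num_real// expr2 /phi (bigD1 i)//= lerDl.
    by apply: sumr_ge0 => j _; rewrite -expr2 sqr_ge0.
  - by rewrite expr0n.
have phi2 s : phi s <= N * `|D s| ^+ 2.
  apply: (@le_trans _ _ (\sum_(i < n) `|D s| ^+ 2)); last first.
    by rewrite sumr_const card_ord -[leLHS]mulr_natl.
  apply: ler_sum => i _; rewrite -expr2 -[_ ^+ 2]real_normK ?num_real//.
  by rewrite ler_sqr ?nnegrE// row_coord_le.
have dphiP (s : R) : 0 <= s <= T -> is_derive s 1 phi (dphi s).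
  move=> sT; apply: is_derive_bigsum => i.
  exact: (is_deriveM (dP s i sT) (dP s i sT)).
have dphib s : 0 <= s <= T -> dphi s <= c * phi s + N * e ^+ 2.
  move=> sT; set d := `|D s|.
  apply: (@le_trans _ _ (N * (2 * (d * (K * d + e))))).
    apply: (@le_trans _ _ (\sum_(i < n) 2 * (d * (K * d + e)))); last first.
      by rewrite sumr_const card_ord -[leLHS]mulr_natl.
    apply: ler_sum => i _; rewrite -[leLHS]mulr2n -[leLHS]mulr_natl ler_wpM2l//.
    apply: le_trans (ler_norm _) _; rewrite normrM ler_pM//.
      exact: row_coord_le.
    exact: bd.
  have d0 : 0 <= d by exact: normr_ge0.
  have h1 : 2 * (d * (K * d + e)) <= (2 * K + 1) * d ^+ 2 + e ^+ 2.
    have := sqr_ge0 (d - e); rewrite -subr_ge0 => h.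
    rewrite -subr_ge0; have -> : (2 * K + 1) * d ^+ 2 + e ^+ 2 - 2 * (d * (K * d + e)) =
       (d - e) ^+ 2 by ring.
    exact: sqr_ge0.
  apply: (le_trans (ler_wpM2l N0 h1)); rewrite mulrDr lerD2r mulrA.
  apply: (@le_trans _ _ (c * d ^+ 2)).
    by rewrite ler_wpM2r ?sqr_ge0// /c lerDl.
  by apply: ler_wpM2l; [exact: ltW|exact: phi1].
pose psi s := (phi s + N * e ^+ 2) * expR (- c * s).
have dexp (s : R) : is_derive s 1 (fun s => expR (- c * s)) (expR (- c * s) * - c).
  have d1 : is_derive s 1 (fun x => - c * x) (- c).
    by apply: is_derive_eq; rewrite /GRing.scale /= mulr1.
  exact: (is_derive1_comp (is_derive_expR (- c * s)) d1).
have /andP[t0 tT'] := tT.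
have [s|z] := @mean_value R psi
   (fun s => (phi s + N * e ^+ 2) * (expR (- c * s) * - c) + expR (- c * s) * dphi s) 0 t.
  rewrite min_l// max_r// => /andP[s0 st].
  have sT : 0 <= s <= T by rewrite s0 (le_trans st).
  have d1 : is_derive s 1 (fun s => phi s + N * e ^+ 2) (dphi s).
    have := is_deriveD (dphiP s sT) (is_derive_cst (N * e ^+ 2) s 1).
    by rewrite addr0.
  exact: (is_deriveM d1 (dexp s)).
rewrite min_l// max_r// subr0 => /andP[z0 zt] Ez.
have zT : 0 <= z <= T by rewrite z0 (le_trans zt).
have psile : psi t <= psi 0.
  rewrite -subr_le0 Ez; apply: mulr_le0_ge0 => //.
  have -> : (phi z + N * e ^+ 2) * (expR (- c * z) * - c) + expR (- c * z) * dphi z =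
     expR (- c * z) * (dphi z - c * (phi z + N * e ^+ 2)) by ring.
  apply: mulr_ge0_le0; first exact: expR_ge0.
  rewrite subr_le0; apply: le_trans (dphib z zT) _.
  by rewrite mulrDr lerD2l ler_peMl// mulr_ge0// sqr_ge0.
have key : `|D t| ^+ 2 <= N * (`|D 0| ^+ 2 + e ^+ 2) * expR (c * T).
  apply: le_trans (phi1 t) _.
  apply: (@le_trans _ _ (psi t * expR (c * t))).
    by rewrite /psi -mulrA -expRD mulNr addNr expR0 mulr1 lerDl mulr_ge0// sqr_ge0.
  apply: ler_pM.
  - by rewrite /psi mulr_ge0 ?expR_ge0// addr_ge0// mulr_ge0// sqr_ge0.
  - exact: expR_ge0.
  - apply: le_trans psile _; rewrite /psi mulr0 expR0 mulr1 mulrDr lerD2r.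
    exact: phi2.
  - by rewrite ler_expR ler_wpM2l// ltW.
have e1 : 1 <= expR (c * T).
  by apply: le_trans (expR_ge1Dx _); rewrite lerDl mulr_ge0// ltW.
rewrite -ler_sqr ?nnegrE ?mulr_ge0 ?addr_ge0 ?(ltW B0)//.
apply: le_trans key _; rewrite exprMn mulrAC; apply: ler_pM.
- by rewrite mulr_ge0// expR_ge0.
- by rewrite addr_ge0// sqr_ge0.
- rewrite /B exprMn; apply: ler_pM => //.
    by clear - N0; rewrite expr2; nra.
  by rewrite expr2 ler_peMr.
- by rewrite sqrrD -addrA lerD2l lerDr mulrn_wge0// mulr_ge0.
Qed.

End Gronwall.

Section SmoothDependence.
Variable R : realType.

(** Compactness of [0, 1] in the form of a Lebesgue number: the local radii combine into one because
    [P] survives shrinking. *)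
Lemma segment_uniform (P : R -> R -> Prop) :
  (forall t, 0 <= t <= 1 -> exists2 r : R, 0 < r & forall s, `|s - t| < r -> P r s) ->
  (forall d d' s, 0 < d' -> d' <= d -> P d s -> P d' s) ->
  exists2 d : R, 0 < d & forall s, 0 <= s <= 1 -> P d s.
Proof.
move=> loc mono.
have := iffLR (compact_near_coveringP _) (segment_compact (a := 0 : R) (b := 1)).
move=> /(_ R (at_right (0 : R)) P _) H.
have : \forall d \near (0 : R)^'+, [set` `[0 : R, 1]] `<=` P d.
  apply: H => t /=; rewrite in_itv /= => /loc[r r0 Hr].
  exists ([set s | `|s - t| < r], [set d | 0 < d < r]) => /=.
    split; first by apply: (iffRL (near_normP (t : R) (fun s : R => `|s - t| < r))); exists r.
    by near=> d; apply/andP; split; near: d; [exact: nbhs_right_gt|exact: nbhs_right_lt].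
  by move=> [s d] /= [sr /andP[d0 dr]]; apply: mono (Hr _ sr) => //; exact: ltW.
move=> Hd.
have [d [d0 Hd']] := filter_ex (filterI (nbhs_right_gt (0 : R)) Hd).
by exists d => // s s01; apply: Hd'; rewrite /= in_itv.
Unshelve. all: by end_near. Qed.

Lemma tube n (O : set 'rV[R]_n) (h : 'rV[R]_n -> R) (c : R -> 'rV[R]_n) (e : R) :
  open O -> (forall x, O x -> {for x, continuous h}) ->
  (forall t : R, 0 <= t <= 1 -> O (c t) /\ {for t, continuous c}) -> 0 < e ->
  exists2 d : R, 0 < d & forall t, 0 <= t <= 1 -> forall y, `|y - c t| < d ->
    O y /\ `|h y - h (c t)| < e.
Proof.
move=> oO ch cc e0; apply: segment_uniform; last first.
  by move=> d d' s d'0 dd' H y /lt_le_trans yd; apply: H; exact: yd.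
move=> t /cc[Oct ct].
have [d1 d10 H1] := open_ball_sub oO Oct.
have e2 : 0 < e / 2 by rewrite divr_gt0.
have /continuous_eps/(_ _ e2)[d2 d20 H2] := ch _ Oct.
pose d := Num.min d1 d2; have d0 : 0 < d / 2 by rewrite divr_gt0// lt_min d10.
have /continuous_eps/(_ _ d0)[r r0 Hr] := ct.
exists (Num.min r (d / 2)); first by rewrite lt_min r0.
move=> s; rewrite lt_min => /andP[/Hr sr _] y; rewrite lt_min => /andP[_ yd].
have : `|y - c t| < d.
  have -> : y - c t = (y - c s) + (c s - c t) by rewrite addrA subrK.
  by apply: le_lt_trans (ler_normD _ _) _; rewrite (splitr d) ltrD.
have : `|c s - c t| < d by apply: lt_trans sr _; rewrite ltr_pdivrMr// ltr_pMr ?ltr1n// -[ltRHS]mulr1 mulr1 lt_min d10.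
rewrite !lt_min => /andP[_ /H2 B1] /andP[/H1 Oy /H2 B2]; split=> //.
have -> : h y - h (c s) = (h y - h (c t)) - (h (c s) - h (c t)) by ring.
by apply: le_lt_trans (ler_normB _ _) _; rewrite (splitr e) ltrD.
Qed.

Lemma segment_bounded (h : R -> R) :
  (forall t : R, 0 <= t <= 1 -> {for t, continuous h}) ->
  exists2 M : R, 0 < M & forall t, 0 <= t <= 1 -> `|h t| <= M.
Proof.
move=> ch.
have [d d0 H] : exists2 d : R, 0 < d & forall s, 0 <= s <= 1 -> `|h s| <= d^-1.
  apply: segment_uniform => [t /ch/continuous_eps/(_ 1 ltr01)[r r0 Hr]|].
    have p0 : 0 < (`|h t| + 1)^-1 by rewrite invr_gt0 ltr_wpDl.
    exists (Num.min r (`|h t| + 1)^-1); first by rewrite lt_min r0.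
    move=> s; rewrite lt_min => /andP[/Hr sr _].
    apply: (@le_trans _ _ (`|h t| + 1)).
      have -> : h s = h t + (h s - h t) by rewrite addrC subrK.
      by apply: le_trans (ler_normD _ _) _; rewrite lerD2l ltW.
    by rewrite -[leLHS]invrK lef_pV2 ?posrE// ?lt_min ?r0// ge_min lexx orbT.
  by move=> d d' s d'0 dd' /le_trans; apply; rewrite lef_pV2 ?posrE// (lt_le_trans d'0).
by exists d^-1 => //; rewrite invr_gt0.
Qed.

(** Time is [0, 1] because fields are rescaled beforehand. The last clause, continuity in the
    initial point uniformly in time, is the only regularity of this dependence that is assumed;
    differentiability of all orders is deduced from it. *)
Definition is_flow n (O : set 'rV[R]_n) (f : 'rV[R]_n -> 'rV[R]_n)
    (B : set 'rV[R]_n) (Phi : R -> 'rV[R]_n -> 'rV[R]_n) :=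
  [/\ (forall x, B x -> Phi 0 x = x),
      (forall x (t : R), B x -> 0 <= t <= 1 -> O (Phi t x) /\
         forall i, is_derive t 1 (fun s => Phi s x 0 i) (f (Phi t x) 0 i))
    & forall x, B x -> forall e : R, 0 < e -> exists2 d : R, 0 < d &
        forall y, B y -> `|y - x| < d ->
          forall t, 0 <= t <= 1 -> `|Phi t y - Phi t x| < e].

(** Freezing time outside [0, 1] extends the coefficients of the variational equation continuously
    to the whole line, as [picard] requires. *)
Definition clamp01 (t : R) := Num.max 0 (Num.min 1 t).

Lemma clamp01_in t : 0 <= clamp01 t <= 1.
Proof. by rewrite /clamp01 le_max lexx /= ge_max ler01 ge_min lexx. Qed.

Lemma clamp01_id t : 0 <= t <= 1 -> clamp01 t = t.
Proof. by move=> /andP[t0 t1]; rewrite /clamp01 min_r// max_r. Qed.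

Lemma clamp01_lip t s : `|clamp01 t - clamp01 s| <= `|t - s|.
Proof.
have h1 := ler_norm (t - s); have h2 := ler_norm (s - t); rewrite distrC in h2.
rewrite /clamp01 ler_norml; case: (leP 1 t) => ?; case: (leP 1 s) => ?;
  rewrite ?(max_r ler01); try (case: (leP 0 t) => ?); try (case: (leP 0 s) => ?);
  by apply/andP; split; lra.
Qed.

Lemma clamp01_cont : continuous clamp01.
Proof.
move=> t; apply/(continuous_eps clamp01 t) => e e0; exists e => // s.
exact: le_lt_trans (clamp01_lip _ _).
Qed.

End SmoothDependence.

Lemma continuous_ext (U V : topologicalType) (f g : U -> V) x :
  f =1 g -> {for x, continuous f} -> {for x, continuous g}.
Proof. by move=> /funext ->. Qed.

Lemma continuous_bigsum (R : realType) (U : normedModType R) (I : Type) (r : seq I)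
    (x : U) (F : I -> U -> R) :
  (forall i, {for x, continuous (F i)}) ->
  {for x, continuous (fun y => \sum_(i <- r) F i y)}.
Proof.
move=> H; elim: r => [|i r IH].
  apply: (@continuous_ext _ _ (fun=> 0)); last exact: cst_continuous.
  by move=> y; rewrite big_nil.
apply: (@continuous_ext _ _ (fun y => F i y + \sum_(i <- r) F i y)).
  by move=> y; rewrite big_cons.
by apply: continuousD => //; exact: H.
Qed.

Lemma norm_sum_le (R : realType) n (a b : 'I_n -> R) (M N : R) :
  0 <= M -> (forall j, `|a j| <= M) -> (forall j, `|b j| <= N) ->
  `|\sum_j a j * b j| <= n%:R * (M * N).
Proof.
move=> M0 aM bN; apply: le_trans (ler_norm_sum _ _ _) _.
apply: (@le_trans _ _ (\sum_(j < n) M * N)); last first.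
  by rewrite sumr_const card_ord -[leLHS]mulr_natl.
by apply: ler_sum => j _; rewrite normrM ler_pM.
Qed.

(** * The variational equation along a flow *)

Section Variation.
Variables (R : realType) (n : nat) (O : set 'rV[R]_n) (f : 'rV[R]_n -> 'rV[R]_n).
Variables (B : set 'rV[R]_n) (Phi : R -> 'rV[R]_n -> 'rV[R]_n).
Hypotheses (oO : open O) (oB : open B).
Hypothesis smf : forall i, sm O (fun x => f x 0 i).
Hypothesis HF : is_flow O f B Phi.

Let df i j := pt j (fun y => f y 0 i).
Let A x t i j := df i j (Phi (clamp01 t) x).

Lemma flow_in x t : B x -> 0 <= t <= 1 -> O (Phi t x).
Proof. by case: HF => _ H _ Bx t1; exact: (H x t Bx t1).1. Qed.

Lemma flow_time_cont x (t : R) : B x -> 0 <= t <= 1 ->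
  {for t, continuous (fun s => Phi s x)}.
Proof.
case: HF => _ H _ Bx t1; apply: row_continuous => i.
exact: is_derive_cont ((H x t Bx t1).2 i).
Qed.

Lemma df_cont i j x : O x -> {for x, continuous (df i j)}.
Proof. by move=> Ox; exact: (Ck_cont (Ck_pt j (smf i 1%N)) Ox). Qed.

Lemma A_cont x i j : B x -> continuous (fun t => A x t i j).
Proof.
move=> Bx t; apply: (@continuous_for_comp _ _ _ (fun t => Phi (clamp01 t) x)).
  apply: (@continuous_for_comp _ _ _ (@clamp01 R) (fun s => Phi s x)).
    exact: clamp01_cont.
  exact: (flow_time_cont Bx (clamp01_in t)).
exact: df_cont (flow_in Bx (clamp01_in t)).
Qed.

Lemma A_bounded x : B x ->
  exists2 M : R, 0 < M & forall t i j, `|A x t i j| <= M.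
Proof.
move=> Bx.
have [d d0 Hd] : exists2 d : R, 0 < d & forall i, forall j t, `|A x t i j| <= d^-1.
  apply: finite_delta => [i|i d d' d'0 dd' H j t]; last first.
    by apply: le_trans (H j t) _; rewrite lef_pV2 ?posrE// (lt_le_trans d'0).
  apply: finite_delta => [j|j d d' d'0 dd' H t]; last first.
    by apply: le_trans (H t) _; rewrite lef_pV2 ?posrE// (lt_le_trans d'0).
  have [t t1|M M0 HM] := @segment_bounded R (fun t => df i j (Phi t x)).
    apply: (@continuous_for_comp _ _ _ (fun s => Phi s x)).
      exact: (flow_time_cont Bx t1).
    exact: df_cont (flow_in Bx t1).
  by exists M^-1; rewrite ?invr_gt0// invrK => t; apply: HM; exact: clamp01_in.
by exists d^-1; rewrite ?invr_gt0// => t i j; exact: Hd.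
Qed.

(** A linear equation with bounded coefficients is globally Lipschitz, so [picard] applies directly;
    time 2 leaves room for two-sided derivatives at the ends of [0, 1]. *)
Lemma variation_ex x w : exists Y : R -> 'rV[R]_n, B x -> Y 0 = w /\
  forall (t : R) i, `|t| < 2 ->
    is_derive t 1 (fun s => Y s 0 i) (\sum_j A x t i j * Y t 0 j).
Proof.
have [Bx|nB] := pselect (B x); last by exists (fun=> 0).
have [M M0 HM] := A_bounded Bx.
pose F t (y : 'rV[R]_n) : 'rV[R]_n := \row_i (\sum_j A x t i j * y 0 j).
have L0 : 0 < n%:R * M + 1 by rewrite ltr_wpDl// mulr_ge0// ltW.
have [t y z|y i t||Y [Y0 HY]] := @picard R n F (n%:R * M + 1) L0 _ _ w 2.
- apply: (@le_trans _ _ (n%:R * (M * `|y - z|))); last first.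
    by rewrite mulrA ler_wpM2r// lerDl.
  apply: row_norm_le => [|i]; first by rewrite !mulr_ge0// ltW.
  have -> : (F t y - F t z) 0 i = \sum_j A x t i j * (y - z) 0 j.
    by rewrite !mxE -sumrB; apply: eq_bigr => j _; rewrite !mxE mulrBr.
  by apply: norm_sum_le => [|//|j]; [exact: ltW|exact: row_coord_le].
- apply: (@continuous_ext _ _ (fun t => \sum_j A x t i j * y 0 j)).
    by move=> s; rewrite mxE.
  apply: continuous_bigsum => j; apply: continuousM; last exact: cst_continuous.
  exact: A_cont.
- by [].
- by exists Y => _; split=> // t i t2; have := HY t i t2; rewrite mxE.
Qed.

Definition variation x w := projT1 (cid (variation_ex x w)).

Lemma variation0 x w : B x -> variation x w 0 = w.
Proof. by move=> Bx; have [] := projT2 (cid (variation_ex x w)) Bx. Qed.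

Lemma variation_der x w (t : R) i : B x -> 0 <= t <= 1 ->
  is_derive t 1 (fun s => variation x w s 0 i)
    (\sum_j df i j (Phi t x) * variation x w t 0 j).
Proof.
move=> Bx t1; have [_] := projT2 (cid (variation_ex x w)) Bx.
have t2 : `|t| < 2 by rewrite ger0_norm; lra.
by move=> /(_ t i t2); rewrite /A clamp01_id.
Qed.

Lemma df_uniform x (e : R) : B x -> 0 < e -> exists2 d : R, 0 < d &
  forall t, 0 <= t <= 1 -> forall y, `|y - Phi t x| < d -> O y /\
    forall i j, `|df i j y - df i j (Phi t x)| < e.
Proof.
move=> Bx e0.
have [d d0 H] : exists2 d : R, 0 < d & forall i, forall j t, 0 <= t <= 1 ->
    forall y, `|y - Phi t x| < d -> O y /\ `|df i j y - df i j (Phi t x)| < e.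
  apply: finite_delta => [i|i d d' d'0 dd' H j t t1 y yd]; last first.
    by apply: H t1 _ _; exact: lt_le_trans dd'.
  apply: finite_delta => [j|j d d' d'0 dd' H t t1 y yd]; last first.
    by apply: H t1 _ _; exact: lt_le_trans dd'.
  apply: (@tube _ _ O (df i j) (fun t => Phi t x)) => //.
    by move=> y Oy; exact: df_cont.
  by move=> t t1; split; [exact: flow_in|exact: flow_time_cont].
have [d2 d20 H2] : exists2 d : R, 0 < d & forall t, 0 <= t <= 1 ->
    forall y, `|y - Phi t x| < d -> O y /\ `|cst 0 y - cst 0 (Phi t x) : R| < e.
  apply: (@tube _ _ O (cst 0) (fun t => Phi t x)) => //.
    by move=> y _; exact: cst_continuous.
  by move=> t t1; split; [exact: flow_in|exact: flow_time_cont].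
exists (Num.min d d2) => [|t t1 y]; first by rewrite lt_min d0.
rewrite lt_min => /andP[yd yd2]; split; first exact: (H2 t t1 y yd2).1.
by move=> i j; exact: (H i j t t1 y yd).2.
Qed.

(** The remainder of the first-order expansion is controlled uniformly along a trajectory; both
    Gronwall estimates of [flow_derive] feed on it. *)
Lemma f_uniform x (e : R) : B x -> 0 < e -> exists2 d : R, 0 < d &
  forall t, 0 <= t <= 1 -> forall y, `|y - Phi t x| < d -> forall i,
    `|f y 0 i - f (Phi t x) 0 i - \sum_j df i j (Phi t x) * (y - Phi t x) 0 j|
      <= e * `|y - Phi t x|.
Proof.
move=> Bx e0; have e1 : 0 < e / n.+1%:R by rewrite divr_gt0.
have [d d0 Hd] := df_uniform Bx e1; exists d => // t t1 y yd i.
have := @mvt_ball R n (fun y => f y 0 i) (Phi t x) d (e / n.+1%:R) d0 _ y (Phi t x) yd.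
rewrite subrr normr0 => /(_ _ d0) H.
have -> : \sum_j df i j (Phi t x) * (y - Phi t x) 0 j =
  \sum_j pt j (fun y => f y 0 i) (Phi t x) * (y 0 j - Phi t x 0 j).
  by apply: eq_bigr => j _; rewrite !mxE.
apply: le_trans (H _) _.
  move=> j z zd; have [Oz Hz] := Hd t t1 z zd; split; last exact/ltW/Hz.
  by case: (Ck_der j (smf i 1%N) Oz).
rewrite mulrA ler_wpM2r//.
by rewrite mulrCA ler_piMr ?(ltW e0)// ler_pdivrMr// mul1r ler_nat.
Qed.

(** Two Gronwall estimates. The first bounds [D], the difference of two trajectories, by a multiple
    of [|h|]. Then [Z], the difference between [D] and [h] times the variation, solves the linear
    equation up to an error [e1 |D|], and the second estimate bounds it by [e |h|]. *)
Lemma flow_derive x w t i : B x -> 0 <= t <= 1 ->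
  is_derive x w (fun y => Phi t y 0 i) (variation x w t 0 i).
Proof.
move=> Bx t1; have [P0 PD PC] := HF.
have [M M0 HM] := A_bounded Bx.
have HM' s k j : 0 <= s <= 1 -> `|df k j (Phi s x)| <= M.
  by move=> s1; have := HM s k j; rewrite /A clamp01_id.
have K0 : 0 <= n%:R * M + 1 by rewrite addr_ge0// mulr_ge0// ltW.
have K1 : 0 <= n%:R * M by rewrite mulr_ge0// ltW.
have [B1 B10 G1] := @gronwall R n _ 1 K0 ler01.
have [B2 B20 G2] := @gronwall R n _ 1 K1 ler01.
have [da da0 Ha] := f_uniform Bx ltr01.
apply/is_derive_eps => e e0.
pose W := `|w| + 1; have W0 : 0 < W by rewrite ltr_wpDl.
(* Chosen so that the constants of both estimates multiply out to [e]. *)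
pose e1 := e / (B2 * (B1 * W)).
have e10 : 0 < e1 by rewrite divr_gt0// !mulr_gt0.
have [db db0 Hb] := f_uniform Bx e10.
have [dc dc0 Hc] := open_ball_sub oB Bx.
have dab : 0 < Num.min da db by rewrite lt_min da0.
have [dd dd0 Hd] := PC x Bx _ dab.
exists (Num.min dc dd / W) => [|h]; first by rewrite divr_gt0// lt_min dc0.
rewrite ltr_pdivlMr// => hW.
have hw : `|x + h *: w - x| < Num.min dc dd.
  rewrite addrC addKr normrZ; apply: le_lt_trans hW.
  by rewrite ler_wpM2l// lerDl.
move: hw; rewrite lt_min => /andP[/Hc Bxh xdd].
set xh := x + h *: w in Bxh xdd *.
have xhx : `|xh - x| <= W * `|h|.
  by rewrite /xh addrC addKr normrZ mulrC ler_wpM2r// lerDl.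
have close s : 0 <= s <= 1 -> `|Phi s xh - Phi s x| < Num.min da db by exact: Hd.
pose D s := Phi s xh - Phi s x.
have D0 : D 0 = xh - x by rewrite /D !P0.
have dDP (s : R) k : 0 <= s <= 1 -> is_derive s 1 (fun r => D r 0 k)
    (f (Phi s xh) 0 k - f (Phi s x) 0 k).
  move=> s1; rewrite /D; under eq_fun do rewrite !mxE.
  exact: (is_deriveB ((PD xh s Bxh s1).2 k) ((PD x s Bx s1).2 k)).
have Dbd s : 0 <= s <= 1 -> `|D s| <= B1 * (W * `|h|).
  move=> s1; apply: le_trans (G1 D _ 0 (lexx _) dDP _ s s1) _; last first.
    by rewrite addr0 D0 ler_wpM2l// ltW.
  move=> r k r1; have := close r r1; rewrite lt_min => /andP[ra _].
  have := Ha r r1 _ ra k; rewrite mul1r addr0 -/(D r).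
  set u := f (Phi r xh) 0 k - _; set v := \sum_j _ => uv.
  have -> : u = (u - v) + v by rewrite subrK.
  apply: le_trans (ler_normD _ _) _; rewrite mulrDl mul1r addrC lerD//.
  rewrite -mulrA; apply: norm_sum_le => [|j|j]; [exact: ltW|exact: HM'|exact: row_coord_le].
pose Z s := D s - h *: variation x w s.
pose dZ s k := \sum_j df k j (Phi s x) * Z s 0 j +
  (f (Phi s xh) 0 k - f (Phi s x) 0 k - \sum_j df k j (Phi s x) * D s 0 j).
have dZP (s : R) k : 0 <= s <= 1 -> is_derive s 1 (fun r => Z r 0 k) (dZ s k).
  move=> s1; rewrite /Z; under eq_fun do rewrite !mxE.
  have := is_deriveB (dDP s k s1) (is_deriveZ h (variation_der w k Bx s1)).
  rewrite /D; under eq_fun do rewrite !mxE.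
  move=> dz; apply: is_derive_eq dz _.
  have -> : dZ s k = f (Phi s xh) 0 k - f (Phi s x) 0 k
      - h * \sum_j df k j (Phi s x) * variation x w s 0 j.
    have E : \sum_j df k j (Phi s x) * Z s 0 j = \sum_j df k j (Phi s x) * D s 0 j
        - h * \sum_j df k j (Phi s x) * variation x w s 0 j.
      rewrite mulr_sumr -sumrB; apply: eq_bigr => j _.
      by rewrite /Z /D !mxE; ring.
    by rewrite /dZ E; ring.
  by [].
have Z0 : Z 0 = 0.
  by rewrite /Z D0 variation0// /xh [x + _]addrC addrK subrr.
have e2 : 0 <= e1 * (B1 * (W * `|h|)).
  exact: (mulr_ge0 (ltW e10) (mulr_ge0 (ltW B10) (mulr_ge0 (ltW W0) (normr_ge0 h)))).
have := G2 Z dZ _ e2 dZP _ t t1.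
rewrite Z0 normr0 add0r => Zbd.
have E : B2 * (e1 * (B1 * (W * `|h|))) = e * `|h|.
  by rewrite /e1; field; rewrite !lt0r_neq0.
rewrite -E; apply: le_trans (Zbd _).
  by have := row_coord_le (Z t) i; rewrite /Z /D !mxE.
move=> r k r1; apply: le_trans (ler_normD _ _) _; apply: lerD.
  rewrite -mulrA; apply: norm_sum_le => [|j|j]; [exact: ltW|exact: HM'|exact: row_coord_le].
have := close r r1; rewrite lt_min => /andP[_ rb].
apply: le_trans (Hb r r1 _ rb k) _; rewrite ler_wpM2l ?(ltW e10)//; exact: Dbd.
Qed.

(** This supplies the last clause of [is_flow] for the doubled system made of the flow and its
    variation. *)
Lemma variation_cont x w (e : R) : B x -> 0 < e -> exists2 d : R, 0 < d &
  forall y v, B y -> `|y - x| < d -> `|v - w| < d ->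
    forall t, 0 <= t <= 1 -> `|variation y v t - variation x w t| < e.
Proof.
move=> Bx e0; have [P0 PD PC] := HF.
have [M M0 HM] := A_bounded Bx.
have HM' s k j : 0 <= s <= 1 -> `|df k j (Phi s x)| <= M.
  by move=> s1; have := HM s k j; rewrite /A clamp01_id.
have K0 : 0 <= n%:R * (M + 1) by rewrite mulr_ge0// addr_ge0// ltW.
have [B1 B10 G1] := @gronwall R n _ 1 K0 ler01.
have [N N0 HN] : exists2 N : R, 0 < N & forall s, 0 <= s <= 1 -> `|variation x w s| <= N.
  have [s s1|N N0 HN] := @segment_bounded R (fun s => `|variation x w s|).
    apply: cvg_norm; suff : {for s, continuous (fun s => variation x w s)} by [].
    apply: row_continuous => i; exact: is_derive_cont (variation_der w i Bx s1).
  by exists N => // s /HN; rewrite normr_id.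
pose e1 := Num.min 1 (e / (4 * B1 * (n.+1%:R * N))).
have e10 : 0 < e1 by rewrite lt_min ltr01 divr_gt0// !mulr_gt0.
have [da da0 Ha] := df_uniform Bx e10.
have [db db0 Hb] := PC x Bx _ da0.
have p0 : 0 < e / (4 * B1) by rewrite divr_gt0// mulr_gt0.
exists (Num.min db (e / (4 * B1))) => [|y v By]; first by rewrite lt_min db0.
rewrite !lt_min => /andP[yb _] /andP[_ vw] t t1.
have close s (s1 : 0 <= s <= 1) := (Ha s s1 _ (Hb y By yb s s1)).2.
pose Z s := variation y v s - variation x w s.
pose dZ s k := \sum_j df k j (Phi s y) * variation y v s 0 j
             - \sum_j df k j (Phi s x) * variation x w s 0 j.
have dZP (s : R) k : 0 <= s <= 1 -> is_derive s 1 (fun r => Z r 0 k) (dZ s k).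
  move=> s1; rewrite /Z; under eq_fun do rewrite !mxE.
  exact: (is_deriveB (variation_der v k By s1) (variation_der w k Bx s1)).
have e20 : 0 <= n%:R * (e1 * N).
  exact: (mulr_ge0 (ler0n _ _) (mulr_ge0 (ltW e10) (ltW N0))).
apply: le_lt_trans (G1 Z dZ _ e20 dZP _ t t1) _.
  move=> s k s1; have -> : dZ s k = \sum_j df k j (Phi s y) * Z s 0 j +
    \sum_j (df k j (Phi s y) - df k j (Phi s x)) * variation x w s 0 j.
    rewrite /dZ -big_split -sumrB /=; apply: eq_bigr => j _.
    by rewrite /Z !mxE; ring.
  apply: le_trans (ler_normD _ _) _; apply: lerD.
    rewrite -mulrA; apply: norm_sum_le => [|j|j].
    - by rewrite addr_ge0// ltW.
    - have -> : df k j (Phi s y) = df k j (Phi s x) + (df k j (Phi s y) - df k j (Phi s x)).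
        by rewrite addrC subrK.
      apply: le_trans (ler_normD _ _) _; apply: lerD; first exact: HM'.
      by apply: le_trans (ltW (close s s1 k j)) _; rewrite ge_min lexx.
    - exact: row_coord_le.
  apply: norm_sum_le => [|j|j]; first exact: ltW.
    exact/ltW/close.
  by apply: le_trans (row_coord_le _ _) _; exact: HN.
have -> : Z 0 = v - w by rewrite /Z !variation0.
have h1 : B1 * `|v - w| < e / 4.
  have -> : e / 4 = B1 * (e / (4 * B1)) by field; rewrite lt0r_neq0.
  by rewrite ltr_pM2l.
have h2 : B1 * (n%:R * (e1 * N)) <= e / 4.
  have -> : e / 4 = B1 * (n.+1%:R * (e / (4 * B1 * (n.+1%:R * N)) * N)).
    by field; rewrite !lt0r_neq0// ?ltr0Sn.
  rewrite ler_wpM2l ?(ltW B10)// ler_pM//; first exact: (mulr_ge0 (ltW e10) (ltW N0)).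
    by rewrite ler_nat.
  by rewrite ler_wpM2r ?(ltW N0)// ge_min lexx orbT.
by rewrite mulrDr; lra.
Qed.

End Variation.

(** * Smooth dependence on initial conditions, and local flows *)

Section FlowSmooth.
Variable R : realType.

Lemma norm_lsubmx n m (x : 'rV[R]_(n + m)) : `|lsubmx x| <= `|x|.
Proof. by apply: row_norm_le => // i; rewrite mxE row_coord_le. Qed.

Lemma norm_rsubmx n m (x : 'rV[R]_(n + m)) : `|rsubmx x| <= `|x|.
Proof. by apply: row_norm_le => // i; rewrite mxE row_coord_le. Qed.

Lemma row_mx_norm_lt n m (x : 'rV[R]_n) (y : 'rV[R]_m) (e : R) :
  0 < e -> `|x| < e -> `|y| < e -> `|row_mx x y| < e.
Proof.
move=> e0 xe ye; apply: row_norm_lt => // i; case: (splitP i) => j ij.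
  have -> : i = lshift m j by exact/val_inj.
  by rewrite row_mxEl (le_lt_trans (row_coord_le _ _)).
have -> : i = rshift n j by exact/val_inj.
by rewrite row_mxEr (le_lt_trans (row_coord_le _ _)).
Qed.

Lemma open_lsubmx n m (O : set 'rV[R]_n) : open O ->
  open [set z : 'rV[R]_(n + m) | O (lsubmx z)].
Proof.
move=> oO; apply: open_of_balls => z /= /(open_ball_sub oO)[e e0 He].
by exists e => // y yz; apply: He; rewrite -linearB; exact: le_lt_trans (norm_lsubmx _) yz.
Qed.

Lemma Ck_lsubmx n m k (O : set 'rV[R]_n) f : open O -> Ck k O f ->
  Ck k [set z : 'rV[R]_(n + m) | O (lsubmx z)] (fun z => f (lsubmx z)).
Proof.
move=> oO ckf; apply: (@Ck_comp _ _ _ _ _ O (@lsubmx R 1 n m)) => //.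
  exact: open_lsubmx.
move=> j; apply: Ck_eq (Ck_coord _ _ (lshift m j)); first exact: open_lsubmx.
by move=> z _; rewrite mxE.
Qed.

Lemma flow_continuous n (O B : set 'rV[R]_n) f Phi t i : open B ->
  is_flow O f B Phi -> 0 <= t <= 1 -> Ck 0 B (fun x => Phi t x 0 i).
Proof.
move=> oB [_ _ PC] t1; split=> // x Bx; apply/continuous_eps => e e0.
have [d1 d10 H1] := open_ball_sub oB Bx; have [d2 d20 H2] := PC x Bx e e0.
exists (Num.min d1 d2) => [|y]; first by rewrite lt_min d10.
rewrite lt_min => /andP[/H1 By /(H2 y By)/(_ t t1)].
by apply: le_lt_trans; have := row_coord_le (Phi t y - Phi t x) i; rewrite !mxE.
Qed.

(** The flow together with its variation is the flow of the tangent field, in twice the dimension.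
    By induction that larger flow is of class [k], and its second half consists of the first
    derivatives of the original one. The dimension is quantified inside the induction for this
    reason. *)
Theorem flow_Ck k : forall n (O B : set 'rV[R]_n) (f : 'rV[R]_n -> 'rV[R]_n) Phi, open O -> open B ->
  (forall i, sm O (fun x => f x 0 i)) -> is_flow O f B Phi ->
  forall t i, 0 <= t <= 1 -> Ck k B (fun x => Phi t x 0 i).
Proof.
elim: k => [|k IH] n O B f Phi oO oB smf HF t i t1; first exact: flow_continuous HF t1.
have [P0 PD PC] := HF.
split; first by case: (flow_continuous i oB HF t1).
pose Y x w := variation smf HF x w.
move=> j; have dj x : B x -> is_derive x (delta_mx 0 j) (fun y => Phi t y 0 i)
    (Y x (delta_mx 0 j) t 0 i).
  by move=> Bx; apply: flow_derive.
split; first by move=> x /dj[].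
pose O2 := [set z : 'rV[R]_(n + n) | O (lsubmx z)].
pose B2 := [set z : 'rV[R]_(n + n) | B (lsubmx z)].
pose f2 (z : 'rV[R]_(n + n)) : 'rV[R]_(n + n) := row_mx (f (lsubmx z))
  (\row_i (\sum_j pt j (fun y => f y 0 i) (lsubmx z) * rsubmx z 0 j)).
pose Phi2 t (z : 'rV[R]_(n + n)) : 'rV[R]_(n + n) :=
  row_mx (Phi t (lsubmx z)) (Y (lsubmx z) (rsubmx z) t).
have HF2 : is_flow O2 f2 B2 Phi2.
  split=> [z Bz|z s Bz s1|z Bz e e0].
  - by rewrite /Phi2 /Y P0// variation0// hsubmxK.
  - split; first by rewrite /O2 /= /Phi2 row_mxKl; exact: (PD _ s Bz s1).1.
    move=> a; rewrite /Phi2 /f2 row_mxKl row_mxKr.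
    case: (splitP a) => b ab.
      have -> : a = lshift n b by exact/val_inj.
      rewrite row_mxEl; under eq_fun do rewrite row_mxEl.
      exact: (PD _ s Bz s1).2.
    have -> : a = rshift n b by exact/val_inj.
    rewrite row_mxEr mxE; under eq_fun do rewrite row_mxEr.
    exact: variation_der.
  - have [d1 d10 H1] := PC _ Bz e e0.
    have [d2 d20 H2] := variation_cont oO smf HF (rsubmx z) Bz e0.
    exists (Num.min d1 d2) => [|y By]; first by rewrite lt_min d10.
    move=> yz s s1; rewrite /Phi2 opp_row_mx add_row_mx; apply: row_mx_norm_lt => //.
      apply: H1 => //; rewrite -linearB.
      by apply: le_lt_trans (norm_lsubmx _) (lt_le_trans yz _); rewrite ge_min lexx.
    have yz2 : `|y - z| < d2 by apply: lt_le_trans yz _; rewrite ge_min lexx orbT.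
    apply: H2 => //; rewrite -linearB.
      exact: le_lt_trans (norm_lsubmx _) yz2.
    exact: le_lt_trans (norm_rsubmx _) yz2.
have oO2 : open O2 by exact: open_lsubmx.
have oB2 : open B2 by exact: open_lsubmx.
have smf2 a : sm O2 (fun z => f2 z 0 a).
  move=> m; case: (splitP a) => b ab.
    have -> : a = lshift n b by exact/val_inj.
    apply: (@Ck_eq _ _ _ _ (fun z => f (lsubmx z) 0 b)) => //.
      by move=> z _; rewrite /f2 row_mxEl.
    exact: Ck_lsubmx (smf b m).
  have -> : a = rshift n b by exact/val_inj.
  apply: (@Ck_eq _ _ _ _
    (fun z => \sum_j pt j (fun y => f y 0 b) (lsubmx z) * z 0 (rshift n j))) => //.
    move=> z _; rewrite /f2 row_mxEr mxE.
    by apply: eq_bigr => c _; rewrite [rsubmx z 0 c]mxE.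
  apply: Ck_sum => // c; apply: CkM => //; last exact: Ck_coord.
  exact: Ck_lsubmx (sm_pt c (smf b) m).
have ck2 := IH _ _ _ _ _ oO2 oB2 smf2 HF2 t (rshift n i) t1.
apply: (@Ck_eq _ _ _ _ (fun x => Phi2 t (row_mx x (delta_mx 0 j)) 0 (rshift n i))) => //.
  move=> x Bx; rewrite /Phi2 row_mxEr row_mxKl row_mxKr.
  by rewrite (is_derive_pt (dj x Bx)).
apply: (@Ck_comp _ _ _ _ B B2 (fun x => row_mx x (delta_mx 0 j))
  (fun z => Phi2 t z 0 (rshift n i))) => //.
  move=> a; case: (splitP a) => b ab.
    have -> : a = lshift n b by exact/val_inj.
    by apply: Ck_eq (Ck_coord _ _ b) => // x _; rewrite row_mxEl.
  have -> : a = rshift n b by exact/val_inj.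
  by apply: Ck_eq (Ck_cst _ _ ((delta_mx 0 j : 'rV[R]_n) 0 b)) => // x _; rewrite row_mxEr.
by move=> x Bx; rewrite /B2 /= row_mxKl.
Qed.

Definition clampr (l u t : R) := Num.max l (Num.min u t).

Lemma clampr_lip (l u t s : R) : l <= u ->
  `|clampr l u t - clampr l u s| <= `|t - s|.
Proof.
move=> lu; have h1 := ler_norm (t - s); have h2 := ler_norm (s - t).
rewrite distrC in h2; rewrite /clampr ler_norml.
case: (leP u t) => ?; case: (leP u s) => ?; rewrite ?(max_r lu);
  try (case: (leP l t) => ?); try (case: (leP l s) => ?);
  by apply/andP; split; lra.
Qed.

Lemma clampr_id (l u t : R) : l <= t <= u -> clampr l u t = t.
Proof. by move=> /andP[lt tu]; rewrite /clampr min_r// max_r. Qed.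

Lemma clampr_in (l u t : R) : l <= u -> l <= clampr l u t <= u.
Proof. by move=> lu; rewrite /clampr le_max lexx /= ge_max lu ge_min lexx. Qed.

(** Clamping the coordinates to a cube around [x0] makes the field bounded and globally Lipschitz;
    slowing it down by [eps] keeps trajectories up to time 2 inside the cube, where clamping does
    nothing. *)
Theorem local_flow_is_flow n (O : set 'rV[R]_n) (f : 'rV[R]_n -> 'rV[R]_n) x0 :
  open O -> O x0 -> (forall i, sm O (fun x => f x 0 i)) ->
  exists (eps r : R) (Phi : R -> 'rV[R]_n -> 'rV[R]_n), [/\ 0 < eps, 0 < r,
    (forall x (t : R), `|x - x0| < r -> `|t| < 2 -> O (Phi t x) /\
       forall i, is_derive t 1 (fun s => Phi s x 0 i) (eps * f (Phi t x) 0 i)),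
    (forall x, `|x - x0| < r -> Phi 0 x = x)
  & is_flow O (fun x => eps *: f x) [set x | `|x - x0| < r] Phi].
Proof.
move=> oO Ox0 smf.
have [d1 d10 H1] := open_ball_sub oO Ox0.
have [d2 d20 H2] : exists2 d : R, 0 < d & forall i, forall j y, `|y - x0| < d ->
    `|pt j (fun y => f y 0 i) y - pt j (fun y => f y 0 i) x0| < 1.
  apply: finite_delta => [i|i d d' d'0 dd' H j y yd]; last first.
    by apply: H; apply: lt_le_trans dd'.
  apply: finite_delta => [j|j d d' d'0 dd' H y yd]; last first.
    by apply: H; apply: lt_le_trans dd'.
  by have /continuous_eps/(_ _ ltr01) := Ck_cont (Ck_pt j (smf i 1%N)) Ox0.
pose q := Num.min d1 d2; have q0 : 0 < q by rewrite lt_min d10.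
pose rho := q / 3; have rho0 : 0 < rho by rewrite divr_gt0.
pose M := \sum_i \sum_j `|pt j (fun y => f y 0 i) x0|.
have M0 : 0 <= M by rewrite sumr_ge0// => i _; rewrite sumr_ge0.
have MP i j : `|pt j (fun y => f y 0 i) x0| <= M.
  rewrite /M (bigD1 i)//= (bigD1 j)//= -addrA lerDl addr_ge0//.
    by rewrite sumr_ge0.
  by rewrite sumr_ge0// => k _; rewrite sumr_ge0.
pose L : R := n%:R * (1 + M) + 1.
have L0 : 0 < L by rewrite ltr_wpDl// mulr_ge0// addr_ge0.
have lipf a b : `|a - x0| < q -> `|b - x0| < q -> `|f a - f b| <= L * `|a - b|.
  move=> aq bq; apply: row_norm_le => [|i]; first by rewrite mulr_ge0// ltW.
  have E : (f a - f b) 0 i =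
    (f a 0 i - f b 0 i - \sum_j pt j (fun y => f y 0 i) x0 * (a 0 j - b 0 j))
    + \sum_j pt j (fun y => f y 0 i) x0 * (a 0 j - b 0 j).
    by rewrite subrK !mxE.
  rewrite E; apply: le_trans (ler_normD _ _) _.
  apply: (@le_trans _ _ (n%:R * (1 * `|a - b|) + n%:R * (M * `|a - b|))); last first.
    by rewrite -mulrDr -mulrDl mulrA /L [leRHS]mulrDl lerDl mul1r.
  apply: lerD.
    apply: (@mvt_ball R n (fun y => f y 0 i) x0 q) => // j y.
    rewrite lt_min => /andP[/H1 Oy /(H2 i j) Hy]; split; last exact: ltW.
    by case: (Ck_der j (smf i 1%N) Oy).
  apply: norm_sum_le => // j; have := row_coord_le (a - b) j; by rewrite !mxE.
pose cl (y : 'rV[R]_n) : 'rV[R]_n :=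
  \row_i clampr (x0 0 i - 2 * rho) (x0 0 i + 2 * rho) (y 0 i).
have lu i : x0 0 i - 2 * rho <= x0 0 i + 2 * rho by lra.
have clq y : `|cl y - x0| < q.
  apply: row_norm_lt => // i; rewrite !mxE.
  have := clampr_in (y 0 i) (lu i); rewrite ltr_norml => /andP[? ?].
  have ? : q = 3 * rho by rewrite /rho mulrC divfK.
  by apply/andP; split; lra.
have cllip y z : `|cl y - cl z| <= `|y - z|.
  apply: row_norm_le => // i; rewrite !mxE.
  apply: le_trans (clampr_lip _ _ (lu i)) _.
  by have := row_coord_le (y - z) i; rewrite !mxE.
have clid y : `|y - x0| <= 2 * rho -> cl y = y.
  move=> yr; apply/rowP => i; rewrite !mxE clampr_id//.
  have := le_trans (row_coord_le _ i) yr; rewrite !mxE ler_norml => /andP[? ?].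
  by apply/andP; split; lra.
pose N := `|f x0| + L * q + 1.
have N0 : 0 < N by rewrite ltr_wpDl// addr_ge0// mulr_ge0// ltW.
have fN y : `|f (cl y)| <= N.
  have -> : f (cl y) = f x0 + (f (cl y) - f x0) by rewrite addrC subrK.
  apply: le_trans (ler_normD _ _) _; rewrite /N -addrA lerD2l.
  have x0q : `|x0 - x0| < q by rewrite subrr normr0.
  apply: le_trans (lipf _ _ (clq y) x0q) _.
  apply: (@le_trans _ _ (L * q)); last by rewrite lerDl.
  by rewrite ler_wpM2l ?(ltW L0)// ltW.
(* At speed at most [eps * N], a time 2 covers the distance [rho]. *)
pose eps := rho / (2 * N); have eps0 : 0 < eps by rewrite divr_gt0// mulr_gt0.
pose F (t : R) y := eps *: f (cl y).
have epsL : 0 < eps * L by rewrite mulr_gt0.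
have lipF t y z : `|F t y - F t z| <= eps * L * `|y - z|.
  rewrite /F -scalerBr normrZ gtr0_norm// -mulrA ler_wpM2l ?(ltW eps0)//.
  apply: le_trans (lipf _ _ (clq y) (clq z)) _.
  by rewrite ler_wpM2l ?(ltW L0).
have contF y i : continuous (fun t => F t y 0 i) by move=> t; exact: cst_continuous.
have /choice[Y HY] : forall x, exists y : R -> 'rV[R]_n, y 0 = x /\
    forall (t : R) i, `|t| < 2 -> is_derive t 1 (fun s => y s 0 i) (F t (y t) 0 i).
  by move=> x; exact: (picard epsL lipF contF x (ltr0Sn _ 1)).
pose Phi t x := Y x t.
have stay x (t : R) : `|x - x0| < rho -> `|t| < 2 -> `|Phi t x - x0| <= 2 * rho.
  move=> xr t2; have -> : Phi t x - x0 = (Y x t - Y x 0) + (x - x0).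
    by rewrite (HY x).1 addrA subrK.
  apply: le_trans (ler_normD _ _) _.
  have -> : 2 * rho = rho + rho by ring.
  apply: lerD; last exact: ltW.
  apply: row_norm_le => [|i]; first exact: ltW.
  rewrite !mxE; have := @derivative_bound R (fun s => Y x s 0 i)
    (fun s => F s (Y x s) 0 i) 0 t (eps * N).
  rewrite subr0 => H; apply: le_trans (H _) _ => [s Hs|].
    have s2 : `|s| < 2.
      by have := @between_dist R 0 t s; rewrite add0r subr0 => /(_ Hs)/le_lt_trans; apply.
    split; first exact: (HY x).2.
    rewrite /F mxE normrM gtr0_norm// ler_wpM2l ?(ltW eps0)//.
    by apply: le_trans (row_coord_le _ _) (fN _).
  have E : rho = eps * N * 2 by rewrite /eps; field; rewrite lt0r_neq0.
  by rewrite [leRHS]E ler_wpM2l ?ltW// mulr_gt0.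
have derP x (t : R) i : `|x - x0| < rho -> `|t| < 2 ->
    is_derive t 1 (fun s => Phi s x 0 i) (eps * f (Phi t x) 0 i).
  move=> xr t2; have := (HY x).2 t i t2.
  by rewrite /F mxE clid//; exact: stay.
have inO x (t : R) : `|x - x0| < rho -> `|t| < 2 -> O (Phi t x).
  move=> xr t2; apply: H1; have := stay x t xr t2 => h.
  apply: le_lt_trans h _; rewrite /rho.
  have : q <= d1 by rewrite ge_min lexx.
  by clear - q0 => ?; lra.
exists eps, rho, Phi; split=> //.
- by move=> x t xr t2; split=> [|i]; [exact: inO|exact: derP].
- by move=> x _; exact: (HY x).1.
have t12 (t : R) : 0 <= t <= 1 -> `|t| < 2.
  by move=> /andP[t0 t1]; rewrite ger0_norm// (le_lt_trans t1)// ltr1n.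
split=> [x _|x t xr t1|x xr e e0]; first exact: (HY x).1.
  split=> [|j]; first exact: inO (t12 t t1).
  by rewrite mxE; exact: derP (t12 t t1).
have [B0 B00 G] := @gronwall R n _ 1 (ltW epsL) ler01.
exists (e / B0) => [|y yr yx t t1]; first by rewrite divr_gt0.
apply: le_lt_trans (G (fun s => Phi s y - Phi s x)
  (fun s j => F s (Phi s y) 0 j - F s (Phi s x) 0 j) 0 (lexx _) _ _ t t1) _.
- move=> s j s1; under eq_fun do rewrite !mxE.
  exact: (is_deriveB ((HY y).2 s j (t12 s s1)) ((HY x).2 s j (t12 s s1))).
- move=> s j s1; rewrite addr0; apply: le_trans (lipF s _ _).
  by have := row_coord_le (F s (Phi s y) - F s (Phi s x)) j; rewrite !mxE.
- by rewrite addr0 /Phi (HY y).1 (HY x).1 mulrC -ltr_pdivlMr.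
Qed.

Theorem local_flow n (O : set 'rV[R]_n) (f : 'rV[R]_n -> 'rV[R]_n) x0 :
  open O -> O x0 -> (forall i, sm O (fun x => f x 0 i)) ->
  exists (eps r : R) (Phi : R -> 'rV[R]_n -> 'rV[R]_n), [/\ 0 < eps, 0 < r,
    (forall x (t : R), `|x - x0| < r -> `|t| < 2 -> O (Phi t x) /\
       forall i, is_derive t 1 (fun s => Phi s x 0 i) (eps * f (Phi t x) 0 i)),
    (forall x, `|x - x0| < r -> Phi 0 x = x)
  & forall i, sm [set x | `|x - x0| < r] (fun x => Phi 1 x 0 i)].
Proof.
move=> oO Ox0 smf.
have [eps [r [Phi [eps0 r0 HP P0 HF]]]] := local_flow_is_flow oO Ox0 smf.
exists eps, r, Phi; split=> // i k.
have oB : open [set x | `|x - x0| < r].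
  apply: open_of_balls => x /= xr; exists (r - `|x - x0|); first by rewrite subr_gt0.
  move=> y yx; have -> : y - x0 = (y - x) + (x - x0) by rewrite addrA subrK.
  by apply: le_lt_trans (ler_normD _ _) _; rewrite -ltrBrDr.
apply: (@flow_Ck k n O _ (fun x => eps *: f x) Phi oO oB) => //; last by rewrite ler01 lexx.
move=> j m; apply: Ck_eq (CkM oO (Ck_cst m O eps) (smf j m)) => // x _.
by rewrite mxE.
Qed.

End FlowSmooth.

(** * Inverse functions *)

Section MatrixSmooth.
Variable R : realType.

Lemma Ck_det m n k (O : set 'rV[R]_m) (A : 'rV[R]_m -> 'M[R]_n) : open O ->
  (forall i j, Ck k O (fun x => A x i j)) -> Ck k O (fun x => \det (A x)).
Proof.
move=> oO H; rewrite /determinant; apply: Ck_sum => // s.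
by apply: CkM => //; [exact: Ck_cst|apply: Ck_prod].
Qed.

Lemma Ck_invmx m n k (O : set 'rV[R]_m) (A : 'rV[R]_m -> 'M[R]_n) : open O ->
  (forall x, O x -> A x \in unitmx) ->
  (forall i j, Ck k O (fun x => A x i j)) ->
  forall i j, Ck k O (fun x => invmx (A x) i j).
Proof.
move=> oO uA H i j.
apply: (@Ck_eq _ _ _ _ (fun x => (\det (A x))^-1 * cofactor (A x) j i)) => //.
  by move=> x Ox; rewrite /invmx uA// !mxE.
apply: CkM => //.
  apply: CkV => //; last exact: Ck_det.
  by move=> x /uA; rewrite unitmxE unitfE.
rewrite /cofactor; apply: CkM => //; first exact: Ck_cst.
apply: Ck_det => // a b.
by apply: Ck_eq (H (lift j a) (lift i b)) => // x _; rewrite !mxE.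
Qed.

Lemma open_nbhd_ball n (x0 : 'rV[R]_n) (r : R) : open [set x | `|x - x0| < r].
Proof.
apply: open_of_balls => x /= xr; exists (r - `|x - x0|); first by rewrite subr_gt0.
move=> y yx; have -> : y - x0 = (y - x) + (x - x0) by rewrite addrA subrK.
by apply: le_lt_trans (ler_normD _ _) _; rewrite -ltrBrDr.
Qed.

Lemma Ck_neq0_near n k (O : set 'rV[R]_n) f x0 : open O -> Ck k O f -> O x0 ->
  f x0 != 0 -> exists2 d : R, 0 < d & forall x, `|x - x0| < d -> f x != 0.
Proof.
move=> oO ck Ox f0; have e0 : 0 < `|f x0| by rewrite normr_gt0.
have /continuous_eps/(_ _ e0)[d d0 Hd] := Ck_cont ck Ox.
exists d => // x /Hd; apply: contraTneq => ->.
by rewrite sub0r normrN ltxx.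
Qed.

End MatrixSmooth.

Section InverseFunction.
Variables (R : realType) (n : nat) (O : set 'rV[R]_n) (z : 'rV[R]_n -> 'rV[R]_n).
Hypothesis oO : open O.
Hypothesis smz : forall i, sm O (fun x => z x 0 i).

Let J x : 'M[R]_n := \matrix_(i, j) pt j (fun y => z y 0 i) x.

(** Near [x0] the map differs from its linear part by at most [e |a - b|], where [e] is so small
    against the inverse Jacobian that equal values give [|a - b| <= |a - b| / 2]. *)
Lemma locally_injective x0 : O x0 -> J x0 \in unitmx ->
  exists2 d : R, 0 < d & forall a b, `|a - x0| < d -> `|b - x0| < d ->
    z a = z b -> a = b.
Proof.
move=> Ox0 uJ; pose C := \sum_i \sum_j `|invmx (J x0) i j|.
have C0 : 0 <= C by rewrite sumr_ge0// => i _; rewrite sumr_ge0.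
have CP i j : `|invmx (J x0) i j| <= C.
  rewrite /C (bigD1 i)//= (bigD1 j)//= -addrA lerDl addr_ge0//.
    by rewrite sumr_ge0.
  by rewrite sumr_ge0// => k _; rewrite sumr_ge0.
pose e := (2 * (n%:R * C + 1))^-1.
have q0 : 0 < n%:R * C + 1 by rewrite ltr_wpDl// mulr_ge0.
have e0 : 0 < e by rewrite invr_gt0 mulr_gt0.
have [d d0 Hd] : exists2 d : R, 0 < d & forall i a b,
    `|a - x0| < d -> `|b - x0| < d -> `|z a 0 i - z b 0 i
       - \sum_j pt j (fun y => z y 0 i) x0 * (a 0 j - b 0 j)| <= e * `|a - b|.
  apply: finite_delta => [i|i d d' d'0 dd' H a b ad bd]; last first.
    by apply: H; [apply: lt_le_trans ad dd'|apply: lt_le_trans bd dd'].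
  apply: (@strict_diff R n O) => //.
    by move=> j x Ox; case: (Ck_der j (smz i 1%N) Ox).
  by move=> j; exact: (Ck_cont (Ck_pt j (smz i 1%N)) Ox0).
exists d => // a b ad bd zab; apply/eqP; rewrite -subr_eq0 -normr_le0.
have E i : (a - b) 0 i = \sum_k invmx (J x0) i k * (J x0 *m (a - b)^T) k 0.
  have : ((a - b)^T) i 0 = (invmx (J x0) *m (J x0 *m (a - b)^T)) i 0 by rewrite mulKmx.
  by rewrite [LHS]mxE [RHS]mxE.
have key : `|a - b| <= n%:R * (C * (e * `|a - b|)).
  apply: row_norm_le => [|i]; first by rewrite !mulr_ge0// ltW.
  rewrite E; apply: norm_sum_le => // k.
  have := Hd k a b ad bd; rewrite zab subrr sub0r normrN.
  by congr (`|_| <= _); rewrite mxE; apply: eq_bigr => j _; rewrite !mxE.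
have h : n%:R * C * e <= 1 / 2.
  have : n%:R * C * e <= (n%:R * C + 1) * e by rewrite ler_wpM2r ?(ltW e0)// lerDl.
  move=> /le_trans; apply; rewrite /e le_eqVlt; apply/orP; left; apply/eqP.
  by field; rewrite lt0r_neq0.
have : `|a - b| <= 1 / 2 * `|a - b|.
  by apply: le_trans key _; rewrite !mulrA ler_wpM2r.
by move=> ?; lra.
Qed.

(** The inverse comes from a flow: up to the time scale [eps], the solution of [x' = J(x)^-1 w]
    starting at [x0] satisfies [z(x(t)) = z(x0) + t w]. With [w] carried along as a frozen half of
    the state, smooth dependence on initial data makes the inverse smooth at once. *)
Theorem inverse_function x0 : O x0 -> J x0 \in unitmx ->
  exists (r : R) (B : set 'rV[R]_n) (g : 'rV[R]_n -> 'rV[R]_n),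
    [/\ 0 < r, open B /\ B x0, B `<=` O,
     (forall x, B x -> `|z x - z x0| < r /\ g (z x) = x) &
     (forall y, `|y - z x0| < r -> B (g y) /\ z (g y) = y) /\
     forall i, sm [set y | `|y - z x0| < r] (fun y => g y 0 i)].
Proof.
move=> Ox0 uJ.
have smJ i j k : Ck k O (fun x => J x i j).
  by apply: Ck_eq (sm_pt j (smz i) k) => // x _; rewrite mxE.
have [d1 d10 inj] := locally_injective Ox0 uJ.
have [d2 d20 H2] := open_ball_sub oO Ox0.
have [d3 d30 H3] : exists2 d : R, 0 < d & forall x, `|x - x0| < d -> \det (J x) != 0.
  apply: (@Ck_neq0_near _ _ 0%N O (fun x => \det (J x))) => //.
    by apply: Ck_det.
  by move: uJ; rewrite unitmxE unitfE.
pose rho := Num.min d1 (Num.min d2 d3).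
have rho0 : 0 < rho by rewrite !lt_min d10 d20.
pose Br := [set x | `|x - x0| < rho].
have oBr : open Br by exact: open_nbhd_ball.
have BrP x : Br x -> [/\ `|x - x0| < d1, O x & J x \in unitmx].
  rewrite /Br /= !lt_min => /and3P[x1 /H2 Ox /H3]; split=> //.
  by rewrite unitmxE unitfE.
pose O2 := [set q : 'rV[R]_(n + n) | Br (lsubmx q)].
have oO2 : open O2 by exact: open_lsubmx.
pose f (q : 'rV[R]_(n + n)) : 'rV[R]_(n + n) :=
  row_mx (\row_i (\sum_k invmx (J (lsubmx q)) i k * q 0 (rshift n k))) 0.
have smf i : sm O2 (fun q => f q 0 i).
  move=> k; case: (splitP i) => b ib.
    have -> : i = lshift n b by exact/val_inj.
    apply: (@Ck_eq _ _ _ _ (fun q => \sum_k invmx (J (lsubmx q)) b k * q 0 (rshift n k))) => //.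
      by move=> q _; rewrite /f row_mxEl mxE.
    apply: Ck_sum => // c; apply: CkM => //; last exact: Ck_coord.
    apply: (@Ck_lsubmx R n n k Br (fun x => invmx (J x) b c)) => //.
    apply: Ck_invmx => //; first by move=> x /BrP[].
    by move=> a a'; apply: Ck_sub (smJ a a' k) => x /BrP[].
  have -> : i = rshift n b by exact/val_inj.
  by apply: Ck_eq (Ck_cst _ _ 0) => // q _; rewrite /f row_mxEr mxE.
have [|eps [r [Phi [eps0 r0 PD P0 smP]]]] := @local_flow R _ O2 f (row_mx x0 0) oO2 _ smf.
  by rewrite /O2 /= row_mxKl /Br /= subrr normr0.
have inr (w : 'rV[R]_n) : `|w| < r -> `|row_mx x0 w - row_mx x0 0| < r.
  move=> wr; rewrite opp_row_mx add_row_mx subrr subr0.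
  by apply: row_mx_norm_lt => //; rewrite normr0.
have path (w : 'rV[R]_n) : `|w| < r -> Br (lsubmx (Phi 1 (row_mx x0 w))) /\
    z (lsubmx (Phi 1 (row_mx x0 w))) = z x0 + eps *: w.
  move=> wr; have PDw t (t2 : `|t| < 2) := PD _ t (inr w wr) t2.
  have t12 (t : R) : Num.min 0 1 <= t <= Num.max 0 1 -> `|t| < 2.
    rewrite min_l// max_r// => /andP[t0 t1]; rewrite ger0_norm//.
    by apply: le_lt_trans t1 _; rewrite ltr1n.
  have one2 : `|1 : R| < 2 by rewrite normr1 ltr1n.
  split; first exact: (PDw 1 one2).1.
  have wc (t : R) : Num.min 0 1 <= t <= Num.max 0 1 -> forall k,
      Phi t (row_mx x0 w) 0 (rshift n k) = w 0 k.
    move=> t1 k; have := @zero_derivative_eq R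
      (fun s => Phi s (row_mx x0 w) 0 (rshift n k)) 0 t.
    rewrite P0 ?row_mxEr; last exact: inr.
    move=> H; symmetry; apply: H => s Hs.
    have s2 : `|s| < 2.
      have := @between_dist R 0 t s; rewrite add0r subr0 => /(_ Hs)/le_lt_trans; apply.
      exact: t12.
    by have := (PDw s s2).2 (rshift n k); rewrite /f row_mxEr mxE mulr0.
  apply/rowP => i; rewrite !mxE.
  (* Along the solution the Jacobian and its inverse cancel, so each component of [z] has the
     constant derivative [eps * w 0 i]. *)
  have [t t1|c _] := @mean_value R
      (fun s => z (lsubmx (Phi s (row_mx x0 w))) 0 i) (fun=> eps * w 0 i) 0 1.
    have [Bt Dt] := PDw t (t12 t t1); have [_ Ot Ut] := BrP _ Bt.
    have H := @chain_Ck R n 0 O (fun x => z x 0 i)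
      (fun s => lsubmx (Phi s (row_mx x0 w))) t
      (fun j => eps * f (Phi t (row_mx x0 w)) 0 (lshift n j)) oO (smz i 1%N) Ot.
    apply: is_derive_eq (H _) _.
      by move=> j; have := Dt (lshift n j); under [fun s => lsubmx _ 0 j]eq_fun do rewrite mxE.
    set X := lsubmx _ in Ot Ut *.
    have -> : \sum_j pt j (fun x => z x 0 i) X * (eps * f (Phi t (row_mx x0 w)) 0 (lshift n j)) =
       eps * (J X *m (invmx (J X) *m w^T)) i 0.
      rewrite mxE mulr_sumr; apply: eq_bigr => j _.
      rewrite /f row_mxEl -/X [(\row__ _) 0 j]mxE [J X i j]mxE mulrCA; congr (_ * (_ * _)).
      rewrite mxE; apply: eq_bigr => k _; rewrite [(w^T) k 0]mxE wc//.
    by rewrite mulKVmx// mxE.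
  rewrite P0 ?row_mxKl; last exact: inr.
  by rewrite subr0 mulr1 => /(congr1 (fun u => u + z x0 0 i)); rewrite subrK addrC.
pose r' := eps * r; have r'0 : 0 < r' by rewrite mulr_gt0.
pose g y := lsubmx (Phi 1 (row_mx x0 (eps^-1 *: (y - z x0)))).
have gP y : `|y - z x0| < r' -> Br (g y) /\ z (g y) = y.
  move=> yr; have wr : `|eps^-1 *: (y - z x0)| < r.
    rewrite normrZ gtr0_norm ?invr_gt0// mulrC ltr_pdivrMr// mulrC //.
  have [Bg Eg] := path _ wr; split=> //; rewrite Eg scalerA mulfV ?lt0r_neq0//.
  by rewrite scale1r addrC subrK.
(* Both conditions are imposed so that [z] maps [B] bijectively onto a full ball: [Br] gives
   injectivity, the second condition keeps values within reach of the flow. *)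
pose B := [set x | Br x /\ `|z x - z x0| < r'].
exists r', B, g; split=> //.
- split; last by rewrite /B /Br /= !subrr !normr0.
  apply: open_of_balls => x [Bx xr].
  have [_ Ox _] := BrP _ Bx.
  have cz : {for x, continuous z}.
    by apply: row_continuous => i; exact: (Ck_cont (smz i 0%N) Ox).
  have e0 : 0 < r' - `|z x - z x0| by rewrite subr_gt0.
  have /continuous_eps/(_ _ e0)[e1 e10 He1] := cz.
  have [e2 e20 He2] := open_ball_sub oBr Bx.
  exists (Num.min e1 e2) => [|y]; first by rewrite lt_min e10.
  rewrite lt_min => /andP[/He1 yz /He2 By]; split=> //.
  have -> : z y - z x0 = (z y - z x) + (z x - z x0) by rewrite addrA subrK.
  by apply: le_lt_trans (ler_normD _ _) _; rewrite -ltrBrDr.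
- by move=> x [/BrP[]].
- move=> x [Bx xr]; split=> //; have [Bg Eg] := gP _ xr.
  by apply: inj Eg; [have [] := BrP _ Bg|have [] := BrP _ Bx].
split=> [y yr|i k].
  by have [Bg Eg] := gP y yr; split=> //; split=> //; rewrite Eg.
have oN : open [set y | `|y - z x0| < r'] by exact: open_nbhd_ball.
apply: (@Ck_eq _ _ _ _ (fun y => Phi 1 (row_mx x0 (eps^-1 *: (y - z x0))) 0 (lshift n i))) => //.
  by move=> y _; rewrite /g [RHS]mxE.
apply: (@Ck_comp _ _ _ _ _ [set q | `|q - row_mx x0 0| < r]
  (fun y => row_mx x0 (eps^-1 *: (y - z x0)))
  (fun q => Phi 1 q 0 (lshift n i))) => //.
- exact: open_nbhd_ball.
- move=> a; case: (splitP a) => b ab.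
    have -> : a = lshift n b by exact/val_inj.
    by apply: Ck_eq (Ck_cst _ _ (x0 0 b)) => // y _; rewrite row_mxEl.
  have -> : a = rshift n b by exact/val_inj.
  apply: (@Ck_eq _ _ _ _ (fun y => eps^-1 * (y 0 b - z x0 0 b))) => //.
    by move=> y _; rewrite row_mxEr !mxE.
  apply: CkM => //; first exact: Ck_cst.
  by apply: CkB => //; [exact: Ck_coord|exact: Ck_cst].
- move=> y yr /=; apply: inr; rewrite normrZ gtr0_norm ?invr_gt0//.
  by rewrite mulrC ltr_pdivrMr// mulrC.
- exact: smP.
Qed.

End InverseFunction.

(** * Matrix calculus and Christoffel symbols *)

Section MatrixEntries.
Variable R : comRingType.

Lemma addmxE m n (A B : 'M[R]_(m, n)) i j : (A + B) i j = A i j + B i j.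
Proof. by rewrite mxE. Qed.
Lemma oppmxE m n (A : 'M[R]_(m, n)) i j : (- A) i j = - A i j.
Proof. by rewrite mxE. Qed.
Lemma scalemxE m n (k : R) (A : 'M[R]_(m, n)) i j : (k *: A) i j = k * A i j.
Proof. by rewrite mxE. Qed.
Lemma zeromxE m n i j : (0 : 'M[R]_(m, n)) i j = 0.
Proof. by rewrite mxE. Qed.

Lemma trD m n (A B : 'M[R]_(m, n)) : (A + B)^T = A^T + B^T.
Proof. exact: linearD. Qed.
Lemma trN m n (A : 'M[R]_(m, n)) : (- A)^T = - A^T.
Proof. exact: linearN. Qed.
Lemma trZ m n (k : R) (A : 'M[R]_(m, n)) : (k *: A)^T = k *: A^T.
Proof. exact: linearZ. Qed.

Lemma mx_lincomb m n (A B C D : 'M[R]_(m, n)) : C = D -> A - B = C - D -> A = B.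
Proof. by move=> -> /eqP; rewrite subrr subr_eq0 => /eqP. Qed.

End MatrixEntries.

Ltac mxexpand := rewrite ?(mulmxDl, mulmxDr, mulNmx, mulmxN, trD, trN, trZ,
  trmx_mul, trmxK, mulmxA, opprD, opprK, mulmx0, mul0mx, subr0, add0r, addr0) /=;
  rewrite -?scalemxAl -?scalemxAr -?scalemxAl.

(** * Derivatives of matrix-valued functions *)

Section MatrixCalculus.
Variables (R : realType) (N : nat).
Implicit Types (O : set 'rV[R]_N) (c d : 'I_N) (x y : 'rV[R]_N).

Definition dmx m n c (A : 'rV[R]_N -> 'M[R]_(m, n)) x : 'M[R]_(m, n) :=
  \matrix_(i, j) pt c (fun y => A y i j) x.

Definition msm m n O (A : 'rV[R]_N -> 'M[R]_(m, n)) :=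
  forall i j, sm O (fun x => A x i j).

Lemma sm_eq O f g : open O -> (forall x, O x -> f x = g x) -> sm O f -> sm O g.
Proof. by move=> oO fg H k; exact: Ck_eq (H k). Qed.

Lemma smD O f g : open O -> sm O f -> sm O g -> sm O (fun x => f x + g x).
Proof. by move=> oO F G k; exact: CkD. Qed.

Lemma smN O f : open O -> sm O f -> sm O (fun x => - f x).
Proof. by move=> oO F k; exact: CkN. Qed.

Lemma smB O f g : open O -> sm O f -> sm O g -> sm O (fun x => f x - g x).
Proof. by move=> oO F G k; exact: CkB. Qed.

Lemma smM O f g : open O -> sm O f -> sm O g -> sm O (fun x => f x * g x).
Proof. by move=> oO F G k; exact: CkM. Qed.

Lemma smV O f : open O -> (forall x, O x -> f x != 0) -> sm O f ->
  sm O (fun x => (f x)^-1).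
Proof. by move=> oO f0 F k; exact: CkV. Qed.

Lemma sm_cst O (a : R) : sm O (fun=> a).
Proof. by move=> k; exact: Ck_cst. Qed.

Lemma sm_sub O O' f : O' `<=` O -> sm O f -> sm O' f.
Proof. by move=> sO F k; exact: Ck_sub (F k). Qed.

Lemma sm_der O f x c : sm O f -> O x -> is_derive x (delta_mx 0 c) f (pt c f x).
Proof. by move=> F; exact: Ck_der (F 1%N). Qed.

Lemma sm_sum O (I : Type) (r : seq I) (P : pred I) F : open O ->
  (forall i, sm O (F i)) -> sm O (fun x => \sum_(i <- r | P i) F i x).
Proof. by move=> oO H k; apply: Ck_sum => // i; exact: H. Qed.

Lemma msm_sub m n O O' (A : 'rV[R]_N -> 'M[R]_(m, n)) : O' `<=` O ->
  msm O A -> msm O' A.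
Proof. by move=> sO H i j; exact: sm_sub (H i j). Qed.

Lemma msm_cst m n O (A : 'M[R]_(m, n)) : msm O (fun=> A).
Proof. by move=> i j; exact: sm_cst. Qed.

Lemma msmD m n O (A B : 'rV[R]_N -> 'M[R]_(m, n)) : open O ->
  msm O A -> msm O B -> msm O (fun x => A x + B x).
Proof.
by move=> oO HA HB i j; apply: sm_eq (smD oO (HA i j) (HB i j)) => // x _; rewrite mxE.
Qed.

Lemma msmN m n O (A : 'rV[R]_N -> 'M[R]_(m, n)) : open O ->
  msm O A -> msm O (fun x => - A x).
Proof. by move=> oO HA i j; apply: sm_eq (smN oO (HA i j)) => // x _; rewrite mxE. Qed.

Lemma msmZ m n O f (A : 'rV[R]_N -> 'M[R]_(m, n)) : open O ->
  sm O f -> msm O A -> msm O (fun x => f x *: A x).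
Proof.
by move=> oO Hf HA i j; apply: sm_eq (smM oO Hf (HA i j)) => // x _; rewrite mxE.
Qed.

Lemma msmT m n O (A : 'rV[R]_N -> 'M[R]_(m, n)) : open O ->
  msm O A -> msm O (fun x => (A x)^T).
Proof. by move=> oO HA i j; apply: sm_eq (HA j i) => // x _; rewrite mxE. Qed.

Lemma msmM m n p O (A : 'rV[R]_N -> 'M[R]_(m, n)) (B : 'rV[R]_N -> 'M[R]_(n, p)) :
  open O -> msm O A -> msm O B -> msm O (fun x => A x *m B x).
Proof.
move=> oO HA HB i j.
apply: (@sm_eq _ (fun x => \sum_k A x i k * B x k j)) => //.
  by move=> x _; rewrite mxE.
by apply: sm_sum => // k; exact: smM.
Qed.

Lemma msm_dmx m n O (A : 'rV[R]_N -> 'M[R]_(m, n)) c : open O ->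
  msm O A -> msm O (dmx c A).
Proof. by move=> oO HA i j; apply: sm_eq (sm_pt c (HA i j)) => // x _; rewrite mxE. Qed.

Lemma msm_inv n O (A : 'rV[R]_N -> 'M[R]_n) : open O ->
  (forall x, O x -> A x \in unitmx) -> msm O A -> msm O (fun x => invmx (A x)).
Proof. by move=> oO uA HA i j k; apply: Ck_invmx => // a b; exact: HA. Qed.

Lemma pt_eq O f g c x : open O -> O x -> (forall y, O y -> f y = g y) ->
  pt c f x = pt c g x.
Proof.
move=> oO Ox fg; apply: near_eq_derive; apply/near_normP.
by have [d d0 H] := open_ball_sub oO Ox; exists d => // y /H/fg.
Qed.

Lemma dmx_eq m n O (A B : 'rV[R]_N -> 'M[R]_(m, n)) c x : open O -> O x ->
  (forall y, O y -> A y = B y) -> dmx c A x = dmx c B x.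
Proof.
move=> oO Ox AB; apply/matrixP => i j; rewrite !mxE.
by apply: (@pt_eq O) => // y /AB ->.
Qed.

Lemma dmx_cst m n (A : 'M[R]_(m, n)) c x : dmx c (fun=> A) x = 0.
Proof.
apply/matrixP => i j; rewrite !mxE.
exact: (is_derive_pt (is_derive_cst (A i j) x (delta_mx 0 c))).
Qed.

Lemma dmxT m n (A : 'rV[R]_N -> 'M[R]_(m, n)) c x :
  dmx c (fun y => (A y)^T) x = (dmx c A x)^T.
Proof.
by apply/matrixP => i j; rewrite !mxE; congr pt; apply/funext => y; rewrite mxE.
Qed.

Lemma dmxD m n O (A B : 'rV[R]_N -> 'M[R]_(m, n)) c x : msm O A -> msm O B -> O x ->
  dmx c (fun y => A y + B y) x = dmx c A x + dmx c B x.
Proof.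
move=> HA HB Ox; apply/matrixP => i j; rewrite !mxE.
under [fun y => _]eq_fun do rewrite mxE.
exact: (is_derive_pt (is_deriveD (sm_der c (HA i j) Ox) (sm_der c (HB i j) Ox))).
Qed.

Lemma dmxN m n O (A : 'rV[R]_N -> 'M[R]_(m, n)) c x : msm O A -> O x ->
  dmx c (fun y => - A y) x = - dmx c A x.
Proof.
move=> HA Ox; apply/matrixP => i j; rewrite !mxE.
under [fun y => _]eq_fun do rewrite mxE.
exact: (is_derive_pt (is_deriveN (sm_der c (HA i j) Ox))).
Qed.

Lemma ptM O f g c x : sm O f -> sm O g -> O x ->
  pt c (fun y => f y * g y) x = pt c f x * g x + f x * pt c g x.
Proof.
move=> Hf Hg Ox.
rewrite (is_derive_pt (is_deriveM (sm_der c Hf Ox) (sm_der c Hg Ox))).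
by rewrite /GRing.scale /= addrC; congr (_ + _); rewrite mulrC.
Qed.

Lemma dmxZ m n O f (A : 'rV[R]_N -> 'M[R]_(m, n)) c x : sm O f -> msm O A -> O x ->
  dmx c (fun y => f y *: A y) x = pt c f x *: A x + f x *: dmx c A x.
Proof.
move=> Hf HA Ox; apply/matrixP => i j; rewrite !mxE.
under [fun y => _]eq_fun do rewrite mxE.
by rewrite (ptM _ Hf (HA i j) Ox).
Qed.

Lemma dmxM m n p O (A : 'rV[R]_N -> 'M[R]_(m, n)) (B : 'rV[R]_N -> 'M[R]_(n, p)) c x :
  msm O A -> msm O B -> O x ->
  dmx c (fun y => A y *m B y) x = dmx c A x *m B x + A x *m dmx c B x.
Proof.
move=> HA HB Ox; apply/matrixP => i j; rewrite !mxE.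
under [fun y => _]eq_fun do rewrite mxE.
rewrite -big_split /=; apply: is_derive_pt; apply: is_derive_bigsum => k.
have H := is_deriveM (sm_der c (HA i k) Ox) (sm_der c (HB k j) Ox).
apply: is_derive_eq H _; rewrite /GRing.scale /= !mxE addrC; congr (_ + _).
by rewrite mulrC.
Qed.

Lemma dmx_comm m n O (A : 'rV[R]_N -> 'M[R]_(m, n)) c d x : open O -> msm O A -> O x ->
  dmx c (dmx d A) x = dmx d (dmx c A) x.
Proof.
move=> oO HA Ox; apply/matrixP => i j.
have E e : (fun y => dmx e A y i j) = pt e (fun y => A y i j).
  by apply/funext => y; rewrite mxE.
by rewrite [LHS]mxE [RHS]mxE !E; exact: (pt_comm c d oO (HA i j 2%N) Ox).
Qed.

End MatrixCalculus.

(* Matrix-valued fields are generalised first: [ring] would otherwise compare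
   them up to conversion. *)
Ltac mxgen := repeat match goal with
  | |- context [@dmx ?R ?N ?m ?n ?c ?A ?x] => generalize (@dmx R N m n c A x); intro
  | |- context [@pt ?R ?n ?c ?f ?x] => generalize (@pt R n c f x); intro
  end.
Ltac mxring := mxgen; do 3 mxexpand; let i := fresh in let j := fresh in
  apply/matrixP => i j; rewrite ?(addmxE, oppmxE, scalemxE, zeromxE); ring.

(** * The Levi-Civita connection in coordinates *)

Section Christoffel.
Variable R : realType.
Notation V := 'rV[R]_4.
Implicit Types (O : set V) (G K : V -> 'M[R]_4) (x : V) (a b c d : 'I_4).

Definition chr G x a b c : R :=
  2^-1 * \sum_d invmx (G x) a d *
    (pt b (fun y => G y d c) x + pt c (fun y => G y d b) x
     - pt d (fun y => G y b c) x).

(* The matrix with entries [Gamma^a_cb]. *)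
Definition Gam G c x : 'M[R]_4 := \matrix_(a, b) chr G x a c b.

(** Uniqueness of the Levi-Civita connection. With its index lowered, [H c = G L_c] is symmetric in
    one pair of slots and symmetrises to the derivative of [G] in another; the usual cyclic
    combination isolates it. *)
Lemma koszul G (L : 'I_4 -> 'M[R]_4) x : G x \in unitmx ->
  (forall c a b, L c a b = L b a c) ->
  (forall c, dmx c G x = G x *m L c + (L c)^T *m G x) -> (G x)^T = G x ->
  forall c, L c = Gam G c x.
Proof.
move=> uG Ls Lc Gs c; pose H c := G x *m L c.
have dG k a b : pt k (fun y => G y a b) x = H k a b + H k b a.
  have := Lc k => /matrixP/(_ a b); rewrite mxE => ->; rewrite mxE; congr (_ + _).
  have -> : (L k)^T *m G x = (H k)^T by rewrite trmx_mul Gs.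
  by rewrite mxE.
have Hs k a b : H k a b = H b a k.
  by rewrite !mxE; apply: eq_bigr => j _; rewrite Ls.
apply/matrixP => a b; rewrite mxE /chr.
have -> : L c a b = (invmx (G x) *m H c) a b by rewrite mulKmx.
rewrite mxE mulr_sumr; apply: eq_bigr => d _.
rewrite !dG (Hs b d c) (Hs b c d) (Hs c b d) mulrCA; congr (_ * _); by field.
Qed.

Lemma chr_sym O G x a b c : open O -> O x -> (forall y, O y -> (G y)^T = G y) ->
  chr G x a b c = chr G x a c b.
Proof.
move=> oO Ox Gs; congr (_ * _); apply: eq_bigr => d _; congr (_ * _).
rewrite [pt b _ _ + _]addrC; congr (_ - _); apply: (pt_eq _ oO Ox) => y Oy.
by rewrite -{1}(Gs y Oy) mxE.
Qed.

Lemma chr_compat O G c x : open O -> O x -> (forall y, O y -> (G y)^T = G y) ->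
  G x \in unitmx -> dmx c G x = G x *m Gam G c x + (Gam G c x)^T *m G x.
Proof.
move=> oO Ox Gs uG.
pose H c : 'M[R]_4 := \matrix_(d, b) (2^-1 *
  (pt c (fun y => G y d b) x + pt b (fun y => G y d c) x - pt d (fun y => G y c b) x)).
have -> : Gam G c x = invmx (G x) *m H c.
  apply/matrixP => a b; rewrite !mxE /chr mulr_sumr; apply: eq_bigr => d _.
  by rewrite mxE mulrCA.
rewrite mulKVmx// trmx_mul trmx_inv Gs// mulmxKV//.
have Gp k a b : pt k (fun y => G y a b) x = pt k (fun y => G y b a) x.
  by apply: (pt_eq _ oO Ox) => y Oy; rewrite -{1}(Gs y Oy) mxE.
apply/matrixP => a b; rewrite !mxE (Gp c b a) (Gp b a c) (Gp a c b); by field.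
Qed.

Lemma msm_Gam O G c : open O -> (forall x, O x -> G x \in unitmx) -> msm O G ->
  msm O (Gam G c).
Proof.
move=> oO uG sG a b; apply: (@sm_eq _ _ _ (fun x => chr G x a c b)) => //.
  by move=> x _; rewrite mxE.
apply: smM => //; first exact: sm_cst.
apply: sm_sum => // d; apply: smM => //; first exact: msm_inv.
by apply: smB => //; [apply: smD => //|]; apply: sm_pt; exact: sG.
Qed.

Definition jac (F : V -> V) x : 'M[R]_4 := \matrix_(a, b) pt b (fun y => F y 0 a) x.

Lemma msm_jac O (F : V -> V) : open O -> (forall a, sm O (fun x => F x 0 a)) -> msm O (jac F).
Proof.
by move=> oO sF a b; apply: sm_eq (sm_pt b (sF a)) => // x _; rewrite mxE.
Qed.

Lemma dmx_comp m n O O' (F : V -> V) (K : V -> 'M[R]_(m, n)) c x :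
  open O -> open O' -> (forall a, sm O (fun x => F x 0 a)) ->
  (forall y, O y -> O' (F y)) -> msm O' K -> O x ->
  dmx c (fun y => K (F y)) x = \sum_d jac F x d c *: dmx d K (F x).
Proof.
move=> oO oO' sF FO sK Ox; apply/matrixP => i j; rewrite mxE summxE.
have := @chain_map R 4 4 0 O' F (fun y => K y i j) x (delta_mx 0 c)
  (fun d => jac F x d c) oO' (sK i j 1%N) (FO _ Ox).
move=> H; rewrite (is_derive_pt (H _)); last first.
  by move=> d; rewrite mxE; exact: sm_der (sF d) Ox.
by apply: eq_bigr => d _; rewrite !mxE mulrC.
Qed.

Lemma jac_comm O (F : V -> V) a b c x : open O -> (forall a, sm O (fun x => F x 0 a)) -> O x ->
  dmx c (jac F) x a b = dmx b (jac F) x a c.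
Proof.
move=> oO sF Ox.
have E e : (fun y => jac F y a e) = pt e (fun y => F y 0 a).
  by apply/funext => y; rewrite mxE.
by rewrite [LHS]mxE [RHS]mxE !E; exact: (pt_comm c b oO (sF a 2%N) Ox).
Qed.

(** By uniqueness: the pulled back connection [L] is torsion free because second derivatives of [F]
    commute, and it is compatible with the pulled back metric, so [koszul] identifies it. The
    defining formula with the inverse metric never has to be transformed. *)
Lemma christoffel_transform O O' (F : V -> V) G K c x :
  open O -> open O' -> (forall a, sm O (fun x => F x 0 a)) ->
  (forall y, O y -> O' (F y)) -> msm O' K -> O x ->
  (forall y, O' y -> (K y)^T = K y) -> (forall y, O' y -> K y \in unitmx) ->
  (forall y, O y -> jac F y \in unitmx) ->
  (forall y, O y -> G y = (jac F y)^T *m K (F y) *m jac F y) ->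
  jac F x *m Gam G c x =
    dmx c (jac F) x + (\sum_d jac F x d c *: Gam K d (F x)) *m jac F x.
Proof.
move=> oO oO' sF FO sK Ox Ks uK uJ GE; set J := jac F x.
have O'x := FO _ Ox; have uJx := uJ _ Ox.
pose S c := \sum_d J d c *: Gam K d (F x).
pose L c := invmx J *m (dmx c (jac F) x + S c *m J).
suff -> : Gam G c x = L c by rewrite mulKVmx.
symmetry; move: c; apply: koszul.
- by rewrite GE// !unitmx_mul unitmx_tr uJx uK.
- move=> c a b; rewrite !mxE; apply: eq_bigr => k _; congr (_ * _).
  rewrite ![(dmx _ _ _ + _) k _]mxE; congr (_ + _); first exact: (jac_comm _ _ _ oO sF Ox).
  rewrite [LHS]mxE [RHS]mxE.
  transitivity (\sum_e \sum_d J d c * Gam K d (F x) k e * J e b).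
    by apply: eq_bigr => e _; rewrite summxE mulr_suml; apply: eq_bigr => d _; rewrite mxE.
  rewrite exchange_big /=; apply: eq_bigr => e _.
  rewrite summxE mulr_suml; apply: eq_bigr => d _; rewrite !mxE.
  by rewrite (chr_sym k e d oO' O'x Ks); ring.
- move=> c; have sJ := msm_jac oO sF.
  have sKF : msm O (fun y => K (F y)).
    move=> i j k; apply: (@Ck_comp _ _ _ _ O O' F (fun y => K y i j)) => //.
      by move=> a; exact: sF.
    exact: sK.
  rewrite (dmx_eq _ oO Ox GE) (dmxM _ _ sJ Ox); last by apply: msmM => //; exact: msmT.
  rewrite (dmxM _ _ sKF Ox); last exact: msmT.
  rewrite dmxT (dmx_comp _ oO oO' sF FO sK Ox) -/J.
  have -> : \sum_d J d c *: dmx d K (F x) = K (F x) *m S c + (S c)^T *m K (F x).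
    rewrite mulmx_sumr linear_sum /= mulmx_suml -big_split /=; apply: eq_bigr => d _.
    rewrite (chr_compat _ oO' O'x Ks (uK _ O'x)) scalerDr linearZ /=.
    by rewrite linearZ /= -scalemxAl.
  have JL : J *m L c = dmx c (jac F) x + S c *m J by rewrite mulKVmx.
  have JLT : (L c)^T *m J^T = (dmx c (jac F) x)^T + J^T *m (S c)^T.
    by rewrite -trmx_mul JL linearD /= trmx_mul.
  rewrite GE// -/J -!mulmxA JL !mulmxA JLT; mxring.
- by rewrite GE// !trmx_mul trmxK Ks// mulmxA.
Qed.

End Christoffel.

(** * Null frames *)

Section FrameAlgebra.
Variable R : realType.
Notation ec i := (delta_mx i 0 : 'cV[R]_4).

Lemma sum4 (W : zmodType) (F : 'I_4 -> W) : \sum_i F i = F 0 + F 1 + F 2 + F 3.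
Proof.
rewrite !big_ord_recl big_ord0 addr0 !addrA.
by congr (F _ + F _ + F _ + F _); exact/val_inj.
Qed.

Lemma ord4P (i : 'I_4) : [\/ i = 0, i = 1, i = 2 | i = 3].
Proof.
case: i => -[|[|[|[|//]]]] Hi; [constructor 1|constructor 2|constructor 3|constructor 4];
  exact/val_inj.
Qed.

Lemma forall4 (P : 'I_4 -> Prop) : P 0 -> P 1 -> P 2 -> P 3 -> forall i, P i.
Proof. by move=> p0 p1 p2 p3 i; case: (ord4P i) => ->. Qed.

Lemma mulmx_delta n (A : 'M[R]_(n, 4)) i j k : (A *m ec i) j k = A j i.
Proof.
rewrite mxE (bigD1 i)//= mxE !ord1 !eqxx mulr1 big1 ?addr0// => m mi.
by rewrite mxE (negbTE mi) mulr0.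
Qed.

Lemma neq0_entry m n (A : 'M[R]_(m, n)) : A != 0 -> exists i j, A i j != 0.
Proof.
move=> A0; apply: contrapT => H; move/eqP: A0; apply; apply/matrixP => i j.
by rewrite mxE; apply: contrapT => /eqP Aij; apply: H; exists i, j.
Qed.

(** Four basis vectors cannot all be multiples of one [v]. Every identity [al X = be(X) v] valid for
    all [X] is split into two vanishing statements by this. *)
Lemma indep_alg (v : 'cV[R]_4) (al : R) (be : 'I_4 -> R) : v != 0 ->
  (forall c, al *: ec c = be c *: v) -> al = 0 /\ forall c, be c = 0.
Proof.
move=> v0 H; have [i [j]] := neq0_entry v0; rewrite ord1 => vi.
have al0 : al = 0.
  have [k ki] : exists k : 'I_4, k != i.
    by case: (ord4P i) => ->; [exists 1|exists 0|exists 0|exists 0].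
  have /matrixP/(_ i 0) := H k; rewrite !mxE eqxx eq_sym (negbTE ki) mulr0 => /esym/eqP.
  rewrite mulf_eq0 (negbTE vi) orbF => /eqP b0.
  have /matrixP/(_ k 0) := H k; rewrite !mxE !eqxx b0 mul0r mulr1; exact.
split=> // c; have /matrixP/(_ i 0) := H c; rewrite al0 scale0r mxE [RHS]mxE.
by move=> /esym/eqP; rewrite mulf_eq0 (negbTE vi) orbF => /eqP.
Qed.

Lemma sym_cancel (v w : 'cV[R]_4) : v != 0 -> w *m v^T + v *m w^T = 0 -> w = 0.
Proof.
move=> v0 H; have [i [j]] := neq0_entry v0; rewrite ord1 => vi.
have E a b : w a 0 * v b 0 + v a 0 * w b 0 = 0.
  by have /matrixP/(_ a b) := H; rewrite !mxE !big_ord_recl !big_ord0 !addr0 !mxE.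
have wi : w i 0 = 0.
  have := E i i; rewrite mulrC -mulr2n => /eqP; rewrite mulrn_eq0 /= mulf_eq0 (negbTE vi).
  by move=> /eqP.
apply/matrixP => a b; rewrite ord1 mxE; have := E a i; rewrite wi mulr0 addr0 => /eqP.
by rewrite mulf_eq0 (negbTE vi) orbF => /eqP.
Qed.

(* Unique factorisation in the symmetric algebra, applied to [l . L_d = e_d . m]. *)
Lemma sigma_alg (l m : 'cV[R]_4) (L : 'I_4 -> 'cV[R]_4) : l != 0 ->
  (forall d, ec d *m m^T + m *m (ec d)^T = l *m (L d)^T + L d *m l^T) ->
  exists sg : R, forall d, L d = sg *: ec d.
Proof.
move=> l0 H; have [i [j]] := neq0_entry l0; rewrite ord1 => li {j}.
have E d a b : (a == d)%:R * m b 0 + m a 0 * (b == d)%:R =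
    l a 0 * L d b 0 + L d a 0 * l b 0.
  by have /matrixP/(_ a b) := H d; rewrite !mxE !big_ord_recl !big_ord0 !addr0 !mxE !eqxx !andbT.
pose sg := m i 0 / l i 0.
have mi : m i 0 = sg * l i 0 by rewrite /sg divfK.
have Li d : L d i 0 = sg * (i == d)%:R.
  have := E d i i; rewrite mi.
  have -> : (i == d)%:R * (sg * l i 0) + sg * l i 0 * (i == d)%:R =
    2 * l i 0 * (sg * (i == d)%:R) by ring.
  have -> : l i 0 * L d i 0 + L d i 0 * l i 0 = 2 * l i 0 * L d i 0 by ring.
  by move=> /mulfI -> //; rewrite mulf_neq0.
have mj b : m b 0 = sg * l b 0.
  have [->//|bi] := eqVneq b i.
  have := E b b i; have := E b b b; have := E b i b.
  rewrite !Li eqxx [i == b]eq_sym (negbTE bi) !mulr0 !mul0r !mulr1 !mul1r addr0 add0r.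
  rewrite mi => E1 E2 _.
  have : L b b 0 = sg.
    by apply: (mulfI li); rewrite -E1 mulrC.
  move=> Lbb; move: E2; rewrite Lbb => E2.
  by apply: (mulfI (_ : 2 != 0 :> R)); rewrite ?pnatr_eq0//; move: E2; lra.
exists sg => d; apply/matrixP => b k; rewrite ord1 !mxE eqxx andbT.
have := E d i b; rewrite Li mi mj => E1; apply: (mulfI li).
by move: E1; lra.
Qed.

(** The Gram matrix of a null tetrad in the order [l, n, x, y]. *)
Definition eta : 'M[R]_4 :=
  \matrix_(i, j) ((i == 0) && (j == 1) || (i == 1) && (j == 0)
                  || (i == 2) && (j == 2) || (i == 3) && (j == 3))%:R.

Lemma etaE (A : 'M[R]_4) j : [/\ (eta *m A) 0 j = A 1 j, (eta *m A) 1 j = A 0 j,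
  (eta *m A) 2 j = A 2 j & (eta *m A) 3 j = A 3 j].
Proof. by split; rewrite mxE sum4 !mxE /= ?mul0r ?mul1r ?addr0 ?add0r. Qed.

Lemma etaK : eta *m eta = 1%:M.
Proof.
apply/matrixP; apply: forall4; apply: forall4; rewrite mxE sum4 !mxE /=;
  by rewrite ?mul0r ?mul1r ?mulr0 ?addr0 ?add0r.
Qed.

Lemma eta_e0 : eta *m ec 0 = ec 1.
Proof. by apply/matrixP; apply: forall4 => j; rewrite ord1 mulmx_delta !mxE. Qed.

Variables (G T F : 'M[R]_4).
Hypothesis Gs : G^T = G.
Hypothesis TG : T^T *m G *m T = eta.
Let l := T *m ec 0.
Hypothesis Fskew : G *m F + F^T *m G = 0.
Hypothesis Fl : F *m l = 0.

Lemma frame_inv : T *m (eta *m T^T *m G) = 1%:M.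
Proof. by apply: mulmx1C; rewrite -!mulmxA (mulmxA T^T) TG etaK. Qed.

Lemma frame_unit : T \in unitmx.
Proof. by have [] := mulmx1_unit frame_inv. Qed.

Lemma frame_unitG : G \in unitmx.
Proof. by have [_] := mulmx1_unit frame_inv; rewrite unitmx_mul => /andP[]. Qed.

Lemma frame_l_neq0 : l != 0.
Proof.
apply/negP => /eqP /(congr1 (mulmx (invmx T))); rewrite mulKmx ?frame_unit// mulmx0.
by move=> /matrixP/(_ 0 0); rewrite !mxE => /eqP; rewrite oner_eq0.
Qed.

Lemma frame_Gl : T^T *m (G *m l) = ec 1.
Proof. by rewrite /l !mulmxA TG eta_e0. Qed.

Lemma frame_Gl_tr : (ec 1)^T = l^T *m G *m T.
Proof. by rewrite -frame_Gl (trmx_mul _ (G *m l)) trmxK (trmx_mul G) Gs. Qed.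

Lemma frame_cancel n (A B : 'M[R]_(4, n)) : T^T *m G *m A = T^T *m G *m B -> A = B.
Proof.
have u : T^T *m G \in unitmx by rewrite unitmx_mul unitmx_tr frame_unit frame_unitG.
by move=> /(congr1 (mulmx (invmx (T^T *m G)))); rewrite !mulKmx.
Qed.

(** [F] with its index lowered, in the frame. Skewness and [F l = 0] leave the three entries 12, 13
    and 23, which are the coefficients of [F] on [l /\ x], [l /\ y] and [x /\ y]. *)
Let f := T^T *m G *m F *m T.

Let f_skew : f^T = - f.
Proof.
rewrite /f !trmx_mul trmxK Gs !mulmxA -[T^T *m F^T *m G]mulmxA.
by have /eqP := Fskew; rewrite addrC addr_eq0 => /eqP ->; rewrite mulmxN mulNmx !mulmxA.
Qed.

Let fsk i j : f i j = - f j i.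
Proof. by have /matrixP/(_ j i) := f_skew; rewrite [LHS]mxE [RHS]mxE. Qed.

Let fd i : f i i = 0.
Proof. by have := fsk i i => /eqP; rewrite -addr_eq0 -mulr2n mulrn_eq0 /= => /eqP. Qed.

Let f0 i : f i 0 = 0.
Proof.
have : f *m ec 0 = 0 by rewrite /f -mulmxA -/l -mulmxA Fl mulmx0.
by move=> /matrixP/(_ i 0); rewrite mulmx_delta [RHS]mxE.
Qed.

Let f0' i : f 0 i = 0. Proof. by rewrite fsk f0 oppr0. Qed.

Let f_eq0 : f 1 2 = 0 -> f 1 3 = 0 -> f 2 3 = 0 -> F = 0.
Proof.
move=> z1 z2 z3; have f00 : f = 0.
  apply/matrixP; apply: forall4; apply: forall4; rewrite [RHS]mxE ?fd ?f0 ?f0'//;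
  by rewrite fsk ?z1 ?z2 ?z3 oppr0.
apply: frame_cancel; rewrite mulmx0.
by have := congr1 (mulmx^~ (invmx T)) f00; rewrite /= mulmxK ?frame_unit// mul0mx.
Qed.

(* Reads [B F = 0] in the frame; [eta] swaps the two null directions. *)
Let BF_frame (B : 'M[R]_4) : B *m F = 0 -> forall i j,
  (B *m T) i 0 * f 1 j + (B *m T) i 2 * f 2 j + (B *m T) i 3 * f 3 j = 0.
Proof.
move=> BF i j.
have : B *m T *m (eta *m f) = 0.
  rewrite /f -!mulmxA.
  have -> : T *m (eta *m (T^T *m (G *m (F *m T)))) = F *m T.
    by have := frame_inv => /(congr1 (mulmx^~ (F *m T))); rewrite mul1mx -!mulmxA.
  by rewrite mulmxA BF mul0mx.
move=> /matrixP/(_ i j); rewrite [LHS]mxE [RHS]mxE sum4.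
have [-> -> -> ->] := etaE f j.
by rewrite f0' mulr0 addr0.
Qed.

(** The cases are [f 2 3 = 0] and [f 2 3 != 0]. In the first, [F = l /\ z] with [z] spacelike, so
    [l] lies in the image of [F] and [B] kills it. In the second, [B F = 0] expresses [B x] and
    [B y] through [B l], and the kernel of [F] meets the orthogonal complement of [l] only in
    multiples of [l]. *)
Lemma frame_dichotomy : F != 0 ->
  (forall B : 'M[R]_4, B *m F = 0 -> B *m l = 0) \/
  [/\ exists r2 r3 : R, forall B : 'M[R]_4, B *m F = 0 ->
        B *m (T *m ec 2) = r2 *: (B *m l) /\ B *m (T *m ec 3) = r3 *: (B *m l)
    & forall w : 'cV[R]_4, F *m w = 0 -> l^T *m G *m w = 0 ->
        exists t : R, w = t *: l].
Proof.
move=> F0.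
have BTE (B : 'M[R]_4) k : B *m (T *m ec k) = (B *m T) *m ec k by rewrite mulmxA.
have [C0|C0] := eqVneq (f 2 3) 0; [left|right].
  move=> B /BF_frame H; rewrite /l BTE; apply/matrixP => i j; rewrite mulmx_delta [RHS]mxE.
  have := H i 2; have := H i 3; rewrite fd C0 [f 3 2]fsk C0 oppr0 fd !mulr0 !addr0.
  move=> /eqP; rewrite mulf_eq0 => /orP[/eqP //|/eqP z2].
  move=> /eqP; rewrite mulf_eq0 => /orP[/eqP //|/eqP z1].
  by move: F0; rewrite f_eq0 ?eqxx.
split.
  exists (- f 1 3 / f 2 3), (f 1 2 / f 2 3) => B /BF_frame H; rewrite /l !BTE.
  split; apply/matrixP => i j; rewrite [RHS]mxE !mulmx_delta.
    have := H i 3; rewrite fd mulr0 addr0 => E.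
    have -> : (B *m T) i 2 = - ((B *m T) i 0 * f 1 3) / f 2 3.
      by apply: (mulIf C0); rewrite divfK//; lra.
    by field.
  have := H i 2; rewrite fd mulr0 addr0 [f 3 2]fsk => E.
  have -> : (B *m T) i 3 = ((B *m T) i 0 * f 1 2) / f 2 3.
    by apply: (mulIf C0); rewrite divfK//; lra.
  by field.
move=> w Fw lw; pose y := invmx T *m w.
have wy : w = T *m y by rewrite /y mulKVmx ?frame_unit.
have y1 : y 1 0 = 0.
  have : (ec 1)^T *m y = 0.
    by rewrite frame_Gl_tr -mulmxA -wy lw.
  by move=> /matrixP/(_ 0 0); rewrite [LHS]mxE [RHS]mxE sum4 ![(ec 1)^T _ _]mxE ![ec 1 _ _]mxE /= !mul0r mul1r !addr0 add0r.
have fy : f *m y = 0 by rewrite /f -mulmxA -wy -mulmxA Fw mulmx0.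
have fyi i : f i 2 * y 2 0 + f i 3 * y 3 0 = 0.
  by have /matrixP/(_ i 0) := fy; rewrite [LHS]mxE [RHS]mxE sum4 y1 f0 mul0r mulr0 !add0r.
have y3 : y 3 0 = 0.
  by have := fyi 2; rewrite fd mul0r add0r => /eqP; rewrite mulf_eq0 (negbTE C0) => /eqP.
have y2 : y 2 0 = 0.
  have := fyi 3; rewrite fd mul0r addr0 fsk mulNr => /eqP.
  by rewrite oppr_eq0 mulf_eq0 (negbTE C0) => /eqP.
exists (y 0 0); rewrite wy /l scalemxAr; congr (_ *m _).
by apply/matrixP; apply: forall4 => j; rewrite ord1 [RHS]mxE [X in _ * X]mxE ?y1 ?y2 ?y3 /= ?mulr0 ?mulr1.
Qed.

Let frame_mul (A B : 'M[R]_4) :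
  T^T *m G *m (A *m B) *m T = (T^T *m G *m A *m T) *m eta *m (T^T *m G *m B *m T).
Proof.
rewrite -[in RHS]mulmxA -!mulmxA; do 3 congr (_ *m _).
by have := frame_inv => /(congr1 (mulmx^~ (B *m T))); rewrite mul1mx -!mulmxA.
Qed.

(** The metric is positive on the plane of [x] and [y], so the relevant diagonal entries of the
    square are minus sums of squares of entries of [f]. *)
Lemma frame_sq_neq0 : F != 0 -> F *m F != 0.
Proof.
apply: contra_neq => FF.
have E i j : f i 2 * f 2 j + f i 3 * f 3 j = 0.
  have : f *m (eta *m f) = 0.
    by have := frame_mul F F; rewrite FF mulmx0 mul0mx -/f -mulmxA.
  move=> /matrixP/(_ i j); rewrite [LHS]mxE [RHS]mxE sum4.
  have [-> -> -> ->] := etaE f j.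
  by rewrite f0' f0 mulr0 mul0r !add0r.
have C0 : f 2 3 = 0.
  have := E 2 2; rewrite fd mul0r add0r [f 3 2]fsk mulrN => /eqP.
  by rewrite oppr_eq0 mulf_eq0 orbb => /eqP.
have := E 1 1; rewrite [f 2 1]fsk [f 3 1]fsk !mulrN -opprD => /eqP.
rewrite oppr_eq0 -!expr2 paddr_eq0 ?sqr_ge0// !sqrf_eq0 => /andP[/eqP A0 /eqP B0].
exact: f_eq0.
Qed.

(** Since [a] commutes with [F], the product [a F] is again skew and kills [l], so it too has only
    three entries. It kills the kernel of [F] as well, in particular [z], which is the axis of a
    skew 3 by 3 matrix; two such matrices with a common axis are proportional. *)
Lemma frame_kappa (a : 'M[R]_4) : (G *m a)^T = G *m a -> a *m F = F *m a -> F != 0 ->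
  exists k : R, a *m F = k *: F.
Proof.
move=> Ga aF F0; pose M := T^T *m G *m (a *m F) *m T.
have Msk : M^T = - M.
  rewrite {1}/M !trmx_mul trmxK Gs.
  have -> : T^T *m (F^T *m a^T *m (G *m T)) = T^T *m F^T *m (G *m a)^T *m T.
    by rewrite trmx_mul Gs !mulmxA.
  rewrite Ga /M aF !mulmxA -[T^T *m F^T *m G]mulmxA.
  by have /eqP := Fskew; rewrite addrC addr_eq0 => /eqP ->; rewrite !(mulmxN, mulNmx) !mulmxA.
have Ms i j : M i j = - M j i by have /matrixP/(_ j i) := Msk; rewrite [LHS]mxE [RHS]mxE.
have Md i : M i i = 0.
  by have := Ms i i => /eqP; rewrite -addr_eq0 -mulr2n mulrn_eq0 /= => /eqP.
have M0 i : M i 0 = 0.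
  have : M *m ec 0 = 0 by rewrite /M -!mulmxA -/l Fl !mulmx0.
  by move=> /matrixP/(_ i 0); rewrite mulmx_delta [RHS]mxE.
have M0' i : M 0 i = 0 by rewrite Ms M0 oppr0.
pose z : 'cV[R]_4 := \col_i (if i == 1 then f 2 3 else if i == 2 then - f 1 3 else
  if i == 3 then f 1 2 else 0).
have [z0 z1 z2 z3] : [/\ z 0 0 = 0, z 1 0 = f 2 3, z 2 0 = - f 1 3 & z 3 0 = f 1 2].
  by split; rewrite [LHS]mxE.
have fz : f *m z = 0.
  apply/matrixP; apply: forall4 => j; rewrite ord1 [LHS]mxE [RHS]mxE sum4 z0 z1 z2 z3 ?f0' ?f0 ?fd.
  - by rewrite !mul0r !addr0.
  - ring.
  - by rewrite [f 2 1]fsk; ring.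
  - by rewrite [f 3 1]fsk [f 3 2]fsk; ring.
have Mz : M *m z = 0 by rewrite /M frame_mul -/f -mulmxA fz mulmx0.
have Mzi i : M i 1 * f 2 3 - M i 2 * f 1 3 + M i 3 * f 1 2 = 0.
  have /matrixP/(_ i 0) := Mz; rewrite [LHS]mxE [RHS]mxE sum4 z0 z1 z2 z3.
  by rewrite mulr0 add0r mulrN.
have e1 : M 1 2 * f 1 3 = M 1 3 * f 1 2.
  by have := Mzi 1; rewrite Md; lra.
have e2 : M 1 2 * f 2 3 = M 2 3 * f 1 2.
  by have := Mzi 2; rewrite Md (Ms 2 1); lra.
have e3 : M 1 3 * f 2 3 = M 2 3 * f 1 3.
  by have := Mzi 3; rewrite Md (Ms 3 1) (Ms 3 2); lra.
have [k [k1 k2 k3]] : exists k, [/\ M 1 2 = k * f 1 2, M 1 3 = k * f 1 3 & M 2 3 = k * f 2 3].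
  have [A0|A0] := eqVneq (f 1 2) 0; last first.
    exists (M 1 2 / f 1 2); rewrite divfK//; split=> //.
      by apply: (mulIf A0); rewrite -e1; field.
    by apply: (mulIf A0); rewrite -e2; field.
  have [B0|B0] := eqVneq (f 1 3) 0; last first.
    exists (M 1 3 / f 1 3); rewrite divfK//; split=> //.
      by apply: (mulIf B0); rewrite e1 A0; ring.
    by apply: (mulIf B0); rewrite -e3; field.
  have [C0|C0] := eqVneq (f 2 3) 0; last first.
    exists (M 2 3 / f 2 3); rewrite divfK//; split=> //.
      by apply: (mulIf C0); rewrite e2 A0; ring.
    by apply: (mulIf C0); rewrite e3 B0; ring.
  by move: F0; rewrite f_eq0 ?eqxx.
exists k; apply: frame_cancel; rewrite -scalemxAr.
have : M = k *: f.
  apply/matrixP; apply: forall4; apply: forall4;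
    rewrite [RHS]mxE ?Md ?M0 ?M0' ?fd ?f0 ?f0' ?mulr0//.
  - by rewrite Ms [f 2 1]fsk k1 mulrN.
  - by rewrite Ms [f 3 1]fsk k2 mulrN.
  - by rewrite Ms [f 3 2]fsk k3 mulrN.
move=> /(congr1 (mulmx^~ (invmx T))); rewrite /= /M mulmxK ?frame_unit//.
by rewrite /f -scalemxAl mulmxK ?frame_unit.
Qed.

(** A symmetric form with [l], [x] and [y] in its kernel has one entry left, that on [n], and the
    covector dual to [n] is [l] lowered. *)
Lemma frame_rank1 (E : 'M[R]_4) : (G *m E)^T = G *m E -> E *m l = 0 ->
  E *m (T *m ec 2) = 0 -> E *m (T *m ec 3) = 0 ->
  exists e : R, E = e *: (l *m l^T *m G).
Proof.
move=> GE E0 E2 E3; pose S := T^T *m (G *m E) *m T.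
have Sc k : E *m (T *m ec k) = 0 -> forall i, S i k = 0.
  move=> Ek i; have : S *m ec k = 0 by rewrite /S -!mulmxA Ek !mulmx0.
  by move=> /matrixP/(_ i 0); rewrite mulmx_delta [RHS]mxE.
have Ss i j : S i j = S j i.
  have : S^T = S by rewrite /S !trmx_mul trmxK -trmx_mul GE mulmxA.
  by move=> /matrixP/(_ i j); rewrite mxE => <-.
exists (S 1 1); apply: frame_cancel.
have u := frame_unit.
suff : S = S 1 1 *: (ec 1 *m (ec 1)^T).
  move=> /(congr1 (mulmx^~ (invmx T))); rewrite /= {1}/S mulmxK// mulmxA => ->.
  rewrite frame_Gl_tr -frame_Gl -scalemxAl -scalemxAr.
  by rewrite !mulmxA mulmxK.
have S0 := Sc 0 E0; have S2 := Sc 2 E2; have S3 := Sc 3 E3.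
have D i j : (S 1 1 *: (ec 1 *m (ec 1)^T)) i j = S 1 1 * ((i == 1)%:R * (j == 1)%:R).
  by rewrite [LHS]mxE [X in _ * X]mxE big_ord1 [(ec 1)^T _ _]mxE ![ec 1 _ _]mxE eqxx !andbT.
clearbody S; apply/matrixP; apply: forall4; apply: forall4; rewrite D /=
  ?mulr0 ?mul0r ?mulr0 ?mulr1 ?S0 ?S2 ?S3//.
all: by rewrite Ss ?S0 ?S2 ?S3.
Qed.

(** Except for the one belonging to [n], all columns of the lowered [B] are multiples of [G l]; by
    symmetry only the row and the column of [n] survive, and [s] is read off from them. *)
Lemma frame_null_pair (B : 'M[R]_4) (u tau r2 r3 : R) : (G *m B)^T = G *m B -> tau != 0 ->
  B *m l = (u * tau) *: l -> B *m (T *m ec 2) = r2 *: (B *m l) ->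
  B *m (T *m ec 3) = r3 *: (B *m l) ->
  exists s : 'cV[R]_4, B = tau *: (s *m l^T *m G + l *m s^T *m G).
Proof.
move=> GB tau0 B0 B2 B3; pose S := T^T *m (G *m B) *m T.
have Ss i j : S i j = S j i.
  have : S^T = S by rewrite /S !trmx_mul trmxK -trmx_mul GB mulmxA.
  by move=> /matrixP/(_ i j); rewrite mxE => <-.
have Sc k q : B *m (T *m ec k) = q *: (B *m l) -> forall i, S i k = q * (u * tau) * (i == 1)%:R.
  move=> Bk i; have : S *m ec k = (q * (u * tau)) *: ec 1.
    rewrite /S -!mulmxA Bk B0 -!scalemxAr frame_Gl scalerA //.
  by move=> /matrixP/(_ i 0); rewrite mulmx_delta [RHS]mxE [X in _ * X]mxE eqxx andbT.
have S0 i : S i 0 = u * tau * (i == 1)%:R.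
  by have := Sc 0 1; rewrite -/l scale1r mul1r; apply.
(* [y] holds the lowered components of [s]; the one on [n] is halved because the symmetric product
   counts it twice. *)
pose y : 'cV[R]_4 := \col_i (if i == 0 then u else if i == 1 then S 1 1 / (2 * tau)
  else if i == 2 then r2 * u else r3 * u).
pose s := T *m (eta *m y).
have Gsy : T^T *m G *m s = y by rewrite /s mulmxA TG mulmxA etaK mul1mx.
exists s; apply: frame_cancel.
have u' := frame_unit.
suff : S = tau *: (y *m (ec 1)^T + ec 1 *m y^T).
  move=> /(congr1 (mulmx^~ (invmx T))); rewrite /= {1}/S mulmxK// mulmxA => ->.
  have yT : y^T = s^T *m G *m T by rewrite -Gsy trmx_mul (trmx_mul T^T) trmxK Gs mulmxA.
  rewrite yT -Gsy frame_Gl_tr -frame_Gl -scalemxAl -scalemxAr.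
  by congr (_ *: _); rewrite !mulmxDl !mulmxDr !mulmxA !mulmxK.
have [y0 y1 y2 y3] : [/\ y 0 0 = u, y 1 0 = S 1 1 / (2 * tau), y 2 0 = r2 * u & y 3 0 = r3 * u].
  by split; rewrite [LHS]mxE.
have S2 := Sc 2 r2 B2; have S3 := Sc 3 r3 B3.
have E i j : (tau *: (y *m (ec 1)^T + ec 1 *m y^T)) i j =
   tau * (y i 0 * (j == 1)%:R + (i == 1)%:R * y j 0).
  rewrite [LHS]mxE [X in _ * X]mxE [(y *m _) i j]mxE [(ec 1 *m _) i j]mxE !big_ord1.
  by rewrite [(ec 1)^T _ _]mxE [y^T _ _]mxE ![ec 1 _ _]mxE eqxx !andbT.
clearbody S y.
by apply/matrixP; apply: forall4; apply: forall4; rewrite E ?y0 ?y1 ?y2 ?y3 /=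
  ?[S 0 1]Ss ?[S 2 1]Ss ?[S 3 1]Ss ?S0 ?S2 ?S3 /=; field.
Qed.

End FrameAlgebra.

(** * Curvature and the Sinyukov equation *)

Section CurvatureAlgebra.
Variable R : realType.
Notation ec i := (delta_mx i 0 : 'cV[R]_4).
Implicit Types (G A : 'M[R]_4) (Rm : 'I_4 -> 'I_4 -> 'M[R]_4).

Lemma sum_ec (w : 'cV[R]_4) : \sum_c w c 0 *: ec c = w.
Proof.
apply/matrixP => i j; rewrite ord1 summxE (bigD1 i)//= !mxE !eqxx mulr1 big1 ?addr0//.
by move=> k ki; rewrite !mxE eq_sym (negbTE ki) mulr0.
Qed.

(* A tensor symmetric in its first and third and skew in its last two indices vanishes. *)
Lemma contract_alg G Rm (l : 'cV[R]_4) : G^T = G -> G \in unitmx ->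
  (forall c d, Rm d c = - Rm c d) ->
  (forall c d, G *m Rm c d + (Rm c d)^T *m G = 0) ->
  (forall b c d, Rm c d *m ec b + Rm d b *m ec c + Rm b c *m ec d = 0) ->
  (forall c d, Rm c d *m l = 0) -> forall d, \sum_c l c 0 *: Rm c d = 0.
Proof.
move=> Gs uG anti skew cyc Rl d0; pose S d := \sum_c l c 0 *: Rm c d.
have SC d b : S d *m ec b = S b *m ec d.
  rewrite /S !mulmx_suml; apply/eqP; rewrite -subr_eq0 -sumrB; apply/eqP.
  transitivity (\sum_c l c 0 *: (Rm b d *m ec c)).
    apply: eq_bigr => c _; rewrite -!scalemxAl -scalerBr; congr (_ *: _).
    have := cyc b c d; rewrite (anti b d) (anti c b) => H.
    by apply: (mx_lincomb H); mxring.
  transitivity (Rm b d *m \sum_c l c 0 *: ec c).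
    by rewrite mulmx_sumr; apply: eq_bigr => c _; rewrite scalemxAr.
  by rewrite sum_ec.
pose t d := G *m S d.
have tsk d a b : t d a b = - t d b a.
  have : t d + (t d)^T = 0.
    rewrite /t trmx_mul Gs// /S mulmx_sumr linear_sum /= mulmx_suml -big_split /= big1// => c _.
    by rewrite trZ -scalemxAr -scalemxAl -scalerDr skew scaler0.
  move=> /matrixP/(_ a b); rewrite [LHS]mxE [(t d)^T a b]mxE [RHS]mxE => /eqP.
  by rewrite addr_eq0 => /eqP.
have tC d a b : t d a b = t b a d.
  by rewrite -(mulmx_delta (t d) b a 0) -(mulmx_delta (t b) d a 0) /t -!mulmxA SC.
have t0 : t d0 = 0.
  apply/matrixP => a b; rewrite [RHS]mxE.
  have : t d0 a b = - t d0 a b.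
    by rewrite {1}tC tsk [t b _ _]tC tsk opprK [t a _ _]tC tsk.
  by move=> /eqP; rewrite -addr_eq0 -mulr2n mulrn_eq0 /= => /eqP.
by rewrite -[LHS](mulKmx uG) -/(S d0) -/(t d0) t0 mulmx0.
Qed.

(** Contracting the Ricci identity with [l] over the index [c] removes the curvature and leaves
    [l L_d + L_d l = e_d m + m e_d], where [m] is the derivative of [lam] along [l]; [sigma_alg]
    then applies. *)
Lemma Dlam_alg G A Rm (l : 'cV[R]_4) (L : 'I_4 -> 'cV[R]_4) : G \in unitmx -> l != 0 ->
  (forall d, \sum_c l c 0 *: Rm c d = 0) ->
  (forall c d, Rm c d *m A - A *m Rm c d =
    ec d *m (L c)^T *m G + L c *m (ec d)^T *m G
    - (ec c *m (L d)^T *m G + L d *m (ec c)^T *m G)) ->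
  exists sg : R, forall d, L d = sg *: ec d.
Proof.
move=> uG l0 Rc Ric; pose m := \sum_c l c 0 *: L c.
apply: (@sigma_alg R l m L l0) => d.
have : (ec d *m m^T + m *m (ec d)^T) *m G = (l *m (L d)^T + L d *m l^T) *m G.
  apply/eqP; rewrite -subr_eq0; apply/eqP.
  transitivity (\sum_c l c 0 *: (Rm c d *m A - A *m Rm c d)).
    rewrite -{1 2}(sum_ec l) /m.
    rewrite !linear_sum /= !mulmx_suml -!big_split /= !mulmx_suml -sumrB.
    by apply: eq_bigr => c _; rewrite Ric; mxring.
  transitivity ((\sum_c l c 0 *: Rm c d) *m A - A *m \sum_c l c 0 *: Rm c d).
    rewrite mulmx_suml mulmx_sumr -sumrB; apply: eq_bigr => c _.
    by rewrite scalerBr scalemxAl scalemxAr.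
  by rewrite Rc mul0mx mulmx0 subrr.
by move=> /(congr1 (mulmx^~ (invmx G))); rewrite !mulmxK.
Qed.

(** The same contraction, now of the Ricci identity for a vector, leaves a relation covered by
    [indep_alg]. *)
Lemma dsigma_alg Rm (l w : 'cV[R]_4) (p : 'I_4 -> R) : l != 0 ->
  (forall d, \sum_c l c 0 *: Rm c d = 0) ->
  (forall c d, Rm c d *m w = p c *: ec d - p d *: ec c) -> forall c, p c = 0.
Proof.
move=> l0 Rc Ric.
have H d : (\sum_e l e 0 * p e) *: ec d = p d *: l.
  apply/eqP; rewrite -subr_eq0; apply/eqP.
  transitivity (\sum_e l e 0 *: (Rm e d *m w)).
    have -> : p d *: l = \sum_e p d *: (l e 0 *: ec e) by rewrite -scaler_sumr sum_ec.
    rewrite scaler_suml -sumrB; apply: eq_bigr => e _.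
    by rewrite Ric scalerBr !scalerA [p d * _]mulrC.
  transitivity ((\sum_e l e 0 *: Rm e d) *m w).
    by rewrite mulmx_suml; apply: eq_bigr => e _; rewrite scalemxAl.
  by rewrite Rc mul0mx.
by have [_] := indep_alg l0 H.
Qed.

End CurvatureAlgebra.

Ltac Gamgen := repeat match goal with
  | |- context [@dmx ?R ?N ?m ?n ?c ?A ?x] => generalize (@dmx R N m n c A x); intro
  | |- context [@Gam ?R ?G ?c ?x] => generalize (@Gam R G c x); intro
  | |- context [@pt ?R ?n ?c ?f ?x] => generalize (@pt R n c f x); intro
  end.
Ltac mxring ::= Gamgen; do 3 mxexpand; let i := fresh in let j := fresh in
  apply/matrixP => i j; rewrite ?(addmxE, oppmxE, scalemxE, zeromxE); ring.

(** * Integrability conditions of Sinyukov's equation *)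

Section Curvature.
Variables (R : realType) (O : set 'rV[R]_4) (G : 'rV[R]_4 -> 'M[R]_4).
Notation ec i := (delta_mx i 0 : 'cV[R]_4).
Hypothesis oO : open O.
Hypothesis sG : msm O G.
Hypothesis Gs : forall x, O x -> (G x)^T = G x.
Hypothesis uG : forall x, O x -> G x \in unitmx.
Implicit Types (x : 'rV[R]_4) (b c d : 'I_4).

(** The curvature endomorphism [R(e_c, e_d)], written as a commutator so that index sums become
    matrix products. *)
Definition Rie c d x : 'M[R]_4 := dmx c (Gam G d) x - dmx d (Gam G c) x
  + Gam G c x *m Gam G d x - Gam G d x *m Gam G c x.

Lemma sGam c : msm O (Gam G c).
Proof. exact: msm_Gam. Qed.

Lemma dG c x : O x -> dmx c G x = G x *m Gam G c x + (Gam G c x)^T *m G x.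
Proof. by move=> Ox; apply: (chr_compat _ oO Ox Gs); exact: uG. Qed.

Lemma GamC b c x : O x -> Gam G c x *m ec b = Gam G b x *m ec c.
Proof.
move=> Ox; apply/matrixP => i j; rewrite !mulmx_delta [LHS]mxE [RHS]mxE.
exact: chr_sym oO Ox Gs.
Qed.

Lemma dGamC b c d x : O x -> dmx d (Gam G c) x *m ec b = dmx d (Gam G b) x *m ec c.
Proof.
move=> Ox; apply/matrixP => i j; rewrite !mulmx_delta [LHS]mxE [RHS]mxE.
by apply: (pt_eq _ oO Ox) => y Oy; rewrite [LHS]mxE [RHS]mxE; exact: chr_sym oO Oy Gs.
Qed.

Lemma sRie c d : msm O (Rie c d).
Proof.
have s := sGam; apply: msmD => //; last by apply: msmN => //; apply: msmM.
apply: msmD => //; last exact: msmM.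
by apply: msmD => //; [exact: msm_dmx|apply: msmN => //; exact: msm_dmx].
Qed.

Local Opaque Gam dmx pt.

Lemma Rie_anti c d x : Rie d c x = - Rie c d x.
Proof. by rewrite /Rie; mxring. Qed.

(** Second derivatives of [G] commute, and metric compatibility expresses them through [Gam] and its
    derivatives. The same device yields every Ricci identity below. *)
Lemma Rie_skew c d x : O x -> G x *m Rie c d x + (Rie c d x)^T *m G x = 0.
Proof.
move=> Ox.
have E e f : dmx e (dmx f G) x =
   (G x *m Gam G e x + (Gam G e x)^T *m G x) *m Gam G f x + G x *m dmx e (Gam G f) x
   + ((dmx e (Gam G f) x)^T *m G x
      + (Gam G f x)^T *m (G x *m Gam G e x + (Gam G e x)^T *m G x)).
  rewrite (dmx_eq _ oO Ox (fun y Oy => dG f Oy)).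
  have s1 : msm O (fun y => G y *m Gam G f y) by apply: msmM => //; exact: sGam.
  have s2 : msm O (fun y => (Gam G f y)^T) by apply: msmT => //; exact: sGam.
  rewrite (dmxD _ s1 _ Ox); last exact: msmM.
  by rewrite (dmxM _ sG (sGam f) Ox) (dmxM _ s2 sG Ox) dmxT !dG.
apply: (mx_lincomb (dmx_comm c d oO sG Ox)); rewrite !E /Rie; mxring.
Qed.

Lemma Rie_cyclic b c d x : O x ->
  Rie c d x *m ec b + Rie d b x *m ec c + Rie b c x *m ec d = 0.
Proof.
move=> Ox; have := dGamC b d c Ox; have := dGamC c b d Ox; have := dGamC d c b Ox.
have := GamC b d Ox; have := GamC b c Ox; have := GamC c d Ox.
rewrite /Rie; Gamgen => H1 H2 H3 H4 H5 H6; mxexpand.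
by rewrite -!mulmxA H1 H2 H3 H4 H5 H6; mxring.
Qed.

Lemma Rie_contract (l : 'cV[R]_4) x : O x -> (forall c d, Rie c d x *m l = 0) ->
  forall d, \sum_c l c 0 *: Rie c d x = 0.
Proof.
move=> Ox; apply: (@contract_alg R (G x) (fun c d => Rie c d x) l (Gs Ox) (uG Ox)).
- by move=> c d; exact: Rie_anti.
- by move=> c d; exact: Rie_skew.
- by move=> b c d; exact: Rie_cyclic.
Qed.

Lemma Rie_parallel (l : 'rV[R]_4 -> 'cV[R]_4) : msm O l ->
  (forall c x, O x -> dmx c l x = - (Gam G c x *m l x)) ->
  forall c d x, O x -> Rie c d x *m l x = 0.
Proof.
move=> sl dl c d x Ox.
have E e f : dmx e (dmx f l) x = - (dmx e (Gam G f) x *m l x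
    - Gam G f x *m (Gam G e x *m l x)).
  rewrite (dmx_eq _ oO Ox (dl f)).
  have s1 : msm O (fun y => Gam G f y *m l y) by apply: msmM => //; exact: sGam.
  by rewrite (dmxN _ s1 Ox) (dmxM _ (sGam f) sl Ox) dl// mulmxN.
apply: (mx_lincomb (dmx_comm d c oO sl Ox)); rewrite !E /Rie; mxring.
Qed.

Variables (a : 'rV[R]_4 -> 'M[R]_4) (lam : 'rV[R]_4 -> 'cV[R]_4).
Hypothesis sa : msm O a.
Hypothesis slam : msm O lam.
Hypothesis da : forall c x, O x -> dmx c a x = - (Gam G c x *m a x) + a x *m Gam G c x
  + (ec c *m (lam x)^T *m G x + lam x *m (ec c)^T *m G x).

Let L c x := dmx c lam x + Gam G c x *m lam x.

(** Second derivatives of [a], computed from Sinyukov's equation, must commute. [Q] is the [lam]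
    part of the right side of that equation and [L] the covariant derivative of [lam]. *)
Lemma Ricci_a c d x : O x ->
  Rie c d x *m a x - a x *m Rie c d x =
  ec d *m (L c x)^T *m G x + L c x *m (ec d)^T *m G x
  - (ec c *m (L d x)^T *m G x + L d x *m (ec c)^T *m G x).
Proof.
move=> Ox.
pose Q f y := ec f *m (lam y)^T *m G y + lam y *m (ec f)^T *m G y.
have slT : msm O (fun y => (lam y)^T) by exact: msmT.
have sQ1 f : msm O (fun y => ec f *m (lam y)^T).
  by apply: msmM => //; exact: msm_cst.
have sQ2 f : msm O (fun y => lam y *m (ec f)^T).
  by apply: msmM => //; exact: msm_cst.
have sQ1G f : msm O (fun y => ec f *m (lam y)^T *m G y) by apply: msmM.
have sQ2G f : msm O (fun y => lam y *m (ec f)^T *m G y) by apply: msmM.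
have sQ f : msm O (Q f) by apply: msmD.
have dQ e f : dmx e (Q f) x =
   ec f *m ((L e x)^T - (lam x)^T *m (Gam G e x)^T) *m G x
   + ec f *m (lam x)^T *m (G x *m Gam G e x + (Gam G e x)^T *m G x)
   + ((L e x - Gam G e x *m lam x) *m (ec f)^T *m G x
      + lam x *m (ec f)^T *m (G x *m Gam G e x + (Gam G e x)^T *m G x)).
  have dl : dmx e lam x = L e x - Gam G e x *m lam x by rewrite /L addrK.
  rewrite (dmxD _ (sQ1G f) (sQ2G f) Ox) (dmxM _ (sQ1 f) sG Ox) (dmxM _ (sQ2 f) sG Ox).
  rewrite (dmxM _ (msm_cst O (ec f)) slT Ox) (dmxM _ slam (msm_cst O (ec f)^T) Ox).
  rewrite !dmx_cst dmxT dl !dG// mul0mx mulmx0 add0r addr0.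
  by rewrite [(_ - _)^T]linearB /= trmx_mul.
have E e f : dmx e (dmx f a) x =
   - (dmx e (Gam G f) x *m a x + Gam G f x *m (- (Gam G e x *m a x) + a x *m Gam G e x + Q e x))
   + ((- (Gam G e x *m a x) + a x *m Gam G e x + Q e x) *m Gam G f x
      + a x *m dmx e (Gam G f) x) + dmx e (Q f) x.
  rewrite (dmx_eq _ oO Ox (da f)).
  have s1 : msm O (fun y => Gam G f y *m a y) by apply: msmM => //; exact: sGam.
  have s2 : msm O (fun y => a y *m Gam G f y) by apply: msmM => //; exact: sGam.
  have s3 : msm O (fun y => - (Gam G f y *m a y) + a y *m Gam G f y).
    by apply: msmD => //; exact: msmN.
  rewrite (dmxD _ s3 (sQ f) Ox) (dmxD _ (msmN oO s1) s2 Ox) (dmxN _ s1 Ox).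
  by rewrite (dmxM _ (sGam f) sa Ox) (dmxM _ sa (sGam f) Ox) !da.
have := dmx_comm c d oO sa Ox; rewrite !E !dQ => H.
have GC := GamC c d Ox.
have GCT : (ec c)^T *m (Gam G d x)^T = (ec d)^T *m (Gam G c x)^T.
  by rewrite -!trmx_mul GC.
apply: (mx_lincomb (esym H)); move: GC GCT; rewrite /Rie /Q {H dQ E}.
move: (L c x) (L d x); Gamgen => Lc Ld GC GCT.
do 3 mxexpand.
rewrite -!(mulmxA (lam x) (ec _)^T (_^T)) GCT.
rewrite GC; mxring.
Qed.

Variable l : 'rV[R]_4 -> 'cV[R]_4.
Hypothesis sl : msm O l.
Hypothesis dl : forall c x, O x -> dmx c l x = - (Gam G c x *m l x).
Hypothesis l0 : forall x, O x -> l x != 0.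

Local Opaque Rie.

(** A fixed entry of [nabla lam], hence smooth at once; that it is the factor in
    [nabla lam = sigma id] is the content of [Dlam]. *)
Definition sigma x : R := (dmx 0 lam x + Gam G 0 x *m lam x) 0 0.

Lemma Rl c d x : O x -> Rie c d x *m l x = 0.
Proof. exact: Rie_parallel. Qed.

Lemma Dlam c x : O x -> dmx c lam x + Gam G c x *m lam x = sigma x *: ec c.
Proof.
move=> Ox; have Rc := Rie_contract Ox (fun c d => Rl c d Ox).
have [sg Hsg] := @Dlam_alg R (G x) (a x) (fun c d => Rie c d x) (l x) (L^~ x)
  (uG Ox) (l0 Ox) Rc (fun c d => Ricci_a c d Ox).
rewrite -[LHS]/(L c x) Hsg; congr (_ *: _).
by rewrite /sigma -/(L 0 x) Hsg [RHS]mxE [X in _ * X]mxE /= mulr1.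
Qed.

Lemma s_sigma : sm O sigma.
Proof.
have : msm O (fun x => dmx 0 lam x + Gam G 0 x *m lam x).
  by apply: msmD => //; [exact: msm_dmx|apply: msmM => //; exact: sGam].
by move=> /(_ 0 0).
Qed.

Lemma dlam c x : O x -> dmx c lam x = sigma x *: ec c - Gam G c x *m lam x.
Proof. by move=> Ox; rewrite -Dlam// addrK. Qed.

Local Transparent Rie.

Lemma Ricci_lam c d x : O x ->
  Rie c d x *m lam x = pt c sigma x *: ec d - pt d sigma x *: ec c.
Proof.
move=> Ox.
have E e f : dmx e (dmx f lam) x = pt e sigma x *: ec f -
   (dmx e (Gam G f) x *m lam x + Gam G f x *m (sigma x *: ec e - Gam G e x *m lam x)).
  rewrite (dmx_eq _ oO Ox (dlam f)).
  have s1 : msm O (fun y => sigma y *: ec f).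
    by apply: msmZ => //; [exact: s_sigma|exact: msm_cst].
  have s2 : msm O (fun y => Gam G f y *m lam y) by apply: msmM => //; exact: sGam.
  rewrite (dmxD _ s1 (msmN oO s2) Ox) (dmxN _ s2 Ox) (dmxZ _ s_sigma (msm_cst O (ec f)) Ox).
  by rewrite dmx_cst scaler0 addr0 (dmxM _ (sGam f) slam Ox) dlam.
have := dmx_comm c d oO slam Ox; rewrite !E => H.
apply: (mx_lincomb (esym H)); move: (GamC c d Ox); rewrite /Rie {H E}.
move: (sigma x); Gamgen => sg GC; do 3 mxexpand.
by rewrite GC; mxring.
Qed.

Local Opaque Rie.

Lemma dsigma c x : O x -> pt c sigma x = 0.
Proof.
move=> Ox; have Rc := Rie_contract Ox (fun c d => Rl c d Ox).
exact: (@dsigma_alg R (fun c d => Rie c d x) (l x) (lam x)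
  (fun c => pt c sigma x) (l0 Ox) Rc (fun c d => Ricci_lam c d Ox)).
Qed.

Lemma Rlam c d x : O x -> Rie c d x *m lam x = 0.
Proof. by move=> Ox; rewrite Ricci_lam// !dsigma// !scale0r subrr. Qed.

(** Once [nabla lam = sigma id], the right side of [Ricci_a] antisymmetrises in [c] and [d] an
    expression symmetric in them. *)
Lemma Ra c d x : O x -> a x *m Rie c d x = Rie c d x *m a x.
Proof.
move=> Ox; apply/esym/eqP; rewrite -subr_eq0; apply/eqP.
rewrite Ricci_a// /L !Dlam// !linearZ /=; mxring.
Qed.

End Curvature.

Lemma constant_on_ball (R : realType) n (x0 : 'rV[R]_n) (r : R) f :
  sm [set x | `|x - x0| < r] f ->
  (forall c x, `|x - x0| < r -> pt c f x = 0) ->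
  forall x, `|x - x0| < r -> f x = f x0.
Proof.
move=> sf df x xr.
have := @zero_derivative_eq R (fun t => f (x0 + t *: (x - x0))) 0 1.
rewrite scale0r addr0 scale1r [x0 + _]addrC subrK => H; symmetry; apply: H => t.
rewrite min_l// max_r// => /andP[t0 t1].
have inr : `|x0 + t *: (x - x0) - x0| < r.
  rewrite [x0 + _]addrC addrK normrZ ger0_norm//; apply: le_lt_trans xr.
  by rewrite ler_piMl.
have D (i : 'I_n) : is_derive t 1 (fun s : R => (x0 + s *: (x - x0)) 0 i) ((x - x0) 0 i).
  by have := iffLR (is_derive_line (fun y : 'rV[R]_n => y 0 i) x0 (x - x0) _ t)
    (coord_is_derive i _ _).
have := @chain_Ck R n 0 _ f (fun s => x0 + s *: (x - x0)) t _
  (@open_nbhd_ball R n x0 r) (sf 1%N) inr D.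
by rewrite big1// => i _; rewrite df// mul0r.
Qed.

Section KillingAlgebra.
Variable R : realType.
Notation ec i := (delta_mx i 0 : 'cV[R]_4).
Implicit Types (G A F X Ga : 'M[R]_4) (lam e : 'cV[R]_4).

(** Multiplying the derivative of [A F = k F] by [F] on the left cancels everything except
    [kc F^2]. *)
Lemma kap_const_alg G A F X Ga lam e (k kc : R) : A *m F = k *: F -> A *m F = F *m A ->
  lam^T *m G *m F = 0 -> F *m lam = 0 -> F *m F != 0 ->
  (- (Ga *m A) + A *m Ga + (e *m lam^T *m G + lam *m e^T *m G)) *m F + A *m X
    = kc *: F + k *: X -> kc = 0.
Proof.
move=> AF FA lF Fl FF E; have {FA} FA : F *m A = k *: F by rewrite -FA.
have : F *m (kc *: F + k *: X) = k *: (F *m X).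
  rewrite -E; do 3 mxexpand.
  have Z : F *m e *m lam^T *m G *m F = 0.
    by rewrite -!mulmxA (mulmxA lam^T) lF !mulmx0.
  rewrite -(mulmxA (F *m Ga)) AF !FA Z Fl.
  by mxring.
rewrite mulmxDr -!scalemxAr -[RHS]add0r => /addIr /eqP.
by rewrite scaler_eq0 (negbTE FF) orbF => /eqP.
Qed.

Lemma BP_alg G A F X Ga lam e (k : R) : A *m F = k *: F ->
  lam^T *m G *m F = 0 ->
  (- (Ga *m A) + A *m Ga + (e *m lam^T *m G + lam *m e^T *m G)) *m F + A *m X = k *: X ->
  (A - k%:M) *m (X + Ga *m F - F *m Ga) = - (lam *m e^T *m G *m F).
Proof.
move=> AF lF E; apply: (mx_lincomb E); rewrite mulmxBl mul_scalar_mx.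
do 3 mxexpand.
have Z : e *m lam^T *m G *m F = 0 by rewrite -!mulmxA (mulmxA lam^T) lF mulmx0.
rewrite -(mulmxA Ga) AF Z; mxring.
Qed.

Lemma lGP_alg G F X Ga (l : 'cV[R]_4) : l^T *m G *m F = 0 ->
  (- (Ga *m l))^T *m (G *m F) + l^T *m ((G *m Ga + Ga^T *m G) *m F + G *m X) = 0 ->
  l^T *m G *m (X + Ga *m F - F *m Ga) = 0.
Proof.
move=> lF E; apply: (mx_lincomb E); do 3 mxexpand.
by rewrite lF; mxring.
Qed.

Lemma Ql_alg G A Ga lam (l e : 'cV[R]_4) (k : R) : A *m l = k *: l ->
  (- (Ga *m A) + A *m Ga + (e *m lam^T *m G + lam *m e^T *m G)) *m l
    + A *m (- (Ga *m l)) = k *: (- (Ga *m l)) ->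
  e *m (lam^T *m G *m l) + lam *m (e^T *m G *m l) = 0.
Proof.
move=> Al E; apply: (mx_lincomb E); do 3 mxexpand.
by rewrite -(mulmxA Ga) Al; mxring.
Qed.

Lemma mx11 (A : 'M[R]_1) : A = (A 0 0)%:M.
Proof. exact: mx11_scalar. Qed.

End KillingAlgebra.

(** * The eigenvalue of [a] on the image of the curvature *)

Section Kappa.
Variables (R : realType) (O : set 'rV[R]_4) (G : 'rV[R]_4 -> 'M[R]_4).
Notation ec i := (delta_mx i 0 : 'cV[R]_4).
Hypothesis oO : open O.
Hypothesis sG : msm O G.
Hypothesis Gs : forall x, O x -> (G x)^T = G x.
Hypothesis uG : forall x, O x -> G x \in unitmx.
Variables (a : 'rV[R]_4 -> 'M[R]_4) (lam l : 'rV[R]_4 -> 'cV[R]_4).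
Hypothesis sa : msm O a.
Hypothesis slam : msm O lam.
Hypothesis da : forall c x, O x -> dmx c a x = - (Gam G c x *m a x) + a x *m Gam G c x
  + (ec c *m (lam x)^T *m G x + lam x *m (ec c)^T *m G x).
Hypothesis sl : msm O l.
Hypothesis dl : forall c x, O x -> dmx c l x = - (Gam G c x *m l x).
Variable T : 'rV[R]_4 -> 'M[R]_4.
Hypothesis TG : forall x, O x -> (T x)^T *m G x *m T x = eta R.
Hypothesis lT : forall x, O x -> l x = T x *m ec 0.
Hypothesis Ga : forall x, O x -> (G x *m a x)^T = G x *m a x.
Variables (c0 d0 i0 j0 : 'I_4).
Let F := Rie G c0 d0.
Hypothesis F0 : forall x, O x -> F x i0 j0 != 0.

Lemma l_neq0 x : O x -> l x != 0.
Proof. by move=> Ox; rewrite lT//; exact: frame_l_neq0 (TG Ox). Qed.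

(** A quotient of fixed entries, so that the eigenvalue is smooth before it is known to be constant.
    The same device defines the other proportionality factors below. *)
Definition kap x := (a x *m F x) i0 j0 / F x i0 j0.

Lemma Fx0 x : O x -> F x != 0.
Proof. by move=> Ox; apply/eqP => E; move: (F0 Ox); rewrite E mxE eqxx. Qed.

Lemma Fskew x : O x -> G x *m F x + (F x)^T *m G x = 0.
Proof. exact: Rie_skew. Qed.

Lemma Fl x : O x -> F x *m l x = 0.
Proof. by move=> Ox; exact: (Rie_parallel oO sG uG sl dl). Qed.

Lemma FlT x : O x -> F x *m (T x *m ec 0) = 0.
Proof. by move=> Ox; rewrite -lT//; exact: Fl. Qed.

Lemma aF x : O x -> a x *m F x = F x *m a x.
Proof. by move=> Ox; exact: (Ra oO sG Gs uG sa slam da sl dl l_neq0). Qed.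

Lemma Flam x : O x -> F x *m lam x = 0.
Proof. by move=> Ox; exact: (Rlam oO sG Gs uG sa slam da sl dl l_neq0). Qed.

Lemma wGF (w : 'cV[R]_4) x : O x -> F x *m w = 0 -> w^T *m G x *m F x = 0.
Proof.
move=> Ox Fw; have := Fskew Ox => /eqP; rewrite addr_eq0 => /eqP E.
by rewrite -mulmxA E mulmxN mulmxA -trmx_mul Fw trmx0 mul0mx oppr0.
Qed.

Lemma kapE x : O x -> a x *m F x = kap x *: F x.
Proof.
move=> Ox; have [k Hk] := frame_kappa (Gs Ox) (TG Ox) (Fskew Ox) (FlT Ox) (Ga Ox) (aF Ox) (Fx0 Ox).
by rewrite Hk; congr (_ *: _); rewrite /kap Hk mxE mulfK// F0.
Qed.

Lemma sF : msm O F.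
Proof. exact: sRie. Qed.

Lemma skap : sm O kap.
Proof.
apply: smM => //; last by apply: smV => //; exact: sF.
by apply: msmM => //; exact: sF.
Qed.

Let dkF c x : O x ->
  (- (Gam G c x *m a x) + a x *m Gam G c x
    + (ec c *m (lam x)^T *m G x + lam x *m (ec c)^T *m G x)) *m F x + a x *m dmx c F x
  = pt c kap x *: F x + kap x *: dmx c F x.
Proof.
move=> Ox; rewrite -(da c Ox) -(dmxM c sa sF Ox) -(dmxZ c skap sF Ox).
exact: (dmx_eq _ oO Ox kapE).
Qed.

Lemma dkap c x : O x -> pt c kap x = 0.
Proof.
move=> Ox; apply: (kap_const_alg (kapE Ox) (aF Ox) _ (Flam Ox) _ (dkF c Ox)).
  by apply: wGF => //; exact: Flam.
exact: (frame_sq_neq0 (Gs Ox) (TG Ox) (Fskew Ox) (FlT Ox) (Fx0 Ox)).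
Qed.

Let B x := a x - (kap x)%:M.

Lemma BF x : O x -> B x *m F x = 0.
Proof. by move=> Ox; rewrite mulmxBl kapE// mul_scalar_mx subrr. Qed.

(** The covariant derivative of [F] along [e_c]. *)
Let P c x := dmx c F x + Gam G c x *m F x - F x *m Gam G c x.

Lemma BP c x : O x -> B x *m P c x = - (lam x *m (ec c)^T *m G x *m F x).
Proof.
move=> Ox; apply: BP_alg; first exact: kapE.
  by apply: wGF => //; exact: Flam.
by rewrite dkF// dkap// scale0r add0r.
Qed.

Lemma lGP c x : O x -> (l x)^T *m G x *m P c x = 0.
Proof.
move=> Ox; apply: lGP_alg; first by apply: wGF => //; exact: Fl.
have slT : msm O (fun y => (l y)^T) by exact: msmT.
have sGF : msm O (fun y => G y *m F y) by apply: msmM => //; exact: sF.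
rewrite -(dG oO Gs uG c Ox) -(dl c Ox) -(dmxM c sG sF Ox) -dmxT -(dmxM c slT sGF Ox).
rewrite (dmx_eq (B := fun=> 0) c oO Ox) ?dmx_cst// => y Oy.
by rewrite mulmxA; apply: wGF => //; exact: Fl.
Qed.

(* If [l] were an eigenvector on an open set, differentiating [a l = kap l] would give
   [X (lam . l) + lam (X . l) = 0] for all [X]. *)
Lemma not_eigen O' x : open O' -> O' `<=` O -> O' x ->
  (forall y, O' y -> B y *m l y = 0) -> lam x = 0.
Proof.
move=> oO' sO O'x Bl; apply/eqP/negPn/negP => lam0.
have Ox := sO _ O'x.
have al y : O' y -> a y *m l y = kap y *: l y.
  by move=> O'y; have /eqP := Bl _ O'y; rewrite mulmxBl mul_scalar_mx subr_eq0 => /eqP.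
have Q c : ec c *m ((lam x)^T *m G x *m l x) + lam x *m ((ec c)^T *m G x *m l x) = 0.
  apply: (@Ql_alg R (G x) (a x) (Gam G c x) (lam x) (l x) (ec c) (kap x)).
    exact: al.
  have := dmx_eq c oO' O'x al.
  rewrite (dmxM c (msm_sub sO sa) (msm_sub sO sl) O'x).
  rewrite (dmxZ c (sm_sub sO skap) (msm_sub sO sl) O'x).
  by rewrite da// dl// dkap// scale0r add0r.
have H c : ((lam x)^T *m G x *m l x) 0 0 *: ec c =
    (- ((ec c)^T *m G x *m l x) 0 0) *: lam x.
  have Qc := Q c.
  rewrite (mx11 ((lam x)^T *m _ *m _)) (mx11 ((ec c)^T *m _ *m _)) !mul_mx_scalar in Qc.
  move/eqP: Qc; rewrite addr_eq0 => /eqP ->.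
  by rewrite scaleNr.
have [_ be] := indep_alg lam0 H.
have : G x *m l x = 0.
  apply/matrixP => i j; rewrite ord1 [RHS]mxE; have := be i => /eqP; rewrite oppr_eq0 => /eqP.
  rewrite -mulmxA mxE (bigD1 i)//= big1 ?addr0 => [|k ki]; last first.
    by rewrite [(ec i)^T _ _]mxE [ec i k 0]mxE (negbTE ki) mul0r.
  by rewrite [(ec i)^T _ _]mxE [ec i i 0]mxE !eqxx mul1r.
move=> /(congr1 (mulmx (invmx (G x)))); rewrite mulKmx ?uG// mulmx0 => E.
by move: (l_neq0 Ox); rewrite E eqxx.
Qed.

(** Differentiating [B F = 0] gives [B nabla_c F = - lam e_c^T G F], whose value on a suitable
    vector is a nonzero multiple of [lam]. The image of [nabla_c F] is orthogonal to [l], hence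
    spanned by [l], [x] and [y], where by the dichotomy [B] takes only multiples of [B l] as
    values. *)
Lemma Bl_lam x : O x -> lam x != 0 -> B x *m l x != 0 ->
  exists2 u : R, u != 0 & B x *m l x = u *: lam x.
Proof.
move=> Ox lam0 Bl0.
have [H|[[r2 [r3 H]] _]] := frame_dichotomy (Gs Ox) (TG Ox) (Fskew Ox) (FlT Ox) (Fx0 Ox).
  by move: Bl0; rewrite lT// H ?eqxx//; exact: BF.
have [BT2 BT3] := H _ (BF Ox); rewrite -lT// in BT2 BT3.
have GF0 : G x *m F x != 0.
  apply/eqP => /(congr1 (mulmx (invmx (G x)))); rewrite mulKmx ?uG// mulmx0 => E.
  by move: (Fx0 Ox); rewrite E eqxx.
have [c [b cb]] := neq0_entry GF0.
pose z := P c x *m ec b.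
have Bz : B x *m z = - (G x *m F x) c b *: lam x.
  rewrite /z mulmxA BP// mulNmx scaleNr; congr (- _).
  rewrite -!mulmxA (mulmxA (G x)) (mx11 ((ec c)^T *m _)) mul_mx_scalar; congr (_ *: _).
  rewrite mxE (bigD1 c)//= big1 ?addr0 => [|k kc]; last first.
    by rewrite [(ec c)^T _ _]mxE [ec c k 0]mxE (negbTE kc) mul0r.
  by rewrite [(ec c)^T _ _]mxE [ec c c 0]mxE !eqxx mul1r mulmx_delta.
pose y := invmx (T x) *m z.
have uT := frame_unit (TG Ox).
have zy : z = T x *m y by rewrite /y mulKVmx.
have y1 : y 1 0 = 0.
  have : (ec 1)^T *m y = 0.
    rewrite (frame_Gl_tr (Gs Ox) (TG Ox)) -lT// -mulmxA -zy /z mulmxA lGP// mul0mx //.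
  move=> /matrixP/(_ 0 0); rewrite [LHS]mxE [RHS]mxE sum4 ![(ec 1)^T _ _]mxE ![ec 1 _ _]mxE /=.
  by rewrite !mul0r mul1r !addr0 add0r.
have Bz2 : B x *m z = (y 0 0 + r2 * y 2 0 + r3 * y 3 0) *: (B x *m l x).
  rewrite zy -{1}(sum_ec y) sum4 y1 scale0r addr0 !mulmxDr -!scalemxAr -lT// BT2 BT3.
  by rewrite !scalerA -!scalerDl ![_ * y _ _]mulrC.
set w := _ + _ + _ in Bz2.
have w0 : w != 0.
  apply/eqP => w0; move: Bz2; rewrite w0 scale0r Bz => /eqP.
  by rewrite scaler_eq0 oppr_eq0 (negbTE cb) (negbTE lam0).
exists (- (G x *m F x) c b / w); first by rewrite mulf_neq0 ?oppr_eq0 ?invr_eq0.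
apply: (scalerI w0); rewrite -Bz2 Bz scalerA mulrCA mulfV// mulr1 //.
Qed.

End Kappa.

(** * The cone vector field *)

Section ConeAlgebra.
Variable R : realType.
Notation ec i := (delta_mx i 0 : 'cV[R]_4).
Implicit Types (G A Ga X : 'M[R]_4) (lam l s e w z : 'cV[R]_4).

Lemma row_col_scalar n (A : 'M[R]_(n, 1)) (B : 'M[R]_1) : A *m B = B 0 0 *: A.
Proof. by rewrite {1}(mx11 B) mul_mx_scalar. Qed.

Lemma ecT_entry c (w : 'cV[R]_4) : ((ec c)^T *m w) 0 0 = w c 0.
Proof.
rewrite mxE (bigD1 c)//= big1 ?addr0 => [|k kc]; last first.
  by rewrite [(ec c)^T _ _]mxE [ec c k 0]mxE (negbTE kc) mul0r.
by rewrite [(ec c)^T _ _]mxE [ec c c 0]mxE !eqxx mul1r.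
Qed.

Lemma du_alg G A Ga lam l (k u uc sg : R) c : A *m l = k *: l + u *: lam ->
  (- (Ga *m A) + A *m Ga + (ec c *m lam^T *m G + lam *m (ec c)^T *m G)) *m l
    + A *m (- (Ga *m l))
  = k *: (- (Ga *m l)) + (uc *: lam + u *: (sg *: ec c - Ga *m lam)) ->
  ((lam^T *m G *m l) 0 0 - sg * u) *: ec c = (uc - (G *m l) c 0) *: lam.
Proof.
move=> Al E.
have E2 : ec c *m (lam^T *m G *m l) + lam *m ((ec c)^T *m (G *m l)) =
    uc *: lam + (u * sg) *: ec c.
  apply: (mx_lincomb E); do 3 mxexpand.
  rewrite -(mulmxA Ga) Al -scalerA; do 2 mxexpand.
  by mxring.
rewrite row_col_scalar row_col_scalar ecT_entry in E2.
by apply: (mx_lincomb E2); rewrite !scalerBl [sg * u]mulrC; mxring.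
Qed.

End ConeAlgebra.

(* [s] is a homothetic vector field normalised by [s.l = u], and [u] is a potential of [l]. *)
Definition cone_data (R : realType) (O : set 'rV[R]_4) (G a : 'rV[R]_4 -> 'M[R]_4)
    (l s : 'rV[R]_4 -> 'cV[R]_4) (u : 'rV[R]_4 -> R) (kap c e1 e2 : R) :=
  [/\ sm O u /\ (forall x, O x -> u x != 0),
      (forall b x, O x -> pt b u x = (G x *m l x) b 0),
      msm O s /\ (forall b x, O x -> dmx b s x = delta_mx b 0 - Gam G b x *m s x),
      (forall x, O x -> ((s x)^T *m G x *m l x) 0 0 = u x)
    & forall x, O x -> a x = kap%:M + c *: (s x *m (s x)^T *m G x)
        + e1 *: (s x *m (l x)^T *m G x + l x *m (s x)^T *m G x)
        + e2 *: (l x *m (l x)^T *m G x)].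

(** * Solving for the Sinyukov tensor *)

Section ConeStructure.
Variables (R : realType) (x2 : 'rV[R]_4) (r : R) (G : 'rV[R]_4 -> 'M[R]_4).
Notation ec i := (delta_mx i 0 : 'cV[R]_4).
Let O := [set x : 'rV[R]_4 | `|x - x2| < r].
Let oO : open O := @open_nbhd_ball R 4 x2 r.
Hypothesis r0 : 0 < r.
Hypothesis sG : msm O G.
Hypothesis Gs : forall x, O x -> (G x)^T = G x.
Hypothesis uG : forall x, O x -> G x \in unitmx.
Variables (a : 'rV[R]_4 -> 'M[R]_4) (lam l : 'rV[R]_4 -> 'cV[R]_4).
Hypothesis sa : msm O a.
Hypothesis slam : msm O lam.
Hypothesis da : forall c x, O x -> dmx c a x = - (Gam G c x *m a x) + a x *m Gam G c x
  + (ec c *m (lam x)^T *m G x + lam x *m (ec c)^T *m G x).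
Hypothesis sl : msm O l.
Hypothesis dl : forall c x, O x -> dmx c l x = - (Gam G c x *m l x).
Variable T : 'rV[R]_4 -> 'M[R]_4.
Hypothesis TG : forall x, O x -> (T x)^T *m G x *m T x = eta R.
Hypothesis lT : forall x, O x -> l x = T x *m ec 0.
Hypothesis Ga : forall x, O x -> (G x *m a x)^T = G x *m a x.
Variables (c0 d0 i0 j0 i p q : 'I_4).
Let F := Rie G c0 d0.
Hypothesis F0 : forall x, O x -> F x i0 j0 != 0.
Hypothesis lam_i : forall x, O x -> lam x i 0 != 0.
Hypothesis l_p : forall x, O x -> l x p 0 != 0.
Hypothesis Gl_q : forall x, O x -> (G x *m l x) q 0 != 0.
Let k := kap G a c0 d0 i0 j0 x2.
Let B x := a x - k%:M.
Hypothesis Bl0 : forall x, O x -> B x *m l x != 0.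

Let Ox2 : O x2. Proof. by rewrite /O /= subrr normr0. Qed.

Let kapE' x : O x -> kap G a c0 d0 i0 j0 x = k.
Proof.
move=> Ox; apply: (constant_on_ball (x0 := x2) (r := r)) => //.
  exact: (skap oO sG uG sa F0).
move=> c y yr; exact: (dkap oO sG Gs uG sa slam da sl dl TG lT Ga F0 c yr).
Qed.

Let l00 x : O x -> l x != 0.
Proof. by move=> Ox; exact: (l_neq0 TG lT Ox). Qed.

Let lam0 x : O x -> lam x != 0.
Proof. by move=> Ox; apply/eqP => E; move: (lam_i Ox); rewrite E mxE eqxx. Qed.

Let BFx x : O x -> B x *m F x = 0.
Proof.
move=> Ox; have := BF oO sG Gs uG sa slam da sl dl TG lT Ga F0 Ox.
by rewrite kapE'.
Qed.

Let S := sigma G lam x2.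

Let sigE x : O x -> sigma G lam x = S.
Proof.
move=> Ox; apply: (constant_on_ball (x0 := x2) (r := r)) => //.
  exact: (s_sigma oO sG uG slam).
move=> c y yr; exact: (dsigma oO sG Gs uG sa slam da sl dl l00 c yr).
Qed.

Let dlamS c x : O x -> dmx c lam x = S *: ec c - Gam G c x *m lam x.
Proof. by move=> Ox; rewrite (dlam oO sG Gs uG sa slam da sl dl l00 c Ox) sigE. Qed.

Let u x := (B x *m l x) i 0 / lam x i 0.

Let BlE x : O x -> B x *m l x = u x *: lam x.
Proof.
move=> Ox.
have [|u' u'0] := @Bl_lam R O G oO sG Gs uG a lam l sa slam da sl dl T TG lT Ga c0 d0 i0 j0 F0 x Ox (lam0 Ox).
  by rewrite kapE'// Bl0.
rewrite kapE'// -/(B x) => E; rewrite E; congr (_ *: _).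
by rewrite /u E mxE mulfK// lam_i.
Qed.

Let u0 x : O x -> u x != 0.
Proof.
by move=> Ox; apply/eqP => E; move: (Bl0 Ox); rewrite BlE// E scale0r eqxx.
Qed.

Let sB : msm O B.
Proof. by apply: msmD => //; exact: (msm_cst _ (- k%:M)). Qed.

Let su : sm O u.
Proof.
apply: smM => //; last by apply: smV => //; exact: slam.
by apply: msmM.
Qed.

Let al x : O x -> a x *m l x = k *: l x + u x *: lam x.
Proof. by move=> Ox; rewrite -BlE// mulmxBl mul_scalar_mx addrC subrK. Qed.

(** Differentiating [a l = k l + u lam] along [e_c] equates a multiple of [e_c] with a multiple of
    [lam]. Both factors vanish: one determines [lam . l], the other shows that [u] is a potential of
    [l]. *)
Let du_lam x : O x -> ((lam x)^T *m G x *m l x) 0 0 = S * u x /\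
  forall c, pt c u x = (G x *m l x) c 0.
Proof.
move=> Ox.
have H c : (((lam x)^T *m G x *m l x) 0 0 - S * u x) *: ec c =
    (pt c u x - (G x *m l x) c 0) *: lam x.
  apply: (@du_alg R (G x) (a x) (Gam G c x) (lam x) (l x) k (u x) (pt c u x) S c (al Ox)).
  have s1 : msm O (fun y => k *: l y) by apply: msmZ => //; exact: sm_cst.
  have s2 : msm O (fun y => u y *: lam y) by apply: msmZ.
  have := dmx_eq c oO Ox al.
  rewrite (dmxM c sa sl Ox) (dmxD c s1 s2 Ox) (dmxZ c (sm_cst O k) sl Ox) (dmxZ c su slam Ox).
  have -> : pt c (fun=> k) x = 0.
    exact: (is_derive_pt (is_derive_cst k x (delta_mx 0 c))).
  by rewrite scale0r add0r da// dl// dlamS.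
have [/eqP e1 e2] := indep_alg (lam0 Ox) H.
split; first by move: e1; rewrite subr_eq0 => /eqP.
by move=> c; have /eqP := e2 c; rewrite subr_eq0 => /eqP.
Qed.

Let GB x : O x -> (G x *m B x)^T = G x *m B x.
Proof.
by move=> Ox; rewrite /B mulmxBr [(_ - _)^T]linearB /= Ga// mul_mx_scalar trZ Gs.
Qed.

(** The other case of the dichotomy would give [B l = 0]. *)
Let dich x : O x ->
  [/\ exists r2 r3 : R, forall B : 'M[R]_4, B *m F x = 0 ->
        B *m (T x *m ec 2) = r2 *: (B *m l x) /\ B *m (T x *m ec 3) = r3 *: (B *m l x)
    & forall w : 'cV[R]_4, F x *m w = 0 -> (l x)^T *m G x *m w = 0 ->
        exists t : R, w = t *: l x].
Proof.
move=> Ox; rewrite lT//.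
have [H|//] := frame_dichotomy (Gs Ox) (TG Ox) (Fskew oO sG Gs uG c0 d0 Ox)
  (FlT oO sG uG sl dl lT c0 d0 Ox) (Fx0 F0 Ox).
by move: (Bl0 Ox); rewrite lT// H ?eqxx// BFx.
Qed.

Let dB c x : O x -> dmx c B x = - (Gam G c x *m B x) + B x *m Gam G c x
  + (ec c *m (lam x)^T *m G x + lam x *m (ec c)^T *m G x).
Proof.
move=> Ox; rewrite (dmxD c sa (msm_cst O (- k%:M)) Ox) dmx_cst addr0 da// /B.
by rewrite mulmxBr mulmxBl mul_scalar_mx mul_mx_scalar; mxring.
Qed.

Let sllG : msm O (fun y => l y *m (l y)^T *m G y).
Proof. by apply: msmM => //; apply: msmM => //; exact: msmT. Qed.

Let dwwG (w z dw dz : 'rV[R]_4 -> 'cV[R]_4) c x : O x -> msm O w -> msm O z ->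
  dmx c w x = dw x - Gam G c x *m w x -> dmx c z x = dz x - Gam G c x *m z x ->
  dmx c (fun y => w y *m (z y)^T *m G y) x =
    - (Gam G c x *m (w x *m (z x)^T *m G x)) + w x *m (z x)^T *m G x *m Gam G c x
    + (dw x *m (z x)^T *m G x + w x *m (dz x)^T *m G x).
Proof.
move=> Ox sw sz Ew Ez.
have szT : msm O (fun y => (z y)^T) by exact: msmT.
have swz : msm O (fun y => w y *m (z y)^T) by exact: msmM.
rewrite (dmxM c swz sG Ox) (dmxM c sw szT Ox) dmxT Ew Ez (dG oO Gs uG c Ox).
move: (dw x) (dz x); Gamgen => *; mxring.
Qed.

Let llG_pq x : O x -> (l x *m (l x)^T *m G x) p q != 0.
Proof.
move=> Ox; have -> : (l x *m (l x)^T *m G x) p q = l x p 0 * (G x *m l x) q 0.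
  rewrite -mulmxA [LHS]mxE big_ord1; congr (_ * _).
  by rewrite -[in LHS](Gs Ox) -trmx_mul mxE.
by rewrite mulf_neq0 ?l_p ?Gl_q.
Qed.

(** For [S != 0] the field [lam / S] already has covariant derivative the identity. Subtracting
    [lam lam / S] from [B] leaves a symmetric [E] that kills [l] and the image of [F], hence is a
    multiple of [l l]; as [E] is parallel, the multiple is constant. *)
Let caseS : S != 0 -> exists s c e1 e2, cone_data O G a l s u k c e1 e2.
Proof.
move=> S0; pose s x := S^-1 *: lam x.
pose E x := B x - S^-1 *: (lam x *m (lam x)^T *m G x).
have EF x : O x -> E x *m F x = 0.
  move=> Ox; rewrite mulmxBl BFx// sub0r -scalemxAl.
  have Fl := Flam oO sG Gs uG sa slam da sl dl TG lT c0 d0 Ox.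
  by rewrite -!mulmxA (mulmxA _ (G x)) (wGF oO sG Gs uG Ox Fl) !mulmx0 scaler0 oppr0.
have El x : O x -> E x *m l x = 0.
  move=> Ox; rewrite mulmxBl BlE// -scalemxAl -!mulmxA (mulmxA _ (G x)) row_col_scalar.
  by rewrite (du_lam Ox).1 scalerA mulrA mulVf// mul1r subrr.
have slamT : msm O (fun y => (lam y)^T) by exact: msmT.
have sll : msm O (fun y => lam y *m (lam y)^T *m G y) by apply: msmM => //; exact: msmM.
have sE : msm O E.
  by apply: msmD => //; apply: msmN => //; apply: msmZ => //; exact: sm_cst.
have GE x : O x -> (G x *m E x)^T = G x *m E x.
  move=> Ox; rewrite /E mulmxBr [(_ - _)^T]linearB /= GB//; congr (_ - _).
  by rewrite -scalemxAr trZ; congr (_ *: _); rewrite !trmx_mul trmxK Gs// !mulmxA.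
have Erank x : O x -> exists e : R, E x = e *: (l x *m (l x)^T *m G x).
  move=> Ox; have [[r2 [r3 Hr]] _] := dich Ox.
  move: (Hr _ (EF x Ox)); rewrite El// !scaler0 => -[E2 E3].
  have := frame_rank1 (Gs Ox) (TG Ox) (GE x Ox); rewrite -lT//; apply => //; exact: El.
pose e x := E x p q / (l x *m (l x)^T *m G x) p q.
have Ee x : O x -> E x = e x *: (l x *m (l x)^T *m G x).
  move=> Ox; have [e' E'] := Erank x Ox; rewrite {1}E'; congr (_ *: _).
  by rewrite /e E' [in RHS]mxE mulfK// llG_pq.
have se : sm O e by exact: (smM oO (sE p q) (smV oO llG_pq (sllG p q))).
have de c x : O x -> pt c e x = 0.
  move=> Ox; have dE : dmx c E x = - (Gam G c x *m E x) + E x *m Gam G c x.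
    have s2 : msm O (fun y => S^-1 *: (lam y *m (lam y)^T *m G y)).
      by apply: msmZ => //; exact: sm_cst.
    rewrite (dmxD c sB (msmN oO s2) Ox) (dmxN c s2 Ox) (dmxZ c (sm_cst O S^-1) sll Ox).
    have -> : pt c (fun=> S^-1) x = 0.
      exact: (is_derive_pt (is_derive_cst S^-1 x (delta_mx 0 c))).
    rewrite scale0r add0r dB// (dwwG (dw := fun=> S *: ec c) (dz := fun=> S *: ec c) Ox slam slam) ?dlamS//.
    rewrite scalerDr.
    have -> : S^-1 *: (S *: ec c *m (lam x)^T *m G x + lam x *m (S *: ec c)^T *m G x) =
       ec c *m (lam x)^T *m G x + lam x *m (ec c)^T *m G x.
      rewrite trZ -!scalemxAl -!scalemxAr -!scalemxAl -scalerDr scalerA mulVf// scale1r //.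
    rewrite /E; move: (B x) (ec c *m (lam x)^T *m G x) (lam x *m (ec c)^T *m G x)
      (lam x *m (lam x)^T *m G x); Gamgen => *; mxring.
  have := dmx_eq c oO Ox Ee; rewrite dE (dmxZ c se sllG Ox) Ee//.
  rewrite (dwwG (dw := fun=> 0) (dz := fun=> 0) Ox sl sl) ?dl ?sub0r//.
  rewrite trmx0 mulmx0 !mul0mx addr0 => H.
  have : pt c e x *: (l x *m (l x)^T *m G x) = 0.
    apply: (mx_lincomb (esym H)); move: (l x *m (l x)^T *m G x); Gamgen => *; mxring.
  move=> /matrixP/(_ p q); rewrite [LHS]mxE [RHS]mxE => /eqP.
  by rewrite mulf_eq0 (negbTE (llG_pq Ox)) orbF => /eqP.
have ec x : O x -> e x = e x2.
  by move=> Ox; apply: (constant_on_ball (x0 := x2) (r := r)).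
exists s, S, 0, (e x2); split=> //.
- by move=> b x Ox; exact: (du_lam Ox).2.
- split; first by apply: msmZ => //; exact: sm_cst.
  move=> b x Ox; rewrite (dmxZ b (sm_cst O S^-1) slam Ox).
  have -> : pt b (fun=> S^-1) x = 0.
    exact: (is_derive_pt (is_derive_cst S^-1 x (delta_mx 0 b))).
  by rewrite scale0r add0r dlamS// scalerBr scalerA mulVf// scale1r /s scalemxAr.
- move=> x Ox; rewrite /s trZ -!scalemxAl mxE (du_lam Ox).1 mulrA mulVf// mul1r //.
- move=> x Ox; rewrite scale0r addr0 -(ec x Ox) -Ee// /s trZ -!scalemxAl -scalemxAr.
  rewrite [X in _ + X + _]scalerA mulfV// scale1r -scalemxAl /E /B.
  by move: (lam x *m _ *m _) (k%:M) => v1 v2; mxring.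
Qed.

(** For [S = 0] the field [lam] is orthogonal to [l] and killed by [F], hence a multiple [t l], with
    [t] constant. The field [s] is now hidden in [B = t (s l + l s)], and cancelling [l] from the
    derivative of this identity gives [nabla s = id]. *)
Let caseS0 : S = 0 -> exists s c e1 e2, cone_data O G a l s u k c e1 e2.
Proof.
move=> S0.
have lamt x : O x -> exists t : R, lam x = t *: l x.
  move=> Ox; have [_ H] := dich Ox; apply: H.
    exact: (Flam oO sG Gs uG sa slam da sl dl TG lT c0 d0 Ox).
  have := (du_lam Ox).1; rewrite S0 mul0r => E.
  have -> : (l x)^T *m G x *m lam x = ((lam x)^T *m G x *m l x)^T.
    by rewrite !trmx_mul trmxK Gs// mulmxA.
  by rewrite (mx11 (_ *m l x)) E raddf0 trmx0.
pose tau x := lam x p 0 / l x p 0.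
have tauE x : O x -> lam x = tau x *: l x.
  by move=> Ox; have [t E] := lamt x Ox; rewrite {1}E; congr (_ *: _);
    rewrite /tau E mxE mulfK// l_p.
have stau : sm O tau by exact: (smM oO (slam p 0) (smV oO l_p (sl p 0))).
have dtau c x : O x -> pt c tau x = 0.
  move=> Ox; have := dmx_eq c oO Ox tauE.
  rewrite dlamS// S0 scale0r sub0r (dmxZ c stau sl Ox) dl// tauE// -scalemxAr scalerN.
  rewrite -[LHS]add0r => /addIr /esym/eqP.
  by rewrite scaler_eq0 (negbTE (l00 Ox)) orbF => /eqP.
pose t := tau x2.
have tE x : O x -> lam x = t *: l x.
  by move=> Ox; rewrite {1}tauE//; congr (_ *: _); apply: (constant_on_ball (x0 := x2) (r := r)).
have t0 : t != 0.
  by apply/eqP => E; move: (lam0 Ox2); rewrite tE// E scale0r eqxx.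
(* [H] is [B] with both indices up, so [H = t (s l^T + l s^T)]: its entry [(p, p)] gives the
   component [p] of [s], and its row [p] the others. The explicit formula makes [s] smooth. *)
pose H x := B x *m invmx (G x).
have sH : msm O H by apply: msmM => //; exact: msm_inv.
pose sp x := H x p p / (2 * t * l x p 0).
pose s x : 'cV[R]_4 := \col_j ((H x j p / t - l x j 0 * sp x) / l x p 0).
have ssp : sm O sp.
  apply: (smM oO (sH p p)); apply: smV => //; last exact: (smM oO (sm_cst O _) (sl p 0)).
  by move=> x Ox; exact: (mulf_neq0 (mulf_neq0 (lt0r_neq0 (ltr0Sn _ 1)) t0) (l_p Ox)).
have ss : msm O s.
  move=> j j'; apply: (@sm_eq _ _ _ (fun x => (H x j p / t - l x j 0 * sp x) / l x p 0)) => //.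
    by move=> x _; rewrite [RHS]mxE.
  apply: (smM oO _ (smV oO l_p (sl p 0))).
  exact: (smB oO (smM oO (sH j p) (sm_cst O _)) (smM oO (sl j 0) ssp)).
have Bs x : O x -> B x = t *: (s x *m (l x)^T *m G x + l x *m (s x)^T *m G x).
  move=> Ox; have [[r2 [r3 Hr]] _] := dich Ox; have [B2 B3] := Hr _ (BFx Ox).
  have Blt : B x *m l x = (u x * t) *: l x by rewrite BlE// tE// scalerA.
  have := frame_null_pair (Gs Ox) (TG Ox) (GB Ox) t0; rewrite -lT// => NP.
  have [s' Es] := NP _ _ _ Blt B2 B3.
  suff -> : s x = s' by [].
  have Hs j j' : H x j j' = t * (s' j 0 * l x j' 0 + l x j 0 * s' j' 0).
    have -> : H x = t *: (s' *m (l x)^T + l x *m s'^T).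
      by rewrite /H Es -scalemxAl mulmxDl !mulmxK// uG.
    by rewrite !mxE !big_ord1 !mxE.
  apply/matrixP => j j'; rewrite ord1 [LHS]mxE /sp !Hs; field.
  by rewrite t0 l_p.
have ds b x : O x -> dmx b s x = ec b - Gam G b x *m s x.
  move=> Ox; pose X x := dmx b s x + Gam G b x *m s x.
  have sslG : msm O (fun y => s y *m (l y)^T *m G y) by apply: msmM => //; apply: msmM => //; exact: msmT.
  have slsG : msm O (fun y => l y *m (s y)^T *m G y) by apply: msmM => //; apply: msmM => //; exact: msmT.
  have := dmx_eq b oO Ox Bs; rewrite dB//.
  rewrite (dmxZ b (sm_cst O t) (msmD oO sslG slsG) Ox) (dmxD b sslG slsG Ox).
  have -> : pt b (fun=> t) x = 0.
    exact: (is_derive_pt (is_derive_cst t x (delta_mx 0 b))).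
  rewrite (dwwG (dw := X) (dz := fun=> 0) Ox ss sl) ?dl ?sub0r ?addrK//.
  rewrite (dwwG (dw := fun=> 0) (dz := X) Ox sl ss) ?dl ?sub0r ?addrK//.
  rewrite Bs// tE// trmx0 scale0r add0r => E.
  suff : X x - ec b = 0.
    by rewrite /X => /eqP; rewrite subr_eq0 => /eqP <-; rewrite addrK.
  apply: (sym_cancel (l00 Ox)).
  have : ((X x - ec b) *m (l x)^T + l x *m (X x - ec b)^T) *m G x = 0.
    apply: (scalerI t0); rewrite scaler0; apply: (mx_lincomb (esym E)).
    move: (X x) (l x) (s x) (ec b); Gamgen => *; mxring.
  by move=> /(congr1 (mulmx^~ (invmx (G x)))); rewrite mulmxK ?uG// mul0mx.
exists s, 0, t, 0; split=> //.
- by move=> b x Ox; exact: (du_lam Ox).2.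
- move=> x Ox; have := BlE Ox; rewrite Bs// tE// -scalemxAl mulmxDl -!mulmxA.
  rewrite !(mulmxA _ (G x)) !row_col_scalar.
  have -> : ((l x)^T *m G x *m l x) 0 0 = 0.
    have := frame_Gl (TG Ox); rewrite -lT// => GlE.
    rewrite -mulmxA lT// trmx_mul -mulmxA -[T x *m _]lT// GlE ecT_entry mxE //.
  rewrite scale0r add0r !scalerA => /(congr1 (fun M : 'cV[R]_4 => M p 0)).
  rewrite [LHS]mxE [RHS]mxE => /(mulIf (l_p Ox)); rewrite mulrC => /(mulIf t0).
  by [].
- move=> x Ox; rewrite !scale0r !addr0 -Bs// /B addrC subrK //.
Qed.

Lemma cone_structure : exists s c e1 e2, cone_data O G a l s u k c e1 e2.
Proof. by have [/caseS0|/caseS] := eqVneq S 0. Qed.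

End ConeStructure.

Section LocalStructure.
Variables (R : realType) (O : set 'rV[R]_4) (G : 'rV[R]_4 -> 'M[R]_4).
Notation ec i := (delta_mx i 0 : 'cV[R]_4).
Hypothesis oO : open O.
Hypothesis sG : msm O G.
Hypothesis Gs : forall x, O x -> (G x)^T = G x.
Hypothesis uG : forall x, O x -> G x \in unitmx.
Variables (a : 'rV[R]_4 -> 'M[R]_4) (lam l : 'rV[R]_4 -> 'cV[R]_4).
Hypothesis sa : msm O a.
Hypothesis slam : msm O lam.
Hypothesis da : forall c x, O x -> dmx c a x = - (Gam G c x *m a x) + a x *m Gam G c x
  + (ec c *m (lam x)^T *m G x + lam x *m (ec c)^T *m G x).
Hypothesis sl : msm O l.
Hypothesis dl : forall c x, O x -> dmx c l x = - (Gam G c x *m l x).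
Variable T : 'rV[R]_4 -> 'M[R]_4.
Hypothesis TG : forall x, O x -> (T x)^T *m G x *m T x = eta R.
Hypothesis lT : forall x, O x -> l x = T x *m ec 0.
Hypothesis Ga : forall x, O x -> (G x *m a x)^T = G x *m a x.

(** Nonvanishing of [lam] and [F] persists near [x1], and by [not_eigen] some point [x2] there also
    has [(a - kap) l != 0]. The ball around [x2] keeps one component of each field away from zero,
    for use as a denominator. *)
Lemma local_structure x1 c0 d0 : O x1 -> lam x1 != 0 -> Rie G c0 d0 x1 != 0 ->
  exists (x2 : 'rV[R]_4) (r : R), [/\ 0 < r, [set x | `|x - x2| < r] `<=` O &
    exists s u k c e1 e2, cone_data [set x | `|x - x2| < r] G a l s u k c e1 e2].
Proof.
move=> Ox1 lam0 F0; set F := Rie G c0 d0 in F0.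
have [i0 [j0 Fij]] := neq0_entry F0.
have [i [i' lami]] := neq0_entry lam0; rewrite ord1 in lami.
have sF : msm O F by exact: sRie.
have [d1 d10 H1] := Ck_neq0_near oO (sF i0 j0 0%N) Ox1 Fij.
have [d2 d20 H2] := Ck_neq0_near oO (slam i 0 0%N) Ox1 lami.
have [d3 d30 H3] := open_ball_sub oO Ox1.
pose r1 := Num.min d1 (Num.min d2 d3).
have r10 : 0 < r1 by rewrite !lt_min d10 d20 d30.
pose O1 := [set x : 'rV[R]_4 | `|x - x1| < r1].
have O1P x : O1 x -> [/\ F x i0 j0 != 0, lam x i 0 != 0 & O x].
  rewrite /O1 /= !lt_min => /andP[h1 /andP[h2 h3]].
  by split; [exact: H1|exact: H2|exact: H3].
have oO1 : open O1 := @open_nbhd_ball R 4 x1 r1.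
have O1x : O1 x1 by rewrite /O1 /= subrr normr0.
have sO1 : O1 `<=` O by move=> x /O1P[].
pose kp := kap G a c0 d0 i0 j0.
have [x2 O1x2 Bl2] : exists2 x2, O1 x2 & (a x2 - (kp x2)%:M) *m l x2 != 0.
  apply: contrapT => H; move: lam0; apply/negP; rewrite negbK; apply/eqP.
  have F1 x : O1 x -> Rie G c0 d0 x i0 j0 != 0 by case/O1P.
  have B1 y : O1 y -> (a y - (kap G a c0 d0 i0 j0 y)%:M) *m l y = 0.
    by move=> O1y; apply/eqP/negPn/negP => N; apply: H; exists y.
  exact: (@not_eigen R O1 G oO1 (msm_sub sO1 sG) (fun x Ox => Gs (sO1 x Ox))
    (fun x Ox => uG (sO1 x Ox)) a lam l (msm_sub sO1 sa) (msm_sub sO1 slam)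
    (fun c x Ox => da c (sO1 x Ox)) (msm_sub sO1 sl) (fun c x Ox => dl c (sO1 x Ox)) T
    (fun x Ox => TG (sO1 x Ox)) (fun x Ox => lT (sO1 x Ox)) (fun x Ox => Ga (sO1 x Ox))
    c0 d0 i0 j0 F1 O1 x1 oO1 (fun x Ox => Ox) O1x B1).
have Ox2 := sO1 _ O1x2.
have [j [j' Blj]] := neq0_entry Bl2; rewrite ord1 in Blj.
have l2 : l x2 != 0 := l_neq0 TG lT Ox2.
have [p [p' lp]] := neq0_entry l2; rewrite ord1 in lp.
have Gl2 : G x2 *m l x2 != 0.
  apply/eqP => /(congr1 (mulmx (invmx (G x2)))); rewrite mulKmx ?uG// mulmx0 => E.
  by move: l2; rewrite E eqxx.
have [q [q' Glq]] := neq0_entry Gl2; rewrite ord1 in Glq.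
have sB : msm O (fun x => (a x - (kp x2)%:M) *m l x).
  by apply: msmM => //; apply: msmD => //; exact: (msm_cst _ (- _)).
have [e1 e10 K1] := Ck_neq0_near oO (sB j 0 0%N) Ox2 Blj.
have [e2 e20 K2] := Ck_neq0_near oO (sl p 0 0%N) Ox2 lp.
have [e3 e30 K3] := Ck_neq0_near oO (msmM oO sG sl q 0 0%N) Ox2 Glq.
have [e4 e40 K4] := open_ball_sub oO1 O1x2.
pose r := Num.min (Num.min e1 e2) (Num.min e3 e4).
have r0 : 0 < r by rewrite !lt_min e10 e20 e30 e40.
pose O2 := [set x : 'rV[R]_4 | `|x - x2| < r].
have O2P x : O2 x -> [/\ ((a x - (kp x2)%:M) *m l x) j 0 != 0, l x p 0 != 0,
   (G x *m l x) q 0 != 0 & O1 x].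
  rewrite /O2 /= !lt_min => /andP[/andP[h1 h2] /andP[h3 h4]].
  by split; [exact: K1|exact: K2|exact: K3|exact: K4].
have sO2 : O2 `<=` O by move=> x /O2P[_ _ _ /sO1].
exists x2, r; split=> //.
have [] := @cone_structure R x2 r G r0 (msm_sub sO2 sG) (fun x Ox => Gs (sO2 x Ox))
    (fun x Ox => uG (sO2 x Ox)) a lam l (msm_sub sO2 sa) (msm_sub sO2 slam)
    (fun c x Ox => da c (sO2 x Ox)) (msm_sub sO2 sl) (fun c x Ox => dl c (sO2 x Ox)) T
    (fun x Ox => TG (sO2 x Ox)) (fun x Ox => lT (sO2 x Ox)) (fun x Ox => Ga (sO2 x Ox))
    c0 d0 i0 j0 i p q.
- by move=> x /O2P[_ _ _ /O1P[]].
- by move=> x /O2P[_ _ _ /O1P[]].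
- by move=> x /O2P[].
- by move=> x /O2P[].
- by move=> x /O2P[H _ _ _]; apply/eqP => E; move: H; rewrite E mxE eqxx.
by move=> s [c [f1 [f2 H]]]; do 6 eexists; exact: H.
Qed.

End LocalStructure.

(** * Charts *)

Lemma lorentzian_unit (R : realType) (G : 'M[R]_4) : lorentzian G -> G \in unitmx.
Proof.
move=> [P uP E]; have : P^T *m G *m P \in unitmx.
  rewrite E unitmxE det_diag unitfE; apply/prodf_neq0 => i _; rewrite mxE.
  by case: ifP; rewrite ?oppr_eq0 oner_eq0.
by rewrite !unitmx_mul => /andP[/andP[]].
Qed.

Section CurveCalculus.
Variable R : realType.

Definition mder m n (t : R) (X : R -> 'M[R]_(m, n)) (dX : 'M[R]_(m, n)) :=
  forall i j, is_derive t 1 (fun s => X s i j) (dX i j).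

(** The connection matrix in the direction [w]: transport along a curve with velocity [w] reads
    [X' = - Gw w X]. *)
Definition Gw (G : 'rV[R]_4 -> 'M[R]_4) x (w : 'cV[R]_4) := \sum_c w c 0 *: Gam G c x.

Lemma mder_eq m n t (X Y : R -> 'M[R]_(m, n)) dX dY : mder t X dX -> X =1 Y -> dX = dY ->
  mder t Y dY.
Proof. by move=> H E <- i j; have := H i j; have -> : X = Y by apply/funext. Qed.

Lemma mderM m n p t (X : R -> 'M[R]_(m, n)) (Y : R -> 'M[R]_(n, p)) dX dY :
  mder t X dX -> mder t Y dY ->
  mder t (fun s => X s *m Y s) (dX *m Y t + X t *m dY).
Proof.
move=> HX HY i j.
have -> : (fun s => (X s *m Y s) i j) = (fun s => \sum_k X s i k * Y s k j).
  by apply/funext => s; rewrite mxE.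
rewrite addmxE [_ i j]mxE [X in _ + X]mxE -big_split /=.
apply: is_derive_bigsum => k.
apply: (is_derive_eq (is_deriveM (HX i k) (HY k j))).
by rewrite /GRing.scale /= addrC [Y t k j * _]mulrC.
Qed.

Lemma mder_comp N m n (O : set 'rV[R]_N) (K : 'rV[R]_N -> 'M[R]_(m, n)) (xc : R -> 'rV[R]_N)
    (t : R) (xd : 'cV[R]_N) : open O -> msm O K -> O (xc t) ->
  (forall i, is_derive t 1 (fun s => xc s 0 i) (xd i 0)) ->
  mder t (fun s => K (xc s)) (\sum_c xd c 0 *: dmx c K (xc t)).
Proof.
move=> oO sK Ox Hx i j; rewrite summxE.
apply: (is_derive_eq (chain_Ck oO (sK i j 1%N) Ox Hx)).
by apply: eq_bigr => c _; rewrite scalemxE [dmx _ _ _ _ _]mxE mulrC.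
Qed.

End CurveCalculus.

Section ChartCalculus.
Variables (R : realType) (M : topologicalType) (A : smooth_structure R M).
Implicit Types (phi chi psi : chart R M) (p q : M) (x : 'rV[R]_4).

Definition cod phi := chart_map phi @` chart_dom phi.
Definition ov phi chi := chart_map phi @` (chart_dom phi `&` chart_dom chi).
Definition tr phi chi x := chart_map chi (chart_inv phi x).

Lemma codP phi x : cod phi x <->
  chart_dom phi (chart_inv phi x) /\ chart_map phi (chart_inv phi x) = x.
Proof.
split=> [[p dp <-]|[d e]]; first by rewrite chart_mapK.
by exists (chart_inv phi x).
Qed.

Lemma ovP phi chi x : ov phi chi x <-> cod phi x /\ chart_dom chi (chart_inv phi x).
Proof.
split=> [[p [dp cp] <-]|[/codP[d e] c]].
  by split; [exists p|rewrite chart_mapK].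
by exists (chart_inv phi x).
Qed.

Lemma cod_open phi : open (cod phi). Proof. exact: chart_cod_open. Qed.

Lemma cod_map phi p : chart_dom phi p -> cod phi (chart_map phi p).
Proof. by move=> d; exists p. Qed.

Lemma preimage_open phi (U : set M) : open U ->
  open [set x | cod phi x /\ U (chart_inv phi x)].
Proof.
move=> oU; rewrite openE => x [cx Ux]; rewrite /interior.
have h1 : nbhs x (cod phi) by apply: open_nbhs_nbhs; split=> //; exact: cod_open.
have h2 : nbhs x (chart_inv phi @^-1` U).
  by apply: (chart_inv_cont cx); apply: open_nbhs_nbhs.
by apply: filterS (filterI h1 h2) => y [].
Qed.

Lemma image_open phi (O : set 'rV[R]_4) : open O ->
  open [set p | chart_dom phi p /\ O (chart_map phi p)].
Proof.
move=> oO; rewrite openE => p [dp Op]; rewrite /interior.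
have h1 : nbhs p (chart_dom phi).
  by apply: open_nbhs_nbhs; split=> //; exact: chart_dom_open.
have h2 : nbhs p (chart_map phi @^-1` O).
  by apply: (chart_map_cont dp); apply: open_nbhs_nbhs.
by apply: filterS (filterI h1 h2) => y [].
Qed.

Lemma ov_open phi chi : open (ov phi chi).
Proof.
have -> : ov phi chi = [set x | cod phi x /\ chart_dom chi (chart_inv phi x)].
  by apply/seteqP; split=> x /ovP.
by apply: preimage_open; exact: chart_dom_open.
Qed.

Lemma ov_cod phi chi : ov phi chi `<=` cod phi.
Proof. by move=> x /ovP[]. Qed.

Lemma ov_map phi chi p : chart_dom phi p -> chart_dom chi p -> ov phi chi (chart_map phi p).
Proof. by move=> d e; exists p. Qed.

Lemma tr_ov phi chi x : ov phi chi x -> ov chi phi (tr phi chi x).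
Proof. by case=> p [d e] <-; rewrite /tr chart_mapK//; exists p. Qed.

Lemma tr_map phi chi p : chart_dom phi p -> tr phi chi (chart_map phi p) = chart_map chi p.
Proof. by move=> d; rewrite /tr chart_mapK. Qed.

Lemma tr_sm phi chi a : A phi -> A chi -> sm (ov phi chi) (fun x => tr phi chi x 0 a).
Proof.
move=> Ap Ac; have [H _] := charts_compatible Ap Ac.
exact/Ck_smooth_on/(H a).
Qed.

Lemma jacobianE phi chi p : jacobian phi chi p = jac (tr phi chi) (chart_map phi p).
Proof. by []. Qed.

Lemma pdE phi c f p : pd phi c f p = pt c (f \o chart_inv phi) (chart_map phi p).
Proof. by []. Qed.

Lemma pd_chain phi chi (f : M -> R) (U : set M) p c : A phi -> A chi ->
  chart_dom phi p -> chart_dom chi p -> open U -> U p ->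
  sm [set y | cod chi y /\ U (chart_inv chi y)] (f \o chart_inv chi) ->
  pd phi c f p = \sum_d pd chi d f p * jacobian phi chi p d c.
Proof.
move=> Ap Ac dp cp oU Up sf.
have oW : open [set y | cod chi y /\ U (chart_inv chi y)] by exact: preimage_open.
have E y : ov phi chi y -> (f \o chart_inv phi) y = (f \o chart_inv chi) (tr phi chi y).
  by case=> q [d e] <-; rewrite /= /tr !chart_mapK.
rewrite [LHS]pdE (pt_eq c (@ov_open phi chi) (ov_map dp cp) E).
have -> : \sum_d pd chi d f p * jacobian phi chi p d c = \sum_d
    pt d (f \o chart_inv chi) (tr phi chi (chart_map phi p)) * jacobian phi chi p d c.
  by apply: eq_bigr => d _; rewrite tr_map.
apply: is_derive_pt.
have H := chain_map oW (sf 1%N)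
  (h := tr phi chi) (x := chart_map phi p) (v := delta_mx 0 c)
  (dh := fun d => jacobian phi chi p d c).
apply: H.
  by rewrite tr_map//; split; [exact: cod_map|rewrite /= chart_mapK].
move=> j; rewrite jacobianE mxE.
exact: (sm_der c (tr_sm j Ap Ac) (ov_map dp cp)).
Qed.

Lemma jacobian_chain phi chi psi p : A phi -> A chi -> A psi ->
  chart_dom phi p -> chart_dom chi p -> chart_dom psi p ->
  jacobian phi psi p = jacobian chi psi p *m jacobian phi chi p.
Proof.
move=> Ap Ac As dp cp sp; apply/matrixP => a b; rewrite [LHS]mxE [RHS]mxE.
rewrite (@pd_chain phi chi _ (chart_dom psi) p b Ap Ac dp cp) //.
- by apply: eq_bigr => d _; rewrite [jacobian chi psi p a d]mxE.
- exact: chart_dom_open.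
by apply: (@sm_sub _ _ (ov chi psi)) => [y /ovP|]; [|exact: tr_sm].
Qed.

Lemma jacobian_id phi p : chart_dom phi p -> jacobian phi phi p = 1%:M.
Proof.
move=> dp; apply/matrixP => a b; rewrite mxE pdE.
have E y : cod phi y -> ((fun q => chart_map phi q 0 a) \o chart_inv phi) y = y 0 a.
  by move=> /codP[_ /= ->].
rewrite (pt_eq b (@cod_open phi) (cod_map dp) E).
by rewrite (is_derive_pt (coord_is_derive a _ _)) !mxE.
Qed.

Lemma jacobian_inv phi chi p : A phi -> A chi -> chart_dom phi p -> chart_dom chi p ->
  jacobian chi phi p *m jacobian phi chi p = 1%:M.
Proof. by move=> Ap Ac dp cp; rewrite -jacobian_chain// jacobian_id. Qed.

Lemma jacobian_unit phi chi p : A phi -> A chi -> chart_dom phi p -> chart_dom chi p ->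
  jacobian phi chi p \in unitmx.
Proof. by move=> Ap Ac dp cp; have [] := mulmx1_unit (jacobian_inv Ap Ac dp cp). Qed.

Lemma jac_tr_unit phi chi x : A phi -> A chi -> ov phi chi x -> jac (tr phi chi) x \in unitmx.
Proof. by move=> Ap Ac [p [d e] <-]; exact: jacobian_unit. Qed.

Section Metric.
Variable g : lorentz_metric A.

Definition gx phi x := g phi (chart_inv phi x).

Lemma gx_map phi p : chart_dom phi p -> gx phi (chart_map phi p) = g phi p.
Proof. by move=> d; rewrite /gx chart_mapK. Qed.

Lemma gx_sm phi : A phi -> msm (cod phi) (gx phi).
Proof. by move=> Ap a b; exact/Ck_smooth_on/metric_smooth. Qed.

Lemma gx_sym phi : A phi -> forall x, cod phi x -> (gx phi x)^T = gx phi x.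
Proof. by move=> Ap x /codP[d _]; exact: metric_sym. Qed.

Lemma g_unit phi p : A phi -> chart_dom phi p -> g phi p \in unitmx.
Proof. by move=> Ap d; apply: lorentzian_unit; exact: (metric_lorentz g). Qed.

Lemma gx_unit phi : A phi -> forall x, cod phi x -> gx phi x \in unitmx.
Proof. by move=> Ap x /codP[d _]; exact: g_unit. Qed.

Lemma christoffelE phi p a b c : chart_dom phi p ->
  christoffel g phi p a b c = Gam (gx phi) b (chart_map phi p) a c.
Proof.
by move=> d; rewrite [RHS]mxE /christoffel /chr gx_map.
Qed.

Lemma christoffel_inv phi x a b c : cod phi x ->
  christoffel g phi (chart_inv phi x) a b c = Gam (gx phi) b x a c.
Proof. by move=> /codP[d e]; rewrite christoffelE// e. Qed.

Lemma riemannE phi p a b c d : chart_dom phi p ->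
  riemann g phi p a b c d = Rie (gx phi) c d (chart_map phi p) a b.
Proof.
move=> dp; rewrite /riemann /Rie.
have E i j : pd phi i (fun q => christoffel g phi q a j b) p =
    dmx i (Gam (gx phi) j) (chart_map phi p) a b.
  rewrite [RHS]mxE pdE.
  apply: (pt_eq i (@cod_open phi) (cod_map dp)) => y cy /=.
  exact: christoffel_inv.
have S i j : \sum_e christoffel g phi p a i e * christoffel g phi p e j b =
    (Gam (gx phi) i (chart_map phi p) *m Gam (gx phi) j (chart_map phi p)) a b.
  by rewrite [RHS]mxE; apply: eq_bigr => e _; rewrite !christoffelE.
by rewrite !E !S !(addmxE, oppmxE).
Qed.

Lemma gx_tensor phi chi x : A phi -> A chi -> ov phi chi x ->
  gx phi x = (jac (tr phi chi) x)^T *m gx chi (tr phi chi x) *m jac (tr phi chi) x.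
Proof.
move=> Ap Ac [p [d e] <-]; rewrite -jacobianE tr_map// !gx_map//.
exact: metric_tensor.
Qed.

Lemma Gam_transform phi chi c x : A phi -> A chi -> ov phi chi x ->
  jac (tr phi chi) x *m Gam (gx phi) c x = dmx c (jac (tr phi chi)) x
    + (\sum_d jac (tr phi chi) x d c *: Gam (gx chi) d (tr phi chi x)) *m jac (tr phi chi) x.
Proof.
move=> Ap Ac ox.
apply: (@christoffel_transform R (ov phi chi) (cod chi)) => //.
- exact: ov_open.
- exact: cod_open.
- by move=> a; exact: tr_sm.
- by move=> y /tr_ov/ov_cod.
- exact: gx_sm.
- exact: gx_sym.
- exact: gx_unit.
- by move=> y; exact: jac_tr_unit.
by move=> y; exact: gx_tensor.
Qed.

Lemma velocity_derive phi chi (xc : R -> 'rV[R]_4) (t : R) (xd : 'cV[R]_4) a :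
  A phi -> A chi -> ov phi chi (xc t) ->
  (forall i, is_derive t 1 (fun s => xc s 0 i) (xd i 0)) ->
  is_derive t 1 (fun s => tr phi chi (xc s) 0 a) ((jac (tr phi chi) (xc t) *m xd) a 0).
Proof.
move=> Ap Ac ox Hx.
have -> : (jac (tr phi chi) (xc t) *m xd) a 0 =
    \sum_i pt i (fun x => tr phi chi x 0 a) (xc t) * xd i 0.
  by rewrite mxE; apply: eq_bigr => i _; rewrite mxE.
exact: (chain_Ck (@ov_open phi chi) (tr_sm a Ap Ac 1%N) ox Hx).
Qed.

(** The inhomogeneous term in the transformation law of [Gam] cancels the derivative of the
    Jacobian, so the transport equation keeps its form in every chart. Velocities of geodesics and
    transported vectors are both covered. *)
Lemma transport_derive phi chi n (xc : R -> 'rV[R]_4) (t : R) (xd : 'cV[R]_4)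
    (z : R -> 'M[R]_(4, n)) : A phi -> A chi -> ov phi chi (xc t) ->
  (forall i, is_derive t 1 (fun s => xc s 0 i) (xd i 0)) ->
  mder t z (- (Gw (gx phi) (xc t) xd *m z t)) ->
  mder t (fun s => jac (tr phi chi) (xc s) *m z s)
    (- (Gw (gx chi) (tr phi chi (xc t)) (jac (tr phi chi) (xc t) *m xd)
        *m (jac (tr phi chi) (xc t) *m z t))).
Proof.
move=> Ap Ac ox Hx Hz.
have oO := @ov_open phi chi.
have sJ : msm (ov phi chi) (jac (tr phi chi)).
  by apply: msm_jac => // a; exact: tr_sm.
have HJ := mder_comp oO sJ ox Hx.
have := mderM HJ Hz.
set J := jac _ _; set L := (X in mder _ _ X); suff -> : L = - (Gw (gx chi)
  (tr phi chi (xc t)) (J *m xd) *m (J *m z t)) by [].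
suff E : \sum_c xd c 0 *: dmx c (jac (tr phi chi)) (xc t) - J *m Gw (gx phi) (xc t) xd =
    - (Gw (gx chi) (tr phi chi (xc t)) (J *m xd) *m J).
  by rewrite /L mulmxN [J *m (_ *m _)]mulmxA -mulmxBl E mulNmx -mulmxA.
rewrite /Gw mulmx_sumr -sumrB mulmx_suml.
under eq_bigr => c _ do rewrite -scalemxAr -scalerBr (Gam_transform c Ap Ac ox)
  opprD addrA subrr sub0r -/J scalerN.
rewrite sumrN; congr (- _).
transitivity (\sum_c \sum_d (xd c 0 * J d c) *: (Gam (gx chi) d (tr phi chi (xc t)) *m J)).
  apply: eq_bigr => c _; rewrite mulmx_suml scaler_sumr; apply: eq_bigr => d _.
  by rewrite -scalemxAl scalerA.
rewrite exchange_big /=; apply: eq_bigr => d _; rewrite -scalemxAl -scaler_suml; congr (_ *: _).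
by rewrite mxE; apply: eq_bigr => c _; rewrite mulrC.
Qed.

End Metric.
End ChartCalculus.

(** * Geodesics *)

Section OdeSmooth.
Variables (R : realType) (N : nat) (O : set 'rV[R]_N) (F : 'rV[R]_N -> 'rV[R]_N).
Variables (I : set R) (y : R -> 'rV[R]_N).
Hypothesis oO : open O.
Hypothesis sF : forall i, sm O (fun x => F x 0 i).
Hypothesis oI : open I.
Hypothesis yO : forall t, I t -> O (y t).
Hypothesis dy : forall (t : R) i, I t -> is_derive t 1 (fun s => y s 0 i) (F (y t) 0 i).

Lemma ode_curve_cont t : I t -> {for t, continuous y}.
Proof.
move=> It; apply: (row_continuous (U := R^o)) => j.
exact: (is_derive_cont (dy j It)).
Qed.

Lemma ode_curve_open (U : set 'rV[R]_N) : open U -> open [set t | I t /\ U (y t)].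
Proof.
move=> oU; rewrite openE => t [It Ut]; rewrite /interior.
have h1 : nbhs t I by apply: open_nbhs_nbhs.
have h2 : nbhs t (y @^-1` U) by apply: (ode_curve_cont It); apply: open_nbhs_nbhs.
by apply: filterS (filterI h1 h2) => s [].
Qed.

(** Every time derivative of [h] along a solution is again a smooth function of the state, namely
    the derivative of the previous one along the field [F]. *)
Lemma ode_smooth1 (U : set 'rV[R]_N) h : open U -> U `<=` O -> sm U h ->
  smooth1_on [set t | I t /\ U (y t)] (fun t => h (y t)).
Proof.
move=> oU UO sh.
have H n : exists2 hn, sm U hn & forall t, I t /\ U (y t) ->
    derive1n n (fun t => h (y t)) t = hn (y t).
  elim: n => [|n [hn shn E]]; first by exists h.
  exists (fun x => \sum_i pt i hn x * F x 0 i).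
    by apply: sm_sum => // i; apply: smM => //; [exact: sm_pt|exact: sm_sub (sF i)].
  move=> t [It Ut]; rewrite derive1nS derive1E.
  have D : is_derive (t : R) 1 (fun s => hn (y s)) (\sum_i pt i hn (y t) * F (y t) 0 i).
    exact: (chain_Ck oU (shn 1%N) Ut (fun i => dy i It)).
  rewrite -(@derive_val _ _ _ _ _ _ _ D); apply: near_eq_derive.
  have := ode_curve_open oU; rewrite openE => /(_ t (conj It Ut)); rewrite /interior.
  by apply: filterS => s /E.
move=> n t [It Ut]; have [hn shn E] := H n.
have D : is_derive (t : R) 1 (fun s => hn (y s)) (\sum_i pt i hn (y t) * F (y t) 0 i).
  exact: (chain_Ck oU (shn 1%N) Ut (fun i => dy i It)).
have D2 : is_derive (t : R) 1 (derive1n n (fun t => h (y t))) (\sum_i pt i hn (y t) * F (y t) 0 i).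
  apply: near_eq_is_derive D.
  have := ode_curve_open oU; rewrite openE => /(_ t (conj It Ut)); rewrite /interior.
  by apply: filterS => s /E ->.
exact: (@ex_derive _ _ _ _ _ _ _ D2).
Qed.

Variables (M : topologicalType) (A : smooth_structure R M) (phi : chart R M).
Hypothesis Aphi : A phi.
Variable pr : 'rV[R]_N -> 'rV[R]_4.
Hypothesis spr : forall i, sm O (fun x => pr x 0 i).
Hypothesis prO : forall x, O x -> cod phi (pr x).

Lemma ode_smooth_curve : smooth_curve A I (fun t => chart_inv phi (pr (y t))).
Proof.
split=> [t It|chi a Achi].
  apply: (@continuous_for_comp R^o 'rV[R]_4 M (fun t => pr (y t))); last first.
    by apply: chart_inv_cont; exact/prO/yO.
  apply: (row_continuous (U := R^o)) => j.
  apply: (@continuous_for_comp R^o 'rV[R]_N R^o y (fun x => pr x 0 j)).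
    exact: ode_curve_cont.
  exact: (Ck_cont (spr j 0%N) (yO It)).
pose U := [set x | O x /\ ov phi chi (pr x)].
have oU : open U.
  rewrite openE => x [Ox Vx]; rewrite /interior.
  have h1 : nbhs x O by apply: open_nbhs_nbhs.
  have h2 : nbhs x (pr @^-1` ov phi chi).
    have cpr : {for x, continuous pr}.
      by apply: row_continuous => j; exact: (Ck_cont (spr j 0%N) Ox).
    by apply: cpr; apply: open_nbhs_nbhs; split=> //; exact: ov_open.
  by apply: filterS (filterI h1 h2) => z [].
have sh : sm U (fun x => tr phi chi (pr x) 0 a).
  move=> k; apply: (Ck_comp oU (@ov_open _ _ phi chi) _ _ (tr_sm a Aphi Achi k)).
    by move=> j; apply: Ck_sub (spr j k) => x [].
  by move=> x [].
have -> : I `&` (fun t => chart_inv phi (pr (y t))) @^-1` chart_dom chi =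
    [set t | I t /\ U (y t)].
  apply/seteqP; split=> t [It] /=.
    by move=> d; split=> //; split; [exact: yO|apply/ovP; split=> //; exact/prO/yO].
  by move=> [_ /ovP[]].
by apply: (ode_smooth1 oU _ sh) => x [].
Qed.

End OdeSmooth.

Section Geodesics.
Variables (R : realType) (M : topologicalType) (A : smooth_structure R M).
Variable g : lorentz_metric A.
Implicit Types (phi chi : chart R M) (p : M).

(** The time interval on which [local_flow] provides solutions. *)
Definition I2 : set R := [set t | `|t| < 2].

Lemma I2_open : open I2.
Proof.
apply: open_of_balls => t /= t2; exists (2 - `|t|); first by rewrite subr_gt0.
move=> s st; rewrite /I2 /= in t2 *; have := ler_normD (s - t) t; rewrite subrK.
by move=> h; apply: (le_lt_trans h); rewrite -ltrBrDr.
Qed.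

Lemma I2_interval : open_interval I2.
Proof.
split; first exact: I2_open.
move=> a b; rewrite /I2 /= !ltr_norml => /andP[a1 _] /andP[_ b2] z /andP[az zb].
by rewrite ltr_norml; apply/andP; split; [exact: lt_le_trans az|exact: le_lt_trans b2].
Qed.

Lemma Gw_entry G x (w z : 'cV[R]_4) a :
  (Gw G x w *m z) a 0 = \sum_b \sum_c Gam G b x a c * w b 0 * z c 0.
Proof.
rewrite /Gw mulmx_suml summxE; apply: eq_bigr => b _.
rewrite -scalemxAl scalemxE mxE mulr_sumr; apply: eq_bigr => c _.
by rewrite mulrA; congr (_ * _); rewrite mulrC.
Qed.

(** [geodesic] asks for the equation in every chart; [transport_derive] carries it over from [phi],
    the velocity being transported along its own curve. *)
Lemma geodesic_chart phi (xc : R -> 'rV[R]_4) (xd : R -> 'cV[R]_4) : A phi ->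
  smooth_curve A I2 (fun t => chart_inv phi (xc t)) ->
  (forall t, `|t| < 2 -> cod phi (xc t)) ->
  (forall (t : R) i, `|t| < 2 -> is_derive t 1 (fun s => xc s 0 i) (xd t i 0)) ->
  (forall (t : R), `|t| < 2 -> mder t xd (- (Gw (gx g phi) (xc t) (xd t) *m xd t))) ->
  geodesic g I2 (fun t => chart_inv phi (xc t)).
Proof.
move=> Ap sc cx Hx Hd; split=> // chi t a Ac It dchi.
have ox s : I2 s -> chart_dom chi (chart_inv phi (xc s)) -> ov phi chi (xc s).
  by move=> Is d; apply/ovP; split=> //; exact: cx.
have V s : I2 s -> chart_dom chi (chart_inv phi (xc s)) -> forall b,
    is_derive (s : R) 1 (fun s => chart_map chi (chart_inv phi (xc s)) 0 b)
      ((jac (tr phi chi) (xc s) *m xd s) b 0).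
  by move=> Is d b; apply: (velocity_derive b Ap Ac (ox s Is d)) => i; exact: Hx.
have Vt b : velocity chi (fun t => chart_inv phi (xc t)) t b =
    (jac (tr phi chi) (xc t) *m xd t) b 0.
  by rewrite /velocity derive1E (@derive_val _ _ _ _ _ _ _ (V t It dchi b)).
have T := transport_derive Ap Ac (ox t It dchi) (fun i => Hx t i It) (Hd t It).
have D2 : derive1n 2 (fun s => chart_map chi (chart_inv phi (xc s)) 0 a) t =
    (- (Gw (gx g chi) (tr phi chi (xc t)) (jac (tr phi chi) (xc t) *m xd t)
        *m (jac (tr phi chi) (xc t) *m xd t))) a 0.
  rewrite derive1nS derive1E -(@derive_val _ _ _ _ _ _ _ (T a 0)).
  apply: near_eq_derive.
  have h1 : nbhs t I2 by apply: open_nbhs_nbhs; split=> //; exact: I2_open.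
  have h2 : nbhs t ((fun s => chart_inv phi (xc s)) @^-1` chart_dom chi).
    by apply: (sc.1 t It); apply: open_nbhs_nbhs; split=> //; exact: chart_dom_open.
  apply: filterS (filterI h1 h2) => s [Is ds].
  by rewrite /derive1n /= derive1E (@derive_val _ _ _ _ _ _ _ (V s Is ds a)).
rewrite D2 oppmxE Gw_entry addrC; apply/eqP; rewrite subr_eq0; apply/eqP.
by apply: eq_bigr => b _; apply: eq_bigr => c _; rewrite !Vt christoffelE.
Qed.

(** The initial velocity is [eps *: v]: slowing the motion by [eps] makes the geodesic live up to
    time 2. The geodesic equation is quadratic in the velocity, so [eps] can be divided out
    later. *)
Lemma geodesic_exists phi p (v : 'cV[R]_4) : A phi -> chart_dom phi p ->
  exists (eps : R) (xc : R -> 'rV[R]_4) (xd : R -> 'cV[R]_4), [/\ 0 < eps,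
    xc 0 = chart_map phi p /\ xd 0 = eps *: v,
    (forall (t : R) i, `|t| < 2 -> is_derive t 1 (fun s => xc s 0 i) (xd t i 0)),
    (forall (t : R), `|t| < 2 -> cod phi (xc t) /\
      mder t xd (- (Gw (gx g phi) (xc t) (xd t) *m xd t)))
  & geodesic g I2 (fun t => chart_inv phi (xc t))].
Proof.
move=> Ap dp.
pose O := [set z : 'rV[R]_(4 + 4) | cod phi (lsubmx z)].
pose F (z : 'rV[R]_(4 + 4)) : 'rV[R]_(4 + 4) :=
  row_mx (rsubmx z) (- (Gw (gx g phi) (lsubmx z) (rsubmx z)^T *m (rsubmx z)^T))^T.
have oO : open O by apply: open_lsubmx; exact: cod_open.
have sr j : sm O (fun z => rsubmx z 0 j).
  by apply: (@sm_eq _ _ _ (fun z : 'rV[R]_(4 + 4) => z 0 (rshift 4 j))) => //;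
    [move=> x _; rewrite mxE|move=> k; exact: Ck_coord].
have sF i : sm O (fun z => F z 0 i).
  case: (split_ordP i) => j ->.
    by apply: sm_eq (sr j) => // x _; rewrite /F row_mxEl.
  apply: (@sm_eq _ _ _ (fun z => - \sum_b \sum_c
      Gam (gx g phi) b (lsubmx z) j c * rsubmx z 0 b * rsubmx z 0 c)) => //.
    move=> x _; rewrite /F row_mxEr [RHS]mxE oppmxE Gw_entry; congr (- _).
    by apply: eq_bigr => b _; apply: eq_bigr => c _; rewrite ![_^T _ _]mxE.
  apply: smN => //; apply: sm_sum => // b; apply: sm_sum => // c.
  have sGm : sm O (fun x => Gam (gx g phi) b (lsubmx x) j c).
    move=> k; 
    exact: (@Ck_lsubmx R 4 4 k _ _ (@cod_open _ _ phi)
      (msm_Gam b (@cod_open _ _ phi) (gx_unit g Ap) (gx_sm g Ap) j c k)).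
  exact: (smM oO (smM oO sGm (sr b)) (sr c)).
pose z0 : 'rV[R]_(4 + 4) := row_mx (chart_map phi p) v^T.
have Oz0 : O z0 by rewrite /O /= row_mxKl; exact: cod_map.
have [eps [r [Phi [eps0 r0 HPhi Phi0 _]]]] := local_flow oO Oz0 sF.
have z0r : `|z0 - z0| < r by rewrite subrr normr0.
pose y t := Phi t z0.
have sFe i : sm O (fun z => (eps *: F z) 0 i).
  by apply: (sm_eq oO _ (smM oO (sm_cst O eps) (sF i))) => x _; rewrite scalemxE.
have dy (t : R) i : I2 t -> is_derive t 1 (fun s => y s 0 i) ((eps *: F (y t)) 0 i).
  by move=> It; rewrite scalemxE; exact: (HPhi z0 t z0r It).2.
have yO t : I2 t -> O (y t) by move=> It; exact: (HPhi z0 t z0r It).1.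
pose xc t : 'rV[R]_4 := lsubmx (y t).
pose xd t : 'cV[R]_4 := eps *: (rsubmx (y t))^T.
have y0 : y 0 = z0 by exact: Phi0.
have Hx (t : R) i : `|t| < 2 -> is_derive t 1 (fun s => xc s 0 i) (xd t i 0).
  move=> It; have := dy t (lshift 4 i) It; rewrite scalemxE /F row_mxEl.
  have -> : xd t i 0 = eps * rsubmx (y t) 0 i by rewrite /xd scalemxE [_^T _ _]mxE.
  have -> : (fun s => y s 0 (lshift 4 i)) = (fun s => xc s 0 i).
    by apply/funext => s; rewrite mxE.
  by [].
have Hd (t : R) : `|t| < 2 -> mder t xd (- (Gw (gx g phi) (xc t) (xd t) *m xd t)).
  move=> It i j; rewrite ord1.
  have -> : (fun s => xd s i 0) = (fun s => eps * y s 0 (rshift 4 i)).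
    by apply/funext => s; rewrite /xd scalemxE !mxE.
  apply: (is_derive_eq (is_deriveZ eps (dy t (rshift 4 i) It))).
  rewrite scalemxE /F row_mxEr [_^T _ _]mxE !oppmxE mulrN /GRing.scale /= mulrN.
  congr (- _); rewrite !Gw_entry mulr_sumr mulr_sumr; apply: eq_bigr => b _.
  rewrite !mulr_sumr; apply: eq_bigr => c _; rewrite /xd !scalemxE; ring.
exists eps, xc, xd; split=> //.
- by rewrite /xc /xd y0 row_mxKl row_mxKr trmxK.
- by move=> t It; split; [exact: yO|exact: Hd].
apply: geodesic_chart => //.
apply: (@ode_smooth_curve R _ O (fun z => eps *: F z) I2 y oO sFe I2_open yO dy M A phi Ap lsubmx).
  by move=> i; apply: (@sm_eq _ _ _ (fun z : 'rV[R]_(4 + 4) => z 0 (lshift 4 i))) => //;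
    [move=> x _; rewrite mxE|move=> k; exact: Ck_coord].
by [].
Qed.

End Geodesics.

(** * The difference of two connections with the same geodesics *)

Section ProjectiveAlgebra.
Variable R : realType.

Lemma sum_two (b c : 'I_4) (t : R) (F : 'I_4 -> R) :
  \sum_i F i * ((i == b)%:R + t * (i == c)%:R) = F b + t * F c.
Proof.
have S j : \sum_i F i * (i == j)%:R = F j.
  rewrite (bigD1 j)//= eqxx mulr1 big1 ?addr0// => i /negbTE ->.
  by rewrite mulr0.
under eq_bigr do rewrite mulrDr mulrCA.
by rewrite big_split /= -mulr_sumr !S.
Qed.

(** The quadratic map of [D] sends every vector to a multiple of itself. Testing it on [e_b + t e_c]
    with [t = 0, 1, -1] kills the entries whose upper index differs from both lower ones and ties
    [D b b b] to [2 * D c b c]. *)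
Lemma projective_alg (D : 'I_4 -> 'I_4 -> 'I_4 -> R) :
  (forall a b c, D a b c = D a c b) ->
  (forall v : 'I_4 -> R, exists mu : R, forall a,
     \sum_b \sum_c D a b c * v b * v c = mu * v a) ->
  exists psi : 'I_4 -> R, forall a b c,
    D a b c = (a == b)%:R * psi c + (a == c)%:R * psi b.
Proof.
move=> Ds H.
have Q b c t : exists mu : R, forall a,
    D a b b + 2 * t * D a b c + t ^+ 2 * D a c c = mu * ((a == b)%:R + t * (a == c)%:R).
  have [mu Hm] := H (fun i => (i == b)%:R + t * (i == c)%:R).
  exists mu => a; rewrite -Hm.
  under eq_bigr => i _ do rewrite sum_two.
  transitivity (\sum_i (D a i b + t * D a i c) * ((i == b)%:R + t * (i == c)%:R)).
    by rewrite sum_two (Ds a c b); ring.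
  by apply: eq_bigr => i _; rewrite mulrDl mulrA.
have D0 a b : a != b -> D a b b = 0.
  move=> ab; have [mu /(_ a)] := Q b b 0; rewrite (negbTE ab) => E.
  by move: E; rewrite mulr0 !mul0r expr0n /= mul0r !addr0 mulr0.
have D1 a b c : a != b -> a != c -> D a b c = 0.
  move=> ab ac; have [mu /(_ a)] := Q b c 1; rewrite (negbTE ab) (negbTE ac) !D0//.
  rewrite /= mulr0n !mulr0 !addr0 mulr0; lra.
have D2 b c : b != c -> D b b b = 2 * D c b c.
  move=> bc; have cb : c != b by rewrite eq_sym.
  have [m Hm] := Q b c 1; have [m' Hm'] := Q b c (-1).
  have := Hm b; have := Hm c; have := Hm' b; have := Hm' c.
  rewrite !eqxx (negbTE bc) (negbTE cb) !(D0 _ _ bc) !(D0 _ _ cb).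
  move: (D b b b) (D b b c) (D c b c) (D c c c) => d1 d2 d3 d4; lra.
exists (fun b => D b b b / 2) => a b c.
have [<-|ab] := eqVneq a b; have [<-|ac] := eqVneq a c.
- by rewrite !mul1r; field.
- by rewrite mul1r mul0r addr0 (D2 c a) 1?eq_sym// (Ds a c a); field.
- by rewrite mul1r mul0r add0r (D2 b a) 1?eq_sym//; field.
by rewrite !mul0r addr0 D1.
Qed.

Lemma Gw_scale (G : 'rV[R]_4 -> 'M[R]_4) x (k : R) (w : 'cV[R]_4) :
  Gw G x (k *: w) *m (k *: w) = k ^+ 2 *: (Gw G x w *m w).
Proof.
have -> : Gw G x (k *: w) = k *: Gw G x w.
  by rewrite /Gw scaler_sumr; apply: eq_bigr => c _; rewrite scalemxE scalerA.
by rewrite -scalemxAl -scalemxAr scalerA.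
Qed.

Lemma deviation_alg (e k1 k2 w q q' : R) : e != 0 -> k1 != 0 ->
  - (e ^+ 2 * q) * k1 ^+ 2 + e * w * k2 + (k1 * e) ^+ 2 * q' = 0 ->
  q' - q = - k2 / (e * k1 ^+ 2) * w.
Proof.
move=> e0 k0 E; apply: (@mulfI _ ((k1 * e) ^+ 2)); first by rewrite expf_neq0// mulf_neq0.
have -> : (k1 * e) ^+ 2 * (- k2 / (e * k1 ^+ 2) * w) = - (e * w * k2) by field; rewrite e0 k0.
by rewrite -[RHS]addr0 -E; ring.
Qed.

End ProjectiveAlgebra.

Section Jacobi.
Variable R : realType.

(** Jacobi's formula: differentiating row [k] alone gives the determinant of [Ak k], whose expansion
    along that row is a diagonal entry of [dA *m \adj (A x)]. *)
Lemma derive_det (N : nat) (x v : 'rV[R]_N) (A : 'rV[R]_N -> 'M[R]_4) (dA : 'M[R]_4) :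
  (forall i j, is_derive x v (fun y => A y i j) (dA i j)) ->
  is_derive x v (fun y => \det (A y)) (\tr (dA *m \adj (A x))).
Proof.
move=> H.
pose Ak k : 'M[R]_4 := \matrix_(i, j) (if i == k then dA i j else A x i j).
have T : \tr (dA *m \adj (A x)) = \sum_k \det (Ak k).
  rewrite /mxtrace; apply: eq_bigr => k _; rewrite (expand_det_row _ k) mxE.
  apply: eq_bigr => j _; rewrite [Ak k k j]mxE eqxx [\adj _ _ _]mxE; congr (_ * _).
  rewrite /cofactor; congr (_ * \det _); apply/matrixP => a b; rewrite !mxE.
  by rewrite eq_sym (negbTE (neq_lift _ _)).
rewrite {}T /determinant exchange_big /=.
apply: is_derive_bigsum => s'.
move: ((-1) ^+ perm.odd_perm s' : R) (perm.fun_of_perm.body s') => sg s.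
have P4 (f : 'I_4 -> R) : \prod_i f i = f 0 * (f 1 * (f 2 * f 3)).
  by rewrite !big_ord_recl big_ord0 mulr1 /=; congr (f _ * (f _ * (f _ * f _))); apply/val_inj.
have -> : (fun y => sg * \prod_i A y i (s i)) = (fun y =>
    sg * (A y 0 (s 0) * (A y 1 (s 1) * (A y 2 (s 2) * A y 3 (s 3))))).
  by apply/funext => y; rewrite P4.
have D := is_deriveZ sg (is_deriveM (H 0 (s 0)) (is_deriveM (H 1 (s 1))
  (is_deriveM (H 2 (s 2)) (H 3 (s 3))))).
apply: (is_derive_eq D).
have fm (f f' : 'rV[R]_N -> R) y : (f * f') y = f y * f' y by [].
rewrite sum4 !P4 ![Ak _ _ _]mxE /= !fm /GRing.scale /=.
by ring.
Qed.

End Jacobi.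

Section Exponential.
Variables (R : realType) (N : nat) (O : set 'rV[R]_N).
Hypothesis oO : open O.

Lemma derive_comp1 (f : 'rV[R]_N -> R) (h : R -> R) x v (l k : R) :
  is_derive x v f l -> is_derive (f x : R) 1 h k -> is_derive x v (fun y => h (f y)) (k * l).
Proof.
move=> /(iffLR (is_derive_dir f x v l)) Hf Hh.
apply: (iffRL (is_derive_dir (fun y => h (f y)) x v (k * l))).
apply: (is_derive1_comp (f := h) (g := fun s : R => f (x + s *: v))) => //.
by rewrite scale0r addr0.
Qed.

(** Bootstrapping: the equation expresses the derivatives of [f] through [f], so each order of
    regularity yields the next. Smoothness of the weight [Ef] is obtained in this way. *)
Lemma sm_linear_ode (f : 'rV[R]_N -> R) (w : 'I_N -> 'rV[R]_N -> R) :
  (forall x, O x -> {for x, continuous f}) -> (forall c, sm O (w c)) ->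
  (forall c x, O x -> is_derive x (delta_mx 0 c) f (w c x * f x)) -> sm O f.
Proof.
move=> cf sw df; elim=> [|k IH]; first by split.
split=> // c; split=> [x Ox|]; first exact: (@ex_derive _ _ _ _ _ _ _ (df c x Ox)).
apply: (@Ck_eq _ _ _ _ (fun x => w c x * f x)) => //.
  by move=> x Ox; rewrite (is_derive_pt (df c x Ox)).
by apply: CkM => //; exact: sw.
Qed.

End Exponential.

Section Projective.
Variables (R : realType) (M : topologicalType) (A : smooth_structure R M).
Variables g g' : lorentz_metric A.
Implicit Types (phi chi : chart R M) (p : M).
Notation ec i := (delta_mx i 0 : 'cV[R]_4).

Lemma smooth1_id : smooth1_on (@I2 R) id.
Proof.
have E1 : derive1n 1 (id : R -> R) = cst 1 by apply/funext => t; rewrite /derive1n /= derive1_id.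
have E n : derive1n n.+2 (id : R -> R) = cst 0.
  elim: n => [|n IH]; last by rewrite derive1nS IH; apply/funext => t; rewrite derive1_cst.
  by apply/funext => t; rewrite derive1nS E1 derive1_cst.
move=> [|[|n]] t _; first exact: derivable_id.
  by rewrite E1; exact: derivable_cst.
by rewrite E; exact: derivable_cst.
Qed.

(** A geodesic of [g] in the direction [v] becomes a geodesic of [g'] after a change of parameter.
    This changes the acceleration only by a multiple of the velocity, so comparing the two equations
    at [p] leaves a multiple of [v]. *)
Lemma geodesic_deviation phi p (v : 'cV[R]_4) : projectively_related g g' ->
  A phi -> chart_dom phi p -> exists mu : R,
  Gw (gx g' phi) (chart_map phi p) v *m v - Gw (gx g phi) (chart_map phi p) v *m v = mu *: v.
Proof.
move=> pr Ap dp.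
have [eps [xc [xd [eps0 [x0 xd0] Hx Hd geo]]]] := geodesic_exists g v Ap dp.
have : unparametrised_geodesic g (@I2 R) (fun t => chart_inv phi (xc t)).
  exists (@I2 R), id; split=> //; first exact: I2_interval.
  - exact: smooth1_id.
  - by rewrite image_id.
  by move=> t _; rewrite derive1_id oner_eq0.
move=> /(pr _ _ (I2_interval R)) [J [sg [oJ ssg sJ sg0 [_ geo']]]].
(* The new parameter value at which the curve passes through [p]; it exists because [sg] maps [J]
   onto the whole interval. *)
have [tau Jt st] : (sg @` J) 0 by rewrite sJ /I2 /= normr0.
have sI s : J s -> `|sg s| < 2.
  by move=> Js; have : (sg @` J) (sg s) by [exists s]; rewrite sJ.
have Dsg s : J s -> is_derive (s : R) 1 sg (sg^`()%classic s).
  by move=> Js; rewrite derive1E; apply: DeriveDef => //; exact: (ssg 0%N s Js).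
have Dsg2 : is_derive (tau : R) 1 (sg^`()%classic) (derive1 (sg^`()%classic) tau).
  by rewrite derive1E; apply: DeriveDef => //; exact: (ssg 1%N tau Jt).
set s1 := sg^`()%classic tau; set s2 := derive1 (sg^`()%classic) tau in Dsg2.
have s10 : s1 != 0 by exact: sg0.
have nJ : nbhs tau J by apply: open_nbhs_nbhs; split=> //; exact: oJ.1.
have V s a : J s -> is_derive (s : R) 1
    (fun s => chart_map phi (chart_inv phi (xc (sg s))) 0 a) (xd (sg s) a 0 * sg^`()%classic s).
  move=> Js.
  have D : is_derive (s : R) 1 (fun s => xc (sg s) 0 a) (xd (sg s) a 0 * sg^`()%classic s).
    exact: (is_derive1_comp (f := fun t => xc t 0 a) (Hx (sg s) a (sI s Js)) (Dsg s Js)).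
  apply: near_eq_is_derive D.
  have : nbhs s J by apply: open_nbhs_nbhs; split=> //; exact: oJ.1.
  by apply: filterS => r /sI/Hd[/codP[_ ->]].
have Vt a : velocity phi ((fun t => chart_inv phi (xc t)) \o sg) tau a = (s1 *: xd 0) a 0.
  by rewrite /velocity derive1E (@derive_val _ _ _ _ _ _ _ (V tau a Jt)) st scalemxE mulrC.
have x0p : chart_inv phi (xc 0) = p by rewrite x0 chart_mapK.
have D2 a : derive1n 2 (fun s => chart_map phi (chart_inv phi (xc (sg s))) 0 a) tau =
    - (Gw (gx g phi) (xc 0) (xd 0) *m xd 0) a 0 * s1 ^+ 2 + xd 0 a 0 * s2.
  have T : is_derive (tau : R) 1 (fun s => xd (sg s) a 0) (- (Gw (gx g phi) (xc 0) (xd 0) *m xd 0) a 0 * s1).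
    apply: (is_derive1_comp (f := fun t => xd t a 0) _ (Dsg tau Jt)).
    by rewrite st -oppmxE; apply: (Hd 0 _).2; rewrite normr0.
  have := is_deriveM T Dsg2 => T2.
  rewrite derive1nS derive1E.
  have -> : 'D_1 (derive1n 1 (fun s => chart_map phi (chart_inv phi (xc (sg s))) 0 a)) tau =
      'D_1 ((fun s => xd (sg s) a 0) * sg^`()%classic) tau.
    apply: near_eq_derive; apply: filterS nJ => s Js.
    by rewrite /derive1n /= derive1E (@derive_val _ _ _ _ _ _ _ (V s a Js)).
  rewrite (@derive_val _ _ _ _ _ _ _ T2) st /GRing.scale /= -/s1 -/s2; ring.
exists (- s2 / (eps * s1 ^+ 2)); apply/matrixP => a j; rewrite ord1.
have := geo' phi tau a Ap Jt; rewrite /= st x0p => /(_ dp).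
rewrite -[X in X + _]/(derive1n 2 (fun s => chart_map phi (chart_inv phi (xc (sg s))) 0 a) tau) D2.
have -> : \sum_b \sum_c christoffel g' phi p a b c *
    velocity phi ((fun t => chart_inv phi (xc t)) \o sg) tau b *
    velocity phi ((fun t => chart_inv phi (xc t)) \o sg) tau c =
    (Gw (gx g' phi) (xc 0) (s1 *: xd 0) *m (s1 *: xd 0)) a 0.
  rewrite Gw_entry; apply: eq_bigr => b _; apply: eq_bigr => c _.
  by rewrite !Vt christoffelE// x0.
have SG (h : lorentz_metric A) (b : R) :
    (Gw (gx h phi) (xc 0) (b *: v) *m (b *: v)) a 0 = b ^+ 2 * (Gw (gx h phi) (xc 0) v *m v) a 0.
  by rewrite Gw_scale [LHS]scalemxE.
rewrite xd0 scalerA !SG [(eps *: v) a 0]scalemxE x0 => E.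
rewrite [LHS]addmxE [X in _ + X]oppmxE [RHS]scalemxE.
by apply: (deviation_alg _ s10 E); rewrite gt_eqF.
Qed.

End Projective.

(** * The Sinyukov tensor of a projective pair *)

Section SinyukovAlgebra.
Variable R : realType.

Lemma lorentzian_det (G : 'M[R]_4) : lorentzian G -> \det G < 0.
Proof.
move=> [P uP /(congr1 determinant)]; rewrite !det_mulmx det_tr det_diag.
rewrite !big_ord_recl big_ord0 !mxE /= !mulr1 => E.
have P0 : \det P != 0 by rewrite -unitfE -unitmxE.
have P2 : 0 < \det P * \det P by rewrite lt_neqAle eq_sym mulf_neq0// -expr2 sqr_ge0.
have : (\det P * \det P) * \det G = -1 by rewrite -E; ring.
by move=> H; rewrite -(pmulr_rlt0 _ P2) H ltrN10.
Qed.

Lemma inv_derive (t : R) : t != 0 -> is_derive t 1 (fun s : R => s^-1) (- t ^- 2).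
Proof.
move=> t0; have H := @is_deriveV R id t 1 1 t0 (is_derive_id t 1).
by apply: (is_derive_eq H); rewrite /GRing.scale /= mulr1.
Qed.

(* [fun t => expR (ln t / 5)] is the fifth root. *)
Lemma root5_derive (t : R) : 0 < t ->
  is_derive t 1 (fun t => expR (ln t / 5)) (expR (ln t / 5) * (t^-1 / 5)).
Proof.
move=> t0; apply: (is_derive1_comp (f := @expR R) (g := fun t => ln t / 5)).
apply: (is_derive_eq (is_deriveM (is_derive1_ln t0) (is_derive_cst (5^-1 : R) t 1))).
by rewrite /GRing.scale /= mulr0 add0r mulrC.
Qed.

(** The product rule for [E Hi G], both metrics being compatible with their connections. The
    derivative of [Hi] contributes [-2 p] through the trace part of [L'], and the weight, of
    logarithmic derivative [2 p], cancels exactly this. *)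
Lemma sinyukov_alg (G H Hi L : 'M[R]_4) (e : 'cV[R]_4) (w : 'rV[R]_4) (E p : R) :
  H *m Hi = 1%:M -> Hi *m H = 1%:M ->
  let L' := L + p%:M + e *m w in
  (2 * p * E) *: (Hi *m G) + E *: (- (Hi *m (H *m L' + L'^T *m H) *m Hi) *m G
    + Hi *m (G *m L + L^T *m G)) =
  - (L *m (E *: (Hi *m G))) + E *: (Hi *m G) *m L
  - E *: (e *m (w *m Hi *m G) + Hi *m w^T *m e^T *m G).
Proof.
move=> H1 H2 L'.
have -> : Hi *m (H *m L' + L'^T *m H) *m Hi = L' *m Hi + Hi *m L'^T.
  by rewrite mulmxDr mulmxDl mulmxA H2 mul1mx -[X in _ + X]mulmxA -[X in _ + _ *m X]mulmxA H1 mulmx1.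
have L'T : L'^T = L^T + p%:M + w^T *m e^T.
  by rewrite /L' !trD trmx_mul tr_scalar_mx.
rewrite L'T /L' !mulmxDl !mulmxDr !mul_scalar_mx mul_mx_scalar.
mxring.
Qed.

End SinyukovAlgebra.

Section SinyukovTensor.
Variables (R : realType) (M : topologicalType) (A : smooth_structure R M).
Variables g g' : lorentz_metric A.
Hypothesis pr : projectively_related g g'.
Implicit Types (phi chi : chart R M) (p : M) (x : 'rV[R]_4).
Notation ec i := (delta_mx i 0 : 'cV[R]_4).

(** The endomorphism [psi_c id + e_c psi] has trace [(4 + 1) psi_c], hence the factor 1/5. *)
Definition psi phi x c : R := 5^-1 * \tr (Gam (gx g' phi) c x - Gam (gx g phi) c x).
Definition psirow phi x : 'rV[R]_4 := \row_c psi phi x c.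

(** Weyl's argument: [geodesic_deviation] holds for all velocities at the point, so [projective_alg]
    gives the shape of the difference, and the trace identifies its covector with [psi]. *)
Lemma Gam_psi phi x c : A phi -> cod phi x ->
  Gam (gx g' phi) c x = Gam (gx g phi) c x + (psi phi x c)%:M + ec c *m psirow phi x.
Proof.
move=> Ap cx; have /codP[dp ex] := cx.
pose D a b d := (Gam (gx g' phi) b x - Gam (gx g phi) b x) a d.
have Ds a b d : D a b d = D a d b.
  rewrite /D !addmxE !oppmxE; congr (_ - _); rewrite [LHS]mxE [RHS]mxE;
    apply: (chr_sym _ _ _ (@cod_open _ _ phi) cx); exact: gx_sym.
have [w Hw] : exists w : 'I_4 -> R, forall a b d, D a b d = (a == b)%:R * w d + (a == d)%:R * w b.
  apply: projective_alg => // v.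
  have [mu E] := geodesic_deviation (\col_i v i) pr Ap dp.
  exists mu => a; have := congr1 (fun X : 'cV[R]_4 => X a 0) E.
  rewrite ex addmxE oppmxE !Gw_entry scalemxE [X in _ = _ * X -> _]mxE => <-.
  rewrite -sumrB; apply: eq_bigr => b _; rewrite -sumrB; apply: eq_bigr => d _.
  by rewrite /D addmxE oppmxE ![(\col_i v i) _ _]mxE -!mulrBl.
have T b : psi phi x b = w b.
  have -> : psi phi x b = 5^-1 * \sum_i ((i == b)%:R * w i + w b).
    congr (_ * _); apply: eq_bigr => i _.
    by have := Hw i b i; rewrite /D eqxx mul1r.
  have S : \sum_i (i == b)%:R * w i = w b.
    rewrite (bigD1 b)//= eqxx mul1r big1 ?addr0// => i /negbTE ->; exact: mul0r.
  by rewrite big_split /= S sumr_const card_ord -mulrS -[w b *+ 5]mulr_natl mulKf ?pnatr_eq0.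
apply/matrixP => a d; have := Hw a c d; rewrite /D addmxE oppmxE => /eqP.
rewrite subr_eq addrC => /eqP ->; rewrite -addrA !addmxE; congr (_ + _).
rewrite addrC; congr (_ + _).
  by rewrite [in RHS]mxE T; case: eqVneq => _; rewrite ?mul1r ?mul0r ?mulr1n ?mulr0n.
rewrite [in RHS]mxE big_ord1 [psirow _ _ _ _]mxE T [ec c _ _]mxE eqxx andbT; done.
Qed.

Lemma spsi phi c : A phi -> sm (cod phi) (fun x => psi phi x c).
Proof.
move=> Ap; have oO := @cod_open _ _ phi.
have sG := msm_Gam c oO (gx_unit g Ap) (gx_sm g Ap).
have sG' := msm_Gam c oO (gx_unit g' Ap) (gx_sm g' Ap).
apply: smM => //; first exact: sm_cst.
apply: sm_sum => // i.
by apply: (msmD oO sG' (msmN oO sG)).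
Qed.

(** A ratio of determinants of two metrics is a scalar, so the chart is immaterial, and it is
    positive because Lorentz determinants are negative. *)
Definition Ef phi p : R := expR (ln (\det (g' phi p) / \det (g phi p)) / 5).

Lemma Ef_gt0 phi p : 0 < Ef phi p. Proof. exact: expR_gt0. Qed.

Lemma det_ratio_gt0 phi p : A phi -> chart_dom phi p -> 0 < \det (g' phi p) / \det (g phi p).
Proof.
move=> Ap dp; rewrite -mulrNN -invrN divr_gt0// oppr_gt0 lorentzian_det//.
  exact: (metric_lorentz g').
exact: (metric_lorentz g).
Qed.

Lemma Ef_chart phi chi p : A phi -> A chi -> chart_dom phi p -> chart_dom chi p ->
  Ef phi p = Ef chi p.
Proof.
move=> Ap Ac dp cp; rewrite /Ef.
suff -> : \det (g' phi p) / \det (g phi p) = \det (g' chi p) / \det (g chi p) by [].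
rewrite (metric_tensor g Ap Ac dp cp) (metric_tensor g' Ap Ac dp cp) !det_mulmx det_tr.
have J0 : \det (jacobian phi chi p) != 0.
  by rewrite -unitfE -unitmxE (jacobian_unit Ap Ac).
have d0 : \det (g chi p) != 0 by rewrite -unitfE -unitmxE g_unit.
move: (\det (jacobian _ _ _)) (\det (g chi p)) (\det (g' chi p)) J0 d0 => v1 v2 v3 J0 d0.
by field; rewrite J0 d0.
Qed.

Lemma Ef5 phi p : A phi -> chart_dom phi p ->
  Ef phi p ^+ 5 = \det (g' phi p) / \det (g phi p).
Proof.
move=> Ap dp; rewrite /Ef -expRM_natl mulr_natl -mulr_natr divfK ?pnatr_eq0//.
by rewrite lnK// posrE det_ratio_gt0.
Qed.

Lemma derive_det_metric (h : lorentz_metric A) phi x c : A phi -> cod phi x ->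
  is_derive x (delta_mx 0 c) (fun y => \det (gx h phi y))
    (2 * \tr (Gam (gx h phi) c x) * \det (gx h phi x)).
Proof.
move=> Ap cx; have oO := @cod_open _ _ phi.
have D i j : is_derive x (delta_mx 0 c) (fun y => gx h phi y i j) (dmx c (gx h phi) x i j).
  by rewrite mxE; exact: (sm_der c (gx_sm h Ap i j) cx).
apply: (is_derive_eq (derive_det D)).
rewrite (chr_compat c oO cx (gx_sym h Ap) (gx_unit h Ap cx)) mulmxDl mxtraceD.
rewrite mxtrace_mulC mulmxA mul_adj_mx -[X in _ + \tr X]mulmxA mul_mx_adj.
by rewrite mul_scalar_mx mul_mx_scalar !mxtraceZ mxtrace_tr; ring.
Qed.

Lemma Ef_derive phi x c : A phi -> cod phi x ->
  is_derive x (delta_mx 0 c) (fun y => Ef phi (chart_inv phi y))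
    (2 * psi phi x c * Ef phi (chart_inv phi x)).
Proof.
move=> Ap cx; have /codP[dp ex] := cx.
have d0 : \det (gx g phi x) != 0 by rewrite -unitfE -unitmxE gx_unit.
have r0 := det_ratio_gt0 Ap dp; rewrite -!/(gx _ _ _) in r0.
have D1 := derive_det_metric g' c Ap cx.
have D2 := derive_det_metric g c Ap cx.
have D3 := derive_comp1 (h := fun t => t^-1) D2 (inv_derive d0).
have D4 := is_deriveM D1 D3.
have D5 := derive_comp1 (h := fun t => expR (ln t / 5)) D4 (root5_derive r0).
apply: (is_derive_eq D5); rewrite /Ef -!/(gx _ _ _) /psi linearB /= /GRing.scale /=.
have d0' : \det (gx g' phi x) != 0 by rewrite -unitfE -unitmxE gx_unit.
move: (expR (ln (\det (gx g' phi x) / \det (gx g phi x)) / 5)) (\det (gx g phi x)) (\det (gx g' phi x)) (\tr (Gam (gx g phi) c x))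
  (\tr (Gam (gx g' phi) c x)) d0 d0' => v1 v2 v3 v4 v5 d0 d0'.
by field; rewrite d0 d0'.
Qed.

Lemma sEf phi : A phi -> sm (cod phi) (fun y => Ef phi (chart_inv phi y)).
Proof.
move=> Ap; have oO := @cod_open _ _ phi.
apply: (@sm_linear_ode _ _ _ oO _ (fun c x => 2 * psi phi x c)).
- move=> x cx; have /codP[dp ex] := cx.
  apply: (@continuous_for_comp _ R^o R^o (fun y => \det (gx g' phi y) / \det (gx g phi y))
    (fun t => expR (ln t / 5))).
    have C : Ck 0 (cod phi) (fun y => \det (gx g' phi y) * (\det (gx g phi y))^-1).
      apply: CkM => //; first by apply: Ck_det => // i j; exact: gx_sm.
      apply: CkV => //; last by apply: Ck_det => // i j; exact: gx_sm.
      by move=> y cy; rewrite -unitfE -unitmxE gx_unit.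
    exact: (Ck_cont C cx).
  exact: (is_derive_cont (root5_derive (det_ratio_gt0 Ap dp))).
- by move=> c; apply: smM => //; [exact: sm_cst|exact: spsi].
by move=> c x cx; exact: Ef_derive.
Qed.

Definition sinyukov_a phi x : 'M[R]_4 := Ef phi (chart_inv phi x) *: (invmx (gx g' phi x) *m gx g phi x).
Definition sinyukov_lam phi x : 'cV[R]_4 :=
  - (Ef phi (chart_inv phi x) *: (invmx (gx g' phi x) *m (psirow phi x)^T)).

Lemma sm_sinyukov_a phi : A phi -> msm (cod phi) (sinyukov_a phi).
Proof.
move=> Ap; have oO := @cod_open _ _ phi; apply: msmZ => //; first exact: sEf.
by apply: msmM => //; [apply: msm_inv => //; [exact: gx_unit|exact: gx_sm]|exact: gx_sm].
Qed.

Lemma sm_sinyukov_lam phi : A phi -> msm (cod phi) (sinyukov_lam phi).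
Proof.
move=> Ap; have oO := @cod_open _ _ phi; apply: msmN => //; apply: msmZ => //; first exact: sEf.
apply: msmM => //; first by apply: msm_inv => //; [exact: gx_unit|exact: gx_sm].
apply: msmT => // i j; apply: sm_eq (spsi j Ap) => // x _; by rewrite [RHS]mxE.
Qed.

Lemma dmx_inv (G : 'rV[R]_4 -> 'M[R]_4) (O : set 'rV[R]_4) c x : open O -> msm O G ->
  (forall y, O y -> G y \in unitmx) -> O x ->
  dmx c (fun y => invmx (G y)) x = - (invmx (G x) *m dmx c G x *m invmx (G x)).
Proof.
move=> oO sG uG Ox; have sI := msm_inv oO uG sG.
have := dmxM c sG sI Ox.
have -> : dmx c (fun y => G y *m invmx (G y)) x = 0.
  rewrite (@dmx_eq _ _ _ _ O _ (fun=> 1%:M) c x oO Ox) ?dmx_cst// => y Oy.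
  by rewrite mulmxV// uG.
move=> /esym/eqP; rewrite addrC addr_eq0 => /eqP /(congr1 (mulmx (invmx (G x)))).
by rewrite mulKmx ?uG// mulmxN mulmxA.
Qed.

Lemma d_sinyukov_a phi c x : A phi -> cod phi x ->
  dmx c (sinyukov_a phi) x = - (Gam (gx g phi) c x *m sinyukov_a phi x) + sinyukov_a phi x *m Gam (gx g phi) c x
    + (ec c *m (sinyukov_lam phi x)^T *m gx g phi x + sinyukov_lam phi x *m (ec c)^T *m gx g phi x).
Proof.
move=> Ap cx; have oO := @cod_open _ _ phi.
have uG' := gx_unit g' Ap cx.
have sI := msm_inv oO (gx_unit g' Ap) (gx_sm g' Ap).
have sG := gx_sm g Ap.
rewrite (dmxZ c (sEf Ap) (msmM oO sI sG) cx) (is_derive_pt (Ef_derive c Ap cx)).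
rewrite (dmxM c sI sG cx) (dmx_inv c oO (gx_sm g' Ap) (gx_unit g' Ap) cx).
rewrite (chr_compat c oO cx (gx_sym g' Ap) uG').
rewrite (chr_compat c oO cx (gx_sym g Ap) (gx_unit g Ap cx)).
rewrite (Gam_psi c Ap cx).
have := sinyukov_alg (gx g phi x) (Gam (gx g phi) c x) (ec c) (psirow phi x)
  (Ef phi (chart_inv phi x)) (psi phi x c) (mulmxV uG') (mulVmx uG') => /= ->.
congr (_ + _).
have Hs : (invmx (gx g' phi x))^T = invmx (gx g' phi x) by rewrite trmx_inv gx_sym.
rewrite /sinyukov_lam trN trZ trmx_mul trmxK Hs.
by move: (invmx _) (psirow _ _) (ec c) (gx g phi x) (Ef _ _) => v1 v2 v3 v4 v5; mxring.
Qed.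

Lemma sinyukov_a_sym phi x : A phi -> cod phi x ->
  (gx g phi x *m sinyukov_a phi x)^T = gx g phi x *m sinyukov_a phi x.
Proof.
move=> Ap cx; rewrite /sinyukov_a -scalemxAr trZ !trmx_mul trmx_inv !gx_sym// mulmxA //.
Qed.

Lemma g'_sinyukov_a phi x : A phi -> cod phi x ->
  gx g' phi x *m sinyukov_a phi x = Ef phi (chart_inv phi x) *: gx g phi x.
Proof. by move=> Ap cx; rewrite /sinyukov_a -scalemxAr mulKVmx// gx_unit. Qed.

(** The scaling contributes [E^4] and the ratio of determinants [E^-5]. Comparison with the
    determinant of [a] in adapted coordinates will yield the formula of [F]. *)
Lemma det_sinyukov_a phi x : A phi -> cod phi x -> \det (sinyukov_a phi x) = (Ef phi (chart_inv phi x))^-1.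
Proof.
move=> Ap cx; have /codP[dp ex] := cx; rewrite /sinyukov_a detZ det_mulmx det_inv.
have E0 : Ef phi (chart_inv phi x) != 0 by rewrite gt_eqF// Ef_gt0.
have d0 : \det (gx g phi x) != 0 by rewrite -unitfE -unitmxE gx_unit.
have d0' : \det (gx g' phi x) != 0 by rewrite -unitfE -unitmxE gx_unit.
apply: (mulfI E0); rewrite mulrA -exprS mulfV// Ef5// -!/(gx _ _ _).
by field; rewrite d0 d0'.
Qed.

Lemma sinyukov_lam_eq0 phi x : A phi -> cod phi x -> sinyukov_lam phi x = 0 -> forall c, psi phi x c = 0.
Proof.
move=> Ap cx /eqP; rewrite oppr_eq0 scaler_eq0 gt_eqF ?Ef_gt0//= => /eqP H c.
have : (psirow phi x)^T = 0.
  by rewrite -[LHS](mulKVmx (gx_unit g' Ap cx)) H mulmx0.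
by move=> /matrixP/(_ c 0); rewrite !mxE.
Qed.

(** [psi] is half the differential of [ln Ef], and [Ef] is the same function in both charts. *)
Lemma psi_chain phi chi p c : A phi -> A chi -> chart_dom phi p -> chart_dom chi p ->
  psi phi (chart_map phi p) c =
  \sum_d psi chi (chart_map chi p) d * jacobian phi chi p d c.
Proof.
move=> Ap Ac dp cp.
have K ph q d : A ph -> chart_dom ph q -> pd ph d (Ef ph) q = 2 * Ef ph q * psi ph (chart_map ph q) d.
  move=> Aph dq; rewrite pdE (is_derive_pt (Ef_derive d Aph (cod_map dq))) chart_mapK//; ring.
have E0 : 2 * Ef chi p != 0 by rewrite mulf_neq0 ?pnatr_eq0// gt_eqF// Ef_gt0.
apply: (mulfI E0); rewrite -{1}(Ef_chart Ap Ac dp cp) -K//.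
rewrite mulr_sumr; under eq_bigr do rewrite mulrA -K//.
have oU : open (chart_dom chi) by exact: chart_dom_open.
have E : pd phi c (Ef phi) p = pd phi c (Ef chi) p.
  rewrite !pdE; apply: (pt_eq c (@ov_open _ _ phi chi) (ov_map dp cp)) => y /ovP[/codP[dy _] cy] /=.
  exact: Ef_chart.
have sE : sm [set y | cod chi y /\ chart_dom chi (chart_inv chi y)] (Ef chi \o chart_inv chi).
  have sub : [set y | cod chi y /\ chart_dom chi (chart_inv chi y)] `<=` cod chi by move=> y [].
  exact: (sm_sub sub (sEf Ac)).
by rewrite E (pd_chain c Ap Ac dp cp oU cp sE).
Qed.

End SinyukovTensor.

(** * Parallel transport and holonomy *)

Section SegmentFlow.
Variables (R : realType) (O : set 'rV[R]_4) (G : 'rV[R]_4 -> 'M[R]_4).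
Hypothesis oO : open O.
Hypothesis sG : msm O G.
Hypothesis uG : forall x, O x -> G x \in unitmx.

(** [Z t] transports along the coordinate segment from [x] to [x + t *: w]. Segments suffice, since
    all paths below are broken lines in charts. *)
Definition seg_solution (x w : 'rV[R]_4) (Z : R -> 'M[R]_4) :=
  Z 0 = 1%:M /\ forall t : R, `|t| < 2 -> O (x + t *: w) /\
    mder t Z (- (Gw G (x + t *: w) w^T *m Z t)).

Let E := [set y : 'rV[R]_(4 + 4 + 4) | O (lsubmx (lsubmx y))].
Let F (y : 'rV[R]_(4 + 4 + 4)) : 'rV[R]_(4 + 4 + 4) :=
  row_mx (row_mx (rsubmx (lsubmx y)) 0)
    (- (Gw G (lsubmx (lsubmx y)) (rsubmx (lsubmx y))^T *m (rsubmx y)^T))^T.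

Let oE : open E.
Proof. exact: (@open_lsubmx R (4 + 4) 4 _ (@open_lsubmx R 4 4 O oO)). Qed.

Let sw j : sm E (fun y => rsubmx (lsubmx y) 0 j).
Proof.
apply: (sm_eq oE (f := fun y : 'rV[R]_(4 + 4 + 4) => y 0 (lshift 4 (rshift 4 j)))).
  by move=> y _; rewrite !mxE.
by move=> k; exact: Ck_coord.
Qed.

Let sz j : sm E (fun y => rsubmx y 0 j).
Proof.
apply: (sm_eq oE (f := fun y : 'rV[R]_(4 + 4 + 4) => y 0 (rshift (4 + 4) j))).
  by move=> y _; rewrite !mxE.
by move=> k; exact: Ck_coord.
Qed.

Let sF i : sm E (fun y => F y 0 i).
Proof.
case: (split_ordP i) => j ->; last first.
  apply: (sm_eq oE (f := fun z => - \sum_b \sum_c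
      Gam G b (lsubmx (lsubmx z)) j c * rsubmx (lsubmx z) 0 b * rsubmx z 0 c)) => //.
    move=> x _; rewrite /F row_mxEr [RHS]mxE oppmxE Gw_entry; congr (- _).
    by apply: eq_bigr => b _; apply: eq_bigr => c _; rewrite ![_^T _ _]mxE.
  apply: smN => //; apply: sm_sum => // b; apply: sm_sum => // c.
  have sGm : sm E (fun x => Gam G b (lsubmx (lsubmx x)) j c).
    move=> k; apply: (@Ck_lsubmx R (4 + 4) 4 k [set z | O (lsubmx z)]
      (fun z => Gam G b (lsubmx z) j c)); first exact: open_lsubmx.
    exact: (@Ck_lsubmx R 4 4 k _ _ oO (msm_Gam b oO uG sG j c k)).
  exact: (smM oE (smM oE sGm (sw b)) (sz c)).
case: (split_ordP j) => k ->.
  by apply: sm_eq (sw k) => // x _; rewrite /F row_mxEl row_mxEl.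
by apply: sm_eq (sm_cst E 0) => // x _; rewrite /F row_mxEl row_mxEr mxE.
Qed.

(** The state consists of the point, the direction and one column of [Z], so that smooth dependence
    on initial data makes the transport smooth in [w]. *)
Lemma segment_flow x0 : O x0 ->
  exists (r : R) (Z : 'rV[R]_4 -> 'rV[R]_4 -> R -> 'M[R]_4), [/\ 0 < r,
    (forall x w, `|x - x0| < r -> `|w| < r -> seg_solution x w (Z x w))
  & msm [set w : 'rV[R]_4 | `|w| < r] (fun w => Z x0 w 1)].
Proof.
move=> Ox0.
pose y0 : 'rV[R]_(4 + 4 + 4) := row_mx (row_mx x0 0) 0.
have Ey0 : E y0 by rewrite /E /= !row_mxKl.
have [eps [rr [Phi [eps0 rr0 HP P0 sP]]]] := local_flow oE Ey0 sF.
pose rho := rr / 2; have rho0 : 0 < rho by rewrite divr_gt0.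
have rhoN : rho != 0 by rewrite lt0r_neq0.
have epsN : eps != 0 by rewrite lt0r_neq0.
pose r := Num.min rr (eps * rr).
have r0 : 0 < r by rewrite lt_min rr0 mulr_gt0.
(* Dividing the direction by [eps] undoes the slowing of time. The columns of the identity are
   scaled by [rho] to lie where the flow is defined; by linearity the factor is removed again in
   [Z]. *)
pose st x (w : 'rV[R]_4) j : 'rV[R]_(4 + 4 + 4) :=
  row_mx (row_mx x (eps^-1 *: w)) (rho *: delta_mx 0 j).
have stB x w j : `|x - x0| < r -> `|w| < r -> `|st x w j - y0| < rr.
  rewrite !lt_min => /andP[x1 _] /andP[_ w2].
  rewrite /st /y0 opp_row_mx add_row_mx opp_row_mx add_row_mx !subr0.
  apply: row_mx_norm_lt => //; first apply: row_mx_norm_lt => //.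
    by rewrite normrZ gtr0_norm ?invr_gt0// ltr_pdivrMl.
  rewrite normrZ gtr0_norm//; apply: (@le_lt_trans _ _ (rho * 1)).
    by apply: ler_wpM2l; [exact: ltW|exact: norm_delta_le].
  by rewrite mulr1 /rho ltr_pdivrMr// mulr_natr mulr2n ltrDl.
pose Z x w t : 'M[R]_4 := \matrix_(i, j) (rho^-1 * Phi t (st x w j) 0 (rshift (4 + 4) i)).
exists r, Z; split=> //.
- move=> x w xr wr; split.
    apply/matrixP => i j; rewrite mxE P0 ?stB// /st row_mxEr !mxE /=.
    by rewrite mulKf.
  pose Y j t := Phi t (st x w j).
  have HY j (t : R) : `|t| < 2 -> E (Y j t) /\ forall i,
      is_derive t 1 (fun s => Y j s 0 i) (eps * F (Y j t) 0 i).
    by move=> t2; apply: HP => //; exact: stB.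
  have Y0 j : Y j 0 = st x w j by apply: P0; exact: stB.
  have between (t s : R) : `|t| < 2 -> Num.min 0 t <= s <= Num.max 0 t -> `|s| < 2.
    move=> t2 /andP[h1 h2]; apply: le_lt_trans t2.
    have [t0|t0] := leP 0 t.
      by rewrite (min_idPl t0) in h1; rewrite (max_idPr t0) in h2; rewrite !ger0_norm.
    rewrite (min_idPr (ltW t0)) in h1; rewrite (max_idPl (ltW t0)) in h2.
    by rewrite !ler0_norm ?(ltW t0)// lerN2.
  have Yw j t : `|t| < 2 -> rsubmx (lsubmx (Y j t)) = eps^-1 *: w.
    move=> t2; apply/matrixP => i k; rewrite ord1.
    have -> : (eps^-1 *: w) 0 k = Y j 0 0 (lshift 4 (rshift 4 k)).
      by rewrite Y0 /st row_mxEl row_mxEr.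
    rewrite !mxE; symmetry.
    apply: (@zero_derivative_eq R (fun s => Y j s 0 (lshift 4 (rshift 4 k))) 0 t) => s /(between _ _ t2) s2.
    apply: (is_derive_eq ((HY j s s2).2 _)).
    by rewrite /F row_mxEl row_mxEr mxE mulr0.
  have Yx j t : `|t| < 2 -> lsubmx (lsubmx (Y j t)) = x + t *: w.
    move=> t2; apply/matrixP => i k; rewrite ord1.
    have : Y j 0 0 (lshift 4 (lshift 4 k)) - 0 * w 0 k = Y j t 0 (lshift 4 (lshift 4 k)) - t * w 0 k.
      apply: (@zero_derivative_eq R (fun s => Y j s 0 (lshift 4 (lshift 4 k)) - s * w 0 k) 0 t)
        => s /(between _ _ t2) s2.
      have D1 := (HY j s s2).2 (lshift 4 (lshift 4 k)).
      have D2 := is_deriveM (is_derive_id (s : R) 1) (is_derive_cst (w 0 k) (s : R) 1).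
      apply: (is_derive_eq (is_deriveB D1 D2)).
      rewrite /F row_mxEl row_mxEl Yw// mxE mulrA (mulfV epsN) mul1r.
      by rewrite /GRing.scale /= mulr0 add0r mulr1 subrr.
    rewrite Y0 /st row_mxEl row_mxEl mul0r subr0 => H.
    by rewrite addmxE scalemxE H !mxE subrK.
  move=> t t2; split.
    by have := (HY 0 t t2).1; rewrite /E /= Yx.
  move=> i j.
  have -> : (fun s => Z x w s i j) = (fun s => rho^-1 * Y j s 0 (rshift (4 + 4) i)).
    by apply/funext => s; rewrite mxE.
  apply: (is_derive_eq (is_deriveZ rho^-1 ((HY j t t2).2 _))).
  rewrite /F row_mxEr [_^T _ _]mxE Yx// Yw// !oppmxE.
  rewrite /GRing.scale /= !mulrN; congr (- _).
  have -> : Gw G (x + t *: w) (eps^-1 *: w)^T = eps^-1 *: Gw G (x + t *: w) w^T.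
    rewrite /Gw scaler_sumr; apply: eq_bigr => c _.
    by rewrite trZ scalemxE scalerA.
  rewrite -scalemxAl scalemxE !mxE (mulrA eps) (mulfV epsN) mul1r mulr_sumr.
  by apply: eq_bigr => k _; rewrite !mxE; ring.
move=> i j.
have oB : open [set w : 'rV[R]_4 | `|w| < r].
  by have := @open_nbhd_ball R 4 0 r; congr open; apply/seteqP; split=> w /=; rewrite subr0.
apply: (sm_eq oB (f := fun w => rho^-1 * Phi 1 (st x0 w j) 0 (rshift (4 + 4) i))).
  by move=> w _; rewrite [RHS]mxE.
apply: (smM oB (sm_cst _ _)) => k.
apply: (Ck_comp oB (@open_nbhd_ball R _ y0 rr) _ _ (sP (rshift (4 + 4) i) k)).
  move=> a; case: (split_ordP a) => b ->; last first.
    by apply: (Ck_eq oB _ (Ck_cst k _ ((rho *: delta_mx 0 j : 'rV[R]_4) 0 b))) => w _; rewrite /st row_mxEr.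
  case: (split_ordP b) => d ->.
    by apply: (Ck_eq oB _ (Ck_cst k _ (x0 0 d))) => w _; rewrite /st row_mxEl row_mxEl.
  apply: (Ck_eq oB _ (CkM oB (Ck_cst k _ eps^-1) (Ck_coord k _ d))) => w _.
  by rewrite /st row_mxEl row_mxEr mxE.
by move=> w wr /=; apply: stB => //; rewrite subrr normr0.
Qed.

Hypothesis Gs : forall x, O x -> (G x)^T = G x.

Lemma seg_isometry x w Z t : seg_solution x w Z -> `|t| < 2 ->
  (Z t)^T *m G (x + t *: w) *m Z t = G x.
Proof.
move=> [Z0 HZ] t2.
have between (s : R) : Num.min 0 t <= s <= Num.max 0 t -> `|s| < 2.
  move=> /andP[h1 h2]; apply: le_lt_trans t2.
  have [t0|t0] := leP 0 t.
    by rewrite (min_idPl t0) in h1; rewrite (max_idPr t0) in h2; rewrite !ger0_norm.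
  rewrite (min_idPr (ltW t0)) in h1; rewrite (max_idPl (ltW t0)) in h2.
  by rewrite !ler0_norm ?(ltW t0)// lerN2.
have -> : G x = (Z 0)^T *m G (x + 0 *: w) *m Z 0.
  by rewrite Z0 trmx1 mul1mx mulmx1 scale0r addr0.
apply/matrixP => i j; symmetry.
apply: (@zero_derivative_eq R (fun s => ((Z s)^T *m G (x + s *: w) *m Z s) i j)) => s /between s2.
have [Ox D] := HZ s s2.
have DT : mder s (fun s => (Z s)^T) (- (Gw G (x + s *: w) w^T *m Z s))^T.
  move=> a b; rewrite [X in is_derive _ _ _ X]mxE.
  have -> : (fun s => (Z s)^T a b) = (fun s => Z s b a) by apply/funext => u; rewrite mxE.
  exact: D.
have Dx k : is_derive (s : R) 1 (fun s => (x + s *: w) 0 k) (w^T k 0).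
  have -> : (fun s => (x + s *: w) 0 k) = (fun s : R => x 0 k + s * w 0 k).
    by apply/funext => u; rewrite !mxE.
  apply: (is_derive_eq (is_deriveD (is_derive_cst (x 0 k) (s : R) 1)
    (is_deriveM (is_derive_id (s : R) 1) (is_derive_cst (w 0 k) (s : R) 1)))).
  by rewrite /GRing.scale /= mulr0 !add0r mulr1 mxE.
have DG := mder_comp oO sG Ox Dx.
have := mderM (mderM DT DG) D.
set L := (X in mder _ _ X); suff -> : L = 0 by move=> /(_ i j); rewrite mxE.
rewrite {}/L.
have -> : \sum_c w^T c 0 *: dmx c G (x + s *: w) =
    G (x + s *: w) *m Gw G (x + s *: w) w^T + (Gw G (x + s *: w) w^T)^T *m G (x + s *: w).
  rewrite /Gw mulmx_sumr linear_sum /= mulmx_suml -big_split /=; apply: eq_bigr => c _.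
  by rewrite (chr_compat c oO Ox Gs (uG Ox)) scalerDr -scalemxAr linearZ /= -scalemxAl.
move: (Gw G _ _) (G _) (Z s) => v1 v2 v3; mxring.
Qed.

Lemma seg_unit x w Z t : seg_solution x w Z -> `|t| < 2 -> O x -> Z t \in unitmx.
Proof.
move=> H t2 Ox; have := uG Ox; rewrite -(seg_isometry H t2) !unitmx_mul.
by case/andP.
Qed.

End SegmentFlow.

Section AffineTime.
Variable R : realType.

Lemma affine_derive (a d t : R) : is_derive t 1 (fun t => a + t * d) d.
Proof.
apply: (is_derive_eq (is_deriveD (is_derive_cst a t 1)
  (is_deriveM (is_derive_id t 1) (is_derive_cst d t 1)))).
by rewrite /GRing.scale /= mulr0 !add0r mulr1.
Qed.

Lemma affine_interval (a d : R) : open_interval [set t | `|a + t * d| < 2].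
Proof.
split.
  rewrite openE => t It; rewrite /interior.
  have h : nbhs t ((fun t => a + t * d) @^-1` @I2 R).
    by apply: (is_derive_cont (affine_derive a d t)); apply: open_nbhs_nbhs;
      split=> //; exact: I2_open.
  exact: h.
move=> u v; rewrite /= !ltr_norml => /andP[u1 u2] /andP[v1 v2] z /andP[uz zv].
have [d0|d0] := leP 0 d.
  have := ler_wpM2r d0 uz; have := ler_wpM2r d0 zv; rewrite ltr_norml.
  move: (u * d) (v * d) (z * d) u1 u2 v1 v2 => *; apply/andP; split; lra.
have := ler_wnM2r (ltW d0) uz; have := ler_wnM2r (ltW d0) zv.
rewrite ltr_norml; move: (u * d) (v * d) (z * d) u1 u2 v1 v2 => *; apply/andP; split; lra.
Qed.

Lemma affine_unit (a b t : R) : `|a| <= 1 -> `|b| <= 1 -> 0 <= t <= 1 ->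
  `|a + t * (b - a)| < 2.
Proof.
move=> a1 b1 /andP[t0 t1]; apply: (@le_lt_trans _ _ 1); last by rewrite ltr1n.
have -> : a + t * (b - a) = (1 - t) * a + t * b by ring.
apply: (le_trans (ler_normD _ _)); rewrite !normrM (ger0_norm t0).
have t1' : 0 <= 1 - t by rewrite subr_ge0.
rewrite (ger0_norm t1').
have := ler_wpM2l t1' a1; have := ler_wpM2l t0 b1.
move: (t * `|b|) ((1 - t) * `|a|) => *; lra.
Qed.

Lemma mder_time m n (Z : R -> 'M[R]_(m, n)) (s : R -> R) (t d : R) D : mder (s t) Z D ->
  is_derive t 1 s d -> mder t (fun t => Z (s t)) (d *: D).
Proof.
move=> HZ Hs i j; rewrite scalemxE mulrC.
exact: (is_derive1_comp (f := fun t => Z t i j) (HZ i j) Hs).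
Qed.

Lemma mder_cst m n (t : R) (C : 'M[R]_(m, n)) : mder t (fun=> C) 0.
Proof. by move=> i j; rewrite zeromxE; exact: is_derive_cst. Qed.

Lemma line_derive (x w : 'rV[R]_4) (a d t : R) k :
  is_derive t 1 (fun s => (x + (a + s * d) *: w) 0 k) ((d *: w^T) k 0).
Proof.
have -> : (fun s => (x + (a + s * d) *: w) 0 k) = (fun s : R => (x 0 k + a * w 0 k) + s * (d * w 0 k)).
  by apply/funext => s; rewrite !mxE; ring.
by rewrite !mxE; exact: affine_derive.
Qed.

Lemma Gw_scalel (G : 'rV[R]_4 -> 'M[R]_4) x (k : R) (w : 'cV[R]_4) :
  Gw G x (k *: w) = k *: Gw G x w.
Proof.
by rewrite /Gw scaler_sumr; apply: eq_bigr => c _; rewrite scalemxE scalerA.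
Qed.

End AffineTime.

(** * Transport along coordinate segments, across charts *)

Section Arcs.
Variables (R : realType) (M : topologicalType) (A : smooth_structure R M).
Variable g : lorentz_metric A.
Implicit Types (phi chi : chart R M) (p : M) (x w : 'rV[R]_4).

Notation seg phi := (seg_solution (cod phi) (gx g phi)).

(** Affine time runs from [s0] to [s1], backwards if need be, and the Jacobians convert both ends to
    the charts in which the transport is recorded. *)
Lemma arc_segment phi chi1 chi2 x w Z (s0 s1 : R) : A phi -> A chi1 -> A chi2 ->
  seg phi x w Z -> `|s0| <= 1 -> `|s1| <= 1 ->
  let p := chart_inv phi (x + s0 *: w) in let q := chart_inv phi (x + s1 *: w) in
  chart_dom chi1 p -> chart_dom chi2 q ->
  arc_transport g chi1 p chi2 q
    (jacobian phi chi2 q *m (Z s1 *m invmx (Z s0)) *m jacobian chi1 phi p).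
Proof.
move=> Ap A1 A2 [Z0 HZ] h0 h1 p q dp dq.
have oO := @cod_open _ _ phi.
have uG := gx_unit g Ap; have sG := gx_sm g Ap; have Gs := gx_sym g Ap.
pose d := s1 - s0; pose sg t := s0 + t * d.
pose I := [set t | `|sg t| < 2].
have oI : open_interval I := affine_interval s0 d.
pose y t := x + sg t *: w; pose gam t := chart_inv phi (y t).
have cy t : I t -> cod phi (y t) by move=> /HZ[].
have ey t : I t -> chart_map phi (gam t) = y t by move=> /cy/codP[].
have dy t : I t -> chart_dom phi (gam t) by move=> /cy/codP[].
have sg0 : sg 0 = s0 by rewrite /sg mul0r addr0.
have sg1 : sg 1 = s1 by rewrite /sg /d; ring.
have y0 : y 0 = x + s0 *: w by rewrite /y sg0.
have y1 : y 1 = x + s1 *: w by rewrite /y sg1.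
have I0 : I 0 by rewrite /I /= sg0 (le_lt_trans h0)// ltr1n.
have I1 : I 1 by rewrite /I /= sg1 (le_lt_trans h1)// ltr1n.
have cx : cod phi x.
  by have := (HZ 0 _).1; rewrite normr0 scale0r addr0 => /(_ (ltr0Sn _ 1)).
have uZ t : `|t| < 2 -> Z t \in unitmx.
  by move=> t2; apply: (seg_unit oO sG uG Gs (conj Z0 HZ) t2 cx).
have h02 : `|s0| < 2 by rewrite (le_lt_trans h0)// ltr1n.
have Dy (t : R) i : I t -> is_derive t 1 (fun s => y s 0 i) ((d *: w^T) i 0).
  by move=> _; exact: line_derive.
have sc : smooth_curve A I gam.
  apply: (@ode_smooth_curve R 4 (cod phi) (fun=> d *: w) I y oO _ oI.1 cy _ M A phi Ap id).
  - by move=> i; exact: sm_cst.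
  - by move=> t i It; have := Dy t i It; rewrite !mxE.
  - by move=> i k; exact: Ck_coord.
  by [].
exists I, gam; split=> //.
- split=> // t; rewrite /= in_itv /= => t01; exact: affine_unit.
- by rewrite /gam y0.
- by rewrite /gam y1.
move=> v; pose C := invmx (Z s0) *m (jacobian chi1 phi p *m v).
exists (fun chi t => jac (tr phi chi) (y t) *m (Z (sg t) *m C)); split; last 2 first.
- rewrite y0 sg0 /C mulKVmx ?uZ// mulmxA.
  have cp : cod phi (x + s0 *: w) by rewrite -y0; exact: cy.
  have /codP[dpp epp] := cp.
  have -> : jac (tr phi chi1) (x + s0 *: w) = jacobian phi chi1 p by rewrite jacobianE epp.
  by rewrite (jacobian_inv A1 Ap dp dpp) mul1mx.
- rewrite y1 sg1 /C !mulmxA.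
  have cp : cod phi (x + s1 *: w) by rewrite -y1; exact: cy.
  have /codP[dpp epp] := cp.
  by have -> : jac (tr phi chi2) (x + s1 *: w) = jacobian phi chi2 q by rewrite jacobianE epp.
split=> [ph ch t Aph Ach It dph dch|ch t a Ach It dch].
  rewrite -(ey t It) -!jacobianE (jacobian_chain Ap Aph Ach (dy t It) dph dch).
  by rewrite -mulmxA.
have ox s : I s -> chart_dom ch (gam s) -> ov phi ch (y s).
  by move=> Is ds; apply/ovP; split=> //; exact: cy.
have V b : velocity ch gam t b = (jac (tr phi ch) (y t) *m (d *: w^T)) b 0.
  have D := velocity_derive b Ap Ach (ox t It dch) (fun i => Dy t i It).
  by rewrite /velocity derive1E (@derive_val _ _ _ _ _ _ _ D).
have Hz : mder t (fun s => Z (sg s) *m C) (- (Gw (gx g phi) (y t) (d *: w^T) *m (Z (sg t) *m C))).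
  have := mderM (mder_time (HZ (sg t) It).2 (affine_derive s0 d t)) (mder_cst t C).
  rewrite mulmx0 addr0 Gw_scalel scalerN mulNmx -!scalemxAl mulmxA //.
have T := transport_derive Ap Ach (ox t It dch) (fun i => Dy t i It) Hz.
have Ta := T a 0; split; first exact: (@ex_derive _ _ _ _ _ _ _ Ta).
rewrite derive1E (@derive_val _ _ _ _ _ _ _ Ta) oppmxE Gw_entry; congr (- _).
apply: eq_bigr => b _; apply: eq_bigr => c _; rewrite V christoffelE//.
Qed.

Lemma transport_trans phi p chi q psi r P Q : transport g phi p chi q P ->
  transport g chi q psi r Q -> transport g phi p psi r (Q *m P).
Proof.
move=> H; elim=> [|chi1 q1 chi2 q2 P1 Q1 _ IH A2 d2 arc]; first by rewrite mul1mx.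
by rewrite -mulmxA; apply: transport_arc IH _ _ arc.
Qed.

(** The way back to the base point is recorded too, because closing a loop needs it and [transport]
    has no inverse built in; the isometry clause carries null frames along. *)
Definition reach phi0 p0 phi q (P : 'M[R]_4) :=
  [/\ A phi /\ chart_dom phi q, transport g phi0 p0 phi q P,
      transport g phi q phi0 p0 (invmx P) & P^T *m g phi q *m P = g phi0 p0].

Lemma reach_unit phi0 p0 phi q P : A phi0 -> chart_dom phi0 p0 ->
  reach phi0 p0 phi q P -> P \in unitmx.
Proof.
by move=> A0 d0 [_ _ _ E]; have := g_unit g A0 d0; rewrite -E !unitmx_mul => /andP[].
Qed.

Lemma arc_transportE phi p chi q P : A chi -> chart_dom chi q ->
  arc_transport g phi p chi q P -> transport g phi p chi q P.
Proof.
by move=> Ac dc H; rewrite -[P]mulmx1; apply: transport_arc Ac dc H; exact: transport_refl.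
Qed.

(** The return path is the same segment traversed backwards; [QI] says that its matrix is inverse to
    that of the way out. *)
Lemma seg_reach phi0 p0 phi chi1 chi2 x w Z (s0 s1 : R) P : A phi0 -> chart_dom phi0 p0 ->
  A phi -> A chi2 -> seg phi x w Z -> `|s0| <= 1 -> `|s1| <= 1 ->
  let p := chart_inv phi (x + s0 *: w) in let q := chart_inv phi (x + s1 *: w) in
  reach phi0 p0 chi1 p P -> chart_dom chi2 q ->
  reach phi0 p0 chi2 q
    (jacobian phi chi2 q *m (Z s1 *m invmx (Z s0)) *m jacobian chi1 phi p *m P).
Proof.
move=> A0 d0 Ap A2 HZ h0 h1 p q [[A1 dp] t1 t2 E] dq.
have oO := @cod_open _ _ phi.
have uG := gx_unit g Ap; have sG := gx_sm g Ap; have Gs := gx_sym g Ap.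
have lt1 (s : R) : `|s| <= 1 -> `|s| < 2 by move=> h; rewrite (le_lt_trans h)// ltr1n.
have cx : cod phi x.
  by have := (HZ.2 0 _).1; rewrite normr0 scale0r addr0 => /(_ (ltr0Sn _ 1)).
have uZ t : `|t| <= 1 -> Z t \in unitmx.
  by move=> /lt1 h; apply: (seg_unit oO sG uG Gs HZ h cx).
have cp : cod phi (x + s0 *: w) := (HZ.2 s0 (lt1 _ h0)).1.
have cq : cod phi (x + s1 *: w) := (HZ.2 s1 (lt1 _ h1)).1.
have [dpp ep] : chart_dom phi p /\ chart_map phi p = x + s0 *: w by move/codP: cp.
have [dqq eq] : chart_dom phi q /\ chart_map phi q = x + s1 *: w by move/codP: cq.
have uP : P \in unitmx.
  by have := g_unit g A0 d0; rewrite -E !unitmx_mul => /andP[].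
have J1 := jacobian_inv A1 Ap dp dpp; have J2 := jacobian_inv Ap A2 dqq dq.
have J1' := jacobian_inv Ap A1 dpp dp; have J2' := jacobian_inv A2 Ap dq dqq.
set Q := jacobian phi chi2 q *m _ *m _.
have uQ : Q \in unitmx.
  by rewrite !unitmx_mul unitmx_inv !uZ// (jacobian_unit Ap A2)// (jacobian_unit A1 Ap).
have aF := arc_segment Ap A1 A2 HZ h0 h1 dp dq.
have aB := arc_segment Ap A2 A1 HZ h1 h0 dq dp.
have QI : jacobian phi chi1 p *m (Z s0 *m invmx (Z s1)) *m jacobian chi2 phi q = invmx Q.
  apply: (can_inj (mulKmx uQ)); rewrite mulmxV// /Q.
  rewrite -!mulmxA (mulmxA (jacobian chi1 phi p)) J1' mul1mx (mulmxA (invmx (Z s0))) mulVmx ?uZ// mul1mx.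
  by rewrite (mulmxA (Z s1)) mulmxV ?uZ// mul1mx J2'.
split=> //.
- by apply: transport_trans t1 _; exact: arc_transportE.
- have -> : invmx (Q *m P) = invmx P *m invmx Q.
    have uQP : Q *m P \in unitmx by rewrite unitmx_mul uQ.
    apply: (can_inj (mulKmx uQP)); rewrite mulmxV// mulmxA -(mulmxA Q) mulmxV// mulmx1.
    by rewrite mulmxV.
  by apply: transport_trans t2; apply: arc_transportE => //; rewrite -QI.
rewrite -E trmx_mul -!mulmxA; congr (_ *m _); rewrite !mulmxA; congr (_ *m _).
rewrite (metric_tensor g A1 Ap dp dpp) /Q !trmx_mul.
have -> : g phi p = gx g phi (x + s0 *: w) by rewrite -ep gx_map.
have i0 := seg_isometry oO sG uG Gs HZ (lt1 _ h0).
have i1 := seg_isometry oO sG uG Gs HZ (lt1 _ h1).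
have E2 : (Z s1 *m invmx (Z s0))^T *m g phi q *m (Z s1 *m invmx (Z s0)) = gx g phi (x + s0 *: w).
  have -> : g phi q = gx g phi (x + s1 *: w) by rewrite -eq gx_map.
  rewrite trmx_mul; transitivity ((invmx (Z s0))^T *m gx g phi x *m invmx (Z s0)).
    by rewrite -i1 !mulmxA.
  rewrite -i0 !mulmxA -trmx_mul mulmxV ?uZ// trmx1 mul1mx -mulmxA mulmxV ?uZ// mulmx1 //.
rewrite -E2 trmx_mul (metric_tensor g Ap A2 dqq dq) !mulmxA //.
Qed.

End Arcs.

Section TwiceDifferentiable.
Variable R : realType.

Lemma mderD m n t (X Y : R -> 'M[R]_(m, n)) dX dY : mder t X dX -> mder t Y dY ->
  mder t (fun s => X s + Y s) (dX + dY).
Proof.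
move=> HX HY i j; rewrite addmxE.
have -> : (fun s => (X s + Y s) i j) = (fun s => X s i j + Y s i j).
  by apply/funext => s; rewrite addmxE.
exact: (is_deriveD (HX i j) (HY i j)).
Qed.

Lemma mderN m n t (X : R -> 'M[R]_(m, n)) dX : mder t X dX ->
  mder t (fun s => - X s) (- dX).
Proof.
move=> HX i j; rewrite oppmxE.
have -> : (fun s => (- X s) i j) = (fun s => - X s i j) by apply/funext => s; rewrite oppmxE.
exact: (is_deriveN (HX i j)).
Qed.

Lemma mderZ m n (t : R) (f : R -> R) (X : R -> 'M[R]_(m, n)) df dX : is_derive t 1 f df ->
  mder t X dX -> mder t (fun s => f s *: X s) (df *: X t + f t *: dX).
Proof.
move=> Hf HX i j; rewrite addmxE !scalemxE.
have -> : (fun s => (f s *: X s) i j) = (fun s => f s * X s i j).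
  by apply/funext => s; rewrite scalemxE.
apply: (is_derive_eq (is_deriveM Hf (HX i j))).
by rewrite /GRing.scale /= addrC mulrC.
Qed.

Lemma mder_unique m n t (X : R -> 'M[R]_(m, n)) D D' : mder t X D -> mder t X D' -> D = D'.
Proof. by move=> H H'; apply/matrixP => i j; exact: is_derive_unique (H i j) (H' i j). Qed.

(** Two derivatives are asked for, so that continuity of the first one comes for free. *)
Definition mC2 m n (X : R -> 'M[R]_(m, n)) := exists X1 X2, forall s : R,
  mder s X (X1 s) /\ mder s X1 (X2 s).

Lemma mC2_cst m n (C : 'M[R]_(m, n)) : mC2 (fun=> C).
Proof. by exists (fun=> 0), (fun=> 0) => s; split; exact: mder_cst. Qed.

Lemma mC2M m n p (X : R -> 'M[R]_(m, n)) (Y : R -> 'M[R]_(n, p)) : mC2 X -> mC2 Y ->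
  mC2 (fun s => X s *m Y s).
Proof.
move=> [X1 [X2 HX]] [Y1 [Y2 HY]].
exists (fun s => X1 s *m Y s + X s *m Y1 s).
exists (fun s => (X2 s *m Y s + X1 s *m Y1 s) + (X1 s *m Y1 s + X s *m Y2 s)) => s.
have [HX1 HX2] := HX s; have [HY1 HY2] := HY s.
by split; [exact: mderM|apply: mderD; exact: mderM].
Qed.

(** The sine has unit speed at 0 and values in [-1, 1]: it turns a curve known for [|t| < 2] into
    one on the whole line, as the definition of the holonomy algebra demands. *)
Lemma mC2_sin m n (Z Z1 Z2 : R -> 'M[R]_(m, n)) :
  (forall t, `|t| < 2 -> mder t Z (Z1 t) /\ mder t Z1 (Z2 t)) ->
  mC2 (fun s => Z (sin s)).
Proof.
move=> H; exists (fun s => cos s *: Z1 (sin s)).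
exists (fun s => - sin s *: Z1 (sin s) + cos s *: (cos s *: Z2 (sin s))) => s.
have sin2 : `|sin s| < 2.
  apply: (@le_lt_trans _ _ 1); last by rewrite ltr1n.
  by rewrite ler_norml sin_le1 sin_geN1.
have [H1 H2] := H _ sin2; split; first exact: (mder_time H1 (is_derive_sin s)).
by apply: (mderZ (is_derive_cos s)); exact: (mder_time H2 (is_derive_sin s)).
Qed.

End TwiceDifferentiable.

(** * From the holonomy algebra to a parallel field *)

Section Holonomy.
Variables (R : realType) (M : topologicalType) (A : smooth_structure R M).
Variable g : lorentz_metric A.
Implicit Types (phi chi : chart R M) (p q : M) (x w : 'rV[R]_4).
Variables (phi0 : chart R M) (p0 : M).
Hypothesis A0 : A phi0.
Hypothesis d0 : chart_dom phi0 p0.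

Notation seg phi := (seg_solution (cod phi) (gx g phi)).

Lemma reach_refl : reach g phi0 p0 phi0 p0 1%:M.
Proof.
by split=> //; rewrite ?invmx1 ?trmx1 ?mul1mx ?mulmx1//; exact: transport_refl.
Qed.

(** The set of reached points and its complement are both open: a point of a small coordinate ball
    is joined to the centre by a segment, which can be traversed either way. *)
Lemma reach_all : connected [set: M] -> forall q, exists chi P, reach g phi0 p0 chi q P.
Proof.
move=> cM; pose S := [set q | exists chi P, reach g phi0 p0 chi q P].
suff : S = setT by move=> E q; have : S q by rewrite E.
have loc q : exists2 U : set M, open U /\ U q & forall q', U q' -> S q <-> S q'.
  have [phi Ap dq] := charts_cover A q.
  have [r [Z [r0 HZ _]]] := segment_flow (@cod_open _ _ phi) (gx_sm g Ap) (gx_unit g Ap) (cod_map dq).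
  exists [set p | chart_dom phi p /\ `|chart_map phi p - chart_map phi q| < r].
    split; last by split=> //; rewrite subrr normr0.
    exact: (@image_open _ _ phi _ (@open_nbhd_ball R 4 (chart_map phi q) r)).
  move=> q' [dq' nq']; set x := chart_map phi q; set w := chart_map phi q' - x.
  have Hs : seg phi x w (Z x w) by apply: HZ => //; rewrite subrr normr0.
  have e0 : chart_inv phi (x + 0 *: w) = q by rewrite scale0r addr0 chart_mapK.
  have e1 : chart_inv phi (x + 1 *: w) = q' by rewrite scale1r /w addrC subrK chart_mapK.
  have n0 : `|0 : R| <= 1 by rewrite normr0.
  have n1 : `|1 : R| <= 1 by rewrite normr1.
  split=> -[chi [P H]].
    rewrite -e0 in H; rewrite -e1 in dq'.
    have := seg_reach A0 d0 Ap Ap Hs n0 n1 H dq'; rewrite /= e1 => K.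
    by exists phi; eexists; exact: K.
  rewrite -e1 in H; rewrite -e0 in dq.
  have := seg_reach A0 d0 Ap Ap Hs n1 n0 H dq; rewrite /= e0 => K.
  by exists phi; eexists; exact: K.
apply: cM.
- by exists p0; exists phi0, 1%:M; exact: reach_refl.
- exists S; last by rewrite setTI.
  rewrite openE => q Sq; have [U [oU Uq] H] := loc q; rewrite /interior.
  have nU : nbhs q U by apply: open_nbhs_nbhs.
  by apply: filterS nU => q' /H[K _]; exact: K.
- exists S; last by rewrite setTI.
  rewrite -[S]setCK; apply: open_closedC; rewrite openE => q Sq.
  have [U [oU Uq] H] := loc q; rewrite /interior.
  have nU : nbhs q U by apply: open_nbhs_nbhs.
  by apply: filterS nU => q' /H[_ K] /K.
Qed.

Lemma seg_reach_same phi x w Z (s0 s1 : R) P : A phi -> seg phi x w Z ->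
  `|s0| <= 1 -> `|s1| <= 1 -> reach g phi0 p0 phi (chart_inv phi (x + s0 *: w)) P ->
  reach g phi0 p0 phi (chart_inv phi (x + s1 *: w)) (Z s1 *m invmx (Z s0) *m P).
Proof.
move=> Ap HZ h0 h1 H; have lt1 (s : R) : `|s| <= 1 -> `|s| < 2.
  by move=> h; rewrite (le_lt_trans h)// ltr1n.
have /codP[dp _] := (HZ.2 s0 (lt1 _ h0)).1; have /codP[dq _] := (HZ.2 s1 (lt1 _ h1)).1.
have := seg_reach A0 d0 Ap Ap HZ h0 h1 H dq.
by rewrite /= !jacobian_id// mul1mx mulmx1.
Qed.

(** Transport along a segment of direction 0 does nothing but change the chart. *)
Lemma reach_chart phi chi q P : A phi -> chart_dom phi q -> reach g phi0 p0 chi q P ->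
  exists P', reach g phi0 p0 phi q P'.
Proof.
move=> Ap dq H.
have [r [Z [r0 HZ _]]] := segment_flow (@cod_open _ _ phi) (gx_sm g Ap) (gx_unit g Ap) (cod_map dq).
set x := chart_map phi q in HZ.
have Hs : seg phi x 0 (Z x 0) by apply: HZ; rewrite ?subrr normr0.
have e0 : chart_inv phi (x + 0 *: 0) = q by rewrite scale0r addr0 chart_mapK.
have n0 : `|0 : R| <= 1 by rewrite normr0.
rewrite -e0 in H; have dq' := dq; rewrite -e0 in dq'.
have := seg_reach A0 d0 Ap Ap Hs n0 n0 H dq'; rewrite e0 => K.
by eexists; exact: K.
Qed.

Variables (l0 : 'cV[R]_4) (T0 : 'M[R]_4).
Hypothesis T0G : T0^T *m g phi0 p0 *m T0 = eta R.
Hypothesis l0T : l0 = T0 *m delta_mx 0 0.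
Hypothesis hol : forall B, holonomy_algebra g phi0 p0 B -> B *m l0 = 0.

Lemma mC2_holonomy (P : R -> 'M[R]_4) B : P 0 = 1%:M ->
  (forall s, holonomy_group g phi0 p0 (P s)) -> mC2 P -> mder 0 P B -> B *m l0 = 0.
Proof.
move=> P0 HP [P1 [P2 H]] HB; apply: hol; exists P.
have D a b (s : R) : is_derive s 1 (fun t => P t a b) (P1 s a b) by exact: (H s).1.
have E a b : derive1 (fun t => P t a b) = (fun s => P1 s a b).
  by apply/funext => s; rewrite derive1E (@derive_val _ _ _ _ _ _ _ (D a b s)).
split=> //.
  by move=> a b s; rewrite E; exact: (is_derive_cont ((H s).2 a b)).
by move=> a b; rewrite derive1E (@derive_val _ _ _ _ _ _ _ (HB a b)).
Qed.

Section Field.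
Variables (phi : chart R M) (q : M) (Pq : 'M[R]_4).
Hypothesis Ap : A phi.
Hypothesis dq : chart_dom phi q.
Hypothesis Hq : reach g phi0 p0 phi q Pq.
Variables (r : R) (Z : 'rV[R]_4 -> 'rV[R]_4 -> R -> 'M[R]_4).
Let xq := chart_map phi q.
Hypothesis r0 : 0 < r.
Hypothesis HZ : forall x w, `|x - xq| < r -> `|w| < r -> seg phi x w (Z x w).
Hypothesis sZ : msm [set w : 'rV[R]_4 | `|w| < r] (fun w => Z xq w 1).

(** Transport from [q] to [x] along the coordinate ray, a radial gauge; [Y x *m (Pq *m l0)] is the
    candidate for the parallel field. *)
Let Y x := Z xq (x - xq) 1.
Let B := [set x : 'rV[R]_4 | `|x - xq| < r].
Let oB : open B := @open_nbhd_ball R 4 xq r.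
Let oO := @cod_open _ _ phi.
Let uG := gx_unit g Ap.
Let sG := gx_sm g Ap.
Let Gs := gx_sym g Ap.
Let Bq : B xq. Proof. by rewrite /B /= subrr normr0. Qed.
Let lt12 : `|1 : R| < 2. Proof. by rewrite normr1 ltr1n. Qed.
Let n0 : `|0 : R| <= 1. Proof. by rewrite normr0. Qed.
Let n1 : `|1 : R| <= 1. Proof. by rewrite normr1. Qed.

Lemma ball_cod : B `<=` cod phi.
Proof.
move=> x Bx; have := ((HZ Bq Bx).2 1 lt12).1.
by rewrite scale1r addrC subrK.
Qed.

Let sY : msm B Y.
Proof.
have oB0 : open [set w : 'rV[R]_4 | `|w| < r].
  by have := @open_nbhd_ball R 4 0 r; congr open; apply/seteqP; split=> w /=; rewrite subr0.
move=> i j k; apply: (Ck_comp oB oB0 (h := fun x => x - xq) _ _ (sZ i j k)) => //.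
move=> a; apply: (Ck_eq oB _ (CkB oB (Ck_coord k _ a) (Ck_cst k _ (xq 0 a)))) => x _.
by rewrite !mxE.
Qed.

Let uY x : B x -> Y x \in unitmx.
Proof. by move=> Bx; apply: (seg_unit oO sG uG Gs (HZ Bq Bx) lt12 (ball_cod Bq)). Qed.

Let uPq : Pq \in unitmx. Proof. exact: reach_unit Hq. Qed.

Let reachY x : B x -> reach g phi0 p0 phi (chart_inv phi x) (Y x *m Pq).
Proof.
move=> Bx; have Hs := HZ Bq Bx.
have e0 : chart_inv phi (xq + 0 *: (x - xq)) = q by rewrite scale0r addr0 chart_mapK.
have H := Hq; rewrite -e0 in H.
have := seg_reach_same Ap Hs n0 n1 H; rewrite scale1r addrC subrK.
by have -> : Z xq (x - xq) 0 = 1%:M := Hs.1; rewrite invmx1 mulmx1.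
Qed.

(* The loop [q -> x -> x + dl sin(t) e_c -> q] is the identity at [t = 0]; its velocity
   there lies in the holonomy algebra, hence kills [l0], which says [nabla_c l = 0].
   The sine keeps the loop inside the ball for all real [t]. *)
Lemma transported_parallel c x : B x -> dmx c Y x *m (Pq *m l0) = - (Gam (gx g phi) c x *m (Y x *m (Pq *m l0))).
Proof.
move=> Bx.
(* A third of the distance to the boundary: the segment in direction [w] stays in the ball up to
   time 2. *)
pose dl := (r - `|x - xq|) / 3.
have dl0 : 0 < dl by rewrite divr_gt0// subr_gt0.
pose w : 'rV[R]_4 := dl *: delta_mx 0 c.
have wn : `|w| <= dl.
  rewrite normrZ gtr0_norm// -[leRHS]mulr1; apply: ler_wpM2l; first exact: ltW.
  exact: norm_delta_le.
have dlr : dl * 3 = r - `|x - xq| by rewrite /dl mulfVK.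
have wr : `|w| < r.
  have := normr_ge0 (x - xq); move: (`|x - xq|) (`|w|) wn dlr => a b; lra.
have Bt t : `|t| < 2 -> B (x + t *: w).
  move=> t2; rewrite /B /= -addrA [_ *: w - _]addrC addrA.
  apply: (le_lt_trans (ler_normD _ _)); rewrite normrZ.
  have : `|t| * `|w| <= 2 * dl by apply: ler_pM => //; exact: ltW.
  move: (`|t| * `|w|) (`|x - xq|) dlr => a b; lra.
have Hs := HZ Bx wr; set Zc := Z x w in Hs.
pose K t := invmx (Y (x + t *: w)).
have Dx t k : is_derive (t : R) 1 (fun s => (x + s *: w) 0 k) (w^T k 0).
  have := line_derive x w 0 1 t k; rewrite scale1r.
  by have -> : (fun s => (x + (0 + s * 1) *: w) 0 k) = (fun s => (x + s *: w) 0 k)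
    by apply/funext => s; rewrite add0r mulr1.
have sI := msm_inv oB uY sY.
have comp2 (N : 'rV[R]_4 -> 'M[R]_4) (U : set 'rV[R]_4) : open U -> msm U N ->
    (forall t, `|t| < 2 -> U (x + t *: w)) -> exists Z1 Z2, forall t, `|t| < 2 ->
    mder t (fun t => N (x + t *: w)) (Z1 t) /\ mder t Z1 (Z2 t).
  move=> oU sN HU; pose N1 y := \sum_k w^T k 0 *: dmx k N y.
  have sN1 : msm U N1.
    move=> i j; apply: (sm_eq oU (f := fun y => \sum_k w^T k 0 * dmx k N y i j)).
      by move=> y _; rewrite /N1 summxE; apply: eq_bigr => k _; rewrite scalemxE.
    by apply: sm_sum => // k; apply: smM => //; [exact: sm_cst|exact: msm_dmx].
  exists (fun t => N1 (x + t *: w)), (fun t => \sum_k w^T k 0 *: dmx k N1 (x + t *: w)).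
  by move=> t t2; split; apply: mder_comp (HU t t2) (Dx t).
have cK : mC2 (fun s => K (sin s)).
  by have [Z1 [Z2 H]] := comp2 _ _ oB sI Bt; exact: mC2_sin H.
have cZ : mC2 (fun s => Zc (sin s)).
  pose N y := Gw (gx g phi) y w^T.
  have sN : msm (cod phi) N.
    move=> i j; apply: (sm_eq oO (f := fun y => \sum_k w^T k 0 * Gam (gx g phi) k y i j)).
      by move=> y _; rewrite /N /Gw summxE; apply: eq_bigr => k _; rewrite scalemxE.
    by apply: sm_sum => // k; apply: smM => //; [exact: sm_cst|exact: msm_Gam].
  have [N1 [N2 HN]] := comp2 _ _ oO sN (fun t t2 => ball_cod (Bt t t2)).
  apply: (@mC2_sin _ _ _ Zc (fun t => - (N (x + t *: w) *m Zc t))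
    (fun t => - (N1 t *m Zc t + N (x + t *: w) *m (- (N (x + t *: w) *m Zc t))))) => t t2.
  have D := (Hs.2 t t2).2; split; first exact: D.
  by apply: mderN; apply: mderM D; exact: (HN t t2).1.
pose P s := invmx Pq *m (K (sin s) *m (Zc (sin s) *m (Y x *m Pq))).
have x0 : x + 0 *: w = x by rewrite scale0r addr0.
have P0 : P 0 = 1%:M.
  rewrite /P /K sin0 x0; have -> : Zc 0 = 1%:M := Hs.1.
  by rewrite mul1mx mulKmx ?uY// mulVmx.
have sin1 (s : R) : `|sin s| <= 1 by rewrite ler_norml sin_le1 sin_geN1.
have lt1 (s : R) : `|s| <= 1 -> `|s| < 2 by move=> h; rewrite (le_lt_trans h)// ltr1n.
have Phol s : holonomy_group g phi0 p0 (P s).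
  have R1 := reachY Bx; rewrite -x0 in R1.
  have R2 := seg_reach_same Ap Hs n0 (sin1 s) R1.
  have Bs := Bt _ (lt1 _ (sin1 s)).
  have R3 := reachY Bs.
  have -> : P s = invmx (Y (x + sin s *: w) *m Pq) *m (Zc (sin s) *m invmx (Zc 0) *m (Y x *m Pq)).
    have -> : Zc 0 = 1%:M := Hs.1.
    have uYP : Y (x + sin s *: w) *m Pq \in unitmx by rewrite unitmx_mul uY.
    apply: (can_inj (mulKmx uYP)); rewrite mulKVmx// invmx1 mulmx1 /P /K.
    by rewrite -mulmxA mulKVmx// mulKVmx// uY.
  rewrite x0 in R2; case: R2 => _ R2 _ _; case: R3 => _ _ R3 _.
  exact: transport_trans R2 R3.
have cP : mC2 P.
  apply: mC2M; first exact: mC2_cst.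
  by apply: mC2M => //; apply: mC2M => //; exact: mC2_cst.
have [P1 [P2 HP]] := cP; have DP := (HP 0).1.
have Bl : P1 0 *m l0 = 0 by exact: (mC2_holonomy P0 Phol cP DP).
have two0 : `|0 : R| < 2 by rewrite normr0.
have Dsin0 : is_derive (0 : R) 1 sin 1 by have := is_derive_sin (0 : R); rewrite cos0.
have DY : mder 0 (fun s => Y (x + sin s *: w) *m Pq) (dl *: dmx c Y x *m Pq).
  have H := mder_comp oB sY (Bt 0 two0) (Dx 0).
  have H2 : mder (sin (0 : R)) (fun s => Y (x + s *: w)) (dl *: dmx c Y x).
    rewrite sin0; have := H; rewrite x0.
    have -> : \sum_k w^T k 0 *: dmx k Y x = dl *: dmx c Y x.
      rewrite (bigD1 c)//= big1 ?addr0 => [|k kc]; last first.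
        by rewrite !mxE eqxx /= (negbTE kc) mulr0 scale0r.
      by rewrite !mxE !eqxx mulr1.
    by [].
  have := mderM (mder_time H2 Dsin0) (mder_cst 0 Pq).
  by rewrite scale1r mulmx0 addr0.
have DN : mder 0 (fun s => Zc (sin s) *m (Y x *m Pq)) (- (dl *: Gam (gx g phi) c x *m (Y x *m Pq))).
  have H := (Hs.2 0 two0).2.
  have H2 : mder (sin (0 : R)) Zc (- (dl *: Gam (gx g phi) c x)).
    rewrite sin0; have := H; rewrite x0; have -> : Zc 0 = 1%:M := Hs.1.
    rewrite mulmx1 /Gw.
    have -> : \sum_k w^T k 0 *: Gam (gx g phi) k x = dl *: Gam (gx g phi) c x.
      rewrite (bigD1 c)//= big1 ?addr0 => [|k kc]; last first.
        by rewrite ![w^T _ _]mxE ![w _ _]mxE mxE eqxx /= (negbTE kc) mulr0 scale0r.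
      by rewrite ![w^T _ _]mxE ![w _ _]mxE mxE !eqxx mulr1.
    by [].
  have := mderM (mder_time H2 Dsin0) (mder_cst 0 (Y x *m Pq)).
  by rewrite scale1r mulmx0 addr0 mulNmx.
(* The broken path to the moved point equals the loop followed by the direct ray. Differentiating
   both sides at 0 and applying them to [l0], which the velocity of the loop kills, leaves the
   parallel equation. *)
have EN : (fun s => Zc (sin s) *m (Y x *m Pq)) = (fun s => (Y (x + sin s *: w) *m Pq) *m P s).
  apply/funext => s; rewrite /P /K -mulmxA mulKVmx// mulKVmx// uY//.
  exact: Bt _ (lt1 _ (sin1 s)).
rewrite EN in DN; have := mder_unique (mderM DY DP) DN.
rewrite P0 mulmx1 sin0 x0 => /(congr1 (mulmx^~ l0)).
rewrite mulmxDl -(mulmxA (Y x *m Pq)) Bl mulmx0 addr0 mulNmx -!mulmxA -!scalemxAl => H.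
have dlN : dl != 0 by rewrite lt0r_neq0.
by apply: (scalerI dlN); rewrite H scalerN.
Qed.

(** The whole frame is transported radially, so its Gram matrix stays [eta], but only its first
    vector is claimed to be parallel. *)
Lemma parallel_frame_at : exists (l : 'rV[R]_4 -> 'cV[R]_4) (T : 'rV[R]_4 -> 'M[R]_4),
  [/\ msm B l, (forall c x, B x -> dmx c l x = - (Gam (gx g phi) c x *m l x)),
      (forall x, B x -> (T x)^T *m gx g phi x *m T x = eta R)
    & (forall x, B x -> l x = T x *m delta_mx 0 0)].
Proof.
exists (fun x => Y x *m (Pq *m l0)), (fun x => Y x *m Pq *m T0); split.
- by apply: msmM => //; exact: msm_cst.
- move=> c x Bx; rewrite (dmxM c sY (msm_cst B (Pq *m l0)) Bx) dmx_cst mulmx0 addr0.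
  exact: transported_parallel.
- move=> x Bx; have [_ _ _ E] := reachY Bx.
  by rewrite trmx_mul -T0G -E /gx !mulmxA.
by move=> x Bx; rewrite l0T !mulmxA.
Qed.

End Field.

End Holonomy.

Section ParallelFrame.
Variables (R : realType) (M : topologicalType) (A : smooth_structure R M).
Variable g : lorentz_metric A.
Notation ec i := (delta_mx i 0 : 'cV[R]_4).

Lemma mx_entry_ec n m (B : 'M[R]_(n, m)) i j :
  B i j = ((delta_mx i 0 : 'cV_n)^T *m B *m (delta_mx j 0 : 'cV_m)) 0 0.
Proof. by rewrite trmx_delta -rowE -colE !mxE. Qed.

Lemma inner_sym (phi : chart R M) p (a b : 'cV[R]_4) : A phi -> chart_dom phi p ->
  inner g phi p a b = inner g phi p b a.
Proof.
move=> Ap dp; have E : (a^T *m g phi p *m b)^T = b^T *m g phi p *m a.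
  by rewrite !trmx_mul trmxK (metric_sym g Ap dp) mulmxA.
by rewrite /inner -E [RHS]mxE.
Qed.

Lemma frame_of_tetrad (phi : chart R M) p l n x y : A phi -> chart_dom phi p ->
  null_tetrad g phi p l n x y ->
  exists2 T : 'M[R]_4, T^T *m g phi p *m T = eta R & l = T *m ec 0.
Proof.
move=> Ap dp [_ [ln xx yy] [ll nn xy] [lx ly] [nx ny]].
pose v (j : 'I_4) := if j == 0 then l else if j == 1 then n else if j == 2 then x else y.
pose T : 'M[R]_4 := \matrix_(i, j) v j i 0.
have Te j : T *m ec j = v j by apply/matrixP => i k; rewrite ord1 mulmx_delta mxE.
exists T; last by rewrite Te.
have S a b := inner_sym a b Ap dp.
have E i j : (T^T *m g phi p *m T) i j = inner g phi p (v i) (v j).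
  by rewrite mx_entry_ec /inner -!Te trmx_mul !mulmxA.
apply/matrixP => i j; rewrite E.
move: i j; apply: forall4; apply: forall4; rewrite [RHS]mxE /v /= ?[inner g phi p n l]S
  ?[inner g phi p x l]S ?[inner g phi p y l]S ?[inner g phi p x n]S ?[inner g phi p y n]S
  ?[inner g phi p y x]S ?ln ?xx ?yy ?ll ?nn ?xy ?lx ?ly ?nx ?ny //.
Qed.

(** [l] is null and orthogonal to [x] and [y], so each of the three generators kills it. The
    holonomy type enters in this form. *)
Lemma wedge_kill (phi : chart R M) p (l n x y : 'cV[R]_4) (B : 'M[R]_4) :
  null_tetrad g phi p l n x y -> A phi -> chart_dom phi p ->
  B \in <<[:: wedge g phi p l x; wedge g phi p l y; wedge g phi p x y]>>%VS -> B *m l = 0.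
Proof.
move=> [_ _ [ll _ _] [lx ly] _] Ap dp HB.
have S a b := inner_sym a b Ap dp.
have I a : a^T *m (g phi p *m l) = (inner g phi p a l)%:M.
  by rewrite [LHS]mx11_scalar /inner mulmxA.
have W a b : wedge g phi p a b *m l = inner g phi p b l *: a - inner g phi p a l *: b.
  by rewrite /wedge -mulmxA mulmxBl -!mulmxA !I !mul_mx_scalar.
pose f : 'Hom('M[R]_4, 'cV[R]_4) := linfun (mulmxr l).
have : B \in lker f.
  apply: (subvP _ B HB); apply/span_subvP => C; rewrite !inE memv_ker lfunE /=.
  move=> /or3P[] /eqP ->; rewrite W ?[inner g phi p x l]S ?[inner g phi p y l]S ?ll ?lx ?ly;
    by rewrite !scale0r subrr.
by rewrite memv_ker lfunE /= => /eqP.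
Qed.

Lemma parallel_frame : holonomy_type_R11 g -> connected [set: M] ->
  forall (phi : chart R M) q, A phi -> chart_dom phi q ->
  exists (r : R) (l : 'rV[R]_4 -> 'cV[R]_4) (T : 'rV[R]_4 -> 'M[R]_4),
  let B := [set x : 'rV[R]_4 | `|x - chart_map phi q| < r] in [/\ 0 < r, B `<=` cod phi,
      msm B l, (forall c x, B x -> dmx c l x = - (Gam (gx g phi) c x *m l x))
    & forall x, B x -> (T x)^T *m gx g phi x *m T x = eta R /\ l x = T x *m ec 0].
Proof.
move=> [phi0 [p0 [l [n [x [y [A0 d0 tet hol]]]]]]] cM phi q Ap dq.
have [T0 T0G l0T] := frame_of_tetrad A0 d0 tet.
have hol0 B : holonomy_algebra g phi0 p0 B -> B *m l = 0.
  by move=> /hol HB; exact: (wedge_kill tet A0 d0 HB).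
have [chi [P H]] := reach_all g A0 d0 cM q.
have [Pq Hq] := reach_chart A0 d0 Ap dq H.
have [r [Z [r0 HZ sZ]]] := segment_flow (@cod_open _ _ phi) (gx_sm g Ap) (gx_unit g Ap) (cod_map dq).
have [ll [T [sl dl TG lT]]] := parallel_frame_at A0 d0 T0G l0T hol0 Ap dq Hq r0 HZ sZ.
exists r, ll, T; split=> //.
- exact: (ball_cod r0 HZ).
by move=> z Bz; split; [exact: TG|exact: lT].
Qed.

End ParallelFrame.

(** * Adapted coordinates *)

Section JacobiFields.
Variables (R : realType) (n : nat) (O : set 'rV[R]_n) (f : 'rV[R]_n -> 'rV[R]_n).
Variables (B : set 'rV[R]_n) (Phi : R -> 'rV[R]_n -> 'rV[R]_n).
Hypotheses (oO : open O) (oB : open B).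
Hypothesis smf : forall i, sm O (fun x => f x 0 i).
Hypothesis HF : is_flow O f B Phi.

(* The derivative of a flow is the unique solution of the linearised equation. *)
Lemma flow_jacobi x w (J : R -> 'rV[R]_n) i : B x -> J 0 = w ->
  (forall (t : R) j, 0 <= t <= 1 -> is_derive t 1 (fun s => J s 0 j)
     (\sum_k pt k (fun y => f y 0 j) (Phi t x) * J t 0 k)) ->
  is_derive x w (fun y => Phi 1 y 0 i) (J 1 0 i).
Proof.
move=> Bx J0 HJ.
have h1 : 0 <= (1 : R) <= 1 by apply/andP; split; [exact: ler01|exact: lexx].
apply: (is_derive_eq (flow_derive oO oB smf HF w i Bx h1)).
set Y := variation smf HF x w.
have [K K0 HK] := A_bounded smf HF Bx.
have nK : 0 <= n%:R * K by rewrite mulr_ge0// ltW.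
have [C C0 G] := @gronwall R n _ 1 nK ler01.
pose dD (t : R) j := \sum_k pt k (fun y => f y 0 j) (Phi t x) * (Y t 0 k - J t 0 k).
have := G (fun t => Y t - J t) dD 0 (lexx _) _ _ 1 h1.
have Y0 : Y 0 = w by exact: variation0.
rewrite Y0 J0 subrr normr0 addr0 mulr0 => H.
suff /eqP : Y 1 - J 1 = 0.
  by rewrite subr_eq0 => /eqP ->.
apply/eqP; rewrite -normr_le0; apply: H.
- move=> t j t01.
  have -> : (fun s => (Y s - J s) 0 j) = (fun s => Y s 0 j - J s 0 j).
    by apply/funext => s; rewrite !mxE.
  apply: (is_derive_eq (is_deriveB (variation_der smf HF w j Bx t01) (HJ t j t01))).
  by rewrite /dD -sumrB; apply: eq_bigr => k _; rewrite mulrBr.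
move=> t j t01; rewrite addr0 /dD -mulrA.
apply: norm_sum_le => [|k|k]; first exact: ltW.
  by have := HK t j k; rewrite clamp01_id.
by have := row_coord_le (Y t - J t) k; rewrite !mxE.
Qed.

End JacobiFields.

Section DirectionalChain.
Variable R : realType.

Lemma sm_dir n (O : set 'rV[R]_n) f x v : open O -> sm O f -> O x ->
  is_derive x v f (\sum_i pt i f x * v 0 i).
Proof.
move=> oO sf Ox; apply: (chain_map (h := id) oO (sf 1%N) Ox) => j.
exact: coord_is_derive.
Qed.

Lemma chain_dir n m (O : set 'rV[R]_m) (h : 'rV[R]_n -> 'rV[R]_m) f x v (dh : 'rV[R]_m) l :
  open O -> sm O f -> O (h x) ->
  (forall j, is_derive x v (fun y => h y 0 j) (dh 0 j)) ->
  is_derive (h x) dh f l -> is_derive x v (fun y => f (h y)) l.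
Proof.
move=> oO sf Oh Hh Hl.
have H := chain_map oO (sf 1%N) Oh Hh.
by rewrite (is_derive_unique Hl (sm_dir dh oO sf Oh)).
Qed.

End DirectionalChain.

(** * The commuting null fields *)

Section NullFields.
Variables (R : realType) (O : set 'rV[R]_4) (G : 'rV[R]_4 -> 'M[R]_4).
Notation ec i := (delta_mx i 0 : 'cV[R]_4).
Hypothesis oO : open O.
Hypothesis sG : msm O G.
Hypothesis Gs : forall x, O x -> (G x)^T = G x.
Hypothesis uG : forall x, O x -> G x \in unitmx.
Variables (l s : 'rV[R]_4 -> 'cV[R]_4) (u : 'rV[R]_4 -> R).
Hypothesis sl : msm O l.
Hypothesis dl : forall c x, O x -> dmx c l x = - (Gam G c x *m l x).
Hypothesis ll : forall x, O x -> ((l x)^T *m G x *m l x) 0 0 = 0.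
Hypothesis su : sm O u.
Hypothesis u0 : forall x, O x -> u x != 0.
Hypothesis du : forall b x, O x -> pt b u x = (G x *m l x) b 0.
Hypothesis ss : msm O s.
Hypothesis ds : forall b x, O x -> dmx b s x = ec b - Gam G b x *m s x.
Hypothesis sl_u : forall x, O x -> ((s x)^T *m G x *m l x) 0 0 = u x.

Definition vfun x : R := ((s x)^T *m G x *m s x) 0 0 / (2 * u x).
(** Solves [s = u n + v l]; then [s . s = 2 u v] and [s . l = u] make [n] null with [l . n = 1]. *)
Definition nvec x : 'cV[R]_4 := (u x)^-1 *: (s x - vfun x *: l x).

Lemma dotC x (a b : 'cV[R]_4) : O x -> (a^T *m G x *m b) 0 0 = (b^T *m G x *m a) 0 0.
Proof.
move=> Ox; have E : (a^T *m G x *m b)^T = b^T *m G x *m a.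
  by rewrite !trmx_mul trmxK Gs// mulmxA.
by rewrite -E [RHS]mxE.
Qed.

Lemma sm_ss : sm O (fun x => ((s x)^T *m G x *m s x) 0 0).
Proof. by apply: msmM => //; apply: msmM => //; exact: msmT. Qed.

Lemma sm_v : sm O vfun.
Proof.
apply: (smM oO sm_ss); apply: smV => //; last exact: (smM oO (sm_cst O 2) su).
by move=> x Ox; rewrite mulf_neq0 ?u0// pnatr_eq0.
Qed.

Lemma sm_n : msm O nvec.
Proof.
apply: msmZ => //; first exact: smV.
by apply: msmD => //; apply: msmN => //; apply: msmZ => //; exact: sm_v.
Qed.

Lemma pt_ss b x : O x -> pt b (fun x => ((s x)^T *m G x *m s x) 0 0) x = 2 * (G x *m s x) b 0.
Proof.
move=> Ox.
have sT : msm O (fun y => (s y)^T) by exact: msmT.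
have sTG : msm O (fun y => (s y)^T *m G y) by exact: msmM.
have E : dmx b (fun x => (s x)^T *m G x *m s x) x = 2 *: ((ec b)^T *m (G x *m s x)).
  rewrite (dmxM b sTG ss Ox) (dmxM b sT sG Ox) dmxT ds// (dG oO Gs uG b Ox).
  have C : (s x)^T *m G x *m ec b = (ec b)^T *m (G x *m s x).
    rewrite [LHS]mx11_scalar [RHS]mx11_scalar; congr (_%:M).
    by rewrite mulmxA dotC.
  rewrite mulmxBr C; move: C => _; rewrite scaler_nat mulr2n.
  by move: (ec b) (G x) (s x); Gamgen => *; mxring.
have := congr1 (fun A : 'M[R]_1 => A 0 0) E.
by rewrite [LHS]mxE scalemxE ecT_entry.
Qed.

Lemma dv b x : O x -> pt b vfun x = (G x *m nvec x) b 0.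
Proof.
move=> Ox.
have E y : O y -> ((s y)^T *m G y *m s y) 0 0 = 2 * (u y * vfun y).
  by move=> Oy; rewrite /vfun; field; rewrite u0.
have suv : sm O (fun y => u y * vfun y) by exact: (smM oO su sm_v).
have := pt_ss b Ox; rewrite (pt_eq b oO Ox E) (ptM b (sm_cst O 2) suv Ox).
rewrite (ptM b su sm_v Ox) du//.
have -> : pt b (fun=> 2 : R) x = 0.
  exact: (is_derive_pt (is_derive_cst (2 : R) x (delta_mx 0 b))).
rewrite mul0r add0r => /(mulfI (lt0r_neq0 (ltr0Sn R 1))) H.
rewrite /nvec -scalemxAr mulmxBr -scalemxAr !scalemxE addmxE oppmxE scalemxE -H.
by field; exact: u0.
Qed.

Lemma dot_n x (a : 'cV[R]_4) : O x -> (a^T *m G x *m nvec x) 0 0 =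
  ((a^T *m G x *m s x) 0 0 - vfun x * (a^T *m G x *m l x) 0 0) / u x.
Proof.
by move=> Ox; rewrite /nvec -scalemxAr mulmxBr -scalemxAr scalemxE addmxE oppmxE scalemxE mulrC.
Qed.

Lemma ln1 x : O x -> ((l x)^T *m G x *m nvec x) 0 0 = 1.
Proof. by move=> Ox; rewrite dot_n// ll// (dotC (l x))// sl_u// mulr0 subr0 divff// u0. Qed.

Lemma sn_v x : O x -> ((s x)^T *m G x *m nvec x) 0 0 = vfun x.
Proof.
move=> Ox; rewrite dot_n// sl_u//.
have -> : ((s x)^T *m G x *m s x) 0 0 = 2 * (u x * vfun x).
  by rewrite /vfun; field; rewrite u0.
by field; exact: u0.
Qed.

Lemma nn0 x : O x -> ((nvec x)^T *m G x *m nvec x) 0 0 = 0.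
Proof.
move=> Ox; rewrite dot_n// (dotC (nvec x) (s x))// (dotC (nvec x) (l x))// sn_v// ln1//.
by rewrite mulr1 subrr mul0r.
Qed.

Lemma s_nl x : O x -> s x = u x *: nvec x + vfun x *: l x.
Proof. by move=> Ox; rewrite /nvec scalerA divff ?u0// scale1r subrK. Qed.

(** Differentiating [s = u n + v l] and solving for [nabla n] gives the projection orthogonal to [l]
    and [n], divided by [u]. *)
Lemma dn c x : O x -> dmx c nvec x =
  (u x)^-1 *: (ec c - (G x *m nvec x) c 0 *: l x - (G x *m l x) c 0 *: nvec x)
  - Gam G c x *m nvec x.
Proof.
move=> Ox.
have s1 : msm O (fun y => u y *: nvec y) by apply: msmZ => //; exact: sm_n.
have s2 : msm O (fun y => vfun y *: l y) by apply: msmZ => //; exact: sm_v.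
have := dmx_eq c oO Ox s_nl; rewrite (dmxD c s1 s2 Ox) (dmxZ c su sm_n Ox) (dmxZ c sm_v sl Ox).
rewrite ds// du// dv// dl// (s_nl Ox) => H.
apply: (scalerI (u0 Ox)); rewrite scalerBr scalerA divff ?u0// scale1r.
apply: (mx_lincomb (esym H)).
move: ((G x *m nvec x) c 0) ((G x *m l x) c 0) => Gn Gl.
by move: (nvec x) (vfun x) (l x) (u x); Gamgen => *; mxring.
Qed.

Definition Dir (X : 'rV[R]_4 -> 'cV[R]_4) x (w : 'cV[R]_4) := \sum_c w c 0 *: dmx c X x.

Lemma Gw_sym x (a b : 'cV[R]_4) : O x -> Gw G x a *m b = Gw G x b *m a.
Proof.
move=> Ox; rewrite /Gw !mulmx_suml.
transitivity (\sum_c \sum_d (a c 0 * b d 0) *: (Gam G c x *m ec d)).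
  apply: eq_bigr => c _; rewrite -{1}(sum_ec b) mulmx_sumr; apply: eq_bigr => d _.
  by rewrite -scalemxAl -scalemxAr scalerA.
rewrite exchange_big /=; apply: eq_bigr => d _; rewrite -{2}(sum_ec a) mulmx_sumr.
apply: eq_bigr => c _; rewrite -scalemxAl -scalemxAr scalerA mulrC; congr (_ *: _).
exact: (GamC oO Gs).
Qed.

Lemma Dir_l x w : O x -> Dir l x w = - (Gw G x w *m l x).
Proof.
move=> Ox; rewrite /Dir /Gw mulmx_suml -sumrN; apply: eq_bigr => c _.
by rewrite dl// scalerN scalemxAl.
Qed.

Lemma dot_sum x (a w : 'cV[R]_4) : O x -> \sum_c w c 0 * (G x *m a) c 0 = (w^T *m G x *m a) 0 0.
Proof. by move=> Ox; rewrite -mulmxA [RHS]mxE; apply: eq_bigr => c _; rewrite [w^T _ _]mxE. Qed.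

Lemma Dir_n x w : O x -> Dir nvec x w = (u x)^-1 *: (w - (w^T *m G x *m nvec x) 0 0 *: l x
   - (w^T *m G x *m l x) 0 0 *: nvec x) - Gw G x w *m nvec x.
Proof.
move=> Ox; rewrite /Dir /Gw mulmx_suml -(dot_sum (nvec x) w Ox) -(dot_sum (l x) w Ox).
rewrite -{2}(sum_ec w) !scaler_suml -!sumrB scaler_sumr -sumrB; apply: eq_bigr => c _.
rewrite dn// scalerBr -scalemxAl; congr (_ - _).
move: ((G x *m nvec x) c 0) ((G x *m l x) c 0) (w c 0) (u x)^-1 => Gn Gl wc ui.
by move: (nvec x) (l x) => n l'; mxring.
Qed.

(** The covariant derivatives of [n] along [l] and of [l] along [n] both vanish; as the connection
    is symmetric, the plain directional derivatives agree, that is, the Lie bracket is zero. *)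
Lemma bracket0 x : O x -> Dir nvec x (l x) = Dir l x (nvec x).
Proof.
move=> Ox; rewrite Dir_n// Dir_l// ln1// ll// scale1r scale0r subr0 subrr scaler0 sub0r.
by rewrite Gw_sym.
Qed.

End NullFields.

Lemma open_preimage_sm (R : realType) n m (O : set 'rV[R]_n) (V : set 'rV[R]_m)
    (h : 'rV[R]_n -> 'rV[R]_m) : open O -> open V -> (forall i, sm O (fun x => h x 0 i)) ->
  open [set x | O x /\ V (h x)].
Proof.
move=> oO oV sh; rewrite openE => x [Ox Vx]; rewrite /interior.
have h1 : nbhs x O by apply: open_nbhs_nbhs.
have h2 : nbhs x (h @^-1` V).
  have ch : {for x, continuous h}.
    by apply: row_continuous => j; exact: (Ck_cont (sh j 0%N) Ox).
  by apply: ch; apply: open_nbhs_nbhs.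
by apply: filterS (filterI h1 h2) => z [].
Qed.

(** * Coordinates that straighten two commuting fields *)

Section AdaptedCoordinates.
Variables (R : realType) (O : set 'rV[R]_4) (l n : 'rV[R]_4 -> 'cV[R]_4).
Notation ec i := (delta_mx i 0 : 'cV[R]_4).
Hypothesis oO : open O.
Hypothesis sl : msm O l.
Hypothesis sn : msm O n.
Hypothesis bracket : forall x, O x -> Dir n x (l x) = Dir l x (n x).

Lemma DirD X x a b : Dir X x (a + b) = Dir X x a + Dir X x b :> 'cV[R]_4.
Proof. by rewrite /Dir -big_split /=; apply: eq_bigr => c _; rewrite addmxE scalerDl. Qed.

Lemma DirZ X x k a : Dir X x (k *: a) = k *: Dir X x a :> 'cV[R]_4.
Proof. by rewrite /Dir scaler_sumr; apply: eq_bigr => c _; rewrite scalemxE scalerA. Qed.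

Let E := [set y : 'rV[R]_(4 + 2) | O (lsubmx y)].
Let oE : open E := @open_lsubmx R 4 2 O oO.
Let al (y : 'rV[R]_(4 + 2)) : R := rsubmx y 0 0.
Let be (y : 'rV[R]_(4 + 2)) : R := rsubmx y 0 1.
(** The last two coordinates of the state are frozen coefficients, so that one flow follows every
    combination of [n] and [l]. *)
Let F (y : 'rV[R]_(4 + 2)) : 'rV[R]_(4 + 2) :=
  row_mx (al y *: n (lsubmx y) + be y *: l (lsubmx y))^T 0.

Let sr j : sm E (fun y => rsubmx y 0 j).
Proof.
apply: (sm_eq oE (f := fun y : 'rV[R]_(4 + 2) => y 0 (rshift 4 j))).
  by move=> y _; rewrite !mxE.
by move=> k; exact: Ck_coord.
Qed.

Let sF i : sm E (fun y => F y 0 i).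
Proof.
case: (split_ordP i) => j ->; last first.
  by apply: sm_eq (sm_cst E 0) => // x _; rewrite /F row_mxEr mxE.
apply: (sm_eq oE (f := fun y => al y * n (lsubmx y) j 0 + be y * l (lsubmx y) j 0)).
  by move=> y _; rewrite /F row_mxEl [RHS]mxE addmxE !scalemxE.
have s1 : sm E (fun y => n (lsubmx y) j 0) by move=> k; exact: (@Ck_lsubmx R 4 2 k _ _ oO (sn j 0 k)).
have s2 : sm E (fun y => l (lsubmx y) j 0) by move=> k; exact: (@Ck_lsubmx R 4 2 k _ _ oO (sl j 0 k)).
exact: (smD oE (smM oE (sr 0) s1) (smM oE (sr 1) s2)).
Qed.

Let dirF y (w : 'rV[R]_(4 + 2)) i : E y ->
  is_derive y w (fun y => F y 0 (lshift 2 i))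
    ((al y *: Dir n (lsubmx y) (lsubmx w)^T + be y *: Dir l (lsubmx y) (lsubmx w)^T
      + (al w *: n (lsubmx y) + be w *: l (lsubmx y))) i 0).
Proof.
move=> Ey; apply: (iffRL (is_derive_dir _ _ _ _)).
have -> : (fun s : R => F (y + s *: w) 0 (lshift 2 i)) = (fun s : R =>
    ((al y + s * al w) *: n (lsubmx y + s *: lsubmx w) +
     (be y + s * be w) *: l (lsubmx y + s *: lsubmx w)) i 0).
  apply/funext => s; rewrite /F row_mxEl [LHS]mxE.
  have -> : lsubmx (y + s *: w) = lsubmx y + s *: lsubmx w by apply/matrixP => a b; rewrite !mxE.
  by rewrite /al /be ![rsubmx (y + _) _ _]mxE !addmxE !scalemxE ![rsubmx _ _ _]mxE.
have Dx k : is_derive (0 : R) 1 (fun s => (lsubmx y + s *: lsubmx w) 0 k) ((lsubmx w)^T k 0).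
  have := line_derive (lsubmx y) (lsubmx w) 0 1 0 k; rewrite scale1r.
  by have -> : (fun s : R => (lsubmx y + (0 + s * 1) *: lsubmx w) 0 k) =
    (fun s => (lsubmx y + s *: lsubmx w) 0 k) by apply/funext => s; rewrite add0r mulr1.
have O0 : O (lsubmx y + 0 *: lsubmx w) by rewrite scale0r addr0.
have D1 := mderZ (affine_derive (al y) (al w) 0) (mder_comp oO sn O0 Dx).
have D2 := mderZ (affine_derive (be y) (be w) 0) (mder_comp oO sl O0 Dx).
apply: (is_derive_eq (mderD D1 D2 i 0)).
rewrite !mul0r !addr0 scale0r addr0 -!/(Dir _ _ _); congr (fun_of_matrix _ i 0).
move: (Dir n _ _) (Dir l _ _) => v1 v2; move: (n _) (l _) => v3 v4; mxring.
Qed.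

Lemma adapted_flow_exists x2 : O x2 -> exists (eps r : R) Phi, [/\ 0 < eps, 0 < r &
  is_flow E (fun y => eps *: F y) [set y | `|y - row_mx x2 0| < r] Phi].
Proof.
move=> Ox2; have Ey : E (row_mx x2 0) by rewrite /E /= row_mxKl.
have [eps [r [Phi [eps0 r0 _ _ HF]]]] := local_flow_is_flow oE Ey sF.
by exists eps, r, Phi.
Qed.

Variables (x2 : 'rV[R]_4) (eps r : R) (Phi : R -> 'rV[R]_(4 + 2) -> 'rV[R]_(4 + 2)).
Let y2 : 'rV[R]_(4 + 2) := row_mx x2 0.
Let B := [set y : 'rV[R]_(4 + 2) | `|y - y2| < r].
Let oB : open B := @open_nbhd_ball R (4 + 2) y2 r.
Hypothesis eps0 : 0 < eps.
Hypothesis HF : is_flow E (fun y => eps *: F y) B Phi.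

Let epsN : eps != 0. Proof. exact: lt0r_neq0. Qed.

Let sFe i : sm E (fun y => (eps *: F y) 0 i).
Proof. by apply: (sm_eq oE _ (smM oE (sm_cst E eps) (sF i))) => x _; rewrite scalemxE. Qed.

Let between01 (t s : R) : 0 <= t <= 1 -> Num.min 0 t <= s <= Num.max 0 t -> 0 <= s <= 1.
Proof.
move=> /andP[t0 t1]; rewrite (min_idPl t0) (max_idPr t0) => /andP[-> st] /=.
exact: le_trans t1.
Qed.

Let flowE y t : B y -> 0 <= t <= 1 -> E (Phi t y).
Proof. by move=> By t01; have [_ H _] := HF; exact: (H y t By t01).1. Qed.

Let flow_ab y t : B y -> 0 <= t <= 1 -> rsubmx (Phi t y) = rsubmx y.
Proof.
move=> By t01; have [P0 H _] := HF; apply/matrixP => i j; rewrite ord1 !mxE.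
transitivity (Phi 0 y 0 (rshift 4 j)); last by rewrite P0.
symmetry; apply: (@zero_derivative_eq R (fun s => Phi s y 0 (rshift 4 j)) 0 t) => s /(between01 t01) s01.
apply: (is_derive_eq ((H y s By s01).2 (rshift 4 j))).
by rewrite scalemxE /F row_mxEr mxE mulr0.
Qed.

Let flow_q y (t : R) i : B y -> 0 <= t <= 1 -> is_derive t 1 (fun s => lsubmx (Phi s y) 0 i)
  ((eps *: (al y *: n (lsubmx (Phi t y)) + be y *: l (lsubmx (Phi t y)))) i 0).
Proof.
move=> By t01; have [P0 H _] := HF.
have -> : (fun s => lsubmx (Phi s y) 0 i) = (fun s => Phi s y 0 (lshift 2 i)).
  by apply/funext => s; rewrite mxE.
apply: (is_derive_eq ((H y t By t01).2 (lshift 2 i))).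
by rewrite !scalemxE /F row_mxEl /al /be (flow_ab By t01) mxE.
Qed.

(* [F] is affine in [(al, be)], so that [(z, ab)] is a variation of the flow. *)
Let jacobi y (z : R -> 'cV[R]_4) (ab : 'rV[R]_2) i : B y ->
  (forall t : R, 0 <= t <= 1 -> mder t z (eps *: (al y *: Dir n (lsubmx (Phi t y)) (z t)
     + be y *: Dir l (lsubmx (Phi t y)) (z t)
     + (ab 0 0 *: n (lsubmx (Phi t y)) + ab 0 1 *: l (lsubmx (Phi t y)))))) ->
  is_derive y (row_mx (z 0)^T ab) (fun y => Phi 1 y 0 (lshift 2 i)) (z 1 i 0).
Proof.
move=> By Hz.
have -> : z 1 i 0 = (row_mx (z 1)^T ab) 0 (lshift 2 i) by rewrite row_mxEl mxE.
apply: (flow_jacobi oE oB sFe HF (J := fun t => row_mx (z t)^T ab) (lshift 2 i) By) => // t j t01.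
have Ey := flowE By t01.
case: (split_ordP j) => k ->.
  have -> : (fun s => row_mx (z s)^T ab 0 (lshift 2 k)) = (fun s => z s k 0).
    by apply/funext => s; rewrite row_mxEl mxE.
  apply: (is_derive_eq (Hz t t01 k 0)).
  have D0 := dirF (row_mx (z t)^T ab) k Ey.
  have D1 := is_deriveZ eps D0.
  have D2 := sm_dir (row_mx (z t)^T ab) oE (sFe (lshift 2 k)) Ey.
  have D3 : is_derive (Phi t y) (row_mx (z t)^T ab) (fun y => (eps *: F y) 0 (lshift 2 k))
     (eps *: ((al (Phi t y) *: Dir n (lsubmx (Phi t y)) (lsubmx (row_mx (z t)^T ab))^T
       + be (Phi t y) *: Dir l (lsubmx (Phi t y)) (lsubmx (row_mx (z t)^T ab))^T
      + (al (row_mx (z t)^T ab) *: n (lsubmx (Phi t y)) + be (row_mx (z t)^T ab) *: l (lsubmx (Phi t y)))) k 0)).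
    have -> : (fun y => (eps *: F y) 0 (lshift 2 k)) = (fun y => eps *: F y 0 (lshift 2 k)).
      by apply/funext => s; rewrite scalemxE.
    exact: D1.
  rewrite -(is_derive_unique D3 D2) scalemxE /al /be row_mxKl row_mxKr trmxK (flow_ab By t01).
  by [].
have -> : (fun s => row_mx (z s)^T ab 0 (rshift 4 k)) = (fun=> ab 0 k).
  by apply/funext => s; rewrite row_mxEr.
apply: (is_derive_eq (is_derive_cst (ab 0 k) (t : R) 1)).
have D2 := sm_dir (row_mx (z t)^T ab) oE (sFe (rshift 4 k)) Ey.
have D3 : is_derive (Phi t y) (row_mx (z t)^T ab) (fun y => (eps *: F y) 0 (rshift 4 k)) 0.
  have -> : (fun y => (eps *: F y) 0 (rshift 4 k)) = (fun=> 0).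
    by apply/funext => s; rewrite scalemxE /F row_mxEr mxE mulr0.
  exact: is_derive_cst.
exact: (is_derive_unique D3 D2).
Qed.

Variables (u v : 'rV[R]_4 -> R).
Hypothesis su : sm O u.
Hypothesis sv : sm O v.
Notation dd f x w := (\sum_c pt c f x * w c 0).
Hypothesis ul : forall x, O x -> dd u x (l x) = 0.
Hypothesis un : forall x, O x -> dd u x (n x) = 1.
Hypothesis vl : forall x, O x -> dd v x (l x) = 1.
Hypothesis vn : forall x, O x -> dd v x (n x) = 0.

(** Along [n] the function [u] grows at rate 1 while [v] is constant, and conversely along [l]. With
    these coefficients the time-one map takes [q] to the slice where [u] and [v] have their values
    at [x2]; [X] is this projection, constant along both fields. *)
Let ab q : 'rV[R]_2 := \row_j (if j == 0 then (u x2 - u q) / eps else (v x2 - v q) / eps).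
Let h q : 'rV[R]_(4 + 2) := row_mx q (ab q).
Let U := [set q | O q /\ B (h q)].
Let X q := lsubmx (Phi 1 (h q)).

Let sab j : sm O (fun q => ab q 0 j).
Proof.
apply: (sm_eq oO (f := fun q => if j == 0 then (u x2 - u q) / eps else (v x2 - v q) / eps)).
  by move=> q _; rewrite mxE.
case: (j == 0); apply: (smM oO _ (sm_cst O _)); exact: (smB oO (sm_cst O _)).
Qed.

Let sh i : sm O (fun q => h q 0 i).
Proof.
case: (split_ordP i) => j ->.
  apply: (sm_eq oO (f := fun q : 'rV[R]_4 => q 0 j)); first by move=> q _; rewrite /h row_mxEl.
  by move=> k; exact: Ck_coord.
by apply: sm_eq (sab j) => // q _; rewrite /h row_mxEr.
Qed.

Let oU : open U. Proof. exact: open_preimage_sm. Qed.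

Let sX i : sm U (fun q => X q 0 i).
Proof.
apply: (sm_eq oU (f := fun q => Phi 1 (h q) 0 (lshift 2 i))); first by move=> q _; rewrite mxE.
have h1 : 0 <= (1 : R) <= 1 by apply/andP; split; [exact: ler01|exact: lexx].
move=> k; apply: (Ck_comp oU oB _ _ (flow_Ck k oE oB sFe HF (lshift 2 i) h1)).
  by move=> j; apply: Ck_sub (sh j k) => q [].
by move=> q [].
Qed.

Let dX q (z : R -> 'cV[R]_4) i : U q ->
  (forall t : R, 0 <= t <= 1 -> mder t z (eps *: (al (h q) *: Dir n (lsubmx (Phi t (h q))) (z t)
     + be (h q) *: Dir l (lsubmx (Phi t (h q))) (z t)
     + ((- dd u q (z 0) / eps) *: n (lsubmx (Phi t (h q)))
       + (- dd v q (z 0) / eps) *: l (lsubmx (Phi t (h q))))))) ->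
  is_derive q (z 0)^T (fun q => X q 0 i) (z 1 i 0).
Proof.
move=> [Oq Bq] Hz.
have h1 : 0 <= (1 : R) <= 1 by apply/andP; split; [exact: ler01|exact: lexx].
have -> : (fun q => X q 0 i) = (fun q => Phi 1 (h q) 0 (lshift 2 i)).
  by apply/funext => s; rewrite mxE.
pose ab' : 'rV[R]_2 := \row_j (if j == 0 then - dd u q (z 0) / eps else - dd v q (z 0) / eps).
have sPhi : sm B (fun y => Phi 1 y 0 (lshift 2 i)).
  by move=> k; exact: (flow_Ck k oE oB sFe HF (lshift 2 i) h1).
apply: (@chain_dir R _ _ B h (fun y => Phi 1 y 0 (lshift 2 i)) q (z 0)^T
  (row_mx (z 0)^T ab') _ oB sPhi Bq).
  move=> j; case: (split_ordP j) => k ->.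
    have -> : (fun y => h y 0 (lshift 2 k)) = (fun y : 'rV[R]_4 => y 0 k).
      by apply/funext => s; rewrite /h row_mxEl.
    by rewrite row_mxEl; exact: coord_is_derive.
  have dirf f : sm O f -> is_derive q (z 0)^T (fun y => (f x2 - f y) / eps) (- dd f q (z 0) / eps).
    move=> sf; have D : is_derive q (z 0)^T f (dd f q (z 0)).
      apply: (is_derive_eq (sm_dir (z 0)^T oO sf Oq)).
      by apply: eq_bigr => c _; rewrite mxE.
    have D2 := is_deriveZ eps^-1 (is_deriveB (is_derive_cst (f x2) q (z 0)^T) D).
    have -> : (fun y => (f x2 - f y) / eps) = (fun y => eps^-1 *: (f x2 - f y)).
      by apply/funext => y; rewrite /GRing.scale /= mulrC.
    apply: (is_derive_eq D2); by rewrite sub0r /GRing.scale /= mulrC.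
  have -> : (fun y => h y 0 (rshift 4 k)) = (fun y => if k == 0 then (u x2 - u y) / eps else (v x2 - v y) / eps).
    by apply/funext => s; rewrite /h row_mxEr mxE.
  by rewrite row_mxEr [ab' _ _]mxE; case: (k == 0); exact: dirf.
by apply: jacobi => // t t01; rewrite ![ab' _ _]mxE /=; exact: Hz.
Qed.

Let Qder q (t : R) : U q -> 0 <= t <= 1 -> forall Y : 'rV[R]_4 -> 'cV[R]_4, msm O Y ->
  mder t (fun s => Y (lsubmx (Phi s (h q)))) (eps *: (al (h q) *: Dir Y (lsubmx (Phi t (h q)))
    (n (lsubmx (Phi t (h q)))) + be (h q) *: Dir Y (lsubmx (Phi t (h q))) (l (lsubmx (Phi t (h q)))))).
Proof.
move=> [Oq Bq] t01 Y sY.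
have := mder_comp oO sY (flowE Bq t01) (fun i => flow_q i Bq t01).
by rewrite -/(Dir _ _ _) DirZ DirD !DirZ.
Qed.

Let scale_down q (Y : 'rV[R]_4 -> 'cV[R]_4) (t : R) : U q -> 0 <= t <= 1 -> msm O Y ->
  mder t (fun s => (1 - s) *: Y (lsubmx (Phi s (h q))))
   ((-1) *: Y (lsubmx (Phi t (h q))) + (1 - t) *: (eps *: (al (h q) *: Dir Y (lsubmx (Phi t (h q)))
    (n (lsubmx (Phi t (h q)))) + be (h q) *: Dir Y (lsubmx (Phi t (h q))) (l (lsubmx (Phi t (h q))))))).
Proof.
move=> Uq t01 sY; apply: (mderZ _ (Qder Uq t01 sY)).
have := affine_derive 1 (-1) t.
by have -> : (fun t : R => 1 + t * -1) = (fun s => 1 - s) by apply/funext => s; rewrite mulrN1.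
Qed.

Let Phi0 q : U q -> lsubmx (Phi 0 (h q)) = q.
Proof. by move=> [_ Bq]; have [P0 _ _] := HF; rewrite P0// /h row_mxKl. Qed.

(** Because the fields commute, [(1 - s) l] solves the linearised flow equation, its term [- l]
    coming from the variation of the coefficients. It starts at [l] and ends at 0. *)
Let dX_l q i : U q -> is_derive q (l q)^T (fun q => X q 0 i) 0.
Proof.
move=> Uq; pose z (s : R) : 'cV[R]_4 := (1 - s) *: l (lsubmx (Phi s (h q))).
have z0 : z 0 = l q by rewrite /z subr0 scale1r Phi0.
have z1 : z 1 i 0 = 0 by rewrite /z subrr scale0r mxE.
have D := @dX q z i Uq; rewrite z1 z0 in D; apply: D => t t01.
apply: (mder_eq (scale_down Uq t01 sl)) => //.
rewrite (ul Uq.1) (vl Uq.1) /z !DirZ oppr0 mul0r scale0r add0r.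
rewrite (bracket (flowE Uq.2 t01)).
move: (Dir l _ _) => v1; move: (Dir l _ _) => v2; move: (l _) => v3.
apply/matrixP => a b; rewrite !(addmxE, scalemxE); field.
exact: epsN.
Qed.

Let dX_n q i : U q -> is_derive q (n q)^T (fun q => X q 0 i) 0.
Proof.
move=> Uq; pose z (s : R) : 'cV[R]_4 := (1 - s) *: n (lsubmx (Phi s (h q))).
have z0 : z 0 = n q by rewrite /z subr0 scale1r Phi0.
have z1 : z 1 i 0 = 0 by rewrite /z subrr scale0r mxE.
have D := @dX q z i Uq; rewrite z1 z0 in D; apply: D => t t01.
apply: (mder_eq (scale_down Uq t01 sn)) => //.
rewrite (un Uq.1) (vn Uq.1) /z !DirZ oppr0 mul0r scale0r addr0.
rewrite (bracket (flowE Uq.2 t01)).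
move: (Dir l _ _) => v1; move: (Dir n _ _) => v2; move: (n _) => v3.
apply/matrixP => a b; rewrite !(addmxE, scalemxE); field.
exact: epsN.
Qed.

Hypothesis r0 : 0 < r.
Hypothesis Ox2 : O x2.

Let ab2 : ab x2 = 0.
Proof. by apply/matrixP => i j; rewrite !mxE !subrr !mul0r if_same. Qed.

Let Ux2 : U x2.
Proof. by split=> //; rewrite /B /= /h ab2 subrr normr0. Qed.

(** At [x2] the coefficients vanish and the flow stands still, so vectors tangent to the slice are
    left unchanged. *)
Let dX_base (w : 'cV[R]_4) i : dd u x2 w = 0 -> dd v x2 w = 0 ->
  is_derive x2 w^T (fun q => X q 0 i) (w i 0).
Proof.
move=> uw vw; apply: (dX (z := fun=> w) i Ux2) => t t01.
apply: (mder_eq (mder_cst t w)) => //.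
rewrite uw vw oppr0 !mul0r /al /be /h row_mxKr ab2 !mxE !scale0r !addr0 scaler0 //.
Qed.

Variables (w2 w3 : 'cV[R]_4) (om2 om3 : 'rV[R]_4).
Hypothesis uw2 : dd u x2 w2 = 0.
Hypothesis uw3 : dd u x2 w3 = 0.
Hypothesis vw2 : dd v x2 w2 = 0.
Hypothesis vw3 : dd v x2 w3 = 0.
Hypothesis om22 : (om2 *m w2) 0 0 = 1.
Hypothesis om23 : (om2 *m w3) 0 0 = 0.
Hypothesis om32 : (om3 *m w2) 0 0 = 0.
Hypothesis om33 : (om3 *m w3) 0 0 = 1.

(** Two linear forms of the projection complete [u] and [v]; they are dual to [w2] and [w3]. *)
Let zeta q : 'rV[R]_4 := \row_a (if a == 0 then u q else if a == 1 then v q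
  else \sum_i (if a == 2 then om2 else om3) 0 i * X q 0 i).

Let sm_zeta a : sm U (fun q => zeta q 0 a).
Proof.
have UO : U `<=` O by move=> q [].
apply: (sm_eq oU (f := fun q => if a == 0 then u q else if a == 1 then v q
  else \sum_i (if a == 2 then om2 else om3) 0 i * X q 0 i)); first by move=> q _; rewrite mxE.
case: (a == 0); first exact: sm_sub su.
case: (a == 1); first exact: sm_sub sv.
by apply: sm_sum => // i; exact: (smM oU (sm_cst U _) (sX i)).
Qed.

Let jac_dir q (w : 'cV[R]_4) (xi : 'rV[R]_4) : U q ->
  (forall i, is_derive q w^T (fun q => X q 0 i) (xi 0 i)) ->
  jac zeta q *m w = \col_a (if a == 0 then dd u q w else if a == 1 then dd v q w
    else \sum_i (if a == 2 then om2 else om3) 0 i * xi 0 i).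
Proof.
move=> Uq Hxi; apply/matrixP => a b; rewrite ord1 [RHS]mxE [LHS]mxE.
have D1 := sm_dir w^T oU (sm_zeta a) Uq.
have -> : \sum_j jac zeta q a j * w j 0 = \sum_i pt i (fun q => zeta q 0 a) q * w^T 0 i.
  by apply: eq_bigr => j _; rewrite [jac _ _ _ _]mxE [w^T _ _]mxE.
apply: (is_derive_unique D1).
have -> : (fun q => zeta q 0 a) = (fun q => if a == 0 then u q else if a == 1 then v q
  else \sum_i (if a == 2 then om2 else om3) 0 i * X q 0 i) by apply/funext => y; rewrite mxE.
have dirf f : sm O f -> is_derive q w^T f (dd f q w).
  move=> sf; apply: (is_derive_eq (sm_dir w^T oO sf Uq.1)).
  by apply: eq_bigr => c _; rewrite mxE.
case: (a == 0); first exact: dirf.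
case: (a == 1); first exact: dirf.
by apply: is_derive_bigsum => i; exact: (is_deriveZ _ (Hxi i)).
Qed.

Let jac_l q : U q -> jac zeta q *m l q = ec 1.
Proof.
move=> Uq.
have H i : is_derive q (l q)^T (fun q => X q 0 i) ((0 : 'rV[R]_4) 0 i).
  by rewrite [_ 0 i]mxE; exact: dX_l.
rewrite (jac_dir Uq H).
apply/matrixP => a b; rewrite ord1 !mxE (ul Uq.1) (vl Uq.1) big1 => [|i _]; last by rewrite mxE mulr0.
by move: a; apply: forall4.
Qed.

Let jac_n q : U q -> jac zeta q *m n q = ec 0.
Proof.
move=> Uq.
have H i : is_derive q (n q)^T (fun q => X q 0 i) ((0 : 'rV[R]_4) 0 i).
  by rewrite [_ 0 i]mxE; exact: dX_n.
rewrite (jac_dir Uq H).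
apply/matrixP => a b; rewrite ord1 !mxE (un Uq.1) (vn Uq.1) big1 => [|i _]; last by rewrite mxE mulr0.
by move: a; apply: forall4.
Qed.

Let jac_w (w : 'cV[R]_4) : dd u x2 w = 0 -> dd v x2 w = 0 ->
  jac zeta x2 *m w = \col_a (if a == 0 then 0 else if a == 1 then 0
    else ((if a == 2 then om2 else om3) *m w) 0 0).
Proof.
move=> uw vw.
have H i : is_derive x2 w^T (fun q => X q 0 i) (w^T 0 i).
  by rewrite [w^T 0 i]mxE; exact: dX_base.
rewrite (jac_dir Ux2 H).
apply/matrixP => a b; rewrite ord1 !mxE uw vw.
by case: ifP => // _; case: ifP => // _; apply: eq_bigr => i _; rewrite [w^T _ _]mxE.
Qed.

Lemma adapted_coordinates_flow : exists (U : set 'rV[R]_4) (zeta : 'rV[R]_4 -> 'rV[R]_4),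
  [/\ open U /\ U x2, U `<=` O, (forall a, sm U (fun q => zeta q 0 a)),
      (forall q, U q -> [/\ zeta q 0 0 = u q, zeta q 0 1 = v q,
         jac zeta q *m l q = ec 1 & jac zeta q *m n q = ec 0])
    & jac zeta x2 \in unitmx].
Proof.
exists U, zeta; split=> //; first by move=> q [].
  by move=> q Uq; split; [rewrite mxE|rewrite mxE|exact: jac_l|exact: jac_n].
(* On the basis [n, l, w2, w3] the Jacobian at [x2] is the identity; [n] comes first because it is
   [d/du], and [l] is [d/dv]. *)
pose C (j : 'I_4) := if j == 0 then n x2 else if j == 1 then l x2 else if j == 2 then w2 else w3.
pose W : 'M[R]_4 := \matrix_(i, j) C j i 0.
have We j : W *m ec j = C j by apply/matrixP => i k; rewrite ord1 mulmx_delta mxE.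
suff E1 : jac zeta x2 *m W = 1%:M by have [] := mulmx1_unit E1.
apply/matrixP => a b; rewrite -[LHS](mulmx_delta _ _ _ 0) -(mulmxA _ W) We.
move: b; apply: forall4; rewrite /C /=.
- by rewrite jac_n// !mxE andbT.
- by rewrite jac_l// !mxE andbT.
- rewrite jac_w// mxE; move: a; apply: forall4; rewrite /= ?om22 ?om32 mxE //.
rewrite jac_w// mxE; move: a; apply: forall4; rewrite /= ?om23 ?om33 mxE //.
Qed.

End AdaptedCoordinates.

Section ChartFromCoordinates.
Variables (R : realType) (M : topologicalType) (A : smooth_structure R M).
Variables (phi : chart R M) (B : set 'rV[R]_4) (zeta h : 'rV[R]_4 -> 'rV[R]_4).
Variables (y0 : 'rV[R]_4) (r : R).
Hypothesis Ap : A phi.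
Hypothesis oB : open B.
Hypothesis Bcod : B `<=` cod phi.
Hypothesis szeta : forall a, sm B (fun x => zeta x 0 a).
Hypothesis zetaB : forall x, B x -> `|zeta x - y0| < r /\ h (zeta x) = x.
Hypothesis hB : forall y, `|y - y0| < r -> B (h y) /\ zeta (h y) = y.
Hypothesis sh : forall a, sm [set y | `|y - y0| < r] (fun y => h y 0 a).

Let D := [set p | chart_dom phi p /\ B (chart_map phi p)].
Let zm p := zeta (chart_map phi p).
Let zi y := chart_inv phi (h y).

Let codE : zm @` D = [set y | `|y - y0| < r].
Proof.
apply/seteqP; split=> [y [p [dp Bp] <-]|y /hB[Bh e]]; first exact: (zetaB Bp).1.
have /codP[d ex] := Bcod Bh.
by exists (chart_inv phi (h y)); rewrite /D /zm /= ?ex.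
Qed.

Let zm_open : open D. Proof. exact: image_open. Qed.

Let zm_cod : open (zm @` D). Proof. by rewrite codE; exact: open_nbhd_ball. Qed.

Let zmK p : D p -> zi (zm p) = p.
Proof. by move=> [dp Bp]; rewrite /zi /zm (zetaB Bp).2 chart_mapK. Qed.

Let zm_cont p : D p -> {for p, continuous zm}.
Proof.
move=> [dp Bp]; apply: continuous_for_comp; first exact: chart_map_cont.
by apply: row_continuous => j; exact: (Ck_cont (szeta j 0%N) Bp).
Qed.

Let zi_cont y : (zm @` D) y -> {for y, continuous zi}.
Proof.
rewrite codE => yr; apply: continuous_for_comp.
  by apply: row_continuous => j; exact: (Ck_cont (sh j 0%N) yr).
by apply: chart_inv_cont; apply: Bcod; exact: (hB yr).1.
Qed.

Definition coord_chart := Chart zm_open zm_cod zmK zm_cont zi_cont.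

(** That the image is a ball matters later: the components of the metric are compared along segments
    inside it. *)
Lemma coord_chart_cod : cod coord_chart = [set y | `|y - y0| < r].
Proof. exact: codE. Qed.

Lemma coord_chart_in : A coord_chart.
Proof.
apply: charts_maximal => psi As; split=> a; apply/Ck_smooth_on => k.
  have oW : open (ov psi coord_chart) := @ov_open _ _ psi coord_chart.
  have W x : ov psi coord_chart x -> ov psi phi x /\ B (tr psi phi x).
    by move=> /ovP[cx [dx Bx]]; split=> //; apply/ovP.
  apply: (Ck_comp oW oB (h := tr psi phi) _ _ (szeta a k)).
    by move=> j; apply: Ck_sub (tr_sm j As Ap k) => x /W[].
  by move=> x /W[].
have oW : open (ov coord_chart psi) := @ov_open _ _ coord_chart psi.
have W y : ov coord_chart psi y -> `|y - y0| < r /\ ov phi psi (h y).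
  move=> /ovP[cy dy]; rewrite coord_chart_cod in cy; split=> //; apply/ovP; split=> //.
  by apply: Bcod; exact: (hB cy).1.
apply: (Ck_comp oW (@ov_open _ _ phi psi) (h := h) _ _ (tr_sm a Ap As k)).
  by move=> j; apply: Ck_sub (sh j k) => y /W[].
by move=> y /W[].
Qed.

Lemma coord_chart_jacobian p : D p -> jacobian phi coord_chart p = jac zeta (chart_map phi p).
Proof.
move=> [dp Bp]; apply/matrixP => a b; rewrite [LHS]mxE [RHS]mxE pdE.
apply: (pt_eq b oB Bp) => x Bx /=; have /codP[_ ex] := Bcod Bx.
by rewrite /zm ex.
Qed.

End ChartFromCoordinates.

Section ConeChart.
Variables (R : realType) (M : topologicalType) (A : smooth_structure R M).
Variable g : lorentz_metric A.
Notation ec i := (delta_mx i 0 : 'cV[R]_4).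
Variables (phi : chart R M) (O : set 'rV[R]_4).
Hypothesis Ap : A phi.
Hypothesis oO : open O.
Hypothesis Oc : O `<=` cod phi.
Let G := gx g phi.
Variables (l s : 'rV[R]_4 -> 'cV[R]_4) (u : 'rV[R]_4 -> R) (a : 'rV[R]_4 -> 'M[R]_4).
Variable T : 'rV[R]_4 -> 'M[R]_4.
Hypothesis sl : msm O l.
Hypothesis dl : forall c x, O x -> dmx c l x = - (Gam G c x *m l x).
Hypothesis TG : forall x, O x -> (T x)^T *m G x *m T x = eta R.
Hypothesis lT : forall x, O x -> l x = T x *m ec 0.
Variables (k c e1 e2 : R).
Hypothesis HC : cone_data O G a l s u k c e1 e2.

Let sG : msm O G := msm_sub Oc (gx_sm g Ap).
Let Gs x : O x -> (G x)^T = G x. Proof. by move=> /Oc; exact: gx_sym. Qed.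
Let uG x : O x -> G x \in unitmx. Proof. by move=> /Oc; exact: gx_unit. Qed.

Let dotT x i j : O x -> ((T x *m ec i)^T *m G x *m (T x *m ec j)) 0 0 = eta R i j.
Proof. by move=> Ox; rewrite -(TG Ox) [in RHS]mx_entry_ec trmx_mul !mulmxA. Qed.

Lemma frame_ll x : O x -> ((l x)^T *m G x *m l x) 0 0 = 0.
Proof. by move=> Ox; rewrite lT// dotT// mxE. Qed.

(** Subtracting a multiple of [l] makes the frame vector orthogonal to [s], and for [x] and [y] this
    changes no product with vectors orthogonal to [l]. *)
Definition wvec (x : 'rV[R]_4) i : 'cV[R]_4 :=
  T x *m ec i - (((s x)^T *m G x *m (T x *m ec i)) 0 0 / u x) *: l x.

Lemma wvec_dot x i (b : 'cV[R]_4) : O x -> ((wvec x i)^T *m G x *m b) 0 0 =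
  ((T x *m ec i)^T *m G x *m b) 0 0
  - ((s x)^T *m G x *m (T x *m ec i)) 0 0 / u x * ((l x)^T *m G x *m b) 0 0.
Proof.
by move=> Ox; rewrite /wvec trD trN trZ !mulmxBl -!scalemxAl addmxE oppmxE scalemxE.
Qed.

Lemma wvec_l x i : O x -> i = 2 \/ i = 3 -> ((wvec x i)^T *m G x *m l x) 0 0 = 0.
Proof.
by move=> Ox i23; rewrite wvec_dot// frame_ll// mulr0 subr0 {1}lT// dotT// mxE; case: i23 => ->.
Qed.

Lemma wvec_s x i : O x -> ((wvec x i)^T *m G x *m s x) 0 0 = 0.
Proof.
move=> Ox; have [[_ u0] _ _ slu _] := HC.
rewrite wvec_dot// (dotC Gs (l x) (s x) Ox) slu// divfK ?u0// (dotC Gs (s x))//.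
by rewrite subrr.
Qed.

Lemma wvec_w x i j : O x -> i = 2 \/ i = 3 -> j = 2 \/ j = 3 ->
  ((wvec x i)^T *m G x *m wvec x j) 0 0 = (i == j)%:R.
Proof.
move=> Ox i23 j23; rewrite (dotC Gs)// wvec_dot// (dotC Gs (l x))// wvec_l// mulr0 subr0.
rewrite (dotC Gs)// wvec_dot// dotT// [X in _ - _ * X](_ : _ = 0) ?mulr0 ?subr0.
  by rewrite mxE; case: i23 => ->; case: j23 => ->.
by rewrite lT// dotT// mxE; case: j23 => ->.
Qed.

Notation n := (nvec G l s u).
Notation v := (vfun G s u).

(** The two [wvec] at [x2] are orthonormal, so lowering their indices gives the dual forms needed;
    being orthogonal to [l] and [n], they are tangent to the slice. The inverse function theorem
    turns the adapted functions into a chart. *)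
Lemma cone_chart x2 : O x2 -> exists (chi : chart R M) (r : R), [/\ A chi, 0 < r,
  chart_dom chi (chart_inv phi x2), cod chi = [set y | `|y - chart_map chi (chart_inv phi x2)| < r]
  & forall p, chart_dom chi p -> [/\ chart_dom phi p, O (chart_map phi p),
      chart_map chi p 0 0 = u (chart_map phi p) /\ chart_map chi p 0 1 = v (chart_map phi p),
      jacobian phi chi p *m l (chart_map phi p) = ec 1
    & jacobian phi chi p *m n (chart_map phi p) = ec 0]].
Proof.
move=> Ox2; have [[su u0] du [ss ds] slu _] := HC.
have ll := frame_ll.
have sv : sm O v := sm_v oO sG su u0 ss.
have sn : msm O n := sm_n oO sG sl su u0 ss.
have ln : forall x, O x -> ((l x)^T *m G x *m n x) 0 0 = 1 := ln1 Gs ll u0 slu.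
have nn : forall x, O x -> ((n x)^T *m G x *m n x) 0 0 = 0 := nn0 Gs ll u0 slu.
have dv b x : O x -> pt b v x = (G x *m n x) b 0 by exact: (dv oO sG Gs uG su u0 du ss ds).
have br x : O x -> Dir n x (l x) = Dir l x (n x).
  exact: (bracket0 oO sG Gs uG sl dl ll su u0 du ss ds slu).
have dotu x (w : 'cV[R]_4) : O x -> \sum_b pt b u x * w b 0 = (w^T *m G x *m l x) 0 0.
  by move=> Ox; rewrite -(dot_sum G _ w Ox); apply: eq_bigr => b _; rewrite du// mulrC.
have dotv x (w : 'cV[R]_4) : O x -> \sum_b pt b v x * w b 0 = (w^T *m G x *m n x) 0 0.
  by move=> Ox; rewrite -(dot_sum G _ w Ox); apply: eq_bigr => b _; rewrite dv// mulrC.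
have [eps [rr [Phi [eps0 rr0 HF]]]] := adapted_flow_exists oO sl sn Ox2.
pose w2 := wvec x2 2; pose w3 := wvec x2 3.
have h2 : (2 : 'I_4) = 2 \/ (2 : 'I_4) = 3 by left.
have h3 : (3 : 'I_4) = 2 \/ (3 : 'I_4) = 3 by right.
have vw i : (i = 2 \/ i = 3) -> \sum_b pt b v x2 * wvec x2 i b 0 = 0.
  by move=> Hi; rewrite dotv// (dot_n G l s u _ Ox2) wvec_s// wvec_l// mulr0 subr0 mul0r.
have [U [zeta [[oU Ux2] UO sz Hz uJ]]] := @adapted_coordinates_flow R O l n oO sl sn br x2 eps rr Phi
  eps0 HF u v su sv
  (fun x Ox => etrans (dotu x (l x) Ox) (ll x Ox))
  (fun x Ox => etrans (dotu x (n x) Ox) (etrans (dotC Gs (n x) (l x) Ox) (ln x Ox)))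
  (fun x Ox => etrans (dotv x (l x) Ox) (ln x Ox))
  (fun x Ox => etrans (dotv x (n x) Ox) (nn x Ox))
  rr0 Ox2 w2 w3 (w2^T *m G x2) (w3^T *m G x2)
  (etrans (dotu x2 w2 Ox2) (wvec_l Ox2 h2)) (etrans (dotu x2 w3 Ox2) (wvec_l Ox2 h3))
  (vw _ h2) (vw _ h3) (wvec_w Ox2 h2 h2) (wvec_w Ox2 h2 h3) (wvec_w Ox2 h3 h2) (wvec_w Ox2 h3 h3).
have [r [B [h [r0 [oB Bx2] BU zB [hB sh]]]]] := inverse_function oU sz Ux2 uJ.
have Bcod : B `<=` cod phi by move=> x /BU/UO/Oc.
have szB b : sm B (fun x => zeta x 0 b) by exact: sm_sub (sz b).
pose chi := coord_chart oB Bcod szB zB hB sh.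
have /codP[dx2 ex2] := Oc Ox2.
exists chi, r; split=> //.
- exact: (coord_chart_in Ap).
- by split=> //=; rewrite ex2.
- by rewrite coord_chart_cod /= ex2.
move=> p [dp Bp]; have Up := BU _ Bp; have [z0 z1 zl zn] := Hz _ Up.
by split=> //; [exact: UO|rewrite coord_chart_jacobian|rewrite coord_chart_jacobian].
Qed.

End ConeChart.

(** * The normal form *)

Section NormalFormAlgebra.
Variable R : realType.
Notation ec i := (delta_mx i 0 : 'cV[R]_4).

(** Some nonzero combination of [w2] and [w3] has no time component, so the form is nonnegative on
    it; on the plane the form is [m] times the Euclidean one. *)
Lemma lorentzian_plane (H : 'M[R]_4) (w2 w3 : 'cV[R]_4) (m : R) : lorentzian H -> H^T = H ->
  (w2^T *m H *m w2) 0 0 = m -> (w3^T *m H *m w3) 0 0 = m -> (w2^T *m H *m w3) 0 0 = 0 ->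
  m != 0 -> 0 < m.
Proof.
move=> [P uP E] Hs h22 h33 h23 m0.
pose t2 := invmx P *m w2; pose t3 := invmx P *m w3.
have w2E : w2 = P *m t2 by rewrite mulKVmx.
have w3E : w3 = P *m t3 by rewrite mulKVmx.
have Q (z : 'cV[R]_4) : ((P *m z)^T *m H *m (P *m z)) 0 0 =
    - z 0 0 ^+ 2 + (z 1 0 ^+ 2 + z 2 0 ^+ 2 + z 3 0 ^+ 2).
  have -> : (P *m z)^T *m H *m (P *m z) = z^T *m (P^T *m H *m P) *m z by rewrite trmx_mul !mulmxA.
  rewrite E mxE sum4 !mul_mx_diag !mxE /= /GRing.scale /=; ring.
have sym : (w3^T *m H *m w2) 0 0 = 0.
  have -> : w3^T *m H *m w2 = (w2^T *m H *m w3)^T by rewrite !trmx_mul trmxK Hs mulmxA.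
  by rewrite mxE.
have quad (al be : R) : ((al *: w2 + be *: w3)^T *m H *m (al *: w2 + be *: w3)) 0 0 =
    m * (al ^+ 2 + be ^+ 2).
  rewrite trD !trZ !mulmxDl !mulmxDr -!scalemxAl -!scalemxAr !addmxE !scalemxE.
  by rewrite h22 h33 h23 sym; ring.
have nonneg (al be : R) : al * t2 0 0 + be * t3 0 0 = 0 -> 0 <= m * (al ^+ 2 + be ^+ 2).
  move=> z0.
  have e : al *: w2 + be *: w3 = P *m (al *: t2 + be *: t3).
    by rewrite mulmxDr -!scalemxAr -w2E -w3E.
  rewrite -quad e Q.
  have -> : (al *: t2 + be *: t3) 0 0 = 0 by rewrite addmxE !scalemxE.
  by rewrite expr0n /= oppr0 add0r !addr_ge0// sqr_ge0.
rewrite lt_neqAle eq_sym m0 /=.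
have [t20|t20] := eqVneq (t2 0 0) 0.
  by have := nonneg 1 0; rewrite t20 mulr0 mul0r addr0 expr1n expr0n /= addr0 mulr1 => ->.
have := nonneg (t3 0 0) (- t2 0 0); rewrite mulNr mulrC subrr => /(_ erefl).
rewrite pmulr_lge0// sqrrN; apply: ltr_wpDl; first exact: sqr_ge0.
by rewrite lt_neqAle eq_sym expf_neq0//= sqr_ge0.
Qed.

Lemma vec_span (W : 'I_4 -> 'cV[R]_4) (J : 'M[R]_4) : J \in unitmx ->
  (forall c, \sum_d J d c *: W d = 0) -> forall d, W d = 0.
Proof.
move=> uJ H d; pose V : 'M[R]_4 := \matrix_(i, j) W j i 0.
have : V *m J = 0.
  apply/matrixP => i c; rewrite [LHS]mxE [RHS]mxE; have := congr1 (fun X : 'cV[R]_4 => X i 0) (H c).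
  rewrite /= summxE [X in _ = X -> _]mxE => Ec; rewrite -[RHS]Ec; apply: eq_bigr => j _.
  by rewrite scalemxE [V _ _]mxE mulrC.
move=> /(congr1 (mulmx^~ (invmx J))); rewrite mulmxK// mul0mx => V0.
apply/matrixP => i j; rewrite ord1.
by have := congr1 (fun X : 'M[R]_4 => X i d) V0; rewrite !mxE.
Qed.

(* The matrix of [a] in adapted coordinates: [K] exchanges [d/du] and [d/dv]. *)
Definition cone_mx (u v k c e1 e2 : R) : 'M[R]_4 :=
  k%:M + ((c * u * v + e1 * u) *: (delta_mx 0 0 + delta_mx 1 1)
  + (c * u ^+ 2) *: delta_mx 0 1 + (c * v ^+ 2 + 2 * e1 * v + e2) *: delta_mx 1 0).

(** [S] stands for the field [s] in the adapted chart and [e_1] for [l], so the left side is [a] as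
    given by [cone_data]. *)
Lemma cone_mxE (K : 'M[R]_4) (u v k c e1 e2 : R) : K^T = K -> K *m ec 1 = ec 0 -> K *m ec 0 = ec 1 ->
  let S := u *: ec 0 + v *: ec 1 in
  k%:M + c *: (S *m S^T *m K) + e1 *: (S *m (ec 1)^T *m K + ec 1 *m S^T *m K)
    + e2 *: (ec 1 *m (ec 1)^T *m K) = cone_mx u v k c e1 e2.
Proof.
move=> Ks K1 K0 S.
have T1 : (ec 1)^T *m K = (ec 0)^T by rewrite -Ks -trmx_mul K1.
have T0 : (ec 0)^T *m K = (ec 1)^T by rewrite -Ks -trmx_mul K0.
have TS : S^T *m K = u *: (ec 1)^T + v *: (ec 0)^T by rewrite trD !trZ mulmxDl -!scalemxAl T0 T1.
rewrite -!mulmxA T1 TS /S /cone_mx !mulmxDl !mulmxDr -!scalemxAl -!scalemxAr.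
have D i j : ec i *m (ec j)^T = delta_mx i j by rewrite trmx_delta mul_delta_mx.
rewrite !D; move: (k%:M) (delta_mx 0 0 : 'M[R]_4) (delta_mx 0 1 : 'M[R]_4)
  (delta_mx 1 0 : 'M[R]_4) (delta_mx 1 1 : 'M[R]_4) => v1 v2 v3 v4 v5; mxring.
Qed.

(** The matrix is block diagonal with a scalar second block. Equated with [det a = 1 / E], this is
    the origin of the denominator of [F]. *)
Lemma det_cone_mx u v k c e1 e2 : \det (cone_mx u v k c e1 e2) =
  k ^+ 2 * (k ^+ 2 + 2 * k * (c * u * v + e1 * u) + (e1 ^+ 2 - c * e2) * u ^+ 2).
Proof.
pose A2 : 'M[R]_2 := \matrix_(i, j) (if i == 0 then (if j == 0 then k + (c * u * v + e1 * u) else c * u ^+ 2)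
  else (if j == 0 then c * v ^+ 2 + 2 * e1 * v + e2 else k + (c * u * v + e1 * u))).
have -> : cone_mx u v k c e1 e2 = block_mx A2 0 0 (k%:M : 'M[R]_2) :> 'M[R]_(2 + 2).
  apply/matrixP => i j.
  case: (split_ordP i) => a ->; case: (split_ordP j) => b ->; rewrite ?(block_mxEul, block_mxEur, block_mxEdl, block_mxEdr) !mxE;
  case: a => [[|[|a]] ha] //; case: b => [[|[|b]] hb] //=; rewrite ?mulr1n ?mulr0n; ring.
rewrite (det_ublock A2 0 k%:M) det_scalar (expand_det_row _ 0) !big_ord_recl big_ord0 /cofactor !det_mx11 !mxE /=.
ring.
Qed.

(** Instead of inverting [a], the proposed [g'] is multiplied by it, and the product must be [F g].
    The constants in [a] are [k] times those of the statement, and [kappa] is [k^-1]. *)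
Lemma partner_alg (K : 'M[R]_4) u v k c e1 e2 (F : R) : k != 0 ->
  K^T = K -> K *m ec 1 = ec 0 -> K *m ec 0 = ec 1 ->
  F * (k ^+ 4 * (1 + 2 * c * u * v + 2 * e1 * u + (e1 ^+ 2 - c * e2) * u ^+ 2)) = 1 ->
  ((k^-1 * F) *: K - (k^-1 ^- 3 * F ^+ 2) *:
      ((c * v ^+ 2 + 2 * e1 * v + e2) *: dxdx R 0 0
       + (c * u ^+ 2) *: dxdx R 1 1
       + (2 * u * (c * v + e1 + (e1 ^+ 2 - c * e2) * u)) *: dxdx R 0 1))
  *m cone_mx u v k (c * k) (e1 * k) (e2 * k) = F *: K.
Proof.
move=> k0 Ks K1 K0 HF.
have e1E a : K a 1 = (a == 0)%:R.
  by have := congr1 (fun X : 'cV[R]_4 => X a 0) K1; rewrite mulmx_delta !mxE andbT.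
have e0E a : K a 0 = (a == 1)%:R.
  by have := congr1 (fun X : 'cV[R]_4 => X a 0) K0; rewrite mulmx_delta !mxE andbT.
have KsE a b : K a b = K b a by rewrite -[in LHS]Ks mxE.
have K0E b : K 0 b = (b == 1)%:R by rewrite KsE e0E.
have K1E b : K 1 b = (b == 0)%:R by rewrite KsE e1E.
set q := 1 + _ + _ + _ in HF.
have HF0 : F * (k ^+ 4 * q) - 1 = 0 by rewrite HF subrr.
(* Some entries agree only modulo the relation [HF]; [Z] is the multiplier that exhibits this. *)
have fin (X Y Z : R) : X - Y = Z * (F * (k ^+ 4 * q) - 1) -> X = Y.
  by rewrite HF0 mulr0 => /eqP; rewrite subr_eq0 => /eqP.
set p := c * v ^+ 2 + 2 * e1 * v + e2.
apply/matrixP; apply: forall4; apply: forall4; rewrite [LHS]mxE sum4 !mxE /= ?K0E ?K1E ?e0E ?e1E /=.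
all: rewrite ?mulr1n ?mulr0n.
- apply: (fin _ _ (- p * F)); rewrite /q /p; field; exact: k0.
- apply: (fin _ _ (- F * (c * u * v + e1 * u))); rewrite /q /p; field; exact: k0.
- by field.
- by field.
- apply: (fin _ _ (- F * (c * u * v + e1 * u))); rewrite /q /p; field; exact: k0.
- apply: (fin _ _ (- F * (c * u ^+ 2))); rewrite /q /p; field; exact: k0.
all: by field.
Qed.

End NormalFormAlgebra.

(** * The metric in the adapted chart *)

Section WarpedForm.
Variables (R : realType) (M : topologicalType) (A : smooth_structure R M).
Variable g : lorentz_metric A.
Notation ec i := (delta_mx i 0 : 'cV[R]_4).
Variables (phi chi : chart R M) (O : set 'rV[R]_4).
Hypothesis Ap : A phi.
Hypothesis Ac : A chi.
Hypothesis oO : open O.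
Hypothesis Oc : O `<=` cod phi.
Let G := gx g phi.
Variables (l n : 'rV[R]_4 -> 'cV[R]_4) (u v : 'rV[R]_4 -> R).
Hypothesis sl : msm O l.
Hypothesis sn : msm O n.
Hypothesis u0 : forall x, O x -> u x != 0.
Hypothesis dl : forall c x, O x -> dmx c l x = - (Gam G c x *m l x).
Hypothesis dn : forall c x, O x -> dmx c n x =
  (u x)^-1 *: (ec c - (G x *m n x) c 0 *: l x - (G x *m l x) c 0 *: n x) - Gam G c x *m n x.
Hypothesis du : forall b x, O x -> pt b u x = (G x *m l x) b 0.
Hypothesis dv : forall b x, O x -> pt b v x = (G x *m n x) b 0.
Hypothesis Hchi : forall p, chart_dom chi p -> [/\ chart_dom phi p, O (chart_map phi p),
      chart_map chi p 0 0 = u (chart_map phi p) /\ chart_map chi p 0 1 = v (chart_map phi p),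
      jacobian phi chi p *m l (chart_map phi p) = ec 1
    & jacobian phi chi p *m n (chart_map phi p) = ec 0].

Let oW : open (ov phi chi) := @ov_open _ _ phi chi.

Let WO : ov phi chi `<=` O.
Proof. by move=> x /ovP[/codP[_ ex] /Hchi[_ +]]; rewrite ex. Qed.

Let Wu x : ov phi chi x -> [/\ tr phi chi x 0 0 = u x, tr phi chi x 0 1 = v x,
  jac (tr phi chi) x *m l x = ec 1 & jac (tr phi chi) x *m n x = ec 0].
Proof.
by move=> /ovP[/codP[_ ex] /Hchi[_ _ [E0 E1] El En]]; move: E0 E1 El En; rewrite jacobianE ex.
Qed.

Let JT0 x : ov phi chi x -> (jac (tr phi chi) x)^T *m ec 0 = G x *m l x.
Proof.
move=> Wx; apply/matrixP => b j; rewrite ord1 mulmx_delta mxE mxE.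
rewrite (pt_eq b oW Wx (g := u)) ?du//; first exact: WO.
by move=> y /Wu[].
Qed.

Let JT1 x : ov phi chi x -> (jac (tr phi chi) x)^T *m ec 1 = G x *m n x.
Proof.
move=> Wx; apply/matrixP => b j; rewrite ord1 mulmx_delta mxE mxE.
rewrite (pt_eq b oW Wx (g := v)) ?dv//; first exact: WO.
by move=> y /Wu[].
Qed.

Let uJ x : ov phi chi x -> jac (tr phi chi) x \in unitmx.
Proof. exact: (jac_tr_unit Ap Ac). Qed.

(** In the new chart [l] is [d/dv], while lowering its index gives [du], because [l] is the gradient
    of [u]. Together with the counterpart for [n] this fixes the [du dv] part of the metric. *)
Lemma chi_K1 x : ov phi chi x -> gx g chi (tr phi chi x) *m ec 1 = ec 0.
Proof.
move=> Wx; have [_ _ El _] := Wu Wx.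
have uJT : (jac (tr phi chi) x)^T \in unitmx by rewrite unitmx_tr uJ.
apply: (can_inj (mulKmx uJT)); rewrite JT0// /G (gx_tensor g Ap Ac Wx) -El.
by rewrite !mulmxA.
Qed.

Lemma chi_K0 x : ov phi chi x -> gx g chi (tr phi chi x) *m ec 0 = ec 1.
Proof.
move=> Wx; have [_ _ _ En] := Wu Wx.
have uJT : (jac (tr phi chi) x)^T \in unitmx by rewrite unitmx_tr uJ.
apply: (can_inj (mulKmx uJT)); rewrite JT1// /G (gx_tensor g Ap Ac Wx) -En.
by rewrite !mulmxA.
Qed.

Let sJ : msm (ov phi chi) (jac (tr phi chi)).
Proof. exact: (msm_jac oW (fun a => tr_sm a Ap Ac)). Qed.

(** For a field with constant components in the new chart the covariant derivative reduces to the
    connection term. *)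
Let Gam_const (X : 'rV[R]_4 -> 'cV[R]_4) (e : 'cV[R]_4) c x : msm O X -> ov phi chi x ->
  (forall y, ov phi chi y -> jac (tr phi chi) y *m X y = e) ->
  \sum_d jac (tr phi chi) x d c *: (Gam (gx g chi) d (tr phi chi x) *m e) =
  jac (tr phi chi) x *m (dmx c X x + Gam G c x *m X x).
Proof.
move=> sX Wx H.
have sX' := msm_sub WO sX.
have D : dmx c (jac (tr phi chi)) x *m X x + jac (tr phi chi) x *m dmx c X x = 0.
  rewrite -(dmxM c sJ sX' Wx) (dmx_eq (B := fun=> e) c oW Wx) ?dmx_cst//.
have T := Gam_transform g c Ap Ac Wx.
rewrite mulmxDr mulmxA T mulmxDl addrA [_ + dmx _ _ _ *m _]addrC D add0r -mulmxA (H _ Wx).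
by rewrite mulmx_suml; apply: eq_bigr => d _; rewrite -scalemxAl.
Qed.

Lemma chi_Gam1 x d : ov phi chi x -> Gam (gx g chi) d (tr phi chi x) *m ec 1 = 0.
Proof.
move=> Wx; move: d; apply: (vec_span (uJ Wx)) => c.
rewrite (Gam_const c sl Wx) => [|y /Wu[]//].
by rewrite dl ?addNr ?mulmx0//; exact: WO.
Qed.

(** [nabla n] is [1 / u] times the projection orthogonal to [l] and [n], which in the chart keeps
    the indices 2 and 3. *)
Lemma chi_Gam0 x d : ov phi chi x -> Gam (gx g chi) d (tr phi chi x) *m ec 0 =
  if (2 <= d)%N then (u x)^-1 *: ec d else 0.
Proof.
move=> Wx; apply/eqP; rewrite -subr_eq0; apply/eqP; move: d.
apply: (vec_span (uJ Wx)) => c.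
under eq_bigr do rewrite scalerBr.
rewrite sumrB (Gam_const c sn Wx) => [|y /Wu[]//].
have Ox := WO Wx; have [_ _ El En] := Wu Wx.
rewrite dn// subrK -scalemxAr !mulmxBr -!scalemxAr El En.
have JE a : jac (tr phi chi) x a c = ((jac (tr phi chi) x)^T *m ec a) c 0.
  by rewrite mulmx_delta [RHS]mxE.
have Jc : jac (tr phi chi) x *m ec c = \sum_d jac (tr phi chi) x d c *: ec d.
  by rewrite -{1}(sum_ec (jac _ x *m _)); apply: eq_bigr => a _; rewrite mulmx_delta.
rewrite Jc -(JT1 Wx) -(JT0 Wx) -!JE !sum4 /= !scaler0 !add0r.
rewrite !scalerA ![_ * (u x)^-1]mulrC -!scalerA -scalerDr -scalerBr.
by move: (jac _ _) => J; apply/eqP; rewrite scaler_eq0; apply/orP; right; apply/eqP; mxring.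
Qed.

Let Gs := gx_sym g Ac.
Let oC := @cod_open _ _ chi.

Lemma chi_dK1 x : ov phi chi x -> dmx 1 (gx g chi) (tr phi chi x) = 0.
Proof.
move=> Wx; have Cx : cod chi (tr phi chi x) := ov_cod (tr_ov Wx).
have G1 : Gam (gx g chi) 1 (tr phi chi x) = 0.
  apply/matrixP => a b; rewrite -[LHS](mulmx_delta _ _ _ 0) (GamC oC Gs b 1 Cx) chi_Gam1//.
  by rewrite !mxE.
by rewrite (chr_compat 1 oC Cx Gs (gx_unit g Ac Cx)) G1 mulmx0 trmx0 mul0mx addr0.
Qed.

(** Logarithmic derivative [2 / u] means growth like [u^2]: this produces the warping factor. *)
Lemma chi_dK0 x (a b : 'I_4) : ov phi chi x -> (2 <= a)%N -> (2 <= b)%N ->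
  dmx 0 (gx g chi) (tr phi chi x) a b = 2 / u x * gx g chi (tr phi chi x) a b.
Proof.
move=> Wx a2 b2; have Cx : cod chi (tr phi chi x) := ov_cod (tr_ov Wx).
have G0 (d : 'I_4) : (2 <= d)%N -> Gam (gx g chi) 0 (tr phi chi x) *m ec d = (u x)^-1 *: ec d.
  by move=> d2; rewrite (GamC oC Gs d 0 Cx) chi_Gam0// d2.
rewrite (chr_compat 0 oC Cx Gs (gx_unit g Ac Cx)) addmxE.
set K := gx g chi _; set L := Gam _ _ _.
have E1 : (K *m L) a b = (u x)^-1 * K a b.
  by rewrite -[LHS](mulmx_delta _ _ _ 0) -mulmxA G0// -scalemxAr scalemxE mulmx_delta.
have E2 : (L^T *m K) a b = (u x)^-1 * K a b.
  have Ks : K^T = K by exact: Gs.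
  have -> : (L^T *m K) a b = (K *m L) b a by rewrite -[K in LHS]Ks -trmx_mul mxE.
  rewrite -[LHS](mulmx_delta _ _ _ 0) -mulmxA G0// -scalemxAr scalemxE mulmx_delta.
  by rewrite -[K in LHS]Ks mxE.
by rewrite E1 E2; field; exact: u0 (WO Wx).
Qed.

Variables (y0 : 'rV[R]_4) (r : R).
Hypothesis r0 : 0 < r.
Hypothesis codchi : cod chi = [set y | `|y - y0| < r].

Let chi_ov y : cod chi y -> exists2 x, ov phi chi x & tr phi chi x = y /\ y 0 0 = u x.
Proof.
move=> /codP[d ey]; have [dp Op [E0 _] _ _] := Hchi d.
exists (chart_map phi (chart_inv chi y)); first by apply: ov_map.
by rewrite tr_map// ey; split=> //; rewrite -E0 ey.
Qed.

Let yz (y z : R) : 'rV[R]_4 :=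
  \row_i (if i == 0 then y0 0 0 else if i == 1 then y0 0 1 else if i == 2 then y else z).

(** The quotient by [u^2] has vanishing derivatives in [u] and [v]. As the image of the chart is a
    ball for the sup norm, the segment moving only [u] and [v] to their values at the centre stays
    inside. *)
Lemma chi_warped y (a b : 'I_4) : cod chi y -> (2 <= a)%N -> (2 <= b)%N ->
  gx g chi y a b = y 0 0 ^+ 2 * (gx g chi (yz (y 0 2) (y 0 3)) a b / y0 0 0 ^+ 2).
Proof.
move=> Cy a2 b2.
have [w wdef] : exists w : 'rV[R]_4, w = y - yz (y 0 2) (y 0 3) by exists (y - yz (y 0 2) (y 0 3)).
pose f x := gx g chi x a b / x 0 0 ^+ 2.
have w23 (i : 'I_4) : (2 <= i)%N -> w 0 i = 0.
  by move: i; apply: forall4 => //= _; rewrite wdef !mxE /= subrr.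
have C0 y' : cod chi y' -> y' 0 0 != 0.
  by move=> /chi_ov[x Wx [_ ->]]; exact: u0 (WO Wx).
have Cy0 : cod chi y0 by rewrite codchi /= subrr normr0.
have Ct t : 0 <= t <= 1 -> cod chi (yz (y 0 2) (y 0 3) + t *: w).
  move=> /andP[t0 t1]; rewrite codchi /=; apply: row_norm_lt => // i.
  have yi : `|y 0 i - y0 0 i| < r.
    have := row_coord_le (y - y0) i; rewrite !mxE => /le_lt_trans; apply.
    by move: Cy; rewrite codchi.
  have [i2|i2] := leqP 2 i.
    have -> : (yz (y 0 2) (y 0 3) + t *: w - y0) 0 i = y 0 i - y0 0 i.
      rewrite !(addmxE, oppmxE, scalemxE) w23// mulr0 addr0; congr (_ - _).
      by move: i i2 {yi}; apply: forall4 => //= _; rewrite mxE.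
    exact: yi.
  have -> : (yz (y 0 2) (y 0 3) + t *: w - y0) 0 i = t * (y 0 i - y0 0 i).
    rewrite !(addmxE, oppmxE, scalemxE).
    have -> : yz (y 0 2) (y 0 3) 0 i = y0 0 i.
      by move: i i2 {yi}; apply: forall4 => //= _; rewrite mxE.
    rewrite wdef addmxE oppmxE.
    have -> : yz (y 0 2) (y 0 3) 0 i = y0 0 i.
      by move: i i2 {yi}; apply: forall4 => //= _; rewrite mxE.
    ring.
  rewrite normrM (ger0_norm t0); apply: le_lt_trans yi.
  by rewrite -[leRHS]mul1r; apply: ler_wpM2r.
have sf : sm (cod chi) f.
  apply: (smM oC (gx_sm g Ac a b)); apply: smV => // [x Cx|].
    by rewrite expf_neq0// C0.
  by apply: (sm_eq oC (f := fun x : 'rV[R]_4 => x 0 0 * x 0 0)) => //;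
    apply: smM => // m; exact: Ck_coord.
have df (c : 'I_4) x : cod chi x -> (c < 2)%N -> pt c f x = 0.
  move=> Cx; have [x' Wx' [ex eu]] := chi_ov Cx.
  have x0 := C0 x Cx.
  have s2 : sm (cod chi) (fun x : 'rV[R]_4 => x 0 0 * x 0 0).
    by apply: smM => // m; exact: Ck_coord.
  have Ef y' : cod chi y' -> gx g chi y' a b = f y' * (y' 0 0 * y' 0 0).
    by move=> Cy'; rewrite /f expr2 divfK// mulf_neq0// C0.
  have := pt_eq c oC Cx Ef; rewrite (ptM c sf s2 Cx).
  have s1 : sm (cod chi) (fun x : 'rV[R]_4 => x 0 0) by move=> m; exact: Ck_coord.
  rewrite (ptM c s1 s1 Cx) (is_derive_pt (coord_is_derive 0 x (delta_mx 0 c))).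
  have -> : pt c (fun x => gx g chi x a b) x = dmx c (gx g chi) x a b by rewrite mxE.
  rewrite -ex; move: c; apply: forall4 => //= + _; last first.
    rewrite chi_dK1// ex [in X in X -> _]mxE mxE /= mul0r mulr0 addr0 mulr0 addr0 => /esym/eqP.
    by rewrite !mulf_eq0 (negbTE x0) !orbF => /eqP.
  have -> : (delta_mx 0 0 : 'rV[R]_4) 0 0 = 1 by rewrite mxE.
  rewrite chi_dK0// ex mul1r mulr1.
  rewrite (Ef _ Cx) -eu => E.
  have : pt 0 f x * (x 0 0 * x 0 0) = 0.
    move: (f x) (pt 0 f x) (x 0 0) x0 E => v1 v2 v3 v30 E.
    have : 2 / v3 * (v1 * (v3 * v3)) = v1 * (v3 + v3) by field.
    by move=> E2; move: E; rewrite E2 -[LHS]add0r => /addIr.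
  by move=> /eqP; rewrite !mulf_eq0 (negbTE x0) !orbF => /eqP.
have fE : f (yz (y 0 2) (y 0 3) + 0 *: w) = f (yz (y 0 2) (y 0 3) + 1 *: w).
  apply: (@zero_derivative_eq R (fun t => f (yz (y 0 2) (y 0 3) + t *: w)) 0 1) => t.
  rewrite (min_idPl ler01) (max_idPr ler01) => t01.
  have Cx := Ct t t01.
  apply: (iffLR (is_derive_line f _ w _ t)).
  apply: (is_derive_eq (sm_dir w oC sf Cx)).
  rewrite big1// => i _; have [i2|i2] := leqP 2 i; first by rewrite w23// mulr0.
  by rewrite df// mul0r.
move: fE; rewrite scale0r addr0 scale1r wdef [X in _ = f X -> _]addrC subrK /f.
have -> : yz (y 0 2) (y 0 3) 0 0 = y0 0 0 by rewrite mxE.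
move=> ->; rewrite mulrC divfK// expf_neq0// C0 //.
Qed.

(** Symmetrised because [h] has to be symmetric for all arguments, also at points outside the chart,
    where the components of [g] are arbitrary. *)
Definition warp_h (y z : R) : 'M[R]_2 := \matrix_(i, j) (2^-1 *
  (gx g chi (yz y z) (rshift 2 i) (rshift 2 j) + gx g chi (yz y z) (rshift 2 j) (rshift 2 i)) / y0 0 0 ^+ 2).

Lemma warp_h_sym y z : (warp_h y z)^T = warp_h y z.
Proof. by apply/matrixP => i j; rewrite !mxE [X in _ * X / _]addrC. Qed.

Lemma chi_warped_metric p : chart_dom chi p -> g chi p = warped_metric chi warp_h p.
Proof.
move=> dp; set y := chart_map chi p.
have Cy : cod chi y by exact: cod_map.
have [x Wx [ex eu]] := chi_ov Cy.
have K1 := chi_K1 Wx; have K0 := chi_K0 Wx; rewrite ex in K1 K0.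
have gE : g chi p = gx g chi y by rewrite gx_map.
set K := gx g chi y in K1 K0 gE.
have Ks : K^T = K by exact: Gs.
have e1E a : K a 1 = (a == 0)%:R.
  by have := congr1 (fun X : 'cV[R]_4 => X a 0) K1; rewrite mulmx_delta !mxE andbT.
have e0E a : K a 0 = (a == 1)%:R.
  by have := congr1 (fun X : 'cV[R]_4 => X a 0) K0; rewrite mulmx_delta !mxE andbT.
have KsE a b : K a b = K b a by rewrite -[in LHS]Ks mxE.
have K0E b : K 0 b = (b == 1)%:R by rewrite KsE e0E.
have K1E b : K 1 b = (b == 0)%:R by rewrite KsE e1E.
have H i j : K (rshift 2 i) (rshift 2 j) =
    y 0 0 ^+ 2 * (gx g chi (yz (y 0 2) (y 0 3)) (rshift 2 i) (rshift 2 j) / y0 0 0 ^+ 2).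
  exact: chi_warped.
have h i j : y 0 0 ^+ 2 * warp_h (y 0 2) (y 0 3) i j = K (rshift 2 i) (rshift 2 j).
  rewrite [warp_h _ _ _ _]mxE; have := H i j; have := H j i; rewrite (KsE (rshift 2 j)).
  move: (K _ _) (gx _ _ _ _ _) (gx _ _ _ _ _) (y 0 0 ^+ 2) (y0 0 0 ^+ 2)^-1 => k a b Y Z E1 E2.
  have : k = 2^-1 * (k + k) by field.
  by move=> ->; rewrite {1}E1 E2; ring.
have r0E : rshift 2 (0 : 'I_2) = 2 :> 'I_4 by apply/val_inj.
have r1E : rshift 2 (1 : 'I_2) = 3 :> 'I_4 by apply/val_inj.
have S2 (V : 'I_2 -> 'M[R]_4) : \sum_(i < 2) V i = V 0 + V 1.
  by rewrite !big_ord_recl big_ord0 addr0; congr (V _ + V _); apply/val_inj.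
rewrite gE /warped_metric !S2 !scalerDr !scalerA -/y !h !r0E !r1E.
have K22 := KsE 2 3.
apply/matrixP; apply: forall4; apply: forall4; rewrite !mxE /= ?K0E ?K1E ?e0E ?e1E /= ?mulr1n ?mulr0n;
  rewrite ?K22; by field.
Qed.

End WarpedForm.

(** * Recovery of the second metric *)

Section ProjectivePartner.
Variables (R : realType) (M : topologicalType) (A : smooth_structure R M).
Variables g g' : lorentz_metric A.
Hypothesis pr : projectively_related g g'.
Notation ec i := (delta_mx i 0 : 'cV[R]_4).

Lemma Gam_diff phi p a b c : A phi -> chart_dom phi p ->
  christoffel g' phi p a b c - christoffel g phi p a b c =
  (a == b)%:R * psi g g' phi (chart_map phi p) c + (a == c)%:R * psi g g' phi (chart_map phi p) b.
Proof.
move=> Ap dp; rewrite !christoffelE// (Gam_psi pr b Ap (cod_map dp)) !addmxE.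
have -> : ((psi g g' phi (chart_map phi p) b)%:M : 'M[R]_4) a c =
    (a == c)%:R * psi g g' phi (chart_map phi p) b.
  by rewrite mxE; case: (a == c); rewrite ?mul1r ?mul0r.
have -> : (delta_mx b 0 *m psirow g g' phi (chart_map phi p)) a c =
    (a == b)%:R * psi g g' phi (chart_map phi p) c.
  by rewrite mxE big_ord1 [psirow _ _ _ _ _ _]mxE [delta_mx b 0 _ _]mxE andbT.
by ring.
Qed.

(** [Ef] is independent of the chart, so its logarithm may be differentiated in any chart meeting
    [V], not just in [chi]. *)
Lemma projective_form_Ef (V : set M) chi (F : M -> R) : A chi -> open V -> V `<=` chart_dom chi ->
  (forall p, V p -> F p = Ef g g' chi p) ->
  projective_form g g' V (differential (fun p => 2^-1 * ln (F p))).
Proof.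
move=> Ac oV Vc FE phi p a b c Ap dp Vp.
have D d : differential (fun p => 2^-1 * ln (F p)) phi p d = psi g g' phi (chart_map phi p) d.
  rewrite /differential pdE.
  have oW := @preimage_open _ _ phi _ oV.
  have Wp : [set x | cod phi x /\ V (chart_inv phi x)] (chart_map phi p).
    by split; [exact: cod_map|rewrite chart_mapK].
  have E y : [set x | cod phi x /\ V (chart_inv phi x)] y ->
      ((fun p => 2^-1 * ln (F p)) \o chart_inv phi) y = 2^-1 * ln (Ef g g' phi (chart_inv phi y)).
    move=> [/codP[dy _] Vy] /=; by rewrite (FE _ Vy) (Ef_chart g g' Ac Ap (Vc _ Vy) dy).
  rewrite (pt_eq d oW Wp E); apply: is_derive_pt.
  have D1 := Ef_derive g g' d Ap (cod_map dp).
  have D2 := derive_comp1 (h := @ln R) D1 (is_derive1_ln (Ef_gt0 g g' phi _)).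
  have D3 := is_deriveZ 2^-1 D2.
  apply: (is_derive_eq D3); rewrite /GRing.scale /=.
  have : Ef g g' phi (chart_inv phi (chart_map phi p)) != 0 by rewrite gt_eqF// Ef_gt0.
  by move: (Ef _ _ _ _) (psi _ _ _ _ _) => e w e0; field.
by rewrite !D Gam_diff.
Qed.

Variables (phi : chart R M) (O : set 'rV[R]_4).
Hypothesis Ap : A phi.
Hypothesis oO : open O.
Hypothesis Oc : O `<=` cod phi.
Let G := gx g phi.
Let a := sinyukov_a g g' phi.
Variables (l s : 'rV[R]_4 -> 'cV[R]_4) (u : 'rV[R]_4 -> R) (T : 'rV[R]_4 -> 'M[R]_4).
Hypothesis sl : msm O l.
Hypothesis dl : forall c x, O x -> dmx c l x = - (Gam G c x *m l x).
Hypothesis TG : forall x, O x -> (T x)^T *m G x *m T x = eta R.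
Hypothesis lT : forall x, O x -> l x = T x *m ec 0.
Variables (k c e1 e2 : R).
Hypothesis HC : cone_data O G a l s u k c e1 e2.

Let Gs x : O x -> (G x)^T = G x. Proof. by move=> /Oc; exact: gx_sym. Qed.
Let uG x : O x -> G x \in unitmx. Proof. by move=> /Oc; exact: gx_unit. Qed.
Let h2 : (2 : 'I_4) = 2 \/ (2 : 'I_4) = 3. Proof. by left. Qed.
Let h3 : (3 : 'I_4) = 2 \/ (3 : 'I_4) = 3. Proof. by right. Qed.
Notation w i x := (wvec g phi l s u T x i).

(** All terms of [a] other than the scalar one contract with [s] or [l], to which [w] is
    orthogonal. *)
Let a_w x i : O x -> i = 2 \/ i = 3 -> a x *m w i x = k *: w i x.
Proof.
move=> Ox Hi; have [_ _ _ _ aE] := HC.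
have ws : (s x)^T *m (G x *m w i x) = 0.
  rewrite mulmxA [LHS]mx11_scalar (dotC Gs)// (wvec_s Ap Oc T HC i Ox).
  by rewrite raddf0.
have wl : (l x)^T *m (G x *m w i x) = 0.
  rewrite mulmxA [LHS]mx11_scalar (dotC Gs)// (wvec_l s u TG lT Ox Hi).
  by rewrite raddf0.
rewrite aE// !mulmxDl mul_scalar_mx -!scalemxAl mulmxDl -!mulmxA !ws !wl !mulmx0 addr0 !scaler0 !addr0 //.
Qed.

(** From [g' a = E g] and [a w = k w], the metric [g'] is [E / k] times [g] on the plane of the two
    [w], where [g] is Euclidean; a Lorentz metric is not negative definite on a plane. *)
Lemma kap_gt0 x : O x -> 0 < k.
Proof.
move=> Ox; have cx := Oc Ox; have /codP[dx ex] := cx.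
have E0 : 0 < Ef g g' phi (chart_inv phi x) := Ef_gt0 g g' phi _.
have EN : Ef g g' phi (chart_inv phi x) != 0 by rewrite gt_eqF.
have ua : a x \in unitmx by rewrite unitmxE unitfE (det_sinyukov_a g g' Ap cx) invr_eq0.
have ww i : i = 2 \/ i = 3 -> ((w i x)^T *m G x *m w i x) 0 0 = 1.
  by move=> Hi; rewrite (wvec_w Ap Oc s u TG lT Ox Hi Hi) eqxx.
have k0 : k != 0.
  apply/eqP => k0; have := a_w Ox h2; rewrite k0 scale0r.
  move=> /(congr1 (mulmx (invmx (a x)))); rewrite mulKmx// mulmx0 => w0.
  by have := ww 2 h2; rewrite w0 mulmx0 mxE => /eqP; rewrite eq_sym oner_eq0.
have Gw' i : i = 2 \/ i = 3 -> gx g' phi x *m w i x = (Ef g g' phi (chart_inv phi x) / k) *: (G x *m w i x).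
  move=> Hi; have := congr1 (mulmx^~ (w i x)) (g'_sinyukov_a g g' Ap cx).
  rewrite -mulmxA a_w// -scalemxAr -scalemxAl => H.
  by apply: (scalerI k0); rewrite H scalerA mulrC divfK.
have H i j : i = 2 \/ i = 3 -> j = 2 \/ j = 3 ->
    ((w i x)^T *m gx g' phi x *m w j x) 0 0 = (Ef g g' phi (chart_inv phi x) / k) * (i == j)%:R.
  move=> Hi Hj; rewrite -mulmxA Gw'// -scalemxAr scalemxE mulmxA.
  by rewrite (wvec_w Ap Oc s u TG lT Ox Hi Hj).
have m0 : 0 < Ef g g' phi (chart_inv phi x) / k.
  apply: (@lorentzian_plane R (gx g' phi x) (w 2 x) (w 3 x)).
  - exact: (metric_lorentz g').
  - exact: gx_sym.
  - by rewrite H// mulr1.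
  - by rewrite H// mulr1.
  - by rewrite H// mulr0.
  by rewrite mulf_neq0// invr_eq0.
by have := m0; rewrite pmulr_rgt0// invr_gt0.
Qed.

Lemma good_chart x2 : O x2 -> exists V : set M, [/\ open V, V (chart_inv phi x2) &
  exists chi : chart R M, [/\ A chi, chart_dom chi = V &
        (exists h : R -> R -> 'M[R]_2,
           (forall y z, (h y z)^T = h y z) /\
           (forall p, V p -> g chi p = warped_metric chi h p)) /\
        exists c e1 e2 kappa : R,
          [/\ 0 < kappa,
              (forall p, V p -> 0 < Ffun chi c e1 e2 kappa p),
              (forall p, V p ->
                 g' chi p = projective_partner chi c e1 e2 kappa (g chi p) p)
            & projective_form g g' V
                (differential
                   (fun p => 2^-1 * ln (Ffun chi c e1 e2 kappa p)))]]].
Proof.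
move=> Ox2; have [[su u0] du [ss ds] slu aE] := HC.
have sG : msm O G := msm_sub Oc (gx_sm g Ap).
have ll : forall x, O x -> ((l x)^T *m G x *m l x) 0 0 = 0 := frame_ll TG lT.
have [chi [r [Ac r0 dx2 codchi Hchi]]] := cone_chart Ap oO Oc sl dl TG lT HC Ox2.
have sn := sm_n oO sG sl su u0 ss.
have dn' := dn oO sG Gs uG sl dl su u0 du ss ds.
have dv' := dv oO sG Gs uG su u0 du ss ds.
have K1 x := chi_K1 Ap Ac du Hchi (x := x).
have K0 x := chi_K0 Ap Ac dv' Hchi (x := x).
have warp := chi_warped_metric Ap Ac sl sn u0 dl dn' du dv' Hchi r0 codchi.
have k0 := kap_gt0 Ox2; have kN : k != 0 by rewrite gt_eqF.
exists (chart_dom chi); split=> //; first exact: chart_dom_open.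
exists chi; split=> //; split.
  exists (warp_h g chi (chart_map chi (chart_inv phi x2))); split; last exact: warp.
  by move=> y z; exact: warp_h_sym.
have kinv : 0 < k^-1 by rewrite invr_gt0.
(* The identity [g' a = E g] in the new chart, and the equality of two expressions of [det a], which
   determines [E]. *)
have main p : chart_dom chi p -> let x := chart_map phi p in let E := Ef g g' chi p in
    g' chi p *m cone_mx (u x) (vfun G s u x) k c e1 e2 = E *: g chi p /\
    E * (k ^+ 4 * (1 + 2 * (c / k) * u x * vfun G s u x + 2 * (e1 / k) * u x
      + ((e1 / k) ^+ 2 - c / k * (e2 / k)) * u x ^+ 2)) = 1.
  move=> cp x E; have [dp Ox [Eu Ev] El En] := Hchi p cp; rewrite -/x in Ox Eu Ev El En.
  have cx := Oc Ox; have ex : chart_inv phi x = p by rewrite /x chart_mapK.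
  have EE : Ef g g' phi (chart_inv phi x) = E by rewrite ex /E (Ef_chart g g' Ap Ac dp cp).
  have E0 : E != 0 by rewrite gt_eqF// Ef_gt0.
  set J := jacobian phi chi p in El En; have uJ : J \in unitmx := jacobian_unit Ap Ac dp cp.
  have uJT : J^T \in unitmx by rewrite unitmx_tr.
  have GE : G x = J^T *m g chi p *m J by rewrite /G /x gx_map// (metric_tensor g Ap Ac dp cp).
  have GE' : gx g' phi x = J^T *m g' chi p *m J by rewrite /x gx_map// (metric_tensor g' Ap Ac dp cp).
  have Wx : ov phi chi x by exact: ov_map.
  have Ks : (g chi p)^T = g chi p := metric_sym g Ac cp.
  have K1p : g chi p *m ec 1 = ec 0 by have := K1 x Wx; rewrite tr_map// gx_map.
  have K0p : g chi p *m ec 0 = ec 1 by have := K0 x Wx; rewrite tr_map// gx_map.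
  have Js : J *m s x = u x *: ec 0 + vfun G s u x *: ec 1.
    have L (b d : R) (y z : 'cV[R]_4) : J *m (b *: y + d *: z) = b *: (J *m y) + d *: (J *m z).
      by rewrite mulmxDr -!scalemxAr.
    have sE := s_nl G l s u0 Ox; have En' : J *m nvec G l s u x = ec 0 by exact: En.
    by rewrite [in LHS]sE L El En'.
  have Ja : J *m a x = cone_mx (u x) (vfun G s u x) k c e1 e2 *m J.
    rewrite -(cone_mxE _ _ _ _ _ _ Ks K1p K0p) -Js -El aE//.
    have tens (b d : 'cV[R]_4) : J *m (b *m d^T *m G x) = (J *m b) *m (J *m d)^T *m g chi p *m J.
      by rewrite GE trmx_mul !mulmxA.
    rewrite !mulmxDr !mulmxDl mul_mx_scalar mul_scalar_mx -!scalemxAr -!scalemxAl.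
    by rewrite mulmxDr mulmxDl !tens.
  split.
    apply: (can_inj (mulKmx uJT)); apply: (can_inj (mulmxK uJ)).
    have := g'_sinyukov_a g g' Ap cx; rewrite EE -/a GE' -/G GE -mulmxA Ja => H.
    by rewrite -[LHS]mulmxA -[X in _ *m X]mulmxA mulmxA H -scalemxAr -scalemxAl.
  have := congr1 determinant Ja; rewrite !det_mulmx (det_sinyukov_a g g' Ap cx) EE det_cone_mx => H.
  have J0 : \det J != 0 by rewrite -unitfE -unitmxE.
  rewrite [RHS]mulrC in H; have := mulfI J0 H => H2.
  have -> : k ^+ 4 * (1 + 2 * (c / k) * u x * vfun G s u x + 2 * (e1 / k) * u x
      + ((e1 / k) ^+ 2 - c / k * (e2 / k)) * u x ^+ 2) = E^-1.
    by rewrite H2; field.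
  by rewrite mulfV.
(* [E k^4 Q = 1] is the formula of [Ffun] with [kappa = k^-1]. *)
have FE p : chart_dom chi p -> Ffun chi (c / k) (e1 / k) (e2 / k) k^-1 p = Ef g g' chi p.
  move=> cp; have [dp Ox [Eu Ev] _ _] := Hchi p cp; have [_ H] := main p cp.
  rewrite /Ffun Eu Ev; set Q := 1 + _ + _ + _ in H *.
  have kQ : k ^+ 4 * Q != 0.
    by apply/eqP => Z; move: H; rewrite Z mulr0 => /eqP; rewrite eq_sym oner_eq0.
  apply: (mulIf kQ); rewrite H.
  have Q0 : Q != 0 by apply: contraNneq kQ => ->; rewrite mulr0.
  by move: (Q) Q0 => q q0; field; rewrite kN q0.
exists (c / k), (e1 / k), (e2 / k), k^-1; split=> //.
- by move=> p cp; rewrite FE// Ef_gt0.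
- move=> p cp; have [dp Ox [Eu Ev] _ _] := Hchi p cp; have [H1 H2] := main p cp.
  have Wx : ov phi chi (chart_map phi p) by exact: ov_map.
  have Ks : (g chi p)^T = g chi p := metric_sym g Ac cp.
  have K1p : g chi p *m ec 1 = ec 0 by have := K1 _ Wx; rewrite tr_map// gx_map.
  have K0p : g chi p *m ec 0 = ec 1 by have := K0 _ Wx; rewrite tr_map// gx_map.
  have := partner_alg kN Ks K1p K0p H2; rewrite !divfK// => H3.
  have uC : cone_mx (u (chart_map phi p)) (vfun G s u (chart_map phi p)) k c e1 e2 \in unitmx.
    rewrite unitmxE unitfE det_cone_mx; apply/eqP => Z.
    have := H2; rewrite (_ : k ^+ 4 * _ = 0) ?mulr0; first by move/eqP; rewrite eq_sym oner_eq0.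
    by rewrite -Z; field.
  apply: (can_inj (mulmxK uC)); rewrite H1 -H3 /projective_partner FE// Eu Ev //.
exact: (projective_form_Ef Ac (@chart_dom_open _ _ chi) (fun p H => H) FE).
Qed.

End ProjectivePartner.

Theorem mainTheorem5 (R : realType) (M : topologicalType)
    (A : smooth_structure R M) (hausM : hausdorff_space M)
    (connM : connected [set: M]) (g g' : lorentz_metric A)
    (g_nonflat : non_flat g) (g_R11 : holonomy_type_R11 g)
    (g_D : exists U : set M,
       [/\ open U, dense U & forall p, U p -> curvature_class_D g p])
    (g_g' : projectively_related g g') :
  exists W : set M, [/\ open W, dense W &
    forall m, W m -> exists V : set M, [/\ open V, V m &
      same_connection g g' V \/
      exists phi : chart R M, [/\ A phi, chart_dom phi = V &
        (exists h : R -> R -> 'M[R]_2,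
           (forall y z, (h y z)^T = h y z) /\
           (forall p, V p -> g phi p = warped_metric phi h p)) /\
        exists c e1 e2 kappa : R,
          [/\ 0 < kappa,
              (forall p, V p -> 0 < Ffun phi c e1 e2 kappa p),
              (forall p, V p ->
                 g' phi p = projective_partner phi c e1 e2 kappa (g phi p) p)
            & projective_form g g' V
                (differential
                   (fun p => 2^-1 * ln (Ffun phi c e1 e2 kappa p)))]]]].
Proof.
pose Good V := same_connection g g' V \/
      exists phi : chart R M, [/\ A phi, chart_dom phi = V &
        (exists h : R -> R -> 'M[R]_2,
           (forall y z, (h y z)^T = h y z) /\
           (forall p, V p -> g phi p = warped_metric phi h p)) /\
        exists c e1 e2 kappa : R,
          [/\ 0 < kappa,
              (forall p, V p -> 0 < Ffun phi c e1 e2 kappa p),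
              (forall p, V p ->
                 g' phi p = projective_partner phi c e1 e2 kappa (g phi p) p)
            & projective_form g g' V
                (differential
                   (fun p => 2^-1 * ln (Ffun phi c e1 e2 kappa p)))]].
(* The largest possible [W] is a union of open sets, so that the real task is density. *)
exists [set m | exists V : set M, [/\ open V, V m & Good V]]; split=> //.
  rewrite openE => m [V [oV Vm GV]]; rewrite /interior.
  have nV : nbhs m V by apply: open_nbhs_nbhs; split=> //; rewrite openE.
  by apply: filterS nV => q Vq; exists V; split.
move=> U [q0 Uq0] oU.
(* If [psi] vanishes throughout [U], the connections coincide there and [V = U] serves. *)
have [Z|NZ] := pselect (forall phi p c, A phi -> chart_dom phi p -> U p ->
    psi g g' phi (chart_map phi p) c = 0).
  exists q0; split=> //; exists U; split=> //; left=> phi p a b c Ap dp Up.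
  apply/eqP; rewrite eq_sym -subr_eq0 (Gam_diff g_g' a b c Ap dp).
  by rewrite !Z// !mulr0 addr0.
have [phi [p [c [Ap dp Up pc]]]] : exists phi p c, [/\ A phi, chart_dom phi p, U p &
    psi g g' phi (chart_map phi p) c != 0].
  apply: contrapT => H; apply: NZ => phi p c Ap dp Up; apply/eqP/negPn/negP => N.
  by apply: H; exists phi, p, c.
(* Otherwise [U] is first shrunk to a set where one component of [psi] has no zero; non-flatness,
   applied to that set, then yields a point where both [psi] and the curvature are nonzero. *)
have [d d0 Hd] := Ck_neq0_near (@cod_open _ _ phi) (spsi g g' c Ap 0%N) (cod_map dp) pc.
pose U1 := [set q | chart_dom phi q /\ `|chart_map phi q - chart_map phi p| < d] `&` U.
have oU1 : open U1.
  apply: openI => //; exact: (@image_open _ _ phi _ (@open_nbhd_ball R 4 (chart_map phi p) d)).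
have U1p : U1 p by split=> //; split=> //; rewrite subrr normr0.
have [chi [q [i [j [e [f [Ac cq U1q rn]]]]]]] : exists chi q a b e f,
    [/\ A chi, chart_dom chi q, U1 q & riemann g chi q a b e f != 0].
  apply: contrapT => H; apply: (g_nonflat U1 oU1); first by exists p.
  move=> chi q a b e f Ac cq U1q; apply/eqP/negPn/negP => N.
  by apply: H; exists chi, q, a, b, e, f.
have [[dq nq] Uq] := U1q.
(* The chart [chi] in which the curvature is nonzero may differ from [phi], so the nonvanishing of
   [psi] is carried over by its transformation law. *)
have lam0 : sinyukov_lam g g' chi (chart_map chi q) != 0.
  apply/eqP => L; have pz := sinyukov_lam_eq0 Ac (cod_map cq) L.
  have := Hd _ nq; rewrite (psi_chain g g' c Ap Ac dq cq) big1 ?eqxx// => b _.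
  by rewrite pz mul0r.
have Rn : Rie (gx g chi) e f (chart_map chi q) != 0.
  by apply/eqP => Z; move: rn; rewrite riemannE// Z mxE eqxx.
have [r [l [T [r0 Bc sl dl HT]]]] := parallel_frame g_R11 connM Ac cq.
(* Intersecting with the preimage of [U] ensures that the point finally found lies in [U]. *)
pose O := [set x : 'rV[R]_4 | `|x - chart_map chi q| < r] `&`
  [set x | cod chi x /\ U (chart_inv chi x)].
have oO : open O by apply: openI; [exact: open_nbhd_ball|exact: preimage_open].
have OB : O `<=` [set x : 'rV[R]_4 | `|x - chart_map chi q| < r] by move=> x [].
have Oc : O `<=` cod chi by move=> x /OB/Bc.
have Oq : O (chart_map chi q).
  by split; [rewrite /= subrr normr0|split; [exact: cod_map|rewrite chart_mapK]].
have [x2 [r2 [r20 BO [s [u [k [c0 [e1 [e2 HC]]]]]]]]] :=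
  @local_structure R O (gx g chi) oO (msm_sub Oc (gx_sm g Ac))
  (fun x Ox => gx_sym g Ac (Oc x Ox)) (fun x Ox => gx_unit g Ac (Oc x Ox))
  (sinyukov_a g g' chi) (sinyukov_lam g g' chi) l (msm_sub Oc (sm_sinyukov_a g g' Ac)) (msm_sub Oc (sm_sinyukov_lam g g' Ac))
  (fun c x Ox => d_sinyukov_a g_g' c Ac (Oc x Ox)) (msm_sub OB sl) (fun c x Ox => dl c x (OB x Ox))
  T (fun x Ox => (HT x (OB x Ox)).1) (fun x Ox => (HT x (OB x Ox)).2)
  (fun x Ox => sinyukov_a_sym g g' Ac (Oc x Ox)) (chart_map chi q) e f Oq lam0 Rn.
have Bx2 : [set x : 'rV[R]_4 | `|x - x2| < r2] x2 by rewrite /= subrr normr0.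
have BB x : [set x : 'rV[R]_4 | `|x - x2| < r2] x -> _ := fun Bx => OB x (BO x Bx).
have [V [oV Vx2 GV]] := @good_chart R M A g g' g_g' chi [set x | `|x - x2| < r2] Ac
  (@open_nbhd_ball R 4 x2 r2) (fun x Bx => Oc x (BO x Bx)) l s u T
  (msm_sub (fun x Bx => OB x (BO x Bx)) sl) (fun c x Bx => dl c x (BB x Bx))
  (fun x Bx => (HT x (BB x Bx)).1) (fun x Bx => (HT x (BB x Bx)).2) k c0 e1 e2 HC x2 Bx2.
exists (chart_inv chi x2); split; first exact: (BO x2 Bx2).2.2.
by exists V; split=> //; right.
Qed.
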